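(* Let $N$ be a prime, $\xi$ a Dirichlet character modulo $N$, $k$ a positive integer with $\xi(-1)=(-1)^k$, and $\{f_n\}_{n\ge1},\{g_n\}_{n\ge1}$ complex sequences with $f_n,g_n=O(n^\sigma)$ for some $\sigma>0$. Suppose that for every $q\in\mathbb{N}$ with $(q,N)=1$, $\Lambda_f(s,c_q)$ and $\Lambda_g(s,c_q)$ continue to entire functions of finite order and satisfy $\Lambda_f(s,c_q)=i^k\xi(q)(Nq^2)^{\frac12-s}\Lambda_g(1-s,c_q)$. Let $f(z)=\sum_{n\ge1}f_ne(nz)$, and suppose moreover that $f|\gamma_1\gamma_2=f|\gamma_2\gamma_1$ for every pair $\gamma_1,\gamma_2\in\Gamma_0(N)$. Then $f\in M_k(\Gamma_0(N),\xi)$.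
   Context: $e(x):=e^{2\pi i x}$; $c_q(n)=\sum_{a \bmod q,\,(a,q)=1}e(an/q)$ is the Ramanujan sum; $\Gamma_\mathbb{C}(s):=2(2\pi)^{-s}\Gamma(s)$; for $\Re(s)>\sigma+1-\frac{k-1}2$, $\Lambda_f(s,c_q)=\Gamma_\mathbb{C}(s+\frac{k-1}2)\sum_{n\ge1}f_nc_q(n)n^{-s-\frac{k-1}2}$ and similarly $\Lambda_g(s,c_q)$ with $g_n$ in place of $f_n$. For $h:\mathbb{H}\to\mathbb{C}$ and $\gamma=\begin{pmatrix}a&b\\c&d\end{pmatrix}\in\mathrm{GL}_2^+(\mathbb{R})$, $h|\gamma(z)=(\det\gamma)^{k/2}(cz+d)^{-k}h\big(\frac{az+b}{cz+d}\big)$ (a right action). $M_k(\Gamma_0(N),\xi)$ is the space of holomorphic modular forms of weight $k$, level $N$, nebentypus $\xi$. *)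

(* Defs.v *)
From Stdlib Require Import Reals ZArith List.
From Coquelicot Require Import Coquelicot.
Open Scope R_scope.

Definition cexp (z : C) : C := (exp (fst z) * cos (snd z), exp (fst z) * sin (snd z)).

Definition e_ (x : C) : C := cexp (2 * PI * Ci * x)%C.

Definition cpowR (r : R) (s : C) : C := cexp (s * RtoC (ln r))%C.

Fixpoint cpown (z : C) (n : nat) : C :=
  match n with O => 1%C | S m => (z * cpown z m)%C end.

(** Euler's Gamma function Gamma(s) = int_0^oo t^(s-1) e^(-t) dt (used for Re s > 0) *)
Definition cGamma (s : C) : C :=
  RInt_gen (V := C_R_CompleteNormedModule)
    (fun t => (cpowR t (s - 1) * RtoC (exp (- t)))%C)
    (at_right 0) (Rbar_locally p_infty).

Definition GammaC (s : C) : C := (2 * cpowR (2 * PI) (- s) * cGamma s)%C.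

Definition ramanujan (q n : nat) : C :=
  fold_right Cplus 0%C
    (map (fun a => e_ (RtoC (INR a * INR n / INR q)))
       (filter (fun a => Nat.eqb (Nat.gcd a q) 1) (seq 0 q))).

Definition dirichlet_char (N : nat) (xi : Z -> C) : Prop :=
  (forall n : Z, xi (n + Z.of_nat N)%Z = xi n) /\
  (forall m n : Z, xi (m * n)%Z = (xi m * xi n)%C) /\
  xi 1%Z = 1%C /\
  (forall n : Z, xi n = 0%C <-> Z.gcd n (Z.of_nat N) <> 1%Z).

Definition mat2 := (Z * Z * Z * Z)%type.
Definition m_a (g : mat2) : Z := let '(a, _, _, _) := g in a.
Definition m_b (g : mat2) : Z := let '(_, b, _, _) := g in b.
Definition m_c (g : mat2) : Z := let '(_, _, c, _) := g in c.
Definition m_d (g : mat2) : Z := let '(_, _, _, d) := g in d.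
Definition mmul (g h : mat2) : mat2 :=
  ((m_a g * m_a h + m_b g * m_c h)%Z, (m_a g * m_b h + m_b g * m_d h)%Z,
   (m_c g * m_a h + m_d g * m_c h)%Z, (m_c g * m_b h + m_d g * m_d h)%Z).

Definition SL2Z (g : mat2) : Prop := (m_a g * m_d g - m_b g * m_c g)%Z = 1%Z.
Definition Gamma0 (N : nat) (g : mat2) : Prop :=
  SL2Z g /\ (Z.of_nat N | m_c g)%Z.

Definition in_H (z : C) : Prop := 0 < Im z.

(** slash operator h|g (z) = (det g)^{k/2} (cz+d)^{-k} h((az+b)/(cz+d)),
    for integer matrices of determinant 1 (so (det g)^{k/2} = 1) *)
Definition slash (k : nat) (g : mat2) (h : C -> C) (z : C) : C :=
  let cz_d := (IZR (m_c g) * z + IZR (m_d g))%C in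
  (Cinv (cpown cz_d k) * h ((IZR (m_a g) * z + IZR (m_b g)) / cz_d))%C.

Definition holo_on (U : C -> Prop) (f : C -> C) : Prop :=
  forall z, U z -> ex_derive (K := C_AbsRing) (V := C_NormedModule) f z.

Definition entire (f : C -> C) : Prop := holo_on (fun _ => True) f.

Definition finite_order (F : C -> C) : Prop :=
  exists (m : nat) (B : R), forall s, Cmod (F s) <= B * exp (Cmod s ^ m).

Definition modular_form (k N : nat) (xi : Z -> C) (f : C -> C) : Prop :=
  holo_on in_H f /\
  (forall g, Gamma0 N g -> forall z, in_H z -> slash k g f z = (xi (m_d g) * f z)%C) /\
  (forall g, SL2Z g -> exists M Y : R,
      forall z, Y < Im z -> Cmod (slash k g f z) <= M).

(** Lambda_f(s, c_q) for Re s > sigma + 1 - (k-1)/2 (where the series converges):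
    Lambda_f(s,c_q) = Gamma_C(s + (k-1)/2) * sum_{n>=1} f_n c_q(n) n^{-s-(k-1)/2}.
    [Lambda_series k f q s v] says this expression is defined and equals v. *)
Definition Lambda_series (k : nat) (fc : nat -> C) (q : nat) (s : C) (v : C) : Prop :=
  let w := (s + RtoC ((INR k - 1) / 2))%C in
  exists D : C,
    is_series (K := R_AbsRing) (V := C_R_NormedModule)
      (fun n => (fc (S n) * ramanujan q (S n) * cpowR (INR (S n)) (- w))%C) D /\
    v = (GammaC w * D)%C.

(* Main.v *)
Require Import Defs.

(** Write g for the Fricke transform N^(-k/2) z^(-k) f(-1/(Nz)).  Mellin inversion, in the form of a
    uniqueness statement proved with the Phragmen-Lindelof principle, turns the functional equation
    for c_q into the relation
      sum_a f(z + a/q) = xi(q) sum_a f | (q 0; -aN 1/q),   a running over the units mod q,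
    on the upper half-plane.  For q = 1 this makes f invariant under U = (1 0; N 1), besides T = (1 1; 0 1).

    For q = p an odd prime different from N, the relation says that the functions
    h_i = f | g_i - f / xi(p), where g_i in Gamma0(N) has top row (p, -i), satisfy
    sum_i h_i | T^(i/p) = 0.  Since Gamma0(N) acts on f through an abelian quotient, conjugating by the
    upper and lower unipotent elements permuting P^1(F_p) isolates the terms, and the braid relation in
    SL_2(F_p) shows that all g_i act alike on the h_i.  The common value h is then invariant under
    translations by arbitrarily small real numbers and under U, hence vanishes.  So f | gamma = xi(d) f
    whenever the top-left entry of gamma is such a prime.

    To reach all of Gamma0(N) one needs that every unit mod N is the class of such a prime or a
    quotient of two such classes.  Let lambda be a limit of (sum_{n <= m, n = a} Lambda(n)/n) / ln m,
    and let l(a) be the constant term of sum_{n <= m, n = a} 1/n.  Summing w(n) ln n / n in two ways shows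
    that lambda - 1/phi(N) is annihilated by convolution with l, and Moebius inversion then gives
    <lambda, nu(a.)> = -nu(a) for nu = lambda - 1/phi(N).  If a is neither a prime class nor a quotient of
    two, this reads -1/phi(N) = 1/phi(N).  The Euclidean algorithm on the top row does the rest. *)

(** The twists by c_q give only a sum over the units a modulo q, never a single additive twist, and
    the algebraic part serves to break this sum into its terms. Commutativity makes that possible:
    up to powers of T and U, which fix f, an element of Gamma0(N) may be taken congruent to 1 modulo
    p^2; its conjugates by T^(i/p) and diag(p, 1/p) then stay in Gamma0(N), and on a vector with
    commuting action conjugation inside Gamma0(N) is invisible. The p + 1 cosets of the T^(i/p) and
    of diag(p, 1/p) are thus permuted like P^1(F_p), with an explicit cocycle, and the relation can
    be averaged over unipotent elements. That the g_i act alike comes from two facts: the action of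
    g_i depends on the square class of i, and some 1 + m^2 is a nonsquare; here p must be odd. The
    Mellin step cuts the integrals at a point tau: the difference to the entire function is small on
    both edges of a wide strip. In the arithmetic step a quotient p/q of prime classes suffices,
    because a matrix of top row (a, 1) can be multiplied by one with top-left entry q so that the
    product has top-left entry p. *)

Module ComplexIntegral.

(* Integrals of complex functions over intervals and around rectangles *)
From Corelib Require Import ssreflect.
From Stdlib Require Import Reals Lra Lia ClassicalEpsilon.
From Coquelicot Require Import Coquelicot.
Open Scope R_scope.

Notation CR := C_R_CompleteNormedModule.

Definition CI (f : R -> C) (a b : R) : C := RInt (V := CR) f a b.

(** Division-free form of the derivative, so that [h = 0] is no exception; [Cder_is_derive]
    identifies it with the derivative over [C_AbsRing]. *)
Definition Cder (f : C -> C) (z l : C) : Prop :=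
  forall eps, 0 < eps -> exists d, 0 < d /\
    forall h, Cmod h < d -> Cmod (f (z + h) - f z - l * h)%C <= eps * Cmod h.

Lemma norm_Cmod (z : C) : norm (V := C_R_NormedModule) z = Cmod z.
Proof.
  unfold norm; simpl; unfold prod_norm, Cmod; simpl.
  unfold norm; simpl; unfold abs; simpl.
  f_equal. rewrite !Rmult_1_r -!Rabs_mult !Rabs_pos_eq //; apply Rle_0_sqr.
Qed.

Lemma is_RInt_pairC (f : R -> C) a b (l : C) :
  is_RInt (V := C_R_NormedModule) f a b l <->
  is_RInt (fun t => fst (f t)) a b (fst l) /\ is_RInt (fun t => snd (f t)) a b (snd l).
Proof.
  split.
  - intros H. split.
    apply (is_RInt_fct_extend_fst (U := R_NormedModule) (V := R_NormedModule) f a b l H).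
    apply (is_RInt_fct_extend_snd (U := R_NormedModule) (V := R_NormedModule) f a b l H).
  - intros [H1 H2].
    replace l with (fst l, snd l) by (destruct l; reflexivity).
    apply (is_RInt_fct_extend_pair (U := R_NormedModule) (V := R_NormedModule) f a b); assumption.
Qed.

Lemma is_RInt_Cmult (c : C) (f : R -> C) a b (l : C) :
  is_RInt (V := C_R_NormedModule) f a b l ->
  is_RInt (V := C_R_NormedModule) (fun t => c * f t)%C a b (c * l)%C.
Proof.
  rewrite !is_RInt_pairC. intros [H1 H2]; simpl. split.
  - apply (is_RInt_minus (V := R_NormedModule)); apply (is_RInt_scal (V := R_NormedModule)); assumption.
  - apply (is_RInt_plus (V := R_NormedModule)); apply (is_RInt_scal (V := R_NormedModule)); assumption.
Qed.

Definition cont (f : R -> C) (x : R) : Prop :=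
  forall eps, 0 < eps -> exists d, 0 < d /\
    forall y, Rabs (y - x) < d -> Cmod (f y - f x)%C < eps.

Lemma cont_continuous f x : cont f x -> continuous (U := C_R_NormedModule) f x.
Proof.
  intros H. apply (filterlim_locally (F := locally x)).
  intros eps. destruct (H eps (cond_pos eps)) as [d [Hd Hy]].
  exists (mkposreal d Hd). intros y Hy'.
  apply: (norm_compat1 (V := C_R_NormedModule)). rewrite norm_Cmod. apply Hy. exact Hy'.
Qed.

Lemma ex_CI f a b : (forall x, Rmin a b <= x <= Rmax a b -> cont f x) ->
  ex_RInt (V := CR) f a b.
Proof.
  intros H. apply (ex_RInt_continuous (V := CR)). intros z Hz.
  apply cont_continuous, H, Hz.
Qed.

Lemma CI_correct f a b : ex_RInt (V := CR) f a b -> is_RInt (V := CR) f a b (CI f a b).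
Proof. apply (RInt_correct (V := CR)). Qed.

Lemma CI_unique f a b (l : C) : is_RInt (V := CR) f a b l -> CI f a b = l.
Proof. apply (is_RInt_unique (V := CR)). Qed.

Lemma CI_bound f a b M : a <= b -> ex_RInt (V := CR) f a b ->
  (forall x, a <= x <= b -> Cmod (f x) <= M) -> Cmod (CI f a b) <= M * (b - a).
Proof.
  intros Hab Hex HM. rewrite -norm_Cmod.
  replace (M * (b - a)) with (scal (V := R_NormedModule) (b - a) M) by (unfold scal; simpl; unfold mult; simpl; ring).
  apply (norm_RInt_le (V := C_R_NormedModule) f (fun _ => M) a b (CI f a b) _ Hab).
  - intros x Hx; rewrite norm_Cmod; auto.
  - apply CI_correct; assumption.
  - apply (is_RInt_const (V := R_NormedModule)).
Qed.

Lemma CI_bound_fun f g a b G : a <= b -> ex_RInt (V := CR) f a b ->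
  (forall x, a <= x <= b -> Cmod (f x) <= g x) -> is_RInt g a b G -> Cmod (CI f a b) <= G.
Proof.
  intros Hab Hex HM HG. rewrite -norm_Cmod.
  apply (norm_RInt_le (V := C_R_NormedModule) f g a b (CI f a b) G Hab); auto.
  - intros x Hx; rewrite norm_Cmod; auto.
  - apply CI_correct; assumption.
Qed.

Lemma CI_Chasles f a b c : ex_RInt (V := CR) f a b -> ex_RInt (V := CR) f b c ->
  (CI f a b + CI f b c)%C = CI f a c.
Proof. intros H1 H2. apply (RInt_Chasles (V := CR)); assumption. Qed.

Lemma CI_plus f g a b : ex_RInt (V := CR) f a b -> ex_RInt (V := CR) g a b ->
  CI (fun t => f t + g t)%C a b = (CI f a b + CI g a b)%C.
Proof. intros H1 H2. apply (RInt_plus (V := CR)); assumption. Qed.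

Lemma CI_minus f g a b : ex_RInt (V := CR) f a b -> ex_RInt (V := CR) g a b ->
  CI (fun t => f t - g t)%C a b = (CI f a b - CI g a b)%C.
Proof. intros H1 H2. apply (RInt_minus (V := CR)); assumption. Qed.

Lemma CI_Cmult c f a b : ex_RInt (V := CR) f a b ->
  CI (fun t => c * f t)%C a b = (c * CI f a b)%C.
Proof. intros H1. apply CI_unique, is_RInt_Cmult, CI_correct, H1. Qed.

Lemma CI_ext f g a b : (forall x, Rmin a b < x < Rmax a b -> f x = g x) ->
  CI f a b = CI g a b.
Proof. apply (RInt_ext (V := CR)). Qed.

Lemma Cmod_triang_minus (a b : C) : Cmod (a - b)%C <= Cmod a + Cmod b.
Proof. rewrite -(Cmod_opp b). apply Cmod_triangle. Qed.

Lemma Cder_cont f z l : Cder f z l -> forall eps, 0 < eps -> exists d, 0 < d /\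
  forall h, Cmod h < d -> Cmod (f (z + h) - f z)%C < eps.
Proof.
  intros H eps He. destruct (H 1 Rlt_0_1) as [d [Hd Hh]].
  assert (Hl := Cmod_ge_0 l).
  exists (Rmin d (eps / (2 + Cmod l))). split.
  - apply Rmin_pos; [exact Hd|]. apply Rdiv_lt_0_compat; lra.
  - intros h Hlt. specialize (Hh h (Rlt_le_trans _ _ _ Hlt (Rmin_l _ _))).
    assert (Hlt2 := Rlt_le_trans _ _ _ Hlt (Rmin_r _ _)).
    replace (f (z + h) - f z)%C with ((f (z + h) - f z - l * h) + l * h)%C by ring.
    eapply Rle_lt_trans; [apply Cmod_triangle|]. rewrite Cmod_mult.
    assert (Cmod h * (2 + Cmod l) < eps).
    { apply (Rmult_lt_reg_r (/ (2 + Cmod l))). apply Rinv_0_lt_compat; lra.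
      rewrite Rmult_assoc Rinv_r; lra. }
    assert (Hh0 := Cmod_ge_0 h). nra.
Qed.

Lemma Cmod_R x : Cmod (x, 0) = Rabs x.
Proof. apply (Cmod_R x). Qed.
Lemma Cmod_I y : Cmod (0, y) = Rabs y.
Proof.
  unfold Cmod; simpl. replace (0 * (0 * 1) + y * (y * 1)) with (Rsqr y) by (unfold Rsqr; ring).
  apply sqrt_Rsqr_abs.
Qed.

Lemma Cmod_le_sum x y : Cmod (x, y) <= Rabs x + Rabs y.
Proof.
  replace (x, y) with ((x, 0) + (0, y))%C by (unfold Cplus; simpl; f_equal; ring).
  eapply Rle_trans; [apply Cmod_triangle|]. rewrite Cmod_R Cmod_I. lra.
Qed.

Lemma hcont F c x : (exists l, Cder F (x, c) l) -> cont (fun t => F (t, c)) x.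
Proof.
  intros [l Hl] eps He. destruct (Cder_cont _ _ _ Hl eps He) as [d [Hd H]].
  exists d; split; [exact Hd|]. intros y Hy.
  replace (y, c) with ((x, c) + ((y - x)%R, 0))%C by (unfold Cplus; simpl; f_equal; ring).
  apply H. rewrite Cmod_R. exact Hy.
Qed.
Lemma vcont F c x : (exists l, Cder F (c, x) l) -> cont (fun t => F (c, t)) x.
Proof.
  intros [l Hl] eps He. destruct (Cder_cont _ _ _ Hl eps He) as [d [Hd H]].
  exists d; split; [exact Hd|]. intros y Hy.
  replace (c, y) with ((c, x) + (0, (y - x)%R))%C by (unfold Cplus; simpl; f_equal; ring).
  apply H. rewrite Cmod_I. exact Hy.
Qed.

(** Counter-clockwise contour integral of F(z) dz around the rectangle: dz is dx on the horizontal
    sides and i dy on the vertical ones. *)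
Definition bd (F : C -> C) (a b c d : R) : C :=
  (CI (fun x => F (x, c)) a b - CI (fun x => F (x, d)) a b
   + Ci * (CI (fun y => F (b, y)) c d - CI (fun y => F (a, y)) c d))%C.

Definition inrect (a b c d : R) (z : C) := a <= fst z <= b /\ c <= snd z <= d.

Definition hol (F : C -> C) (a b c d : R) :=
  forall z, inrect a b c d z -> exists l, Cder F z l.

Lemma hol_sub F a b c d a' b' c' d' : hol F a b c d ->
  a <= a' -> b' <= b -> c <= c' -> d' <= d -> hol F a' b' c' d'.
Proof. intros H ? ? ? ? z [[? ?] [? ?]]. apply H. repeat split; lra. Qed.

Lemma hol_h F a b c d y : hol F a b c d -> a <= b -> c <= y <= d ->
  ex_RInt (V := CR) (fun x => F (x, y)) a b.
Proof.
  intros H Hab Hy. apply ex_CI. rewrite Rmin_left // Rmax_right //.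
  intros x Hx. apply hcont, H. split; simpl; auto.
Qed.
Lemma hol_v F a b c d x : hol F a b c d -> c <= d -> a <= x <= b ->
  ex_RInt (V := CR) (fun y => F (x, y)) c d.
Proof.
  intros H Hab Hy. apply ex_CI. rewrite Rmin_left // Rmax_right //.
  intros y Hx. apply vcont, H. split; simpl; auto.
Qed.

Lemma bd_splitv F a m b c d : hol F a b c d -> a <= m <= b -> c <= d ->
  bd F a b c d = (bd F a m c d + bd F m b c d)%C.
Proof.
  intros H Hm Hcd. unfold bd.
  assert (H1 : hol F a m c d) by (apply (hol_sub _ _ _ _ _ _ _ _ _ H); lra).
  assert (H2 : hol F m b c d) by (apply (hol_sub _ _ _ _ _ _ _ _ _ H); lra).
  rewrite -(CI_Chasles (fun x => F (x, c)) a m b);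
    [| apply (hol_h _ _ _ _ _ _ H1); lra | apply (hol_h _ _ _ _ _ _ H2); lra].
  rewrite -(CI_Chasles (fun x => F (x, d)) a m b);
    [| apply (hol_h _ _ _ _ _ _ H1); lra | apply (hol_h _ _ _ _ _ _ H2); lra].
  ring.
Qed.
Lemma bd_splith F a b c n d : hol F a b c d -> c <= n <= d -> a <= b ->
  bd F a b c d = (bd F a b c n + bd F a b n d)%C.
Proof.
  intros H Hm Hcd. unfold bd.
  assert (H1 : hol F a b c n) by (apply (hol_sub _ _ _ _ _ _ _ _ _ H); lra).
  assert (H2 : hol F a b n d) by (apply (hol_sub _ _ _ _ _ _ _ _ _ H); lra).
  rewrite -(CI_Chasles (fun x => F (a, x)) c n d);
    [| apply (hol_v _ _ _ _ _ _ H1); lra | apply (hol_v _ _ _ _ _ _ H2); lra].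
  rewrite -(CI_Chasles (fun x => F (b, x)) c n d);
    [| apply (hol_v _ _ _ _ _ _ H1); lra | apply (hol_v _ _ _ _ _ _ H2); lra].
  ring.
Qed.

Lemma bd_bound F a b c d M : hol F a b c d -> a <= b -> c <= d ->
  (forall z, inrect a b c d z -> Cmod (F z) <= M) ->
  Cmod (bd F a b c d) <= 2 * M * ((b - a) + (d - c)).
Proof.
  intros H Hab Hcd HM. unfold bd.
  eapply Rle_trans; [apply Cmod_triangle|]. rewrite Cmod_mult Cmod_Ci Rmult_1_l.
  eapply Rle_trans; [apply Rplus_le_compat; apply Cmod_triang_minus|].
  assert (E1 : Cmod (CI (fun x => F (x, c)) a b) <= M * (b - a)).
  { apply CI_bound; auto. apply (hol_h _ _ _ _ _ _ H); lra. intros; apply HM; split; simpl; lra. }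
  assert (E2 : Cmod (CI (fun x => F (x, d)) a b) <= M * (b - a)).
  { apply CI_bound; auto. apply (hol_h _ _ _ _ _ _ H); lra. intros; apply HM; split; simpl; lra. }
  assert (E3 : Cmod (CI (fun x => F (a, x)) c d) <= M * (d - c)).
  { apply CI_bound; auto. apply (hol_v _ _ _ _ _ _ H); lra. intros; apply HM; split; simpl; lra. }
  assert (E4 : Cmod (CI (fun x => F (b, x)) c d) <= M * (d - c)).
  { apply CI_bound; auto. apply (hol_v _ _ _ _ _ _ H); lra. intros; apply HM; split; simpl; lra. }
  lra.
Qed.
End ComplexIntegral.

(** * Rules for complex derivatives, and Goursat's lemma for rectangles *)

Module ComplexDerivative.
From Corelib Require Import ssreflect.
From Stdlib Require Import Reals Lra Lia ClassicalEpsilon.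
From Coquelicot Require Import Coquelicot.
Import ComplexIntegral.
Open Scope R_scope.

Lemma Cder_is_derive f z l :
  Cder f z l <-> is_derive (K := C_AbsRing) (V := C_NormedModule) f z l.
Proof.
  split.
  - intros H. split; [apply is_linear_scal_l|].
    intros x Hx. apply (is_filter_lim_locally_unique (V := AbsRing_NormedModule C_AbsRing)) in Hx. subst x.
    intros eps. destruct (H eps (cond_pos eps)) as [d [Hd Hh]].
    exists (mkposreal d Hd). intros y' Hy.
    set (y := y' : C). change (Cmod (y - z)%C < d) in Hy.
    specialize (Hh _ Hy). replace (z + (y - z))%C with y in Hh by ring.
    change (Cmod (f y - f z - (y - z) * l)%C <= eps * Cmod (y - z)%C).
    rewrite (Cmult_comm (y - z)). exact Hh.
  - intros [_ H] eps He. specialize (H z (fun P HP => HP) (mkposreal eps He)).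
    destruct H as [d Hd]. exists d. split; [apply cond_pos|].
    intros h Hh. specialize (Hd (z + h)%C).
    assert (Hb : ball (M := AbsRing_UniformSpace C_AbsRing) z d (z + h)%C).
    { change (Cmod (z + h - z)%C < d). replace (z + h - z)%C with h by ring. exact Hh. }
    specialize (Hd Hb).
    change (Cmod (f (z + h) - f z - (z + h - z) * l)%C <= eps * Cmod (z + h - z)%C) in Hd.
    replace (z + h - z)%C with h in Hd by ring. rewrite (Cmult_comm l). exact Hd.
Qed.

Lemma Cder_const c z : Cder (fun _ => c) z 0.
Proof. apply Cder_is_derive. apply (is_derive_const (K := C_AbsRing) (V := C_NormedModule)). Qed.
Lemma Cder_id z : Cder (fun x => x) z 1.
Proof.
  intros eps He. exists 1; split; [lra|]. intros h _. cbv beta.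
  replace (z + h - z - 1 * h)%C with (RtoC 0) by ring. rewrite Cmod_0.
  apply Rmult_le_pos; [lra|apply Cmod_ge_0].
Qed.
Lemma Cder_plus f g z l m : Cder f z l -> Cder g z m -> Cder (fun x => f x + g x)%C z (l + m)%C.
Proof. rewrite !Cder_is_derive. apply (is_derive_plus (K := C_AbsRing) (V := C_NormedModule)). Qed.
Lemma Cder_minus f g z l m : Cder f z l -> Cder g z m -> Cder (fun x => f x - g x)%C z (l - m)%C.
Proof. rewrite !Cder_is_derive. apply (is_derive_minus (K := C_AbsRing) (V := C_NormedModule)). Qed.
Lemma Cder_comp f g z l m : Cder f (g z) l -> Cder g z m -> Cder (fun x => f (g x)) z (l * m)%C.
Proof.
  intros H1 H2 eps He. assert (Hl := Cmod_ge_0 l). assert (Hm := Cmod_ge_0 m).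
  set (e2 := Rmin 1 (eps / (2 * (Cmod l + 1)))). set (e1 := eps / (2 * (Cmod m + 1))).
  assert (He1 : 0 < e1) by (apply Rdiv_lt_0_compat; lra).
  assert (He2 : 0 < e2) by (apply Rmin_pos; [lra|apply Rdiv_lt_0_compat; lra]).
  destruct (H1 e1 He1) as [d1 [Hd1 D1]]. destruct (H2 e2 He2) as [d2 [Hd2 D2]].
  destruct (Cder_cont _ _ _ H2 d1 Hd1) as [d3 [Hd3 D3]].
  exists (Rmin d2 d3). split; [apply Rmin_pos; auto|]. intros h Hh.
  specialize (D2 h (Rlt_le_trans _ _ _ Hh (Rmin_l _ _))).
  specialize (D3 h (Rlt_le_trans _ _ _ Hh (Rmin_r _ _))).
  set (k := (g (z + h) - g z)%C) in *. specialize (D1 k D3).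
  replace (g z + k)%C with (g (z + h)%C) in D1 by (unfold k; ring).
  replace (f (g (z + h)) - f (g z) - l * m * h)%C with
    ((f (g (z + h)) - f (g z) - l * k) + l * (k - m * h))%C by ring.
  eapply Rle_trans; [apply Cmod_triangle|]. rewrite Cmod_mult.
  assert (Hk : Cmod k <= (Cmod m + 1) * Cmod h).
  { replace k with ((k - m * h) + m * h)%C by ring. eapply Rle_trans; [apply Cmod_triangle|].
    rewrite Cmod_mult. assert (e2 <= 1) by apply Rmin_l. assert (H0 := Cmod_ge_0 h). nra. }
  assert (E2 : e2 * (2 * (Cmod l + 1)) <= eps).
  { apply (Rmult_le_reg_r (/ (2 * (Cmod l + 1)))). apply Rinv_0_lt_compat; lra.
    rewrite Rmult_assoc Rinv_r; [|lra]. rewrite Rmult_1_r. apply Rmin_r. }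
  assert (E1 : e1 * (2 * (Cmod m + 1)) = eps) by (unfold e1; field; lra).
  assert (H0 := Cmod_ge_0 h).
  assert (e1 * Cmod k <= e1 * ((Cmod m + 1) * Cmod h)) by (apply Rmult_le_compat_l; lra).
  assert (Cmod l * Cmod (k - m * h)%C <= Cmod l * (e2 * Cmod h)) by (apply Rmult_le_compat_l; lra).
  assert (2 * (e2 * Cmod l * Cmod h) <= eps * Cmod h) by nra.
  nra.
Qed.
Lemma Cder_ext f g z l : (forall x, f x = g x) -> Cder f z l -> Cder g z l.
Proof. intros E H eps He. destruct (H eps He) as [d [Hd Hh]]. exists d; split; auto.
  intros h Hlt. rewrite -!E. auto. Qed.
Lemma Cder_sq z : Cder (fun x => x * x)%C z (2 * z)%C.
Proof.
  intros eps He. exists eps; split; [lra|]. intros h Hh. cbv beta.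
  replace ((z + h) * (z + h) - z * z - 2 * z * h)%C with (h * h)%C by ring.
  rewrite Cmod_mult. apply Rmult_le_compat_r; [apply Cmod_ge_0|lra].
Qed.
Lemma Cder_scal c z : Cder (fun x => c * x)%C z c.
Proof.
  intros eps He. exists 1; split; [lra|]. intros h _. cbv beta.
  replace (c * (z + h) - c * z - c * h)%C with (RtoC 0) by ring. rewrite Cmod_0.
  apply Rmult_le_pos; [lra|apply Cmod_ge_0].
Qed.
Lemma Cder_eq f z l m : Cder f z l -> l = m -> Cder f z m.
Proof. intros H <-; exact H. Qed.
Lemma Cder_mult f g z l m : Cder f z l -> Cder g z m ->
  Cder (fun x => f x * g x)%C z (l * g z + f z * m)%C.
Proof.
  intros H1 H2.
  (* Polarisation reduces the product rule to the chain rule and the derivative of the square. *)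
  apply (Cder_ext (fun x => / 4 * ((f x + g x) * (f x + g x) - (f x - g x) * (f x - g x)))%C).
  { intros x. field. }
  eapply Cder_eq.
  - apply (Cder_comp (fun x => / 4 * x)%C (fun x => (f x + g x) * (f x + g x) - (f x - g x) * (f x - g x))%C).
    apply Cder_scal. apply Cder_minus.
    + apply (Cder_comp (fun x => x * x)%C (fun x => f x + g x)%C). apply Cder_sq. apply Cder_plus; eauto.
    + apply (Cder_comp (fun x => x * x)%C (fun x => f x - g x)%C). apply Cder_sq. apply Cder_minus; eauto.
  - cbv beta; field.
Qed.
Lemma Cder_inv (z : C) : z <> 0%C -> Cder (fun x => / x)%C z (- / (z * z))%C.
Proof.
  (* The remainder is h^2 / ((z + h) z^2). The bound [r / 2] keeps [z + h] of modulus above [r / 2],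
     and [eps * r ^ 3 / 2] then absorbs one factor h. *)
  intros Hz eps He. set (r := Cmod z). assert (Hr : 0 < r) by (apply Cmod_gt_0; exact Hz).
  exists (Rmin (r / 2) (eps * r ^ 3 / 2)). split.
  { apply Rmin_pos; [lra|]. assert (0 < r ^ 3) by (apply pow_lt; lra).
    assert (0 < eps * r ^ 3) by (apply Rmult_lt_0_compat; lra). lra. }
  intros h Hh. assert (H1 := Rlt_le_trans _ _ _ Hh (Rmin_l _ _)).
  assert (H2 := Rlt_le_trans _ _ _ Hh (Rmin_r _ _)).
  assert (Hzh : r / 2 < Cmod (z + h)%C).
  { assert (T := Cmod_triangle (z + h)%C (- h)%C).
    replace (z + h + - h)%C with z in T by ring. rewrite Cmod_opp in T. fold r in T. lra. }
  assert (Hn : (z + h)%C <> 0%C) by (intros E; rewrite E Cmod_0 in Hzh; lra).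
  replace (/ (z + h) - / z - - / (z * z) * h)%C with (h * h / ((z + h) * (z * z)))%C
    by (field; auto).
  rewrite Cmod_div; [|repeat apply Cmult_neq_0; auto].
  rewrite !Cmod_mult. fold r. set (a := Cmod h) in *. set (b := Cmod (z + h)%C) in *.
  assert (Ha : 0 <= a) by apply Cmod_ge_0.
  apply (Rmult_le_reg_r (b * (r * r))). { repeat apply Rmult_lt_0_compat; lra. }
  unfold Rdiv. rewrite Rmult_assoc Rinv_l; [|repeat apply Rmult_integral_contrapositive_currified; lra].
  rewrite Rmult_1_r.
  assert (a * a <= a * (eps * r ^ 3 / 2)) by (apply Rmult_le_compat_l; lra).
  assert (eps * a * (r / 2 * (r * r)) <= eps * a * (b * (r * r))).
  { apply Rmult_le_compat_l. apply Rmult_le_pos; lra. apply Rmult_le_compat_r; nra. }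
  simpl in H. nra.
Qed.

Ltac eqR := match goal with |- ?a = ?b => change (@eq R a b) end.

Lemma is_RInt_affine p q a b :
  is_RInt (fun x => p + q * x) a b (p * (b - a) + q * (b * b - a * a) / 2).
Proof.
  replace (p * (b - a) + q * (b * b - a * a) / 2) with
    (minus (p * b + q * (b * b) / 2) (p * a + q * (a * a) / 2)) by (unfold minus, plus, opp; simpl; field).
  apply (is_RInt_derive (fun x => p * x + q * (x * x) / 2) (fun x => p + q * x)).
  - intros x _. auto_derive; auto. field.
  - intros x _. apply (ex_derive_continuous (fun x => p + q * x)). auto_derive. auto.
Qed.

(** This is the part subtracted locally in Goursat's lemma; the four integrals are computed
    explicitly, coordinate by coordinate, and cancel. *)
Lemma bd_affine al be ze a b c d : bd (fun z => al + be * (z - ze))%C a b c d = 0%C.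
Proof.
  destruct al as [a1 a2], be as [b1 b2], ze as [z1 z2].
  assert (Hh : forall y, CI (fun x => (a1, a2) + (b1, b2) * ((x, y) - (z1, z2)))%C a b
    = ((a1 - b1 * z1 - b2 * (y - z2)) * (b - a) + b1 * (b * b - a * a) / 2,
       (a2 + b1 * (y - z2) - b2 * z1) * (b - a) + b2 * (b * b - a * a) / 2)%R).
  { intros y. apply CI_unique. apply is_RInt_pairC; simpl. split.
    - apply (is_RInt_ext (V := R_NormedModule) (fun x => (a1 - b1 * z1 - b2 * (y - z2)) + b1 * x)).
      intros; eqR; ring. apply is_RInt_affine.
    - apply (is_RInt_ext (V := R_NormedModule) (fun x => (a2 + b1 * (y - z2) - b2 * z1) + b2 * x)).
      intros; eqR; ring. apply is_RInt_affine. }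
  assert (Hv : forall x, CI (fun y => (a1, a2) + (b1, b2) * ((x, y) - (z1, z2)))%C c d
    = ((a1 + b1 * (x - z1) + b2 * z2) * (d - c) + (- b2) * (d * d - c * c) / 2,
       (a2 - b1 * z2 + b2 * (x - z1)) * (d - c) + b1 * (d * d - c * c) / 2)%R).
  { intros x. apply CI_unique. apply is_RInt_pairC; simpl. split.
    - apply (is_RInt_ext (V := R_NormedModule) (fun y => (a1 + b1 * (x - z1) + b2 * z2) + (- b2) * y)).
      intros; eqR; ring. apply is_RInt_affine.
    - apply (is_RInt_ext (V := R_NormedModule) (fun y => (a2 - b1 * z2 + b2 * (x - z1)) + b1 * y)).
      intros; eqR; ring. apply is_RInt_affine. }
  unfold bd. rewrite !Hh !Hv. unfold Cminus, Cplus, Cmult, Copp, Ci; simpl.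
  apply injective_projections; simpl; field.
Qed.

Lemma bd_plus F G a b c d : hol F a b c d -> hol G a b c d -> a <= b -> c <= d ->
  bd (fun z => F z + G z)%C a b c d = (bd F a b c d + bd G a b c d)%C.
Proof.
  intros HF HG Hab Hcd. unfold bd.
  assert (Hh : forall y, c <= y <= d -> CI (fun x => F (x, y) + G (x, y))%C a b =
     (CI (fun x => F (x, y)) a b + CI (fun x => G (x, y)) a b)%C).
  { intros y Hy. apply CI_plus; [apply (hol_h _ _ _ _ _ _ HF)|apply (hol_h _ _ _ _ _ _ HG)]; lra. }
  assert (Hv : forall x, a <= x <= b -> CI (fun y => F (x, y) + G (x, y))%C c d =
     (CI (fun y => F (x, y)) c d + CI (fun y => G (x, y)) c d)%C).
  { intros y Hy. apply CI_plus; [apply (hol_v _ _ _ _ _ _ HF)|apply (hol_v _ _ _ _ _ _ HG)]; lra. }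
  rewrite !Hh; try lra. rewrite !Hv; try lra. ring.
Qed.
Section Bisect.
Variable P : R -> R -> R -> R -> Prop.
Variables A B C D : R.
Hypothesis HAB : A <= B.
Hypothesis HCD : C <= D.
Hypothesis Hquad : forall a b c d, a <= b -> c <= d -> A <= a -> b <= B -> C <= c -> d <= D ->
  P a ((a + b) / 2) c ((c + d) / 2) -> P ((a + b) / 2) b c ((c + d) / 2) ->
  P a ((a + b) / 2) ((c + d) / 2) d -> P ((a + b) / 2) b ((c + d) / 2) d -> P a b c d.
Hypothesis Hloc : forall x y, A <= x <= B -> C <= y <= D -> exists de, 0 < de /\
  forall a b c d, A <= a <= x -> x <= b <= B -> C <= c <= y -> y <= d <= D ->
    b - a < de -> d - c < de -> P a b c d.

Definition bad (r : R * R * R * R) : Prop :=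
  let '(a, b, c, d) := r in a <= b /\ c <= d /\ A <= a /\ b <= B /\ C <= c /\ d <= D /\ ~ P a b c d.

Definition half_of (r r' : R * R * R * R) : Prop :=
  let '(a, b, c, d) := r in let '(a', b', c', d') := r' in
  a <= a' /\ c <= c' /\ b' - a' = (b - a) / 2 /\ d' - c' = (d - c) / 2 /\ b' <= b /\ d' <= d.

Lemma bad_step (r : {r | bad r}) : exists r' : {r | bad r}, half_of (proj1_sig r) (proj1_sig r').
Proof.
  destruct r as [[[[a b] c] d] (H1 & H2 & H3 & H4 & H5 & H6 & HP)]; simpl.
  apply NNPP. intros HN. apply HP. apply Hquad; auto; apply NNPP; intros Hn; apply HN.
  - assert (Hb : bad (a, (a + b) / 2, c, (c + d) / 2)) by (repeat split; auto; lra).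
    exists (exist _ _ Hb); simpl; repeat split; lra.
  - assert (Hb : bad ((a + b) / 2, b, c, (c + d) / 2)) by (repeat split; auto; lra).
    exists (exist _ _ Hb); simpl; repeat split; lra.
  - assert (Hb : bad (a, (a + b) / 2, (c + d) / 2, d)) by (repeat split; auto; lra).
    exists (exist _ _ Hb); simpl; repeat split; lra.
  - assert (Hb : bad ((a + b) / 2, b, (c + d) / 2, d)) by (repeat split; auto; lra).
    exists (exist _ _ Hb); simpl; repeat split; lra.
Qed.

(** Goursat's subdivision for an arbitrary property of rectangles: if [P] failed on the whole, a
    failing quarter could be chosen again and again, and [Hloc] at the common point of these nested
    rectangles contradicts the failure of a small one. *)
Lemma bisect : P A B C D.
Proof.
  apply NNPP; intros HN.
  assert (Hb : bad (A, B, C, D)) by (repeat split; auto; lra).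
  set (next := fun r => proj1_sig (constructive_indefinite_description _ (bad_step r))).
  assert (Hnext : forall r, half_of (proj1_sig r) (proj1_sig (next r))).
  { intros r. exact (proj2_sig (constructive_indefinite_description _ (bad_step r))). }
  set (u := fix u n := match n with O => exist _ _ Hb | S n => next (u n) end).
  set (ua := fun n => fst (fst (fst (proj1_sig (u n))))).
  set (ub := fun n => snd (fst (fst (proj1_sig (u n))))).
  set (uc := fun n => snd (fst (proj1_sig (u n)))).
  set (ud := fun n => snd (proj1_sig (u n))).
  assert (Hu : forall n, bad (ua n, ub n, uc n, ud n)).
  { intros n. generalize (proj2_sig (u n)). unfold ua, ub, uc, ud.
    destruct (proj1_sig (u n)) as [[[? ?] ?] ?]; simpl; auto. }
  assert (Hs : forall n, ua n <= ua (S n) /\ uc n <= uc (S n) /\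
     ub (S n) - ua (S n) = (ub n - ua n) / 2 /\ ud (S n) - uc (S n) = (ud n - uc n) / 2 /\
     ub (S n) <= ub n /\ ud (S n) <= ud n).
  { intros n. generalize (Hnext (u n)). unfold ua, ub, uc, ud. simpl.
    destruct (proj1_sig (u n)) as [[[? ?] ?] ?]; destruct (proj1_sig (next (u n))) as [[[? ?] ?] ?]; simpl; auto. }
  assert (Hw : forall n, ub n - ua n = (B - A) / 2 ^ n /\ ud n - uc n = (D - C) / 2 ^ n).
  { induction n as [|n [IH1 IH2]]. unfold ua, ub, uc, ud; simpl. split; field.
    destruct (Hs n) as (_ & _ & -> & -> & _). rewrite IH1 IH2. simpl.
    assert (2 ^ n <> 0) by (apply pow_nonzero; lra). split; field; auto. }
  destruct (ex_finite_lim_seq_incr ua B) as [x Hx].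
  { intros n; apply (proj1 (Hs n)). }
  { intros n. destruct (Hu n) as (H1 & H2 & H3 & H4 & H5 & H6 & HP). lra. }
  destruct (ex_finite_lim_seq_incr uc D) as [y Hy].
  { intros n; apply (proj1 (proj2 (Hs n))). }
  { intros n. destruct (Hu n) as (H1 & H2 & H3 & H4 & H5 & H6 & HP). lra. }
  assert (Hxa : forall n, ua n <= x).
  { intros n. apply (is_lim_seq_incr_compare ua x Hx). intros; apply (proj1 (Hs _)). }
  assert (Hyc : forall n, uc n <= y).
  { intros n. apply (is_lim_seq_incr_compare uc y Hy). intros; apply (proj1 (proj2 (Hs _))). }
  assert (Hmono : forall n m, (n <= m)%nat -> ua m <= ub n /\ uc m <= ud n /\ ub m <= ub n /\ ud m <= ud n).
  { intros n m Hnm. assert (E : ub m <= ub n /\ ud m <= ud n).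
    { induction Hnm. lra. destruct (Hs m) as (h1 & h2 & h3 & h4 & h5 & h6).
      destruct (Hu m) as (H1 & H2 & _). lra. }
    destruct (Hu m) as (H1 & H2 & _). lra. }
  assert (Hxb : forall n, x <= ub n).
  { intros n. apply (is_lim_seq_le_loc ua (fun _ => ub n) x (ub n)).
    exists n. intros m Hm. apply (Hmono n m Hm). exact Hx. apply is_lim_seq_const. }
  assert (Hyd : forall n, y <= ud n).
  { intros n. apply (is_lim_seq_le_loc uc (fun _ => ud n) y (ud n)).
    exists n. intros m Hm. apply (Hmono n m Hm). exact Hy. apply is_lim_seq_const. }
  assert (Bx := conj (Hxa O) (Hxb O)). assert (By := conj (Hyc O) (Hyd O)).
  unfold ua, ub, uc, ud in Bx, By. simpl in Bx, By.
  destruct (Hloc x y Bx By) as [de [Hde HP]].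
  destruct (pow_lt_1_zero (/ 2) ltac:(rewrite Rabs_pos_eq; lra) (de / ((B - A) + (D - C) + 1))) as [n Hn].
  { apply Rdiv_lt_0_compat; lra. }
  specialize (Hn n (le_n n)). rewrite Rabs_pos_eq in Hn; [|apply pow_le; lra].
  rewrite pow_inv in Hn.
  assert (H2n : 0 < / 2 ^ n) by (apply Rinv_0_lt_compat, pow_lt; lra).
  assert (Hk : / 2 ^ n * ((B - A) + (D - C) + 1) < de).
  { apply (Rmult_lt_reg_r (/ ((B - A) + (D - C) + 1))). apply Rinv_0_lt_compat; lra.
    rewrite Rmult_assoc Rinv_r; [|lra]. lra. }
  destruct (Hu n) as (H1 & H2 & H3 & H4 & H5 & H6 & HnP). apply HnP.
  destruct (Hw n) as [W1 W2]. unfold Rdiv in W1, W2.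
  apply HP; auto; nra.
Qed.
End Bisect.

(** The bound [eps * ((b - a) ^ 2 + (d - c) ^ 2)] is divided by four under halving both sides, so it
    adds up exactly over the four quarters and fits [bisect]. *)
Theorem Goursat F a b c d : hol F a b c d -> a <= b -> c <= d -> bd F a b c d = 0%C.
Proof.
  intros HF Hab Hcd.
  assert (Heps : forall eps, 0 < eps -> Cmod (bd F a b c d) <= eps * ((b - a) ^ 2 + (d - c) ^ 2)).
  { intros eps He.
    apply (bisect (fun a b c d => Cmod (bd F a b c d) <= eps * ((b - a) ^ 2 + (d - c) ^ 2))); auto.
    - intros a' b' c' d' h1 h2 h3 h4 h5 h6 P1 P2 P3 P4.
      assert (H' : hol F a' b' c' d') by (apply (hol_sub _ _ _ _ _ _ _ _ _ HF); lra).
      rewrite (bd_splitv F a' ((a' + b') / 2) b' c' d' H'); [|lra|lra].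
      rewrite (bd_splith F a' ((a' + b') / 2) c' ((c' + d') / 2) d'); [|apply (hol_sub _ _ _ _ _ _ _ _ _ HF); lra|lra|lra].
      rewrite (bd_splith F ((a' + b') / 2) b' c' ((c' + d') / 2) d'); [|apply (hol_sub _ _ _ _ _ _ _ _ _ HF); lra|lra|lra].
      eapply Rle_trans; [apply Cmod_triangle|].
      eapply Rle_trans; [apply Rplus_le_compat; apply Cmod_triangle|]. nra.
    - intros x y Hx Hy. destruct (HF (x, y)) as [l Hl]; [split; simpl; auto|].
      (* For sides u and v, maximum times perimeter is at most eps/2 (u + v)^2 with this choice, and
         that is at most eps (u^2 + v^2). The affine approximation is subtracted beforehand, since
         its contour integral is zero. *)
      destruct (Hl (eps / 4)) as [de [Hde Hd]]; [lra|].
      exists (de / 2). split; [lra|]. intros a' b' c' d' h1 h2 h3 h4 h5 h6.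
      assert (H' : hol F a' b' c' d') by (apply (hol_sub _ _ _ _ _ _ _ _ _ HF); lra).
      set (G := fun z => (F z + (- F (x, y) + (- l) * (z - (x, y))))%C).
      assert (Haff : hol (fun z => - F (x, y) + (- l) * (z - (x, y)))%C a' b' c' d').
      { intros z _. eexists. apply Cder_plus. apply Cder_const. apply Cder_mult. apply Cder_const.
        apply Cder_minus. apply Cder_id. apply Cder_const. }
      assert (HG : hol G a' b' c' d').
      { intros z Hz. destruct (H' z Hz) as [m Hm]. destruct (Haff z Hz) as [m2 Hm2].
        eexists. apply Cder_plus; eauto. }
      assert (E : bd F a' b' c' d' = bd G a' b' c' d').
      { unfold G. rewrite bd_plus; auto; try lra. rewrite bd_affine. ring. }
      rewrite E.
      eapply Rle_trans; [apply (bd_bound G a' b' c' d' (eps / 4 * ((b' - a') + (d' - c')))); auto; try lra|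
        replace (eps * ((b' - a') ^ 2 + (d' - c') ^ 2)) with (2 * (eps / 4 * ((b' - a') + (d' - c'))) * ((b' - a') + (d' - c')) + eps / 2 * ((b' - a') - (d' - c')) ^ 2) by field;
        assert (0 <= eps / 2 * ((b' - a') - (d' - c')) ^ 2) by (apply Rmult_le_pos; [lra|apply pow2_ge_0]); lra].
      intros z [Hz1 Hz2].
      assert (Hh : Cmod (z - (x, y))%C <= (b' - a') + (d' - c')).
      { destruct z as [z1 z2]; simpl in Hz1, Hz2. unfold Cminus, Cplus, Copp; simpl.
        eapply Rle_trans; [apply Cmod_le_sum|].
        apply Rplus_le_compat; apply Rabs_le; lra. }
      unfold G. specialize (Hd (z - (x, y))%C). 
      replace ((x, y) + (z - (x, y)))%C with z in Hd by ring.
      replace (F z + (- F (x, y) + - l * (z - (x, y))))%C with (F z - F (x, y) - l * (z - (x, y)))%C by ring.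
      eapply Rle_trans; [apply Hd; lra|]. apply Rmult_le_compat_l; lra. }
  apply Cmod_eq_0. apply Rle_antisym; [|apply Cmod_ge_0].
  apply Rnot_lt_le. intros Hpos.
  set (K := (b - a) ^ 2 + (d - c) ^ 2) in *.
  assert (HK : 0 <= K) by (unfold K; nra).
  assert (H0 : 0 < Cmod (bd F a b c d) / (2 * (K + 1))) by (apply Rdiv_lt_0_compat; lra).
  specialize (Heps _ H0).
  assert (Cmod (bd F a b c d) / (2 * (K + 1)) * K < Cmod (bd F a b c d)).
  { apply (Rmult_lt_reg_r (2 * (K + 1))); [lra|].
    replace (Cmod (bd F a b c d) / (2 * (K + 1)) * K * (2 * (K + 1))) with (Cmod (bd F a b c d) * K) by (field; lra).
    nra. }
  lra.
Qed.
End ComplexDerivative.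

(** * The maximum modulus principle on a rectangle *)

Module MaximumModulus.
From Corelib Require Import ssreflect.
From Stdlib Require Import Reals Lra Lia ClassicalEpsilon.
From Coquelicot Require Import Coquelicot.
Require Import Defs.
Import ComplexIntegral ComplexDerivative.
Open Scope R_scope.

Definition inbd (a b c d : R) (z : C) :=
  inrect a b c d z /\ (fst z = a \/ fst z = b \/ snd z = c \/ snd z = d).

(** Integrability on the boundary alone, for integrands with a singularity inside the rectangle. *)
Record sides (F : C -> C) (a b c d : R) : Prop := {
  side_c : ex_RInt (V := CR) (fun x => F (x, c)) a b;
  side_d : ex_RInt (V := CR) (fun x => F (x, d)) a b;
  side_a : ex_RInt (V := CR) (fun y => F (a, y)) c d;
  side_b : ex_RInt (V := CR) (fun y => F (b, y)) c d }.

Lemma bd_bound_sides F a b c d M : sides F a b c d -> a <= b -> c <= d ->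
  (forall z, inbd a b c d z -> Cmod (F z) <= M) ->
  Cmod (bd F a b c d) <= 2 * M * ((b - a) + (d - c)).
Proof.
  intros [H1 H2 H3 H4] Hab Hcd HM. unfold bd.
  eapply Rle_trans; [apply Cmod_triangle|]. rewrite Cmod_mult Cmod_Ci Rmult_1_l.
  eapply Rle_trans; [apply Rplus_le_compat; apply Cmod_triang_minus|].
  assert (E1 : Cmod (CI (fun x => F (x, c)) a b) <= M * (b - a)).
  { apply CI_bound; auto. intros; apply HM; repeat split; simpl; auto; lra. }
  assert (E2 : Cmod (CI (fun x => F (x, d)) a b) <= M * (b - a)).
  { apply CI_bound; auto. intros; apply HM; repeat split; simpl; auto; lra. }
  assert (E3 : Cmod (CI (fun x => F (a, x)) c d) <= M * (d - c)).
  { apply CI_bound; auto. intros; apply HM; repeat split; simpl; auto; lra. }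
  assert (E4 : Cmod (CI (fun x => F (b, x)) c d) <= M * (d - c)).
  { apply CI_bound; auto. intros; apply HM; repeat split; simpl; auto; lra. }
  lra.
Qed.

Lemma bd_minus_sides F G a b c d : sides F a b c d -> sides G a b c d ->
  bd (fun z => F z - G z)%C a b c d = (bd F a b c d - bd G a b c d)%C.
Proof.
  intros [H1 H2 H3 H4] [K1 K2 K3 K4]. unfold bd.
  rewrite (CI_minus (fun x => F (x, c)) (fun x => G (x, c))) //.
  rewrite (CI_minus (fun x => F (x, d)) (fun x => G (x, d))) //.
  rewrite (CI_minus (fun x => F (a, x)) (fun x => G (a, x))) //.
  rewrite (CI_minus (fun x => F (b, x)) (fun x => G (b, x))) //.
  ring.
Qed.

Section Punctured.
Variables (F : C -> C) (z0 : C) (a b c d : R).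
Hypothesis HF : forall z, inrect a b c d z -> z <> z0 -> exists l, Cder F z l.
Hypothesis Ha : a < fst z0 < b.
Hypothesis Hc : c < snd z0 < d.

Lemma punct_h a' b' y : a <= a' -> a' <= b' -> b' <= b -> c <= y <= d -> y <> snd z0 ->
  ex_RInt (V := CR) (fun x => F (x, y)) a' b'.
Proof.
  intros h1 h2 h3 Hy Hn. apply ex_CI. rewrite Rmin_left // Rmax_right //.
  intros x Hx. apply hcont, HF. split; simpl; lra. intros E; apply Hn; rewrite -E //.
Qed.
Lemma punct_v c' d' x : c <= c' -> c' <= d' -> d' <= d -> a <= x <= b -> x <> fst z0 ->
  ex_RInt (V := CR) (fun y => F (x, y)) c' d'.
Proof.
  intros h1 h2 h3 Hy Hn. apply ex_CI. rewrite Rmin_left // Rmax_right //.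
  intros y Hx. apply vcont, HF. split; simpl; lra. intros E; apply Hn; rewrite -E //.
Qed.
Lemma punct_sides : sides F a b c d.
Proof. split; [apply punct_h|apply punct_h|apply punct_v|apply punct_v]; lra. Qed.

(** Goursat's lemma is applied to the four rectangles around the small square: two of full height to
    its left and right, and two of its own width below and above it. *)
Lemma punct_shrink e : 0 < e -> e < fst z0 - a -> e < b - fst z0 -> e < snd z0 - c -> e < d - snd z0 ->
  bd F a b c d = bd F (fst z0 - e) (fst z0 + e) (snd z0 - e) (snd z0 + e).
Proof.
  intros He h1 h2 h3 h4. set (x := fst z0) in *. set (y := snd z0) in *.
  assert (G1 : bd F a (x - e) c d = 0%C).
  { apply Goursat; try lra. intros z [Hz1 Hz2]. apply HF. split; lra.
    intros E; subst z; fold x in Hz1; lra. }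
  assert (G2 : bd F (x + e) b c d = 0%C).
  { apply Goursat; try lra. intros z [Hz1 Hz2]. apply HF. split; lra.
    intros E; subst z; fold x in Hz1; lra. }
  assert (G3 : bd F (x - e) (x + e) c (y - e) = 0%C).
  { apply Goursat; try lra. intros z [Hz1 Hz2]. apply HF. split; lra.
    intros E; subst z; fold y in Hz2; lra. }
  assert (G4 : bd F (x - e) (x + e) (y + e) d = 0%C).
  { apply Goursat; try lra. intros z [Hz1 Hz2]. apply HF. split; lra.
    intros E; subst z; fold y in Hz2; lra. }
  unfold bd in *.
  rewrite -(CI_Chasles (fun t => F (t, c)) a (x - e) b); [|apply punct_h; fold y; lra|apply punct_h; fold y; lra].
  rewrite -(CI_Chasles (fun t => F (t, c)) (x - e) (x + e) b); [|apply punct_h; fold y; lra|apply punct_h; fold y; lra].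
  rewrite -(CI_Chasles (fun t => F (t, d)) a (x - e) b); [|apply punct_h; fold y; lra|apply punct_h; fold y; lra].
  rewrite -(CI_Chasles (fun t => F (t, d)) (x - e) (x + e) b); [|apply punct_h; fold y; lra|apply punct_h; fold y; lra].
  assert (V : forall t, a <= t <= b -> t <> x -> CI (fun s => F (t, s)) c d =
     (CI (fun s => F (t, s)) c (y - e) + CI (fun s => F (t, s)) (y - e) (y + e) + CI (fun s => F (t, s)) (y + e) d)%C).
  { intros t Ht Hn.
    rewrite -(CI_Chasles (fun s => F (t, s)) c (y - e) d); [|apply punct_v; fold x; lra|apply punct_v; fold x; lra].
    rewrite -(CI_Chasles (fun s => F (t, s)) (y - e) (y + e) d); [|apply punct_v; fold x; lra|apply punct_v; fold x; lra].
    ring. }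
  rewrite (V (x - e)) in G1; try lra. rewrite (V (x + e)) in G2; try lra.
  transitivity ((CI (fun x1 => F (x1, (y - e)%R)) (x - e) (x + e) - CI (fun x1 => F (x1, (y + e)%R)) (x - e) (x + e) +
   Ci * (CI (fun y0 => F ((x + e)%R, y0)) (y - e) (y + e) - CI (fun y0 => F ((x - e)%R, y0)) (y - e) (y + e))) + 0 + 0 + 0 + 0)%C; [|ring].
  rewrite -{1}G1 -{1}G2 -{1}G3 -{1}G4. ring.
Qed.

(** A bounded singularity contributes nothing: around the square of half-side [e] the integral is at
    most a constant times [e]. *)
Lemma punct_zero : (exists K r, 0 < r /\ forall z, z <> z0 -> Cmod (z - z0)%C < r -> Cmod (F z) <= K) ->
  bd F a b c d = 0%C.
Proof.
  intros (K & r & Hr & HK). apply Cmod_eq_0, Rle_antisym; [|apply Cmod_ge_0].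
  apply Rnot_lt_le. intros Hpos.
  (* The perimeter estimate gives [8 * e * (Rabs K + 1)]; this [e] makes it at most half of the
     modulus that is assumed positive. *)
  set (e := Rmin (Rmin (Rmin (fst z0 - a) (b - fst z0)) (Rmin (snd z0 - c) (d - snd z0)))
              (Rmin (r / 2) (Cmod (bd F a b c d) / (8 * (Rabs K + 1)))) / 2).
  assert (HK0 := Rabs_pos K). assert (HK1 := Rle_abs K).
  assert (He : 0 < e).
  { unfold e. apply Rdiv_lt_0_compat; [|lra]. repeat apply Rmin_pos; try lra.
    apply Rdiv_lt_0_compat; lra. }
  assert (B : 2 * e <= fst z0 - a /\ 2 * e <= b - fst z0 /\ 2 * e <= snd z0 - c /\ 2 * e <= d - snd z0
     /\ 2 * e <= r / 2 /\ 2 * e <= Cmod (bd F a b c d) / (8 * (Rabs K + 1))).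
  { unfold e. set (u := Rmin _ (Rmin (r / 2) _)). replace (2 * (u / 2)) with u by field.
    repeat split; unfold u.
    eapply Rle_trans; [apply Rmin_l|eapply Rle_trans; [apply Rmin_l|apply Rmin_l]].
    eapply Rle_trans; [apply Rmin_l|eapply Rle_trans; [apply Rmin_l|apply Rmin_r]].
    eapply Rle_trans; [apply Rmin_l|eapply Rle_trans; [apply Rmin_r|apply Rmin_l]].
    eapply Rle_trans; [apply Rmin_l|eapply Rle_trans; [apply Rmin_r|apply Rmin_r]].
    eapply Rle_trans; [apply Rmin_r|apply Rmin_l].
    eapply Rle_trans; [apply Rmin_r|apply Rmin_r]. }
  destruct B as (B1 & B2 & B3 & B4 & B5 & B6).
  assert (E := punct_shrink e He ltac:(lra) ltac:(lra) ltac:(lra) ltac:(lra)).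
  assert (Bd : Cmod (bd F a b c d) <= 2 * (Rabs K + 1) * ((fst z0 + e - (fst z0 - e)) + (snd z0 + e - (snd z0 - e)))).
  { rewrite {1}E. apply bd_bound_sides; try lra.
    - split; [apply punct_h|apply punct_h|apply punct_v|apply punct_v]; lra.
    - intros z [[Hz1 Hz2] Hz3]. apply Rle_trans with K; [|lra]. apply HK.
      + intros ->. lra.
      + replace (z - z0)%C with ((fst z - fst z0)%R, (snd z - snd z0)%R) by reflexivity.
        eapply Rle_lt_trans; [apply Cmod_le_sum|].
        assert (Rabs (fst z - fst z0) <= e) by (apply Rabs_le; lra).
        assert (Rabs (snd z - snd z0) <= e) by (apply Rabs_le; lra). lra. }
  assert (B7 : 2 * e * (8 * (Rabs K + 1)) <= Cmod (bd F a b c d)).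
  { apply (Rmult_le_reg_r (/ (8 * (Rabs K + 1)))). apply Rinv_0_lt_compat; lra.
    rewrite Rmult_assoc Rinv_r; [|lra]. lra. }
  nra.
Qed.
End Punctured.

(** Each of the four sides contributes a positive amount to the imaginary part. *)
Lemma bd_inv_ne0 (x0 y0 a b c d : R) : a < x0 < b -> c < y0 < d ->
  bd (fun z => / (z - (x0, y0)))%C a b c d <> 0%C.
Proof.
  intros Ha Hc E.
  assert (S : sides (fun z => / (z - (x0, y0)))%C a b c d).
  { apply (punct_sides (fun z => / (z - (x0, y0)))%C (x0, y0)); simpl; auto.
    intros z _ Hz. eexists. apply (Cder_comp (fun z => / z)%C (fun z => z - (x0, y0))%C).
    apply Cder_inv. intros E0. apply Hz. replace z with (z - (x0, y0) + (x0, y0))%C by ring. rewrite E0. ring.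
    apply Cder_minus. apply Cder_id. apply Cder_const. }
  destruct S as [S1 S2 S3 S4].
  apply CI_correct in S1, S2, S3, S4. apply is_RInt_pairC in S1, S2, S3, S4.
  destruct S1 as [_ S1], S2 as [_ S2], S3 as [S3 _], S4 as [S4 _].
  unfold bd in E.
  set (I1 := CI (fun x => / ((x, c) - (x0, y0)))%C a b) in *. set (I2 := CI (fun x => / ((x, d) - (x0, y0)))%C a b) in *.
  set (J1 := CI (fun y => / ((b, y) - (x0, y0)))%C c d) in *. set (J2 := CI (fun y => / ((a, y) - (x0, y0)))%C c d) in *.
  clearbody I1 I2 J1 J2. apply (is_RInt_unique (V := R_CompleteNormedModule)) in S1, S2, S3, S4. simpl in S1, S2, S3, S4.
  apply (f_equal snd) in E. simpl in E.
  assert (P1 : 0 < snd I1).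
  { rewrite -S1. apply RInt_gt_0; [lra| |].
    - intros x Hx. apply Rdiv_lt_0_compat; [lra|]. assert (0 <= (x + - x0) ^ 2) by apply pow2_ge_0. nra.
    - intros x Hx. apply (ex_derive_continuous (fun x => - (c + - y0) / ((x + - x0) ^ 2 + (c + - y0) ^ 2))). auto_derive.
      assert (0 <= (x + - x0) ^ 2) by apply pow2_ge_0. simpl in *; nra. }
  assert (P2 : 0 < - snd I2).
  { rewrite -S2. match goal with |- 0 < - ?r => change (0 < opp r) end. rewrite -RInt_opp.
    2:{ apply (ex_RInt_continuous (V := R_CompleteNormedModule)). intros x Hx.
      apply (ex_derive_continuous (fun x => - (d + - y0) / ((x + - x0) ^ 2 + (d + - y0) ^ 2))). auto_derive.
      assert (0 <= (x + - x0) ^ 2) by apply pow2_ge_0. simpl in *; nra. }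
    apply RInt_gt_0; [lra| |].
    - intros x Hx. unfold opp; simpl. rewrite -Rdiv_opp_l Ropp_involutive. apply Rdiv_lt_0_compat; [lra|]. assert (0 <= (x + - x0) ^ 2) by apply pow2_ge_0. simpl in *; nra.
    - intros x Hx. apply (ex_derive_continuous (fun x => - (- (d + - y0) / ((x + - x0) ^ 2 + (d + - y0) ^ 2)))). auto_derive.
      assert (0 <= (x + - x0) ^ 2) by apply pow2_ge_0. simpl in *; nra. }
  assert (P3 : 0 < fst J1).
  { rewrite -S4. apply RInt_gt_0; [lra| |].
    - intros x Hx. apply Rdiv_lt_0_compat; [lra|]. assert (0 <= (x + - y0) ^ 2) by apply pow2_ge_0. nra.
    - intros x Hx. apply (ex_derive_continuous (fun x => (b + - x0) / ((b + - x0) ^ 2 + (x + - y0) ^ 2))). auto_derive.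
      assert (0 <= (x + - y0) ^ 2) by apply pow2_ge_0. simpl in *; nra. }
  assert (P4 : 0 < - fst J2).
  { rewrite -S3. match goal with |- 0 < - ?r => change (0 < opp r) end. rewrite -RInt_opp.
    2:{ apply (ex_RInt_continuous (V := R_CompleteNormedModule)). intros x Hx.
      apply (ex_derive_continuous (fun x => (a + - x0) / ((a + - x0) ^ 2 + (x + - y0) ^ 2))). auto_derive.
      assert (0 <= (x + - y0) ^ 2) by apply pow2_ge_0. simpl in *; nra. }
    apply RInt_gt_0; [lra| |].
    - intros x Hx. unfold opp; simpl. rewrite -Rdiv_opp_l. apply Rdiv_lt_0_compat; [lra|]. assert (0 <= (x + - y0) ^ 2) by apply pow2_ge_0. simpl in *; nra.
    - intros x Hx. apply (ex_derive_continuous (fun x => - ((a + - x0) / ((a + - x0) ^ 2 + (x + - y0) ^ 2)))). auto_derive.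
      assert (0 <= (x + - y0) ^ 2) by apply pow2_ge_0. simpl in *; nra. }
  lra.
Qed.

Lemma Cder_cpown n : forall F z l, Cder F z l -> exists m, Cder (fun x => cpown (F x) n) z m.
Proof.
  induction n as [|n IH]; intros F z l H; simpl.
  - eexists. apply Cder_const.
  - destruct (IH F z l H) as [m Hm]. eexists. apply Cder_mult; eauto.
Qed.

Lemma Cmod_cpown z n : Cmod (cpown z n) = Cmod z ^ n.
Proof. induction n; simpl. apply Cmod_1. rewrite Cmod_mult IHn //. Qed.

Lemma Ceq_minus (x y : C) : (x - y)%C = 0%C -> x = y.
Proof. intros H. replace x with ((x - y) + y)%C by ring. rewrite H. ring. Qed.

(** Landau's power trick. Let G = F / F(z0) and k = 1/(z - z0). For every n the contour integrals of
    k and of G^n k coincide; if |F(z0)| exceeded M, then |G| <= rho < 1 on the boundary would force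
    this common value to be 0, against [bd_inv_ne0]. *)
Theorem MMP F a b c d M z0 : hol F a b c d -> a < fst z0 < b -> c < snd z0 < d ->
  (forall z, inbd a b c d z -> Cmod (F z) <= M) -> Cmod (F z0) <= M.
Proof.
  intros HF Ha Hc HM. apply Rnot_lt_le. intros Hlt.
  assert (HM0 : 0 <= M).
  { eapply Rle_trans; [apply Cmod_ge_0|apply (HM (a, c))]. repeat split; simpl; auto; lra. }
  set (w := F z0) in *. assert (Hw : w <> 0%C) by (apply Cmod_gt_0; lra).
  destruct z0 as [x0 y0]; simpl in Ha, Hc.
  set (k := fun z => (/ (z - (x0, y0)))%C).
  set (G := fun z => (/ w * F z)%C).
  assert (HG : hol G a b c d).
  { intros z Hz. destruct (HF z Hz) as [l Hl]. eexists. apply Cder_mult. apply Cder_const. exact Hl. }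
  assert (Hk : forall z : C, z <> ((x0, y0) : C) -> exists l, Cder k z l).
  { intros z Hz. eexists. apply (Cder_comp (fun z => / z)%C (fun z => z - (x0, y0))%C).
    apply Cder_inv. intros E0. apply Hz. replace z with (z - (x0, y0) + (x0, y0))%C by ring. rewrite E0. ring.
    apply Cder_minus. apply Cder_id. apply Cder_const. }
  assert (HP : forall n z, inrect a b c d z -> exists l, Cder (fun x => cpown (G x) n) z l).
  { intros n z Hz. destruct (HG z Hz) as [l Hl]. apply (Cder_cpown n G z l Hl). }
  assert (HG0 : G (x0, y0) = 1%C) by (unfold G; fold w; field; auto).
  assert (HP1 : forall n, cpown 1%C n = 1%C) by (induction n as [|n IH]; [reflexivity|]; change (1 * cpown 1%C n = 1)%C; rewrite IH; apply Cmult_1_l).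
  assert (HPk : forall n (z : C), inrect a b c d z -> z <> ((x0, y0) : C) -> exists l, Cder (fun x => cpown (G x) n * k x)%C z l).
  { intros n z Hz Hn. destruct (HP n z Hz) as [l Hl]. destruct (Hk z Hn) as [m Hm].
    eexists. apply Cder_mult; eauto. }
  assert (Sk : sides k a b c d) by (apply (punct_sides k (x0, y0)); simpl; auto).
  assert (SP : forall n, sides (fun x => cpown (G x) n * k x)%C a b c d).
  { intros n. apply (punct_sides _ (x0, y0)); simpl; auto. }
  assert (Eq : forall n, bd k a b c d = bd (fun x => cpown (G x) n * k x)%C a b c d).
  { intros n.
    assert (Z : bd (fun x => cpown (G x) n * k x - k x)%C a b c d = 0%C).
    { apply (punct_zero _ (x0, y0)); simpl; auto.
      - intros z Hz Hn. destruct (HPk n z Hz Hn) as [l Hl]. destruct (Hk z Hn) as [m Hm].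
        eexists. apply Cder_minus; eauto.
      - destruct (HP n (x0, y0)) as [l Hl]; [split; simpl; lra|].
        destruct (Hl 1 Rlt_0_1) as [r [Hr H]]. exists (1 + Cmod l), r. split; [exact Hr|].
        intros z Hz Hzr. specialize (H _ Hzr).
        replace ((x0, y0) + (z - (x0, y0)))%C with z in H by ring. rewrite HG0 HP1 in H.
        set (h := (z - (x0, y0))%C) in *.
        assert (Hh : h <> 0%C).
        { intros E. apply Hz. replace z with (h + (x0, y0))%C by (unfold h; ring). rewrite E. ring. }
        replace (cpown (G z) n * k z - k z)%C with ((cpown (G z) n - 1) / h)%C by (unfold k; fold h; field; auto).
        rewrite Cmod_div //. assert (Hh0 : 0 < Cmod h) by (apply Cmod_gt_0; auto).
        apply (Rmult_le_reg_r (Cmod h)); auto. unfold Rdiv. rewrite Rmult_assoc Rinv_l; [|lra]. rewrite Rmult_1_r.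
        replace (cpown (G z) n - 1)%C with ((cpown (G z) n - 1 - l * h) + l * h)%C by ring.
        eapply Rle_trans; [apply Cmod_triangle|]. rewrite Cmod_mult. lra. }
    assert (Z2 := eq_trans (eq_sym (bd_minus_sides _ _ _ _ _ _ (SP n) Sk)) Z).
    apply Ceq_minus in Z2. symmetry; exact Z2. }
  apply (bd_inv_ne0 x0 y0 a b c d Ha Hc). fold k.
  set (m := Rmin (Rmin (x0 - a) (b - x0)) (Rmin (y0 - c) (d - y0))).
  assert (Hm : 0 < m) by (unfold m; repeat apply Rmin_pos; lra).
  assert (Hm4 : m <= x0 - a /\ m <= b - x0 /\ m <= y0 - c /\ m <= d - y0).
  { unfold m; repeat split.
    eapply Rle_trans; [apply Rmin_l|apply Rmin_l].
    eapply Rle_trans; [apply Rmin_l|apply Rmin_r].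
    eapply Rle_trans; [apply Rmin_r|apply Rmin_l].
    eapply Rle_trans; [apply Rmin_r|apply Rmin_r]. }
  assert (Hkb : forall z, inbd a b c d z -> Cmod (k z) <= / m).
  { intros z [[Hz1 Hz2] Hz3].
    assert (Hge : m <= Cmod (z - (x0, y0))%C).
    { destruct z as [z1 z2]; simpl in *. unfold Cminus, Cplus, Copp; simpl.
      apply Rle_trans with (Rmax (Rabs (z1 + - x0)) (Rabs (z2 + - y0))); [|exact (Rmax_Cmod ((z1 + - x0)%R, (z2 + - y0)%R))].
      destruct Hz3 as [E | [E | [E | E]]]; subst.
      - eapply Rle_trans; [|apply Rmax_l]. rewrite Rabs_left1; lra.
      - eapply Rle_trans; [|apply Rmax_l]. rewrite Rabs_pos_eq; lra.
      - eapply Rle_trans; [|apply Rmax_r]. rewrite Rabs_left1; lra.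
      - eapply Rle_trans; [|apply Rmax_r]. rewrite Rabs_pos_eq; lra. }
    unfold k. rewrite Cmod_inv; [|apply Cmod_gt_0; lra]. apply Rinv_le_contravar; lra. }
  set (rho := M / Cmod w).
  assert (Hrho : 0 <= rho < 1).
  { unfold rho; split. apply Rdiv_le_0_compat; lra.
    apply (Rmult_lt_reg_r (Cmod w)); [lra|]. unfold Rdiv. rewrite Rmult_assoc Rinv_l; lra. }
  assert (HGb : forall z, inbd a b c d z -> Cmod (G z) <= rho).
  { intros z Hz. unfold G, rho, Rdiv. rewrite Cmod_mult Cmod_inv // Rmult_comm.
    apply Rmult_le_compat_r. apply Rlt_le, Rinv_0_lt_compat; lra. apply HM, Hz. }
  set (L := 2 * / m * ((b - a) + (d - c))).
  assert (HL : 0 < L).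
  { unfold L. repeat apply Rmult_lt_0_compat; try lra. apply Rinv_0_lt_compat; lra. }
  assert (Hb : forall n, Cmod (bd k a b c d) <= rho ^ n * L).
  { intros n. rewrite (Eq n). replace (rho ^ n * L) with (2 * (rho ^ n * / m) * ((b - a) + (d - c))) by (unfold L; ring).
    apply bd_bound_sides; auto; try lra. intros z Hz. rewrite Cmod_mult Cmod_cpown.
    apply Rmult_le_compat; try apply Cmod_ge_0; auto. apply pow_le, Cmod_ge_0.
    apply pow_incr. split; [apply Cmod_ge_0|auto]. }
  apply Cmod_eq_0, Rle_antisym; [|apply Cmod_ge_0]. apply Rnot_lt_le. intros Hpos.
  destruct (pow_lt_1_zero rho ltac:(rewrite Rabs_pos_eq; lra) (Cmod (bd k a b c d) / L)) as [n Hn].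
  { apply Rdiv_lt_0_compat; lra. }
  specialize (Hn n (le_n n)). rewrite Rabs_pos_eq in Hn; [|apply pow_le; lra].
  specialize (Hb n). apply (Rmult_lt_compat_r L) in Hn; auto.
  unfold Rdiv in Hn. rewrite Rmult_assoc Rinv_l in Hn; lra.
Qed.
End MaximumModulus.

(** * The complex exponential, and uniqueness on the upper half-plane from values on the imaginary
    axis *)

Module ComplexExponential.
From Corelib Require Import ssreflect.
From Stdlib Require Import Reals Lra Lia ClassicalEpsilon.
From Coquelicot Require Import Coquelicot.
Require Import Defs.
Import ComplexIntegral ComplexDerivative MaximumModulus.
Open Scope R_scope.

Lemma cexp_plus z w : cexp (z + w)%C = (cexp z * cexp w)%C.
Proof.
  unfold cexp, Cplus, Cmult; simpl. rewrite exp_plus cos_plus sin_plus.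
  f_equal; ring.
Qed.
Lemma cexp_0 : cexp 0%C = 1%C.
Proof. unfold cexp, RtoC; simpl. rewrite exp_0 cos_0 sin_0. f_equal; ring. Qed.
Lemma Cmod_cexp z : Cmod (cexp z) = exp (fst z).
Proof.
  unfold Cmod, cexp; simpl.
  replace (exp (fst z) * cos (snd z) * (exp (fst z) * cos (snd z) * 1) + exp (fst z) * sin (snd z) * (exp (fst z) * sin (snd z) * 1))
    with (Rsqr (exp (fst z)) * (Rsqr (sin (snd z)) + Rsqr (cos (snd z)))) by (unfold Rsqr; ring).
  rewrite sin2_cos2 Rmult_1_r sqrt_Rsqr //. apply Rlt_le, exp_pos.
Qed.
Lemma cexp_neq0 z : cexp z <> 0%C.
Proof. apply Cmod_gt_0. rewrite Cmod_cexp. apply exp_pos. Qed.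
Lemma cexp_opp z : cexp (- z)%C = (/ cexp z)%C.
Proof.
  assert (H : (cexp (- z) * cexp z)%C = 1%C).
  { rewrite -cexp_plus. replace (- z + z)%C with (RtoC 0) by ring. apply cexp_0. }
  replace (cexp (- z)%C) with (cexp (- z) * cexp z * / cexp z)%C by (field; apply cexp_neq0).
  rewrite H. ring.
Qed.
Lemma cexp_nat z n : cexp (INR n * z)%C = cpown (cexp z) n.
Proof.
  induction n as [|n IH].
  - simpl. replace (0 * z)%C with (RtoC 0) by ring. apply cexp_0.
  - rewrite S_INR. replace ((INR n + 1)%R * z)%C with (z + INR n * z)%C by (rewrite RtoC_plus; ring).
    rewrite cexp_plus IH. reflexivity.
Qed.
Lemma cexp_R x : cexp (RtoC x) = RtoC (exp x).
Proof. unfold cexp, RtoC; simpl. rewrite cos_0 sin_0. f_equal; ring. Qed.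

Lemma fst_le_Cmod z : fst z <= Cmod z.
Proof. eapply Rle_trans; [apply Rle_abs|apply (Rle_trans _ _ _ (Rmax_l _ _) (Rmax_Cmod z))]. Qed.
Lemma Rabs_fst_le z : Rabs (fst z) <= Cmod z.
Proof. apply (Rle_trans _ _ _ (Rmax_l _ _) (Rmax_Cmod z)). Qed.
Lemma Rabs_snd_le z : Rabs (snd z) <= Cmod z.
Proof. apply (Rle_trans _ _ _ (Rmax_r _ _) (Rmax_Cmod z)). Qed.

(** Integral form of the Taylor remainder; [cexp_m1] bounds this integrand directly, and [cexp_m2]
    bounds it by way of [cexp_m1]. *)
Lemma is_RInt_cexp (w : C) :
  is_RInt (V := C_R_NormedModule) (fun t => w * cexp (RtoC t * w))%C 0 1 (cexp w - 1)%C.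
Proof.
  destruct w as [a b]. apply is_RInt_pairC; simpl. split.
  - replace (exp a * cos b + - (1))
      with (minus (exp (1 * a - 0 * b) * cos (1 * b + 0 * a)) (exp (0 * a - 0 * b) * cos (0 * b + 0 * a))).
    2:{ unfold minus, plus, opp; simpl. replace (1 * a - 0 * b) with a by ring. replace (1 * b + 0 * a) with b by ring.
        replace (0 * a - 0 * b) with 0 by ring. replace (0 * b + 0 * a) with 0 by ring. rewrite exp_0 cos_0. ring. }
    apply (is_RInt_derive (fun t => exp (t * a - 0 * b) * cos (t * b + 0 * a))).
    + intros t _. auto_derive; auto. unfold Rminus; ring.
    + intros t _. apply (ex_derive_continuous (fun t => a * (exp (t * a - 0 * b) * cos (t * b + 0 * a)) - b * (exp (t * a - 0 * b) * sin (t * b + 0 * a)))). auto_derive; auto.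
  - replace (exp a * sin b + - 0)
      with (minus (exp (1 * a - 0 * b) * sin (1 * b + 0 * a)) (exp (0 * a - 0 * b) * sin (0 * b + 0 * a))).
    2:{ unfold minus, plus, opp; simpl. replace (1 * a - 0 * b) with a by ring. replace (1 * b + 0 * a) with b by ring.
        replace (0 * a - 0 * b) with 0 by ring. replace (0 * b + 0 * a) with 0 by ring. rewrite exp_0 sin_0. ring. }
    apply (is_RInt_derive (fun t => exp (t * a - 0 * b) * sin (t * b + 0 * a))).
    + intros t _. auto_derive; auto. unfold Rminus; ring.
    + intros t _. apply (ex_derive_continuous (fun t => a * (exp (t * a - 0 * b) * sin (t * b + 0 * a)) + b * (exp (t * a - 0 * b) * cos (t * b + 0 * a)))). auto_derive; auto.
Qed.

Lemma cexp_m1 w : Cmod (cexp w - 1)%C <= Cmod w * exp (Cmod w).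
Proof.
  rewrite -(CI_unique _ _ _ _ (is_RInt_cexp w)).
  replace (Cmod w * exp (Cmod w)) with (Cmod w * exp (Cmod w) * (1 - 0)) by ring.
  apply CI_bound; [lra|eexists; apply is_RInt_cexp|].
  intros x Hx. rewrite Cmod_mult Cmod_cexp. apply Rmult_le_compat_l; [apply Cmod_ge_0|].
  assert (H : fst (RtoC x * w)%C <= Cmod w).
  { eapply Rle_trans; [apply fst_le_Cmod|]. rewrite Cmod_mult Cmod_R Rabs_pos_eq; [|lra].
    assert (H0 := Cmod_ge_0 w). nra. }
  destruct (Rle_lt_or_eq_dec _ _ H) as [H1|H1]; [left; apply exp_increasing; exact H1|rewrite H1; lra].
Qed.

Lemma exp_le x y : x <= y -> exp x <= exp y.
Proof. intros H. destruct (Rle_lt_or_eq_dec _ _ H) as [H1|H1]; [left; apply exp_increasing; exact H1|rewrite H1; lra]. Qed.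

Lemma cexp_m2 w : Cmod (cexp w - 1 - w)%C <= Cmod w ^ 2 * exp (Cmod w).
Proof.
  assert (H0 := Cmod_ge_0 w).
  assert (HI : is_RInt (V := C_R_NormedModule) (fun t => w * cexp (RtoC t * w) - w)%C 0 1 (cexp w - 1 - w)%C).
  { apply (is_RInt_minus (V := C_R_NormedModule)); [apply is_RInt_cexp|].
    apply is_RInt_pairC. split.
    - evar_last. apply (is_RInt_const (V := R_NormedModule)). unfold scal; simpl; unfold mult; simpl. ring.
    - evar_last. apply (is_RInt_const (V := R_NormedModule)). unfold scal; simpl; unfold mult; simpl. ring. }
  rewrite -(CI_unique _ _ _ _ HI).
  replace (Cmod w ^ 2 * exp (Cmod w)) with (Cmod w * (Cmod w * exp (Cmod w)) * (1 - 0)) by ring.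
  apply CI_bound; [lra|eexists; apply HI|].
  intros x Hx. replace (w * cexp (RtoC x * w) - w)%C with (w * (cexp (RtoC x * w) - 1))%C by ring.
  rewrite Cmod_mult. apply Rmult_le_compat_l; [apply Cmod_ge_0|].
  eapply Rle_trans; [apply cexp_m1|]. rewrite Cmod_mult Cmod_R Rabs_pos_eq; [|lra].
  apply Rmult_le_compat; [nra|apply Rlt_le, exp_pos|nra|apply exp_le; nra].
Qed.

Lemma Cder_cexp z : Cder cexp z (cexp z).
Proof.
  intros eps He. set (m := Cmod (cexp z)). assert (Hm : 0 < m) by (apply Cmod_gt_0, cexp_neq0).
  assert (H1 := exp_pos 1).
  exists (Rmin 1 (eps / (m * exp 1))). split.
  { apply Rmin_pos; [lra|]. apply Rdiv_lt_0_compat; auto. nra. }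
  intros h Hh. rewrite cexp_plus.
  replace (cexp z * cexp h - cexp z - cexp z * h)%C with (cexp z * (cexp h - 1 - h))%C by ring.
  rewrite Cmod_mult. fold m. assert (H0 := Cmod_ge_0 h).
  eapply Rle_trans; [apply Rmult_le_compat_l; [lra|apply cexp_m2]|].
  assert (h1 : Cmod h <= 1) by (eapply Rle_trans; [left; exact Hh|apply Rmin_l]).
  assert (h2 : Cmod h <= eps / (m * exp 1)) by (eapply Rle_trans; [left; exact Hh|apply Rmin_r]).
  assert (h3 : Cmod h * (m * exp 1) <= eps).
  { apply (Rmult_le_reg_r (/ (m * exp 1))). apply Rinv_0_lt_compat; nra. rewrite Rmult_assoc Rinv_r; [|nra]. lra. }
  assert (h4 := exp_le _ _ h1).
  assert (m * Cmod h * exp (Cmod h) <= eps).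
  { eapply Rle_trans; [|exact h3]. replace (Cmod h * (m * exp 1)) with (m * Cmod h * exp 1) by ring.
    apply Rmult_le_compat_l; auto. apply Rmult_le_pos; lra. }
  replace (m * (Cmod h ^ 2 * exp (Cmod h))) with ((m * Cmod h * exp (Cmod h)) * Cmod h) by ring.
  apply Rmult_le_compat_r; auto.
Qed.

Lemma ex_Cder_cexp f z : (exists l, Cder f z l) -> exists l, Cder (fun x => cexp (f x)) z l.
Proof. intros [l H]. eexists. apply (Cder_comp cexp f). apply Cder_cexp. exact H. Qed.
Lemma ex_Cder_mult f g z : (exists l, Cder f z l) -> (exists l, Cder g z l) -> exists l, Cder (fun x => f x * g x)%C z l.
Proof. intros [l H] [m K]. eexists. apply Cder_mult; eauto. Qed.
Lemma ex_Cder_plus f g z : (exists l, Cder f z l) -> (exists l, Cder g z l) -> exists l, Cder (fun x => f x + g x)%C z l.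
Proof. intros [l H] [m K]. eexists. apply Cder_plus; eauto. Qed.
Lemma ex_Cder_minus f g z : (exists l, Cder f z l) -> (exists l, Cder g z l) -> exists l, Cder (fun x => f x - g x)%C z l.
Proof. intros [l H] [m K]. eexists. apply Cder_minus; eauto. Qed.
Lemma ex_Cder_const c z : exists l, Cder (fun _ => c) z l.
Proof. eexists. apply Cder_const. Qed.
Lemma ex_Cder_id z : exists l, Cder (fun x => x) z l.
Proof. eexists. apply Cder_id. Qed.
Lemma ex_Cder_inv f z : (exists l, Cder f z l) -> f z <> 0%C -> exists l, Cder (fun x => / f x)%C z l.
Proof. intros [l H] Hn. eexists. apply (Cder_comp (fun x => / x)%C f). apply Cder_inv, Hn. exact H. Qed.
Lemma ex_Cder_cpown f z n : (exists l, Cder f z l) -> exists l, Cder (fun x => cpown (f x) n) z l.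
Proof. intros [l H]. apply (Cder_cpown n f z l H). Qed.
Lemma ex_Cder_comp f g z : (exists l, Cder f (g z) l) -> (exists l, Cder g z l) -> exists l, Cder (fun x => f (g x)) z l.
Proof. intros [l H] [m K]. eexists. apply Cder_comp; eauto. Qed.

Lemma cont_bounded f a b : a <= b -> (forall x, a <= x <= b -> cont f x) ->
  exists M, forall x, a <= x <= b -> Cmod (f x) <= M.
Proof.
  intros Hab Hc.
  destruct (continuity_ab_maj (fun x => Cmod (f x)) a b Hab) as [Mx [HM _]].
  - intros x Hx. intros eps He. destruct (Hc x Hx eps He) as [d [Hd H]].
    exists d; split; auto. intros y [_ Hy]. specialize (H y Hy). simpl. unfold R_dist.
    apply Rle_lt_trans with (Cmod (f y - f x)%C); auto.
    assert (T1 := Cmod_triangle (f y - f x)%C (f x)). assert (T2 := Cmod_triangle (f x - f y)%C (f y)).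
    replace (f y - f x + f x)%C with (f y) in T1 by ring. replace (f x - f y + f y)%C with (f x) in T2 by ring.
    replace (f x - f y)%C with (- (f y - f x))%C in T2 by ring. rewrite Cmod_opp in T2.
    apply Rabs_le. lra.
  - exists (Cmod (f Mx)). exact HM.
Qed.

Lemma hol_bd_bounded F a b c d : hol F a b c d -> a <= b -> c <= d ->
  exists M, forall z, inbd a b c d z -> Cmod (F z) <= M.
Proof.
  intros H Hab Hcd.
  destruct (cont_bounded (fun x => F (x, c)) a b Hab) as [M1 H1].
  { intros x Hx. apply hcont, H. split; simpl; lra. }
  destruct (cont_bounded (fun x => F (x, d)) a b Hab) as [M2 H2].
  { intros x Hx. apply hcont, H. split; simpl; lra. }
  destruct (cont_bounded (fun x => F (a, x)) c d Hcd) as [M3 H3].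
  { intros x Hx. apply vcont, H. split; simpl; lra. }
  destruct (cont_bounded (fun x => F (b, x)) c d Hcd) as [M4 H4].
  { intros x Hx. apply vcont, H. split; simpl; lra. }
  exists (Rmax (Rmax M1 M2) (Rmax M3 M4)). intros [x y] [[Hx Hy] Hz]; simpl in *.
  destruct Hz as [E | [E | [E | E]]]; subst.
  - eapply Rle_trans; [apply H3; lra|]. eapply Rle_trans; [|apply Rmax_r]. apply Rmax_l.
  - eapply Rle_trans; [apply H4; lra|]. eapply Rle_trans; [|apply Rmax_r]. apply Rmax_r.
  - eapply Rle_trans; [apply H1; lra|]. eapply Rle_trans; [|apply Rmax_l]. apply Rmax_l.
  - eapply Rle_trans; [apply H2; lra|]. eapply Rle_trans; [|apply Rmax_l]. apply Rmax_r.
Qed.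

(** Maximum principle with a weight: on a rectangle with one side on the imaginary axis, where F
    vanishes, exp(n(P - 1)) has modulus at most 1 on the three other sides but grows exponentially
    in n at the given point. *)
Theorem identity_H F : (forall z, 0 < snd z -> exists l, Cder F z l) ->
  (forall y, 0 < y -> F (0, y) = 0%C) -> forall z, 0 < snd z -> F z = 0%C.
Proof.
  intros HF H0 [x0 y0] Hy0; simpl in Hy0.
  destruct (Req_dec x0 0) as [->|Hx0]; [auto|].
  (* The sign of [x0], so that both sides of the axis are treated at once. *)
  set (s := if Rlt_dec 0 x0 is left _ then 1 else -1).
  assert (Hs : s * s = 1) by (unfold s; destruct (Rlt_dec 0 x0); ring).
  assert (Hsx : 0 < s * x0) by (unfold s; destruct (Rlt_dec 0 x0); lra).
  (* The far side lies one unit beyond the point, and height [y0 / 2] keeps the rectangle in the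
     half-plane. With [c * h = PI / 2] the real part of [P] is zero on the horizontal sides; it is
     at most 1 on the far side and equals exp(c) > 1 at the point itself. *)
  set (x2 := s * x0 + 1). set (h := y0 / 2). set (c := PI / (2 * h)).
  assert (Hh : 0 < h) by (unfold h; lra). assert (HPI := PI_RGT_0).
  assert (Hc : 0 < c) by (unfold c; apply Rdiv_lt_0_compat; lra).
  set (P := fun z : C => (cexp (RtoC c * (RtoC x2 - RtoC s * (z - (0, y0)))))%C).
  set (A := Rmin 0 (s * x2)). set (B := Rmax 0 (s * x2)).
  assert (HAB : A < x0 < B).
  { assert (Hs1 : s * x2 = x0 + s) by (unfold x2; rewrite Rmult_plus_distr_l -Rmult_assoc Hs; ring).
    unfold A, B. rewrite Hs1. unfold s in *. destruct (Rlt_dec 0 x0); split.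
    - eapply Rle_lt_trans; [apply Rmin_l|lra].
    - eapply Rlt_le_trans; [|apply Rmax_r]; lra.
    - eapply Rle_lt_trans; [apply Rmin_r|lra].
    - eapply Rlt_le_trans; [|apply Rmax_l]; lra. }
  assert (Hcase : (A = 0 /\ B = s * x2) \/ (A = s * x2 /\ B = 0)).
  { assert (Hs1 : s * x2 = x0 + s) by (unfold x2; rewrite Rmult_plus_distr_l -Rmult_assoc Hs; ring).
    unfold A, B. rewrite Hs1. unfold s in *. destruct (Rlt_dec 0 x0).
    - left. rewrite Rmin_left; [|lra]. rewrite Rmax_right; lra.
    - right. rewrite Rmin_right; [|lra]. rewrite Rmax_left; lra. }
  assert (HR : hol F A B (y0 - h) (y0 + h)).
  { intros [u v] [Hu Hv]; simpl in *. apply HF; simpl. unfold h in *; lra. }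
  destruct (hol_bd_bounded F A B (y0 - h) (y0 + h) HR) as [M HM]; try lra.
  assert (HM0 : 0 <= M).
  { eapply Rle_trans; [apply Cmod_ge_0|apply (HM (A, y0))]. repeat split; simpl; auto; lra. }
  assert (HPre : forall u v, fst (P (u, v)) = exp (c * (x2 - s * u)) * cos (c * s * (v - y0))).
  { intros u v. unfold P, cexp. simpl. f_equal. f_equal. ring.
    rewrite -cos_neg. f_equal. ring. }
  assert (Hn : forall n : nat, Cmod (F (x0, y0)) * exp (INR n * (exp c - 1)) <= M).
  { intros n.
    set (G := fun z => (F z * cexp (RtoC (INR n) * (P z - 1)))%C).
    assert (HG0 : Cmod (G (x0, y0)) = Cmod (F (x0, y0)) * exp (INR n * (exp c - 1))).
    { unfold G. rewrite Cmod_mult Cmod_cexp. f_equal. f_equal.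
      replace (fst (INR n * (P (x0, y0) - 1))%C) with (INR n * (fst (P (x0, y0)) - 1)) by (simpl; ring).
      rewrite HPre. unfold x2. replace (c * (s * x0 + 1 - s * x0)) with c by ring.
      replace (c * s * (y0 - y0)) with 0 by ring. rewrite cos_0. ring. }
    rewrite -HG0. apply (MMP G A B (y0 - h) (y0 + h)); simpl; try lra.
    - intros z Hz. apply ex_Cder_mult. apply HR, Hz. apply ex_Cder_cexp.
      apply ex_Cder_mult. apply ex_Cder_const. apply ex_Cder_minus; [|apply ex_Cder_const].
      apply ex_Cder_cexp. apply ex_Cder_mult. apply ex_Cder_const. apply ex_Cder_minus. apply ex_Cder_const.
      apply ex_Cder_mult. apply ex_Cder_const. apply ex_Cder_minus. apply ex_Cder_id. apply ex_Cder_const.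
    - intros [u v] Hz. unfold G. rewrite Cmod_mult Cmod_cexp.
      assert (Hb : u = 0 \/ fst (P (u, v)) <= 1).
      { rewrite HPre. destruct Hz as [[Hu Hv] Hz]; simpl in *.
        assert (Hside : u = s * x2 -> exp (c * (x2 - s * u)) * cos (c * s * (v - y0)) <= 1).
        { intros ->. replace (c * (x2 - s * (s * x2))) with (c * x2 * (1 - s * s)) by ring.
          rewrite Hs. replace (c * x2 * (1 - 1)) with 0 by ring. rewrite exp_0.
          assert (T := COS_bound (c * s * (v - y0))). lra. }
        assert (Hch : c * h = PI / 2) by (unfold c; field; lra).
        assert (Hcos : (v = y0 - h \/ v = y0 + h) -> exp (c * (x2 - s * u)) * cos (c * s * (v - y0)) <= 1).
        { intros Hv'. replace (cos (c * s * (v - y0))) with 0; [lra|]. symmetry.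
          assert (s = 1 \/ s = -1) by (unfold s; destruct (Rlt_dec 0 x0); auto).
          destruct Hv' as [E|E], H as [E2|E2]; rewrite E E2.
          - replace (c * 1 * (y0 - h - y0)) with (- (c * h)) by ring. rewrite cos_neg Hch. apply cos_PI2.
          - replace (c * -1 * (y0 - h - y0)) with (c * h) by ring. rewrite Hch. apply cos_PI2.
          - replace (c * 1 * (y0 + h - y0)) with (c * h) by ring. rewrite Hch. apply cos_PI2.
          - replace (c * -1 * (y0 + h - y0)) with (- (c * h)) by ring. rewrite cos_neg Hch. apply cos_PI2. }
        destruct Hz as [E | [E | [E | E]]]; auto; destruct Hcase as [[E1 E2]|[E1 E2]]; try (left; lra); right; apply Hside; lra. }
      destruct Hb as [->|Hb].
      + rewrite H0. rewrite Cmod_0. lra. destruct Hz as [[_ Hv] _]; simpl in Hv. unfold h in Hv; lra.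
      + rewrite -(Rmult_1_r M). apply Rmult_le_compat; [apply Cmod_ge_0|apply Rlt_le, exp_pos|apply HM, Hz|].
        apply (Rle_trans _ (exp 0)); [apply exp_le|rewrite exp_0; lra].
        replace (fst (INR n * (P (u, v) - 1))%C) with (INR n * (fst (P (u, v)) - 1)) by (simpl; ring).
        assert (Hn0 := pos_INR n). nra. }
  apply Cmod_eq_0, Rle_antisym; [|apply Cmod_ge_0]. apply Rnot_lt_le. intros Hpos.
  assert (He : 0 < exp c - 1) by (assert (T := exp_ineq1 c ltac:(lra)); lra).
  destruct (INR_unbounded (M / (Cmod (F (x0, y0)) * (exp c - 1)))) as [n Hbig].
  specialize (Hn n).
  assert (Hge : 1 + INR n * (exp c - 1) <= exp (INR n * (exp c - 1))) by apply exp_ineq1_le.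
  assert (Hq : 0 < Cmod (F (x0, y0)) * (exp c - 1)) by nra.
  apply (Rmult_lt_compat_r _ _ _ Hq) in Hbig.
  unfold Rdiv in Hbig. rewrite Rmult_assoc Rinv_l in Hbig; nra.
Qed.
End ComplexExponential.

(** * Functions of finite order and the Phragmen-Lindelof principle on a vertical strip *)

Module PhragmenLindelof.
From Corelib Require Import ssreflect.
From Stdlib Require Import Reals Lra Lia ClassicalEpsilon.
From Coquelicot Require Import Coquelicot.
Require Import Defs.
Import ComplexIntegral ComplexDerivative MaximumModulus ComplexExponential.
Open Scope R_scope.

Lemma cont_Cmult f g x : cont f x -> cont g x -> cont (fun t => f t * g t)%C x.
Proof.
  intros Hf Hg eps He.
  assert (Hf0 := Cmod_ge_0 (f x)). assert (Hg0 := Cmod_ge_0 (g x)).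
  set (k := 2 + Cmod (f x) + Cmod (g x)).
  assert (Hk : 0 < k) by (unfold k; lra).
  assert (He' : 0 < Rmin 1 (eps / k)) by (apply Rmin_pos; [lra|apply Rdiv_lt_0_compat; lra]).
  destruct (Hf _ He') as [d1 [Hd1 H1]]. destruct (Hg _ He') as [d2 [Hd2 H2]].
  exists (Rmin d1 d2). split; [apply Rmin_pos; auto|]. intros y Hy.
  specialize (H1 y (Rlt_le_trans _ _ _ Hy (Rmin_l _ _))).
  specialize (H2 y (Rlt_le_trans _ _ _ Hy (Rmin_r _ _))).
  assert (H1a := Rlt_le_trans _ _ _ H1 (Rmin_l _ _)). assert (H1b := Rlt_le_trans _ _ _ H1 (Rmin_r _ _)).
  assert (H2b := Rlt_le_trans _ _ _ H2 (Rmin_r _ _)).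
  replace (f y * g y - f x * g x)%C with
    ((f y - f x) * (g y - g x) + (f y - f x) * g x + f x * (g y - g x))%C by ring.
  eapply Rle_lt_trans; [apply Cmod_triangle|]. eapply Rle_lt_trans; [apply Rplus_le_compat_r, Cmod_triangle|].
  rewrite !Cmod_mult.
  assert (Ha := Cmod_ge_0 (f y - f x)%C). assert (Hb := Cmod_ge_0 (g y - g x)%C).
  assert (E : eps = eps / k * k) by (field; lra).
  assert (He2 : 0 < eps / k) by (apply Rdiv_lt_0_compat; lra).
  rewrite E. unfold k at 2. nra.
Qed.
Lemma cont_const c x : cont (fun _ => c) x.
Proof. intros eps He. exists 1. split; [lra|]. intros y _. replace (c - c)%C with (RtoC 0) by ring. rewrite Cmod_0; exact He. Qed.
Lemma cont_minus f g x : cont f x -> cont g x -> cont (fun t => f t - g t)%C x.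
Proof.
  intros Hf Hg eps He.
  destruct (Hf (eps / 2)) as [d1 [Hd1 H1]]; [lra|]. destruct (Hg (eps / 2)) as [d2 [Hd2 H2]]; [lra|].
  exists (Rmin d1 d2). split; [apply Rmin_pos; auto|]. intros y Hy.
  specialize (H1 y (Rlt_le_trans _ _ _ Hy (Rmin_l _ _))).
  specialize (H2 y (Rlt_le_trans _ _ _ Hy (Rmin_r _ _))).
  replace (f y - g y - (f x - g x))%C with ((f y - f x) - (g y - g x))%C by ring.
  eapply Rle_lt_trans; [apply Cmod_triang_minus|]. lra.
Qed.
Lemma cont_Cder F x : (exists l, Cder F (RtoC x) l) -> cont (fun t => F (RtoC t)) x.
Proof. apply hcont. Qed.
Lemma cont_cexp_lin w x : cont (fun t => cexp (w * RtoC t)%C) x.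
Proof.
  apply (cont_Cder (fun z => cexp (w * z)%C)). apply ex_Cder_cexp, ex_Cder_mult; [apply ex_Cder_const|apply ex_Cder_id].
Qed.
Lemma cont_RtoC x : cont RtoC x.
Proof. apply (cont_Cder (fun z => z)), ex_Cder_id. Qed.
Lemma cont_opp f x : cont f (- x) -> cont (fun t => f (- t)) x.
Proof.
  intros H eps He. destruct (H eps He) as [d [Hd Hy]]. exists d; split; auto.
  intros y Hyd. apply Hy. replace (- y - - x) with (- (y - x)) by ring. rewrite Rabs_Ropp. exact Hyd.
Qed.

Lemma ex_CI_all f a b : (forall x, cont f x) -> ex_RInt (V := CR) f a b.
Proof. intros H. apply ex_CI. auto. Qed.

Lemma Cder_quadratic F w l K : 0 <= K ->
  (forall h, Cmod h <= 1 -> Cmod (F (w + h) - F w - l * h)%C <= K * Cmod h ^ 2) -> Cder F w l.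
Proof.
  intros HK H eps He. exists (Rmin 1 (eps / (K + 1))). split.
  { apply Rmin_pos; [lra|apply Rdiv_lt_0_compat; lra]. }
  intros h Hh. assert (H1 := Rlt_le_trans _ _ _ Hh (Rmin_l _ _)). assert (H2 := Rlt_le_trans _ _ _ Hh (Rmin_r _ _)).
  eapply Rle_trans; [apply H; lra|]. assert (H0 := Cmod_ge_0 h).
  assert (E : eps = eps / (K + 1) * (K + 1)) by (field; lra).
  assert (0 < eps / (K + 1)) by (apply Rdiv_lt_0_compat; lra).
  rewrite E. replace (K * Cmod h ^ 2) with (K * Cmod h * Cmod h) by ring.
  apply Rmult_le_compat_r; auto. nra.
Qed.

Lemma Rabs_mid a b x : a <= x <= b -> Rabs x <= Rabs a + Rabs b.
Proof. intros H. unfold Rabs; repeat destruct Rcase_abs; lra. Qed.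

(** Differentiation under the integral: [cexp_m2] gives a second-order Taylor estimate that is
    uniform in t on a bounded interval. *)
Lemma Cder_laplace (p : R -> C) a b w : a <= b -> (forall t, cont p t) ->
  Cder (fun w => CI (fun t => p t * cexp (w * RtoC t))%C a b) w (CI (fun t => p t * RtoC t * cexp (w * RtoC t))%C a b).
Proof.
  intros Hab Hp.
  destruct (cont_bounded p a b Hab) as [M HM]; [intros; apply Hp|].
  set (T := Rabs a + Rabs b).
  assert (HT : 0 <= T) by (unfold T; assert (Ha := Rabs_pos a); assert (Hb := Rabs_pos b); lra).
  assert (HM0 : 0 <= M) by (eapply Rle_trans; [apply Cmod_ge_0|apply (HM a); lra]).
  set (K := M * exp (Cmod w * T) * (T ^ 2 * exp T)).
  assert (HK : 0 <= K).
  { unfold K. apply Rmult_le_pos; apply Rmult_le_pos; try apply Rlt_le, exp_pos; auto. apply pow_le; auto. }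
  apply (Cder_quadratic _ _ _ (K * (b - a))); [nra|].
  intros h Hh. assert (H0 := Cmod_ge_0 h).
  assert (E : (CI (fun t => p t * cexp ((w + h) * RtoC t)) a b - CI (fun t => p t * cexp (w * RtoC t)) a b
     - CI (fun t => p t * RtoC t * cexp (w * RtoC t)) a b * h)%C =
     CI (fun t => p t * cexp (w * RtoC t) * (cexp (h * RtoC t) - 1 - h * RtoC t))%C a b).
  { rewrite (Cmult_comm _ h) -CI_Cmult.
    2:{ apply ex_CI_all; intros; apply cont_Cmult; [apply cont_Cmult; [apply Hp|apply cont_RtoC]|apply cont_cexp_lin]. }
    rewrite -CI_minus; try (apply ex_CI_all; intros; apply cont_Cmult; [apply Hp|apply cont_cexp_lin]).
    rewrite -CI_minus.
    - apply CI_ext. intros x _. replace ((w + h) * x)%C with (w * x + h * x)%C by ring. rewrite cexp_plus. ring.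
    - apply ex_CI_all; intros; apply cont_minus; apply cont_Cmult; [apply Hp|apply cont_cexp_lin|apply Hp|apply cont_cexp_lin].
    - apply ex_CI_all; intros; apply cont_Cmult; [apply cont_const|]. apply cont_Cmult; [apply cont_Cmult; [apply Hp|apply cont_RtoC]|apply cont_cexp_lin]. }
  rewrite E. replace (K * (b - a) * Cmod h ^ 2) with (K * Cmod h ^ 2 * (b - a)) by ring.
  apply CI_bound; auto.
  { apply ex_CI_all; intros; apply cont_Cmult. apply cont_Cmult; [apply Hp|apply cont_cexp_lin].
    apply cont_minus; [apply cont_minus; [apply cont_cexp_lin|apply cont_const]|]. apply cont_Cmult; [apply cont_const|apply cont_RtoC]. }
  intros x Hx. rewrite !Cmod_mult Cmod_cexp.
  assert (Hxt := Rabs_mid _ _ _ Hx). fold T in Hxt.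
  assert (Hwt : fst (w * x)%C <= Cmod w * T).
  { eapply Rle_trans; [apply fst_le_Cmod|]. rewrite Cmod_mult Coquelicot.Complex.Cmod_R. apply Rmult_le_compat_l; [apply Cmod_ge_0|auto]. }
  assert (Hm2 : Cmod (cexp (h * x) - 1 - h * x)%C <= T ^ 2 * exp T * Cmod h ^ 2).
  { eapply Rle_trans; [apply cexp_m2|]. rewrite Cmod_mult Coquelicot.Complex.Cmod_R.
    assert (Hxp := Rabs_pos x).
    replace (T ^ 2 * exp T * Cmod h ^ 2) with ((Cmod h * T) ^ 2 * exp T) by ring.
    apply Rmult_le_compat. apply pow_le; nra. apply Rlt_le, exp_pos.
    apply pow_incr; split; nra. apply exp_le. nra. }
  unfold K. replace (M * exp (Cmod w * T) * (T ^ 2 * exp T) * Cmod h ^ 2) with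
   ((M * exp (Cmod w * T)) * (T ^ 2 * exp T * Cmod h ^ 2)) by ring.
  apply Rmult_le_compat; [apply Rmult_le_pos; [apply Cmod_ge_0|apply Rlt_le, exp_pos]|apply Cmod_ge_0| |exact Hm2].
  apply Rmult_le_compat; [apply Cmod_ge_0|apply Rlt_le, exp_pos|apply HM; auto|apply exp_le; auto].
Qed.

(** A form of [finite_order] with room in the exponent: the factor [D] absorbs products and affine
    substitutions, and the base [1 + Cmod z >= 1] allows [m] to be enlarged. *)
Definition fo (F : C -> C) : Prop := exists A D m, 0 <= A /\ 0 <= D /\
  forall z, Cmod (F z) <= A * exp (D * (1 + Cmod z) ^ m).

Lemma fo_weaken F : (exists A D m, forall z, Cmod (F z) <= A * exp (D * (1 + Cmod z) ^ m)) -> fo F.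
Proof.
  intros [A [D [m H]]]. exists (Rabs A), (Rabs D), m. repeat split; try apply Rabs_pos.
  intros z. eapply Rle_trans; [apply H|].
  apply (Rle_trans _ (Rabs A * exp (D * (1 + Cmod z) ^ m))).
  - apply Rmult_le_compat_r; [apply Rlt_le, exp_pos|apply Rle_abs].
  - apply Rmult_le_compat_l; [apply Rabs_pos|]. apply exp_le. apply Rmult_le_compat_r; [|apply Rle_abs].
    apply pow_le. assert (H0 := Cmod_ge_0 z). lra.
Qed.

Lemma fo_max F G : fo F -> fo G -> exists A D m, 0 <= A /\ 0 <= D /\ (1 <= m)%nat /\
  forall z, Cmod (F z) <= A * exp (D * (1 + Cmod z) ^ m) /\ Cmod (G z) <= A * exp (D * (1 + Cmod z) ^ m).
Proof.
  intros [A1 [D1 [m1 [HA1 [HD1 H1]]]]] [A2 [D2 [m2 [HA2 [HD2 H2]]]]].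
  exists (A1 + A2), (D1 + D2), (m1 + m2 + 1)%nat. repeat split; try lra; try lia.
  - eapply Rle_trans; [apply H1|]. assert (H0 := Cmod_ge_0 z).
    apply Rmult_le_compat; try lra; [apply Rlt_le, exp_pos|]. apply exp_le.
    apply Rmult_le_compat; try lra; [apply pow_le; lra|]. apply Rle_pow; [lra|lia].
  - eapply Rle_trans; [apply H2|]. assert (H0 := Cmod_ge_0 z).
    apply Rmult_le_compat; try lra; [apply Rlt_le, exp_pos|]. apply exp_le.
    apply Rmult_le_compat; try lra; [apply pow_le; lra|]. apply Rle_pow; [lra|lia].
Qed.

Lemma fo_mult F G : fo F -> fo G -> fo (fun z => F z * G z)%C.
Proof.
  intros HF HG. destruct (fo_max F G HF HG) as [A [D [m [HA [HD [_ H]]]]]].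
  apply fo_weaken. exists (A * A), (D + D), m. intros z. rewrite Cmod_mult.
  destruct (H z) as [H1 H2]. rewrite Rmult_plus_distr_r exp_plus.
  replace (A * A * (exp (D * (1 + Cmod z) ^ m) * exp (D * (1 + Cmod z) ^ m))) with
   ((A * exp (D * (1 + Cmod z) ^ m)) * (A * exp (D * (1 + Cmod z) ^ m))) by ring.
  apply Rmult_le_compat; auto; apply Cmod_ge_0.
Qed.
Lemma fo_minus F G : fo F -> fo G -> fo (fun z => F z - G z)%C.
Proof.
  intros HF HG. destruct (fo_max F G HF HG) as [A [D [m [HA [HD [_ H]]]]]].
  apply fo_weaken. exists (A + A), D, m. intros z. eapply Rle_trans; [apply Cmod_triang_minus|].
  destruct (H z) as [H1 H2]. lra.
Qed.
Lemma fo_const c : fo (fun _ => c).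
Proof.
  apply fo_weaken. exists (Cmod c), 0, O. intros z. rewrite Rmult_0_l exp_0. lra.
Qed.
Lemma fo_cexp_lin c d : fo (fun z => cexp (c + d * z)%C).
Proof.
  apply fo_weaken. exists 1, (Cmod c + Cmod d), 1%nat. intros z. rewrite Cmod_cexp Rmult_1_l pow_1. apply exp_le.
  eapply Rle_trans; [apply fst_le_Cmod|]. eapply Rle_trans; [apply Cmod_triangle|]. rewrite Cmod_mult.
  assert (H0 := Cmod_ge_0 c). assert (H1 := Cmod_ge_0 d). assert (H2 := Cmod_ge_0 z). nra.
Qed.
Lemma fo_laplace p a b : a <= b -> (forall t, cont p t) -> fo (fun w => CI (fun t => p t * cexp (w * RtoC t))%C a b).
Proof.
  intros Hab Hp. destruct (cont_bounded p a b Hab) as [M HM]; [intros; apply Hp|].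
  assert (HM0 : 0 <= M) by (eapply Rle_trans; [apply Cmod_ge_0|apply (HM a); lra]).
  apply fo_weaken. exists (M * (b - a)), (Rabs a + Rabs b), 1%nat. intros z. rewrite pow_1.
  replace (M * (b - a) * exp ((Rabs a + Rabs b) * (1 + Cmod z))) with (M * exp ((Rabs a + Rabs b) * (1 + Cmod z)) * (b - a)) by ring.
  apply CI_bound; auto. apply ex_CI_all; intros; apply cont_Cmult; [apply Hp|apply cont_cexp_lin].
  intros x Hx. rewrite Cmod_mult Cmod_cexp. apply Rmult_le_compat; [apply Cmod_ge_0|apply Rlt_le, exp_pos|auto|].
  apply exp_le. eapply Rle_trans; [apply fst_le_Cmod|]. rewrite Cmod_mult Coquelicot.Complex.Cmod_R.
  assert (H0 := Cmod_ge_0 z). assert (Hm := Rabs_mid _ _ _ Hx). assert (Hx0 := Rabs_pos x). nra.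
Qed.
Lemma fo_comp_affine F c d : fo F -> fo (fun z => F (c + d * z)%C).
Proof.
  intros [A [D [m [HA [HD H]]]]]. apply fo_weaken. exists A, (D * (1 + Cmod c + Cmod d) ^ m), m. intros z.
  eapply Rle_trans; [apply H|]. apply Rmult_le_compat_l; auto. apply exp_le.
  rewrite Rmult_assoc -Rpow_mult_distr. apply Rmult_le_compat_l; auto. apply pow_incr.
  assert (H0 := Cmod_ge_0 c). assert (H1 := Cmod_ge_0 d). assert (H2 := Cmod_ge_0 z).
  split; [assert (H3 := Cmod_ge_0 (c + d * z)%C); lra|].
  assert (H3 := Cmod_triangle c (d * z)%C). rewrite Cmod_mult in H3. nra.
Qed.
Lemma finite_order_fo F : finite_order F -> fo F.
Proof.
  intros [m [B H]]. apply fo_weaken. exists (Rabs B), 1, m. 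
  intros z. eapply Rle_trans; [apply H|]. apply (Rle_trans _ (Rabs B * exp (Cmod z ^ m))).
  apply Rmult_le_compat_r; [apply Rlt_le, exp_pos|apply Rle_abs].
  apply Rmult_le_compat_l; [apply Rabs_pos|]. apply exp_le. rewrite Rmult_1_l. apply pow_incr.
  assert (H0 := Cmod_ge_0 z). lra.
Qed.

Lemma exp_pow_ge x n : 0 <= x -> (x / INR (S n)) ^ (S n) <= exp x.
Proof.
  intros Hx. assert (Hn : 0 < INR (S n)) by apply lt_0_INR, Nat.lt_0_succ.
  replace (exp x) with (exp (x / INR (S n)) ^ S n).
  2:{ rewrite -Rpower_pow; [|apply exp_pos]. unfold Rpower. rewrite ln_exp. f_equal. field. lra. }
  assert (H0 : 0 <= x / INR (S n)) by (apply Rmult_le_pos; [lra|apply Rlt_le, Rinv_0_lt_compat; lra]).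
  apply pow_incr. split; auto. assert (H := exp_ineq1_le (x / INR (S n))). lra.
Qed.

(** Compares exponents on the horizontal sides of a tall rectangle: growth of finite order plus a
    reserve [T], against the damping. There [2 * Y] stands for [1 + Cmod]. *)
Lemma damp_eventually D m c d T : 0 <= D -> 0 < c -> 0 < d -> 0 <= T ->
  exists Y0, 0 < Y0 /\ forall Y, Y0 <= Y -> D * (2 * Y) ^ m + T <= c * exp (d * Y).
Proof.
  intros HD Hc Hd HT. assert (Hn : 0 < INR (S m)) by apply lt_0_INR, Nat.lt_0_succ.
  set (c' := c * (d / INR (S m)) ^ S m).
  assert (Hc' : 0 < c') by (apply Rmult_lt_0_compat; auto; apply pow_lt, Rdiv_lt_0_compat; auto).
  set (Y0 := Rmax 1 ((D * 2 ^ m + T) / c')).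
  exists Y0. assert (H1 : 1 <= Y0) by apply Rmax_l. split; [lra|].
  intros Y HY. apply (Rle_trans _ (c' * Y ^ S m)).
  - assert (HY2 : (D * 2 ^ m + T) / c' <= Y) by (eapply Rle_trans; [apply Rmax_r|exact HY]).
    assert (HY3 : D * 2 ^ m + T <= c' * Y).
    { apply (Rmult_le_compat_l c') in HY2; [|lra]. replace (c' * ((D * 2 ^ m + T) / c')) with (D * 2 ^ m + T) in HY2 by (field; lra). exact HY2. }
    assert (Hp : 1 <= Y ^ m) by (apply pow_R1_Rle; lra).
    simpl. rewrite Rpow_mult_distr. assert (H2 : 0 <= D * 2 ^ m) by (apply Rmult_le_pos; auto; apply pow_le; lra). nra.
  - unfold c'. rewrite Rmult_assoc -Rpow_mult_distr. apply Rmult_le_compat_l; [lra|].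
    replace (d / INR (S m) * Y) with (d * Y / INR (S m)) by (field; lra). apply exp_pow_ge. nra.
Qed.

(** The factor exp(- e CC), with CC = 2 cos(d w), decays doubly exponentially along the strip and so
    beats finite order. The maximum principle on tall rectangles bounds the product by M + e, and
    then e tends to 0. *)
Theorem phragmen_lindelof F b M : 0 < b -> (forall z, exists l, Cder F z l) -> fo F -> 0 <= M ->
  (forall y, Cmod (F (b, y)) <= M) -> (forall y, Cmod (F (- b, y)) <= M) ->
  forall z, - b < fst z < b -> Cmod (F z) <= M.
Proof.
  intros Hb HF [A [D [m [HA [HD Hfo]]]]] HM HR HL [x0 y0] Hz; simpl in Hz.
  (* Then |d x| <= PI/4 on the closed strip, and the cosine stays above [kap] up to the edges. *)
  set (d := PI / (4 * b)). assert (HPI := PI_RGT_0).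
  assert (Hd : 0 < d) by (apply Rdiv_lt_0_compat; lra).
  assert (Hdb : d * b = PI / 4) by (unfold d; field; lra).
  set (kap := cos (PI / 4)).
  assert (Hkap : 0 < kap) by (apply cos_gt_0; lra).
  assert (Hcos : forall x, - b <= x <= b -> kap <= cos (d * x)).
  { intros x Hx. unfold kap. destruct (Rle_dec 0 x).
    - assert (d * x <= d * b) by (apply Rmult_le_compat_l; lra). assert (0 <= d * x) by nra.
      apply cos_decr_1; lra.
    - assert (d * - x <= d * b) by (apply Rmult_le_compat_l; lra). assert (0 <= d * - x) by nra.
      rewrite -(cos_neg (d * x)). apply cos_decr_1; lra. }
  (* cos(d w) up to the factor 2, written with cexp *)
  set (CC := fun w : C => (cexp (Ci * (RtoC d * w)) + cexp (- (Ci * (RtoC d * w))))%C).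
  assert (HCC : forall x y, fst (CC (x, y)) = cos (d * x) * (exp (d * y) + exp (- (d * y)))).
  { intros x y. unfold CC, cexp; simpl.
    replace (0 * (d * x - 0 * y) - 1 * (d * y + 0 * x)) with (- (d * y)) by ring.
    replace (0 * (d * y + 0 * x) + 1 * (d * x - 0 * y)) with (d * x) by ring.
    rewrite cos_neg Ropp_involutive. ring. }
  assert (Hmain : forall e, 0 < e -> Cmod (F (x0, y0)) * exp (- e * fst (CC (x0, y0))) <= M + e).
  { intros e He.
    set (c := e * kap). assert (Hc : 0 < c) by (apply Rmult_lt_0_compat; auto).
    (* Chosen so that [A * exp (- T) <= e], which bounds the horizontal sides. *)
    set (T := Rmax 0 (ln ((A + 1) / e))).
    destruct (damp_eventually D m c d T HD Hc Hd (Rmax_l _ _)) as [Y0 [HY0 HY]].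
    set (Y := Y0 + b + 1 + Rabs y0).
    assert (Hy0 := Rabs_pos y0). 
    set (G := fun w => (F w * cexp (RtoC (- e) * CC w))%C).
    assert (HG : forall w, Cmod (G w) = Cmod (F w) * exp (- e * fst (CC w))).
    { intros w. unfold G. rewrite Cmod_mult Cmod_cexp. f_equal. f_equal. simpl. ring. }
    rewrite -HG. 
    assert (Hpos : forall x y, - b <= x <= b -> kap * exp (d * Rabs y) <= fst (CC (x, y))).
    { intros x y Hx. rewrite HCC. apply Rmult_le_compat; try lra; [apply Rlt_le, exp_pos|auto|].
      assert (E1 := exp_pos (d * y)). assert (E2 := exp_pos (- (d * y))).
      unfold Rabs; destruct Rcase_abs; [replace (d * - y) with (- (d * y)) by ring|]; lra. }
    assert (Hvert : forall x y, - b <= x <= b -> Cmod (F (x, y)) <= M -> Cmod (G (x, y)) <= M + e).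
    { intros x y Hx HF1. rewrite HG. assert (Hp := Hpos x y Hx). assert (E1 := exp_pos (d * Rabs y)).
      assert (exp (- e * fst (CC (x, y))) <= 1).
      { apply (Rle_trans _ (exp 0)); [apply exp_le|rewrite exp_0; lra]. assert (0 <= fst (CC (x, y))) by nra. assert (0 <= e * fst (CC (x, y))) by (apply Rmult_le_pos; lra). lra. }
      assert (E2 := exp_pos (- e * fst (CC (x, y)))). assert (E3 := Cmod_ge_0 (F (x, y))). nra. }
    assert (Hhor : forall x y, - b <= x <= b -> Rabs y = Y -> Cmod (G (x, y)) <= M + e).
    { intros x y Hx HyY. rewrite HG. assert (Hp := Hpos x y Hx). rewrite HyY in Hp.
      assert (HY' := HY Y ltac:(unfold Y; lra)).
      apply (Rle_trans _ e); [|lra].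
      eapply Rle_trans; [apply Rmult_le_compat_r; [apply Rlt_le, exp_pos|apply Hfo]|].
      rewrite Rmult_assoc -exp_plus.
      assert (Hmod : 1 + Cmod (x, y) <= 2 * Y).
      { assert (Hs := Cmod_le_sum x y). rewrite HyY in Hs.
        assert (Rabs x <= b) by (apply Rabs_le; lra). unfold Y in *. lra. }
      assert (Hpw : D * (1 + Cmod (x, y)) ^ m <= D * (2 * Y) ^ m).
      { apply Rmult_le_compat_l; auto. apply pow_incr. assert (E3 := Cmod_ge_0 (x, y)). lra. }
      assert (Hexp : D * (1 + Cmod (x, y)) ^ m + - e * fst (CC (x, y)) <= - T).
      { unfold c in HY'. nra. }
      apply exp_le in Hexp. eapply Rle_trans; [apply Rmult_le_compat_l; [exact HA|exact Hexp]|].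
      assert (HTl : exp (- T) <= e / (A + 1)).
      { replace (e / (A + 1)) with (exp (- ln ((A + 1) / e))).
        - apply exp_le. assert (HT2 : ln ((A + 1) / e) <= T) by apply Rmax_r. lra.
        - rewrite exp_Ropp exp_ln; [field; lra|apply Rdiv_lt_0_compat; lra]. }
      apply (Rle_trans _ (A * (e / (A + 1)))); [apply Rmult_le_compat_l; auto|].
      assert (E4 : e = e / (A + 1) * (A + 1)) by (field; lra).
      assert (0 < e / (A + 1)) by (apply Rdiv_lt_0_compat; lra). rewrite {2}E4. nra. }
    apply (MMP G (- b) b (- Y) Y); simpl; auto.
    - intros z _. apply ex_Cder_mult; [apply HF|]. apply ex_Cder_cexp, ex_Cder_mult; [apply ex_Cder_const|].
      apply ex_Cder_plus; apply ex_Cder_cexp.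
      + apply ex_Cder_mult; [apply ex_Cder_const|]. apply ex_Cder_mult; [apply ex_Cder_const|apply ex_Cder_id].
      + destruct (ex_Cder_mult (fun _ => (- Ci)%C) (fun z => RtoC d * z)%C z) as [l Hl].
        apply ex_Cder_const. apply ex_Cder_mult; [apply ex_Cder_const|apply ex_Cder_id].
        exists l. eapply Cder_ext; [|exact Hl]. intros x; simpl. ring.
    - unfold Y. assert (H1 := Rle_abs y0). assert (H2 := Rle_abs (- y0)). rewrite Rabs_Ropp in H2. lra.
    - intros [x y] [[Hx Hy] HS]; simpl in *. destruct HS as [E | [E | [E | E]]]; subst.
      + apply Hvert; [lra|apply HL].
      + apply Hvert; [lra|apply HR].
      + apply Hhor; [lra|]. rewrite Rabs_Ropp Rabs_pos_eq; auto. unfold Y; lra.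
      + apply Hhor; [lra|]. rewrite Rabs_pos_eq; auto. unfold Y; lra. }
  apply le_epsilon. intros eps Heps.
  set (S0 := fst (CC (x0, y0))).
  assert (HS0 : 0 < S0).
  { unfold S0. rewrite HCC. apply Rmult_lt_0_compat. assert (H := Hcos x0 ltac:(lra)); lra.
    assert (E1 := exp_pos (d * y0)). assert (E2 := exp_pos (- (d * y0))). lra. }
  set (f0 := Cmod (F (x0, y0))). assert (Hf0 : 0 <= f0) by apply Cmod_ge_0.
  (* Since exp(- e S0) >= 1 - e S0, the bound becomes f0 <= M + e + e f0 S0 = M + eps. *)
  set (e := eps / (1 + f0 * S0)).
  assert (Hden : 0 < 1 + f0 * S0) by nra.
  assert (He : 0 < e) by (apply Rdiv_lt_0_compat; lra).
  specialize (Hmain e He). fold S0 f0 in Hmain.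
  assert (H1 := exp_ineq1_le (- e * S0)).
  assert (E : eps = e * (1 + f0 * S0)) by (unfold e; field; lra). nra.
Qed.
End PhragmenLindelof.

(** * Uniqueness for two-sided Laplace transforms linked by a functional equation *)

Module MellinUniqueness.
From Corelib Require Import ssreflect.
From Stdlib Require Import Reals Lra Lia ClassicalEpsilon.
From Coquelicot Require Import Coquelicot.
Require Import Defs.
Import ComplexIntegral ComplexDerivative MaximumModulus ComplexExponential PhragmenLindelof.
Open Scope R_scope.

Lemma CI_exp_bound p a b C al : a <= b -> al <> 0 -> (forall t, cont p t) ->
  (forall t, a <= t <= b -> Cmod (p t) <= C * exp (al * t)) ->
  Cmod (CI p a b) <= C * (exp (al * b) - exp (al * a)) / al.
Proof.
  intros Hab Hal Hp HC.
  apply (CI_bound_fun p (fun t => C * exp (al * t))); auto.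
  - apply ex_CI_all, Hp.
  - replace (C * (exp (al * b) - exp (al * a)) / al) with (minus (C / al * exp (al * b)) (C / al * exp (al * a)))
      by (unfold minus, plus, opp; simpl; field; auto).
    apply (is_RInt_derive (fun t => C / al * exp (al * t))).
    + intros x _. auto_derive; auto. field; auto.
    + intros x _. apply (ex_derive_continuous (fun t => C * exp (al * t))). auto_derive; auto.
Qed.

(** Two-sided Laplace transform of [P] at [w], that is the Mellin transform in the variable x = e^t,
    as a limit over symmetric intervals. *)
Definition lapl (P : R -> C) (w X : C) : Prop := forall eps, 0 < eps -> exists L0, forall L, L0 <= L ->
  Cmod (CI (fun t => P t * cexp (w * RtoC t))%C (- L) L - X)%C <= eps.

Lemma cont_lapl P w x : cont P x -> cont (fun t => P t * cexp (w * RtoC t))%C x.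
Proof. intros H. apply cont_Cmult; [exact H|apply cont_cexp_lin]. Qed.

Lemma Cmod_lapl (P : R -> C) w t C b0 : Cmod (P t) <= C * exp (- b0 * t) ->
  Cmod (P t * cexp (w * RtoC t))%C <= C * exp ((fst w - b0) * t).
Proof.
  intros H. rewrite Cmod_mult Cmod_cexp.
  replace (fst (w * RtoC t)%C) with (fst w * t) by (simpl; ring).
  replace (exp ((fst w - b0) * t)) with (exp (- b0 * t) * exp (fst w * t)) by (rewrite -exp_plus; f_equal; ring).
  rewrite -Rmult_assoc. apply Rmult_le_compat_r; [apply Rlt_le, exp_pos|exact H].
Qed.

Lemma coef_nonneg (P : R -> C) C b0 : (forall t, Cmod (P t) <= C * exp (- b0 * t)) -> 0 <= C.
Proof.
  intros H. specialize (H 0). rewrite Rmult_0_r exp_0 Rmult_1_r in H. eapply Rle_trans; [apply Cmod_ge_0|exact H].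
Qed.

Lemma CI_left_tail P w C0 b0 a b : (forall t, cont P t) ->
  (forall t, Cmod (P t) <= C0 * exp (- b0 * t)) -> b0 < fst w -> a <= b ->
  Cmod (CI (fun t => P t * cexp (w * RtoC t))%C a b) <= C0 * exp ((fst w - b0) * b) / (fst w - b0).
Proof.
  intros HP H0 Hw Hab. assert (HC := coef_nonneg _ _ _ H0).
  eapply Rle_trans; [apply (CI_exp_bound _ a b C0 (fst w - b0)); auto; try lra|].
  - intros; apply cont_lapl, HP.
  - intros t _. apply Cmod_lapl, H0.
  - apply Rmult_le_compat_r; [apply Rlt_le, Rinv_0_lt_compat; lra|]. apply Rmult_le_compat_l; auto.
    assert (H := exp_pos ((fst w - b0) * a)). lra.
Qed.
Lemma CI_right_tail P w C1 b1 a b : (forall t, cont P t) ->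
  (forall t, Cmod (P t) <= C1 * exp (- b1 * t)) -> fst w < b1 -> a <= b ->
  Cmod (CI (fun t => P t * cexp (w * RtoC t))%C a b) <= C1 * exp ((fst w - b1) * a) / (b1 - fst w).
Proof.
  intros HP H0 Hw Hab. assert (HC := coef_nonneg _ _ _ H0).
  eapply Rle_trans; [apply (CI_exp_bound _ a b C1 (fst w - b1)); auto; try lra|].
  - intros; apply cont_lapl, HP.
  - intros t _. apply Cmod_lapl, H0.
  - replace (C1 * (exp ((fst w - b1) * b) - exp ((fst w - b1) * a)) / (fst w - b1))
     with (C1 * (exp ((fst w - b1) * a) - exp ((fst w - b1) * b)) / (b1 - fst w)) by (field; lra).
    apply Rmult_le_compat_r; [apply Rlt_le, Rinv_0_lt_compat; lra|]. apply Rmult_le_compat_l; auto.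
    assert (H := exp_pos ((fst w - b1) * b)). lra.
Qed.

Lemma lapl_tails P w X C0 b0 C1 b1 tau L : (forall t, cont P t) ->
  (forall t, Cmod (P t) <= C0 * exp (- b0 * t)) -> (forall t, Cmod (P t) <= C1 * exp (- b1 * t)) ->
  b0 < fst w < b1 -> lapl P w X -> tau <= L ->
  Cmod (X - CI (fun t => P t * cexp (w * RtoC t)) tau L)%C <=
    C0 * exp ((fst w - b0) * tau) / (fst w - b0) + C1 * exp ((fst w - b1) * L) / (b1 - fst w).
Proof.
  intros HP H0 H1 Hw HX HtL. apply le_epsilon. intros eps He.
  destruct (HX eps He) as [L0 HL0].
  set (L' := Rmax L0 (Rmax (- tau) L)).
  assert (Ha : L0 <= L') by apply Rmax_l.
  assert (Hb : - tau <= L') by (eapply Rle_trans; [apply Rmax_l|apply Rmax_r]).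
  assert (Hc : L <= L') by (eapply Rle_trans; [apply Rmax_r|apply Rmax_r]).
  specialize (HL0 L' Ha).
  set (f := fun t => (P t * cexp (w * RtoC t))%C) in *.
  assert (Hex : forall a b, ex_RInt (V := CR) f a b) by (intros; apply ex_CI_all; intros; apply cont_lapl, HP).
  assert (E : CI f (- L') L' = (CI f (- L') tau + CI f tau L + CI f L L')%C).
  { rewrite (CI_Chasles f (-L') tau L) //. rewrite (CI_Chasles f (-L') L L') //. }
  assert (T1 : Cmod (CI f (- L') tau) <= C0 * exp ((fst w - b0) * tau) / (fst w - b0)) by (apply CI_left_tail; auto; lra).
  assert (T2 : Cmod (CI f L L') <= C1 * exp ((fst w - b1) * L) / (b1 - fst w)) by (apply CI_right_tail; auto; lra).
  replace (X - CI f tau L)%C with (CI f (- L') tau + CI f L L' - (CI f (- L') L' - X))%C by (rewrite E; ring).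
  eapply Rle_trans; [apply Cmod_triang_minus|]. eapply Rle_trans; [apply Rplus_le_compat_r, Cmod_triangle|]. lra.
Qed.

Lemma CI_zero_imp E t0 : (forall t, cont E t) -> (forall a b, a <= b -> CI E a b = 0%C) -> E t0 = 0%C.
Proof.
  intros HE H0. apply Cmod_eq_0, Rle_antisym; [|apply Cmod_ge_0]. apply le_epsilon. intros eps He.
  destruct (HE t0 eps He) as [d [Hd HB]].
  assert (Hint : CI (fun t => E t0 - E t)%C t0 (t0 + d / 2) = (RtoC (d / 2) * E t0)%C).
  { rewrite CI_minus; try (apply ex_CI_all; auto; intros; apply cont_const).
    rewrite (H0 t0); [|lra].
    replace (CI (fun _ => E t0) t0 (t0 + d / 2)) with (RtoC (d / 2) * E t0)%C; [ring|].
    symmetry. apply CI_unique. evar_last. apply (is_RInt_const (V := CR)).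
    destruct (E t0) as [u v]. unfold scal; simpl; unfold prod_scal, scal; simpl; unfold mult; simpl. unfold Cmult; simpl. f_equal; ring. }
  assert (Hb : Cmod (CI (fun t => E t0 - E t)%C t0 (t0 + d / 2)) <= eps * (t0 + d / 2 - t0)).
  { apply CI_bound; [lra|apply ex_CI_all; intros; apply cont_minus; auto; apply cont_const|].
    intros x Hx. replace (E t0 - E x)%C with (- (E x - E t0))%C by ring. rewrite Cmod_opp. left. apply HB.
    rewrite Rabs_pos_eq; lra. }
  rewrite Hint Cmod_mult Coquelicot.Complex.Cmod_R Rabs_pos_eq in Hb; [|lra].
  assert (H := Cmod_ge_0 (E t0)). nra.
Qed.

Lemma CI_reflect f a b : (forall t, cont f t) -> CI (fun t => f (- t)) a b = CI f (- b) (- a).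
Proof.
  intros Hf. apply CI_unique.
  assert (H : is_RInt (V := CR) f (- a) (- b) (- CI f (- b) (- a))%C).
  { apply (is_RInt_swap (V := CR)). apply CI_correct, ex_CI_all, Hf. }
  apply (is_RInt_comp_opp (V := CR)) in H.
  apply (is_RInt_opp (V := CR)) in H.
  eapply is_RInt_ext; [|evar_last; [exact H|]].
  - intros x _. simpl. destruct (f (- x)) as [u v]. unfold opp; simpl. unfold prod_opp, opp; simpl. f_equal; ring.
  - destruct (CI f (- b) (- a)) as [u v]. unfold opp; simpl. unfold prod_opp, opp; simpl. f_equal; ring.
Qed.

Section MellinUnique.
Variables (P Q : R -> C) (B0 : nat) (X X' : C -> C) (c : C) (k : R).
Hypothesis HP : forall t, cont P t.
Hypothesis HQ : forall t, cont Q t.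
Hypothesis bP : forall B : nat, (B0 <= B)%nat -> exists C, forall t, Cmod (P t) <= C * exp (- INR B * t).
Hypothesis bQ : forall B : nat, (B0 <= B)%nat -> exists C, forall t, Cmod (Q t) <= C * exp (- INR B * t).
Hypothesis hX : forall w, exists l, Cder X w l.
Hypothesis foX : fo X.
Hypothesis lX : forall w, INR B0 < fst w -> lapl P w (X w).
Hypothesis lX' : forall w, INR B0 < fst w -> lapl Q w (X' w).
Hypothesis FE : forall w, X w = (c * X' (RtoC k - w))%C.

(** The substitution w -> k - w on the transform side is t -> -t with the weight exp(- k t); the aim
    is P = c Q'. *)
Let Q' t := (cexp (RtoC (- k) * RtoC t) * Q (- t))%C.
(** X minus the part of its integral to the right of [tau] and minus the integral of c Q' to the
    left of [tau]. If P = c Q', only the tails beyond L would remain. The factor exp(- tau w)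
    normalises the size of what is left on the two edges of a strip. *)
Let Z (tau L : R) (w : C) : C :=
  (cexp (0 + RtoC (- tau) * w) * (X w - CI (fun t => P t * cexp (w * RtoC t)) tau L
     - CI (fun t => c * Q' t * cexp (w * RtoC t)) (- L) tau))%C.

Lemma mu_contQ' t : cont Q' t.
Proof. apply cont_Cmult; [apply cont_cexp_lin|]. apply cont_opp, HQ. Qed.
Lemma mu_contcQ' t : cont (fun t => c * Q' t)%C t.
Proof. apply cont_Cmult; [apply cont_const|apply mu_contQ']. Qed.

Lemma mu_Z_hol tau L w : - L <= tau <= L -> exists l, Cder (Z tau L) w l.
Proof.
  intros H. apply ex_Cder_mult.
  - apply ex_Cder_cexp, ex_Cder_plus; [apply ex_Cder_const|apply ex_Cder_mult; [apply ex_Cder_const|apply ex_Cder_id]].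
  - apply ex_Cder_minus; [apply ex_Cder_minus; [apply hX|]|].
    eexists; apply Cder_laplace; [lra|exact HP]. eexists; apply Cder_laplace; [lra|exact mu_contcQ'].
Qed.
Lemma mu_Z_fo tau L : - L <= tau <= L -> fo (Z tau L).
Proof.
  intros H. apply fo_mult; [apply fo_cexp_lin|]. apply fo_minus; [apply fo_minus; [exact foX|]|].
  apply fo_laplace; [lra|exact HP]. apply fo_laplace; [lra|exact mu_contcQ'].
Qed.

Lemma Q'_int w a b : CI (fun t => c * Q' t * cexp (w * RtoC t))%C a b =
  (c * CI (fun t => Q t * cexp ((RtoC k - w) * RtoC t)) (- b) (- a))%C.
Proof.
  rewrite -CI_reflect; [|intros; apply cont_lapl, HQ].
  rewrite -CI_Cmult.
  - apply CI_ext. intros t _. unfold Q'. replace ((k - w) * (- t)%R)%C with ((- k)%R * t + w * t)%C by (rewrite !RtoC_opp; ring).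
    rewrite cexp_plus. ring.
  - apply ex_CI_all. intros t. apply (cont_opp (fun t => Q t * cexp ((RtoC k - w) * RtoC t))%C). apply cont_lapl, HQ.
Qed.

(** Phragmen-Lindelof on the strip |Re w| <= B with B large. On the right edge X is the transform of
    P; on the left edge the functional equation replaces X(w) by c X'(k - w), which is a convergent
    transform of Q. *)
Lemma mu_small tau w0 eps : 0 < eps -> exists L0, forall L, L0 <= L -> Cmod (Z tau L w0) <= eps.
Proof.
  intros He.
  destruct (bP B0 (le_n _)) as [CP HCP]. destruct (bQ B0 (le_n _)) as [CQ HCQ].
  assert (HCP0 := coef_nonneg _ _ _ HCP). assert (HCQ0 := coef_nonneg _ _ _ HCQ).
  (* On both edges of the strip |Re w| < B the bracket is, up to tails in L, at most [Kst / (B - B0 - |k|)]. *)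
  set (Kst := CP * exp (- INR B0 * tau) + Cmod c * CP * exp (- INR B0 * tau)
     + CQ * Cmod c * exp ((INR B0 - k) * tau) + CQ * exp ((INR B0 - k) * tau)).
  assert (Hc0 := Cmod_ge_0 c).
  assert (HKst : 0 <= Kst).
  { unfold Kst. repeat apply Rplus_le_le_0_compat; repeat apply Rmult_le_pos; auto; apply Rlt_le, exp_pos. }
  destruct (INR_unbounded (INR B0 + Rabs k + 1 + Cmod w0 + 2 * Kst / eps)) as [B HB].
  assert (Hk1 := Rle_abs k). assert (Hk2 := Rle_abs (- k)). rewrite Rabs_Ropp in Hk2.
  assert (Hw0 := Cmod_ge_0 w0). assert (HB0 := pos_INR B0).
  assert (Hke : 0 <= 2 * Kst / eps) by (apply Rmult_le_pos; [lra|apply Rlt_le, Rinv_0_lt_compat; lra]).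
  set (gap := INR B - INR B0 - Rabs k).
  assert (Hgap : 1 <= gap) by (unfold gap; lra).
  assert (HKgap : Kst / gap <= eps / 2).
  { apply (Rmult_le_reg_r gap); [lra|]. replace (Kst / gap * gap) with Kst by (field; lra).
    assert (2 * Kst / eps <= gap) by (unfold gap; lra).
    apply (Rmult_le_compat_r (eps / 2)) in H; [|lra]. replace (2 * Kst / eps * (eps / 2)) with Kst in H by (field; lra). lra. }
  (* A decay rate beyond both edges, so that everything past [L] is at most a constant times exp(-
     L). *)
  destruct (INR_unbounded (INR B + Rabs k + 1)) as [B1 HB1].
  assert (HB01 : (B0 <= B1)%nat) by (apply INR_le; lra).
  destruct (bP B1 HB01) as [CP1 HCP1]. destruct (bQ B1 HB01) as [CQ1 HCQ1].
  assert (HCP10 := coef_nonneg _ _ _ HCP1). assert (HCQ10 := coef_nonneg _ _ _ HCQ1).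
  set (Kt := exp (INR B * Rabs tau) * (CP1 + Cmod c * CQ1) + 1).
  assert (HKt : 0 < Kt).
  { unfold Kt. assert (0 <= exp (INR B * Rabs tau) * (CP1 + Cmod c * CQ1)); [|lra].
    apply Rmult_le_pos; [apply Rlt_le, exp_pos|]. apply Rplus_le_le_0_compat; auto. apply Rmult_le_pos; auto. }
  exists (Rmax (Rabs tau) (- ln (eps / 2 / Kt))). intros L HL.
  assert (HL1 : Rabs tau <= L) by (eapply Rle_trans; [apply Rmax_l|exact HL]).
  assert (HL2 : - ln (eps / 2 / Kt) <= L) by (eapply Rle_trans; [apply Rmax_r|exact HL]).
  assert (Ht1 := Rle_abs tau). assert (Ht2 := Rle_abs (- tau)). rewrite Rabs_Ropp in Ht2.
  assert (Htail : Kt * exp (- L) <= eps / 2).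
  { assert (H : exp (- L) <= eps / 2 / Kt).
    { rewrite -(exp_ln (eps / 2 / Kt)); [apply exp_le; lra|]. apply Rdiv_lt_0_compat; lra. }
    apply (Rmult_le_compat_l Kt) in H; [|lra]. replace (Kt * (eps / 2 / Kt)) with (eps / 2) in H by (field; lra). exact H. }
  assert (HBpos : 0 < INR B) by lra.
  assert (Hetau : forall x, Rabs x = INR B -> exp (- tau * x) <= exp (INR B * Rabs tau)).
  { intros x Hx. apply exp_le. rewrite -Hx -Rabs_mult. eapply Rle_trans; [apply Rle_abs|]. rewrite -Rabs_Ropp. right. f_equal. ring. }
  (* tails of size e^{-L} *)
  assert (Htl : forall (C1 x : R), 0 <= C1 -> Rabs x <= INR B + Rabs k ->
      C1 * exp ((x - INR B1) * L) / (INR B1 - x) <= C1 * exp (- L)).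
  { intros C1 x HC Hx. assert (Hx1 := Rle_abs x).
    assert (H : / (INR B1 - x) <= 1) by (rewrite -Rinv_1; apply Rinv_le_contravar; lra).
    assert (H2 : exp ((x - INR B1) * L) <= exp (- L)).
    { apply exp_le. assert (0 <= L) by (assert (T := Rabs_pos tau); lra). nra. }
    assert (H3 := exp_pos ((x - INR B1) * L)). assert (H4 : 0 < / (INR B1 - x)) by (apply Rinv_0_lt_compat; lra).
    unfold Rdiv. rewrite Rmult_assoc. apply Rmult_le_compat_l; auto. nra. }
  (* heads of size 1/(B - B0 - |k|) *)
  assert (Hhd : forall D x, 0 <= D -> gap <= x -> D / x <= D / gap).
  { intros D x HD Hx. apply Rmult_le_compat_l; auto. apply Rinv_le_contravar; lra. }
  assert (Hside1 : forall y, Cmod (Z tau L (INR B, y)) <= eps).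
  { intros y. set (w := (INR B, y) : C). unfold Z. rewrite Cmod_mult Cmod_cexp.
    replace (fst (0 + (- tau)%R * w)%C) with (- tau * INR B) by (simpl; ring).
    assert (T1 : Cmod (X w - CI (fun t => P t * cexp (w * RtoC t)) tau L)%C <= CP * exp ((INR B - INR B0) * tau) / (INR B - INR B0) + CP1 * exp (- L)).
    { eapply Rle_trans; [apply (lapl_tails P w (X w) CP (INR B0) CP1 (INR B1)); auto; simpl; try lra; apply lX; simpl; lra|].
      apply Rplus_le_compat_l. simpl. apply Htl; auto. rewrite Rabs_pos_eq; lra. }
    assert (T2 : Cmod (CI (fun t => c * Q' t * cexp (w * RtoC t))%C (- L) tau) <= Cmod c * (CQ * exp ((INR B + INR B0 - k) * tau) / (INR B + INR B0 - k))).
    { rewrite Q'_int Cmod_mult Ropp_involutive. apply Rmult_le_compat_l; auto.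
      assert (Hf : fst (RtoC k - w)%C = k - INR B) by (unfold w; simpl; ring).
      eapply Rle_trans; [apply (CI_right_tail Q (RtoC k - w)%C CQ (INR B0)); auto; rewrite ?Hf; lra|].
      rewrite Hf. right. replace ((k - INR B - INR B0) * - tau) with ((INR B + INR B0 - k) * tau) by ring.
      replace (INR B0 - (k - INR B)) with (INR B + INR B0 - k) by ring. reflexivity. }
    assert (T := Cmod_triang_minus (X w - CI (fun t => P t * cexp (w * RtoC t)) tau L)%C (CI (fun t => c * Q' t * cexp (w * RtoC t))%C (- L) tau)).
    assert (HE := exp_pos (- tau * INR B)).
    eapply Rle_trans; [apply Rmult_le_compat_l; [lra|eapply Rle_trans; [exact T|apply Rplus_le_compat; [exact T1|exact T2]]]|].
    assert (I1 : exp (- tau * INR B) * (CP * exp ((INR B - INR B0) * tau) / (INR B - INR B0)) <= CP * exp (- INR B0 * tau) / gap).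
    { eapply Rle_trans; [|apply (Hhd (CP * exp (- INR B0 * tau)) (INR B - INR B0)); [apply Rmult_le_pos; auto; apply Rlt_le, exp_pos|unfold gap; assert (T0 := Rabs_pos k); lra]].
      right. replace (- INR B0 * tau) with (- tau * INR B + (INR B - INR B0) * tau) by ring. rewrite exp_plus. field. lra. }
    assert (I2 : exp (- tau * INR B) * (Cmod c * (CQ * exp ((INR B + INR B0 - k) * tau) / (INR B + INR B0 - k))) <= CQ * Cmod c * exp ((INR B0 - k) * tau) / gap).
    { eapply Rle_trans; [|apply (Hhd (CQ * Cmod c * exp ((INR B0 - k) * tau)) (INR B + INR B0 - k)); [repeat apply Rmult_le_pos; auto; apply Rlt_le, exp_pos|unfold gap; lra]].
      right. replace ((INR B0 - k) * tau) with (- tau * INR B + (INR B + INR B0 - k) * tau) by ring. rewrite exp_plus. field. lra. }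
    assert (I3 : exp (- tau * INR B) * (CP1 * exp (- L)) <= Kt * exp (- L)).
    { rewrite -Rmult_assoc. apply Rmult_le_compat_r; [apply Rlt_le, exp_pos|]. unfold Kt.
      assert (HT := Hetau (INR B) ltac:(apply Rabs_pos_eq; lra)).
      assert (0 <= Cmod c * CQ1) by (apply Rmult_le_pos; auto). assert (HE2 := exp_pos (INR B * Rabs tau)). nra. }
    assert (I4 : CP * exp (- INR B0 * tau) / gap + CQ * Cmod c * exp ((INR B0 - k) * tau) / gap <= Kst / gap).
    { unfold Rdiv. rewrite -Rmult_plus_distr_r. apply Rmult_le_compat_r; [apply Rlt_le, Rinv_0_lt_compat; lra|].
      unfold Kst. assert (0 <= Cmod c * CP * exp (- INR B0 * tau)) by (repeat apply Rmult_le_pos; auto; apply Rlt_le, exp_pos).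
      assert (0 <= CQ * exp ((INR B0 - k) * tau)) by (repeat apply Rmult_le_pos; auto; apply Rlt_le, exp_pos). lra. }
    rewrite !Rmult_plus_distr_l. lra. }
  assert (Hside2 : forall y, Cmod (Z tau L (- INR B, y)) <= eps).
  { intros y. set (w := (- INR B, y) : C). unfold Z. rewrite Cmod_mult Cmod_cexp.
    replace (fst (0 + (- tau)%R * w)%C) with (tau * INR B) by (simpl; ring).
    set (w' := (RtoC k - w)%C). assert (Hw' : fst w' = k + INR B) by (unfold w', w; simpl; ring).
    replace (X w - CI (fun t => P t * cexp (w * RtoC t)) tau L - CI (fun t => c * Q' t * cexp (w * RtoC t)) (- L) tau)%C
     with (c * (X' w' - CI (fun t => Q t * cexp (w' * RtoC t)) (- tau) L) - CI (fun t => P t * cexp (w * RtoC t)) tau L)%C.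
    2:{ rewrite Q'_int Ropp_involutive FE. fold w'. ring. }
    assert (T1 : Cmod (X' w' - CI (fun t => Q t * cexp (w' * RtoC t)) (- tau) L)%C <= CQ * exp ((k + INR B - INR B0) * - tau) / (k + INR B - INR B0) + CQ1 * exp (- L)).
    { eapply Rle_trans; [apply (lapl_tails Q w' (X' w') CQ (INR B0) CQ1 (INR B1)); auto; rewrite ?Hw'; try lra; apply lX'; rewrite Hw'; lra|].
      rewrite Hw'. apply Rplus_le_compat_l. apply Htl; auto. eapply Rle_trans; [apply Rabs_triang|]. rewrite (Rabs_pos_eq (INR B)); lra. }
    assert (T2 : Cmod (CI (fun t => P t * cexp (w * RtoC t))%C tau L) <= CP * exp ((- INR B - INR B0) * tau) / (INR B0 - - INR B)).
    { apply (CI_right_tail P w CP (INR B0)); auto; simpl; lra. }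
    assert (T := Cmod_triang_minus (c * (X' w' - CI (fun t => Q t * cexp (w' * RtoC t)) (- tau) L))%C (CI (fun t => P t * cexp (w * RtoC t))%C tau L)).
    rewrite Cmod_mult in T.
    assert (HE := exp_pos (tau * INR B)).
    eapply Rle_trans; [apply Rmult_le_compat_l; [lra|eapply Rle_trans; [exact T|apply Rplus_le_compat; [apply Rmult_le_compat_l; [exact Hc0|exact T1]|exact T2]]]|].
    assert (I1 : exp (tau * INR B) * (CP * exp ((- INR B - INR B0) * tau) / (INR B0 - - INR B)) <= CP * exp (- INR B0 * tau) / gap).
    { eapply Rle_trans; [|apply (Hhd (CP * exp (- INR B0 * tau)) (INR B0 - - INR B)); [apply Rmult_le_pos; auto; apply Rlt_le, exp_pos|unfold gap; assert (T0 := Rabs_pos k); lra]].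
      right. replace (- INR B0 * tau) with (tau * INR B + (- INR B - INR B0) * tau) by ring. rewrite exp_plus. field. lra. }
    assert (I2 : exp (tau * INR B) * (Cmod c * (CQ * exp ((k + INR B - INR B0) * - tau) / (k + INR B - INR B0))) <= CQ * Cmod c * exp ((INR B0 - k) * tau) / gap).
    { eapply Rle_trans; [|apply (Hhd (CQ * Cmod c * exp ((INR B0 - k) * tau)) (k + INR B - INR B0)); [repeat apply Rmult_le_pos; auto; apply Rlt_le, exp_pos|unfold gap; lra]].
      right. replace ((INR B0 - k) * tau) with (tau * INR B + (k + INR B - INR B0) * - tau) by ring. rewrite exp_plus. field. lra. }
    assert (I3 : exp (tau * INR B) * (Cmod c * (CQ1 * exp (- L))) <= Kt * exp (- L)).
    { replace (exp (tau * INR B) * (Cmod c * (CQ1 * exp (- L)))) with (exp (tau * INR B) * (Cmod c * CQ1) * exp (- L)) by ring.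
      apply Rmult_le_compat_r; [apply Rlt_le, exp_pos|]. unfold Kt.
      assert (HT := Hetau (- INR B) ltac:(rewrite Rabs_Ropp; apply Rabs_pos_eq; lra)).
      replace (- tau * - INR B) with (tau * INR B) in HT by ring.
      assert (0 <= Cmod c * CQ1) by (apply Rmult_le_pos; auto). assert (HE2 := exp_pos (INR B * Rabs tau)). nra. }
    assert (I4 : CP * exp (- INR B0 * tau) / gap + CQ * Cmod c * exp ((INR B0 - k) * tau) / gap <= Kst / gap).
    { unfold Rdiv. rewrite -Rmult_plus_distr_r. apply Rmult_le_compat_r; [apply Rlt_le, Rinv_0_lt_compat; lra|].
      unfold Kst. assert (0 <= Cmod c * CP * exp (- INR B0 * tau)) by (repeat apply Rmult_le_pos; auto; apply Rlt_le, exp_pos).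
      assert (0 <= CQ * exp ((INR B0 - k) * tau)) by (repeat apply Rmult_le_pos; auto; apply Rlt_le, exp_pos). lra. }
    rewrite !Rmult_plus_distr_l. lra. }
  apply (phragmen_lindelof (Z tau L) (INR B)); auto; try lra.
  - intros z. apply mu_Z_hol. lra.
  - apply mu_Z_fo. lra.
  - assert (H := Rabs_fst_le w0). apply Rabs_le_between in H. lra.
Qed.

(** At w = 0, subtracting the small quantities for tau = a and tau = b cancels X and leaves the
    integral of P - c Q' over [a, b], which is therefore zero for all a and b. *)
Theorem mellin_unique t : P t = (c * (cexp (RtoC (- k) * RtoC t) * Q (- t)))%C.
Proof.
  apply Ceq_minus. apply (CI_zero_imp (fun t => P t - c * Q' t)%C).
  { intros; apply cont_minus; [apply HP|apply mu_contcQ']. }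
  intros a b Hab. apply Cmod_eq_0, Rle_antisym; [|apply Cmod_ge_0]. apply le_epsilon. intros eps He.
  destruct (mu_small a 0%C (eps / 2)) as [L1 H1]; [lra|]. destruct (mu_small b 0%C (eps / 2)) as [L2 H2]; [lra|].
  set (L := Rmax L1 L2).
  specialize (H1 L (Rmax_l _ _)). specialize (H2 L (Rmax_r _ _)). unfold Z in H1, H2.
  assert (E0 : forall s, cexp (0 + RtoC s * 0)%C = 1%C).
  { intros s. replace (0 + RtoC s * 0)%C with (RtoC 0) by ring. apply cexp_0. }
  rewrite !E0 in H1 H2.
  set (f1 := fun t => (P t * cexp (0 * RtoC t))%C) in *. set (f2 := fun t => (c * Q' t * cexp (0 * RtoC t))%C) in *.
  assert (X1 : forall u v, ex_RInt (V := CR) f1 u v) by (intros; apply ex_CI_all; intros; apply cont_lapl, HP).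
  assert (X2 : forall u v, ex_RInt (V := CR) f2 u v) by (intros; apply ex_CI_all; intros; apply cont_lapl, mu_contcQ').
  assert (HEQ : CI (fun t => P t - c * Q' t)%C a b = (CI f1 a b - CI f2 a b)%C).
  { rewrite -CI_minus //. apply CI_ext. intros x _. unfold f1, f2. replace (0 * RtoC x)%C with (RtoC 0) by ring. rewrite cexp_0. ring. }
  rewrite HEQ.
  rewrite -(CI_Chasles f1 a b L) // in H1. rewrite -(CI_Chasles f2 (- L) a b) // in H2.
  replace (CI f1 a b - CI f2 a b)%C with
   ((1 * (X 0 - CI f1 b L - (CI f2 (- L) a + CI f2 a b))) - (1 * (X 0 - (CI f1 a b + CI f1 b L) - CI f2 (- L) a)))%C by ring.
  eapply Rle_trans; [apply Cmod_triang_minus|]. lra.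
Qed.
End MellinUnique.
End MellinUniqueness.

(** * Convergence of q-series with coefficients of polynomial growth, and their holomorphy *)

Module QSeries.
From Corelib Require Import ssreflect.
From Stdlib Require Import Reals Lra Lia ClassicalEpsilon.
From Coquelicot Require Import Coquelicot.
Require Import Defs.
Import ComplexIntegral ComplexDerivative MaximumModulus ComplexExponential PhragmenLindelof MellinUniqueness.
Open Scope R_scope.

Fixpoint psum (a : nat -> C) (n : nat) : C :=
  match n with O => a O | S m => (psum a m + a (S m))%C end.
Definition csum (a : nat -> C) (l : C) : Prop :=
  forall eps, 0 < eps -> exists N, forall n, (N <= n)%nat -> Cmod (psum a n - l)%C <= eps.

Lemma psum_sum_n a n : psum a n = sum_n (G := C_R_NormedModule) a n.
Proof.
  induction n as [|n IH]; simpl. by rewrite sum_O. rewrite sum_Sn IH. reflexivity.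
Qed.

Lemma csum_is_series a l : csum a l <-> is_series (K := R_AbsRing) (V := C_R_NormedModule) a l.
Proof.
  split.
  - intros H. apply filterlim_locally. intros eps.
    destruct (H (eps / 2)) as [N HN]; [assert (T := cond_pos eps); lra|]. exists N. intros n Hn.
    apply: (norm_compat1 (V := C_R_NormedModule)). rewrite norm_Cmod. specialize (HN n Hn). rewrite psum_sum_n in HN.
    eapply Rle_lt_trans; [exact HN|]. assert (T := cond_pos eps). lra.
  - intros H eps He.
    assert (He2 : 0 < eps / (norm_factor (V := C_R_NormedModule))) by (apply Rdiv_lt_0_compat; [lra|apply norm_factor_gt_0]).
    assert (H' := proj1 (filterlim_locally (U := C_R_NormedModule) (sum_n (G := C_R_NormedModule) a) l) H (mkposreal _ He2)). clear H. rename H' into H. destruct H as [N HN]. exists N. intros n Hn.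
    specialize (HN n Hn). apply (norm_compat2 (V := C_R_NormedModule)) in HN. rewrite norm_Cmod in HN. rewrite psum_sum_n.
    left. eapply Rlt_le_trans; [exact HN|]. simpl. right. field. apply Rgt_not_eq, (norm_factor_gt_0 (V := C_R_NormedModule)).
Qed.

Lemma psum_plus a b n : psum (fun i => a i + b i)%C n = (psum a n + psum b n)%C.
Proof. induction n as [|n IH]; simpl; [ring|rewrite IH; ring]. Qed.
Lemma psum_mult c a n : psum (fun i => c * a i)%C n = (c * psum a n)%C.
Proof. induction n as [|n IH]; simpl; [ring|rewrite IH; ring]. Qed.

Lemma csum_plus a b l m : csum a l -> csum b m -> csum (fun i => a i + b i)%C (l + m)%C.
Proof.
  intros H K eps He. destruct (H (eps / 2)) as [N1 H1]; [lra|]. destruct (K (eps / 2)) as [N2 H2]; [lra|].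
  exists (max N1 N2). intros n Hn. rewrite psum_plus.
  replace (psum a n + psum b n - (l + m))%C with ((psum a n - l) + (psum b n - m))%C by ring.
  eapply Rle_trans; [apply Cmod_triangle|]. specialize (H1 n ltac:(lia)). specialize (H2 n ltac:(lia)). lra.
Qed.
Lemma csum_mult c a l : csum a l -> csum (fun i => c * a i)%C (c * l)%C.
Proof.
  intros H eps He. assert (Hc := Cmod_ge_0 c). destruct (H (eps / (Cmod c + 1))) as [N HN]; [apply Rdiv_lt_0_compat; lra|].
  exists N. intros n Hn. rewrite psum_mult.
  replace (c * psum a n - c * l)%C with (c * (psum a n - l))%C by ring. rewrite Cmod_mult.
  specialize (HN n Hn). assert (E : eps = eps / (Cmod c + 1) * (Cmod c + 1)) by (field; lra).
  assert (0 < eps / (Cmod c + 1)) by (apply Rdiv_lt_0_compat; lra). assert (Hps := Cmod_ge_0 (psum a n - l)%C). rewrite E. nra.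
Qed.
Lemma csum_ext a b l : (forall n, a n = b n) -> csum a l -> csum b l.
Proof.
  intros E H eps He. destruct (H eps He) as [N HN]. exists N. intros n Hn.
  replace (psum b n) with (psum a n); [auto|]. clear Hn. induction n as [|n IH]; simpl; rewrite E ?IH //.
Qed.
Lemma csum_minus a b l m : csum a l -> csum b m -> csum (fun i => a i - b i)%C (l - m)%C.
Proof.
  intros H K. replace (l - m)%C with (l + (-1) * m)%C by ring.
  eapply csum_ext; [|apply csum_plus; [exact H|apply (csum_mult (-1)%C); exact K]].
  intros n; simpl. ring.
Qed.
Lemma csum_unique a l m : csum a l -> csum a m -> l = m.
Proof.
  intros H K. apply Ceq_minus. apply Cmod_eq_0, Rle_antisym; [|apply Cmod_ge_0].
  apply le_epsilon. intros eps He. destruct (H (eps / 2)) as [N1 H1]; [lra|]. destruct (K (eps / 2)) as [N2 H2]; [lra|].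
  specialize (H1 (max N1 N2) ltac:(lia)). specialize (H2 (max N1 N2) ltac:(lia)).
  replace (l - m)%C with ((psum a (max N1 N2) - m) - (psum a (max N1 N2) - l))%C by ring.
  eapply Rle_trans; [apply Cmod_triang_minus|]. lra.
Qed.

(** A telescoping term with 1/(n+1)^2 <= 2 [zb n]. All series below are dominated by K/(n+1)^2, and
    this one comparison yields their convergence, tails and total bounds. *)
Definition zb (n : nat) : R := / INR (S n) - / INR (S (S n)).
Lemma S_pos n : 0 < INR (S n).
Proof. apply lt_0_INR; lia. Qed.
Lemma S_ge1 n : 1 <= INR (S n).
Proof. apply (le_INR 1); lia. Qed.
Lemma zb_ge n : / INR (S n) ^ 2 <= 2 * zb n.
Proof.
  unfold zb. rewrite (S_INR (S n)). assert (H := S_ge1 n). set (x := INR (S n)) in *.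
  replace (2 * (/ x - / (x + 1))) with (2 * x / (x + 1) * / x ^ 2) by (field; lra).
  rewrite -{1}(Rmult_1_l (/ x ^ 2)). apply Rmult_le_compat_r; [apply Rlt_le, Rinv_0_lt_compat, pow_lt; lra|].
  apply (Rmult_le_reg_r (x + 1)); [lra|]. unfold Rdiv. rewrite Rmult_assoc Rinv_l; lra.
Qed.

Lemma psum_diff_bound a K m n : 0 <= K -> (forall i, Cmod (a i) <= K * / INR (S i) ^ 2) -> (m <= n)%nat ->
  Cmod (psum a n - psum a m)%C <= 2 * K * (/ INR (S (S m)) - / INR (S (S n))).
Proof.
  intros HK Ha Hmn. induction Hmn as [|n Hmn IH].
  - replace (psum a m - psum a m)%C with (RtoC 0) by ring. rewrite Cmod_0. lra.
  - simpl psum. replace (psum a n + a (S n) - psum a m)%C with ((psum a n - psum a m) + a (S n))%C by ring.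
    eapply Rle_trans; [apply Cmod_triangle|]. assert (H := Ha (S n)). assert (Hz := zb_ge (S n)). unfold zb in Hz.
    assert (K * / INR (S (S n)) ^ 2 <= K * (2 * (/ INR (S (S n)) - / INR (S (S (S n)))))) by (apply Rmult_le_compat_l; auto). lra.
Qed.
Lemma psum_bound a K n : 0 <= K -> (forall i, Cmod (a i) <= K * / INR (S i) ^ 2) -> Cmod (psum a n) <= 2 * K.
Proof.
  intros HK Ha. replace (psum a n) with ((psum a n - psum a 0) + a O)%C by (simpl; ring).
  eapply Rle_trans; [apply Cmod_triangle|]. assert (H := psum_diff_bound a K 0 n HK Ha ltac:(lia)).
  assert (H0 := Ha O). simpl in H0. assert (H2 : 0 < / INR (S (S n))) by (apply Rinv_0_lt_compat, S_pos).
  replace (INR 2) with 2 in H by (simpl; ring). rewrite !Rmult_1_r Rinv_1 in H0. nra.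
Qed.
Lemma csum_bound a l K : 0 <= K -> (forall i, Cmod (a i) <= K * / INR (S i) ^ 2) -> csum a l -> Cmod l <= 2 * K.
Proof.
  intros HK Ha H. apply le_epsilon. intros eps He. destruct (H eps He) as [N HN]. specialize (HN N (le_n _)).
  replace l with (psum a N - (psum a N - l))%C by ring. eapply Rle_trans; [apply Cmod_triang_minus|].
  assert (H1 := psum_bound a K N HK Ha). lra.
Qed.
Lemma csum_tail a l K n : 0 <= K -> (forall i, Cmod (a i) <= K * / INR (S i) ^ 2) -> csum a l ->
  Cmod (l - psum a n)%C <= 2 * K * / INR (S (S n)).
Proof.
  intros HK Ha H. apply le_epsilon. intros eps He. destruct (H eps He) as [N HN]. specialize (HN (max N n) ltac:(lia)).
  replace (l - psum a n)%C with ((psum a (max N n) - psum a n) - (psum a (max N n) - l))%C by ring. eapply Rle_trans; [apply Cmod_triang_minus|].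
  assert (H1 := psum_diff_bound a K n (max N n) HK Ha ltac:(lia)).
  assert (H2 : 0 < / INR (S (S (max N n)))) by (apply Rinv_0_lt_compat, S_pos). nra.
Qed.
Lemma ex_csum a K : 0 <= K -> (forall i, Cmod (a i) <= K * / INR (S i) ^ 2) -> exists l, csum a l.
Proof.
  intros HK Ha.
  assert (HC : forall pr : C -> R, (forall z w, Rabs (pr z - pr w) <= Cmod (z - w)%C) -> Cauchy_crit (fun n => pr (psum a n))).
  { intros pr Hpr eps He. destruct (INR_unbounded (4 * K / eps)) as [N HN]. exists N. intros n m Hn Hm. unfold R_dist.
    assert (HD : forall i, (N <= i)%nat -> Cmod (psum a i - psum a N)%C < eps / 2).
    { intros i Hi. eapply Rle_lt_trans; [apply (psum_diff_bound a K N i HK Ha Hi)|].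
      assert (H2 : 0 < / INR (S (S i))) by (apply Rinv_0_lt_compat, S_pos).
      assert (H3 : 0 < INR (S (S N))) by apply S_pos. assert (H3' : INR N < INR (S (S N))) by (apply lt_INR; lia).
      assert (H4 : 2 * K * / INR (S (S N)) < eps / 2).
      { apply (Rmult_lt_reg_r (INR (S (S N)))); auto. rewrite Rmult_assoc Rinv_l; [|lra].
        assert (4 * K / eps * eps < INR (S (S N)) * eps) by (apply Rmult_lt_compat_r; lra).
        replace (4 * K / eps * eps) with (4 * K) in H by (field; lra). lra. }
      nra. }
    eapply Rle_lt_trans; [apply Hpr|].
    replace (psum a n - psum a m)%C with ((psum a n - psum a N) - (psum a m - psum a N))%C by ring.
    eapply Rle_lt_trans; [apply Cmod_triang_minus|]. assert (H1 := HD n Hn). assert (H2 := HD m Hm). lra. }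
  destruct (Rcomplete.R_complete (fun n => fst (psum a n))) as [x Hx]. { apply (HC fst). intros z w. apply (Rabs_fst_le (z - w)%C). }
  destruct (Rcomplete.R_complete (fun n => snd (psum a n))) as [y Hy]. { apply (HC snd). intros z w. apply (Rabs_snd_le (z - w)%C). }
  exists (x, y). intros eps He. destruct (Hx (eps / 2)) as [N1 H1]; [lra|]. destruct (Hy (eps / 2)) as [N2 H2]; [lra|].
  exists (max N1 N2). intros n Hn. specialize (H1 n ltac:(lia)). specialize (H2 n ltac:(lia)). unfold R_dist in *.
  replace (psum a n - (x, y))%C with ((fst (psum a n) - x, snd (psum a n) - y) : C) by (destruct (psum a n); unfold Cminus, Cplus, Copp; simpl; f_equal; ring).
  eapply Rle_trans; [apply Cmod_le_sum|]. lra.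
Qed.

Lemma exp_decay B : exists K, 0 <= K /\ forall x, 0 <= x -> x ^ B * exp (- x) <= K.
Proof.
  destruct B as [|B].
  - exists 1. split; [lra|]. intros x Hx. simpl. rewrite Rmult_1_l -exp_0. apply exp_le. lra.
  - exists (INR (S B) ^ S B). assert (Hn := S_pos B). split; [apply pow_le; lra|]. intros x Hx.
    assert (H := exp_pow_ge x B Hx). unfold Rdiv in H. rewrite Rpow_mult_distr pow_inv in H.
    rewrite exp_Ropp. apply (Rmult_le_reg_r (exp x)); [apply exp_pos|]. rewrite Rmult_assoc Rinv_l; [|apply Rgt_not_eq, exp_pos].
    rewrite Rmult_1_r. assert (Hp : 0 < INR (S B) ^ S B) by (apply pow_lt; auto).
    apply (Rmult_le_compat_l _ _ _ (Rlt_le _ _ Hp)) in H. 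
    replace (INR (S B) ^ S B * (x ^ S B * / INR (S B) ^ S B)) with (x ^ S B) in H by (field; lra). exact H.
Qed.

Lemma qterm_decay m c : 0 < c -> exists K, 0 <= K /\ forall n,
  INR (S n) ^ m * exp (- c * INR (S n)) <= K * / INR (S n) ^ 2.
Proof.
  intros Hc. destruct (exp_decay (m + 2)) as [K [HK H]]. exists (K / c ^ (m + 2)).
  assert (Hcp : 0 < c ^ (m + 2)) by (apply pow_lt; auto).
  split; [apply Rmult_le_pos; [auto|apply Rlt_le, Rinv_0_lt_compat; auto]|].
  intros n. assert (Hn := S_pos n). specialize (H (c * INR (S n)) ltac:(nra)).
  rewrite Rpow_mult_distr (pow_add (INR (S n)) m 2) in H.
  apply (Rmult_le_reg_r (INR (S n) ^ 2 * c ^ (m + 2))). { apply Rmult_lt_0_compat; auto. apply pow_lt; auto. }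
  replace (K / c ^ (m + 2) * / INR (S n) ^ 2 * (INR (S n) ^ 2 * c ^ (m + 2))) with K by (field; lra).
  replace (- c * INR (S n)) with (- (c * INR (S n))) by ring.
  eapply Rle_trans; [|exact H]. right. ring.
Qed.

Lemma Cmod_e_ z : Cmod (e_ z) = exp (- (2 * PI) * snd z).
Proof. unfold e_. rewrite Cmod_cexp. f_equal. simpl. ring. Qed.

Lemma Cder_quadratic_loc F w l K r : 0 <= K -> 0 < r ->
  (forall h, Cmod h <= r -> Cmod (F (w + h) - F w - l * h)%C <= K * Cmod h ^ 2) -> Cder F w l.
Proof.
  intros HK Hr H eps He. exists (Rmin r (eps / (K + 1))). split.
  { apply Rmin_pos; [lra|apply Rdiv_lt_0_compat; lra]. }
  intros h Hh. assert (H1 := Rlt_le_trans _ _ _ Hh (Rmin_l _ _)). assert (H2 := Rlt_le_trans _ _ _ Hh (Rmin_r _ _)).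
  eapply Rle_trans; [apply H; lra|]. assert (H0 := Cmod_ge_0 h).
  assert (E : eps = eps / (K + 1) * (K + 1)) by (field; lra).
  assert (0 < eps / (K + 1)) by (apply Rdiv_lt_0_compat; lra).
  rewrite E. replace (K * Cmod h ^ 2) with (K * Cmod h * Cmod h) by ring.
  apply Rmult_le_compat_r; auto. nra.
Qed.

(** Index shift: [a n] is the coefficient of e((n+1) z), so there is no constant term. *)
Definition qterm (a : nat -> C) (z : C) (n : nat) : C := (a n * e_ (INR (S n) * z))%C.

Definition polybd (a : nat -> C) (A : R) (m : nat) : Prop := 0 <= A /\ forall n, Cmod (a n) <= A * INR (S n) ^ m.

Lemma qterm_bound a A m y : polybd a A m -> 0 < y -> exists K, 0 <= K /\ forall z n, y <= snd z ->
  Cmod (qterm a z n) <= K * / INR (S n) ^ 2.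
Proof.
  intros [HA Ha] Hy. assert (HPI := PI_RGT_0). destruct (qterm_decay m (2 * PI * y)) as [K [HK H]]; [nra|].
  exists (A * K). split; [apply Rmult_le_pos; auto|]. intros z n Hz. unfold qterm. rewrite Cmod_mult Cmod_e_.
  assert (Hn := S_pos n).
  replace (snd (INR (S n) * z)%C) with (INR (S n) * snd z) by (cbn [snd fst RtoC Cmult]; ring).
  apply (Rle_trans _ (A * INR (S n) ^ m * exp (- (2 * PI * y) * INR (S n)))).
  - apply Rmult_le_compat; [apply Cmod_ge_0|apply Rlt_le, exp_pos|apply Ha|]. apply exp_le.
    assert (INR (S n) * y <= INR (S n) * snd z) by (apply Rmult_le_compat_l; lra). nra.
  - rewrite (Rmult_assoc A) (Rmult_assoc A K). apply Rmult_le_compat_l; auto.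
Qed.

Lemma qser_ex a A m z : polybd a A m -> 0 < snd z -> exists l, csum (qterm a z) l.
Proof.
  intros Ha Hz. destruct (qterm_bound a A m (snd z) Ha Hz) as [K [HK H]]. apply (ex_csum _ K); auto. intros; apply H; lra.
Qed.

Theorem qser_hol a A m F : polybd a A m -> (forall z, 0 < snd z -> csum (qterm a z) (F z)) ->
  forall z, 0 < snd z -> exists l, Cder F z l.
Proof.
  intros Ha HF z Hz. destruct Ha as [HA Ha]. assert (HPI := PI_RGT_0).
  set (y := snd z) in *.
  set (b := fun n => (2 * PI * Ci * INR (S n) * a n)%C).
  assert (Hb : polybd b (2 * PI * A) (S m)).
  { split; [nra|]. intros n. unfold b. rewrite !Cmod_mult.
    replace (Cmod (INR (S n))) with (Rabs (INR (S n))) by (rewrite Coquelicot.Complex.Cmod_R; auto).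
    replace (Cmod 2) with 2 by (rewrite Coquelicot.Complex.Cmod_R Rabs_pos_eq; lra).
    replace (Cmod PI) with PI by (rewrite Coquelicot.Complex.Cmod_R Rabs_pos_eq; lra).
    assert (Hn := S_pos n). rewrite (Rabs_pos_eq (INR (S n))); [|lra]. replace (Cmod Ci) with 1 by (unfold Ci; rewrite Cmod_I Rabs_R1; auto).
    specialize (Ha n). apply (Rle_trans _ (2 * PI * 1 * INR (S n) * (A * INR (S n) ^ m))).
    - apply Rmult_le_compat_l; auto. assert (0 <= PI * INR (S n)) by (apply Rmult_le_pos; lra). lra.
    - right. rewrite -(tech_pow_Rmult (INR (S n)) m). ring. }
  destruct (qser_ex b _ _ z Hb Hz) as [l Hl]. exists l.
  destruct (qterm_decay (m + 2) (PI * y)) as [K [HK Hd]]; [nra|].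
  set (KK := A * (2 * PI) ^ 2 * K). assert (HKK : 0 <= KK) by (unfold KK; apply Rmult_le_pos; [apply Rmult_le_pos; [auto|apply pow_le; lra]|auto]).
  (* For |h| at most y/2 the factor exp(2 pi (n+1) |h|) of the second-order remainder costs no more
     than half of the exponential decay of the term. *)
  apply (Cder_quadratic_loc _ _ _ (2 * KK) (y / 2)); [lra|lra|]. intros h Hh.
  assert (Hzh : 0 < snd (z + h)%C).
  { simpl. fold y. assert (H := Rabs_snd_le h). apply Rabs_le_between in H. lra. }
  assert (HS := csum_minus _ _ _ _ (csum_minus _ _ _ _ (HF _ Hzh) (HF _ Hz)) (csum_mult h _ _ Hl)).
  rewrite (Cmult_comm l h). rewrite Rmult_assoc.
  assert (Hh0 := Cmod_ge_0 h).
  apply (csum_bound _ _ (KK * Cmod h ^ 2)) in HS; auto; [apply Rmult_le_pos; auto; apply pow_le; auto|].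
  intros n. unfold qterm, b. set (u := (2 * PI * Ci * INR (S n) * h)%C).
  assert (E : e_ (INR (S n) * (z + h)) = (e_ (INR (S n) * z) * cexp u)%C).
  { unfold e_, u. rewrite -cexp_plus. f_equal. ring. }
  rewrite E. replace (a n * (e_ (INR (S n) * z) * cexp u) - a n * e_ (INR (S n) * z) -
    h * (2 * PI * Ci * INR (S n) * a n * e_ (INR (S n) * z)))%C with (a n * e_ (INR (S n) * z) * (cexp u - 1 - u))%C by (unfold u; ring).
  rewrite !Cmod_mult Cmod_e_.
  assert (Hn := S_pos n).
  assert (Hu : Cmod u = 2 * PI * INR (S n) * Cmod h).
  { unfold u. rewrite !Cmod_mult !Coquelicot.Complex.Cmod_R !(Rabs_pos_eq _ (Rlt_le _ _ Hn)).
    rewrite (Rabs_pos_eq 2); [|lra]. rewrite (Rabs_pos_eq PI); [|lra]. unfold Ci. rewrite Cmod_I Rabs_R1. ring. }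
  assert (Hm2 := cexp_m2 u). rewrite Hu in Hm2.
  replace (snd (INR (S n) * z)%C) with (INR (S n) * y) by (unfold y; cbn [snd fst RtoC Cmult]; ring).
  apply (Rle_trans _ (A * INR (S n) ^ m * exp (- (2 * PI) * (INR (S n) * y)) * ((2 * PI * INR (S n) * Cmod h) ^ 2 * exp (PI * INR (S n) * y)))).
  - apply Rmult_le_compat; [apply Rmult_le_pos; [apply Cmod_ge_0|apply Rlt_le, exp_pos]|apply Cmod_ge_0| |].
    + apply Rmult_le_compat_r; [apply Rlt_le, exp_pos|apply Ha].
    + eapply Rle_trans; [exact Hm2|]. apply Rmult_le_compat_l; [apply pow_le; apply Rmult_le_pos; [apply Rmult_le_pos; lra|lra]|].
      apply exp_le. assert (0 < PI * INR (S n)) by nra. nra.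
  - replace (A * INR (S n) ^ m * exp (- (2 * PI) * (INR (S n) * y)) * ((2 * PI * INR (S n) * Cmod h) ^ 2 * exp (PI * INR (S n) * y)))
     with (A * (2 * PI) ^ 2 * Cmod h ^ 2 * (INR (S n) ^ (m + 2) * exp (- (PI * y) * INR (S n)))).
    + replace (KK * Cmod h ^ 2 * / INR (S n) ^ 2) with (A * (2 * PI) ^ 2 * Cmod h ^ 2 * (K * / INR (S n) ^ 2)) by (unfold KK; ring).
      apply Rmult_le_compat_l; [|apply Hd]. apply Rmult_le_pos; [apply Rmult_le_pos; [auto|apply pow_le; lra]|apply pow_le; auto].
    + replace (exp (- (PI * y) * INR (S n))) with (exp (- (2 * PI) * (INR (S n) * y)) * exp (PI * INR (S n) * y)) by (rewrite -exp_plus; f_equal; ring).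
      rewrite pow_add. ring.
Qed.
End QSeries.

(** * The Gamma function as a Laplace transform, and transforms of exponential series *)

Module GammaMellin.
From Corelib Require Import ssreflect.
From Stdlib Require Import Reals Lra Lia ClassicalEpsilon.
From Coquelicot Require Import Coquelicot.
Require Import Defs.
Import ComplexIntegral ComplexDerivative MaximumModulus ComplexExponential PhragmenLindelof MellinUniqueness QSeries.
Open Scope R_scope.

Lemma exp_small C al eps : 0 <= C -> 0 < al -> 0 < eps -> exists L0, forall L, L0 <= L -> C * exp (- al * L) <= eps.
Proof.
  intros HC Hal He. exists (- ln (eps / (C + 1)) / al). intros L HL.
  assert (H0 : 0 < eps / (C + 1)) by (apply Rdiv_lt_0_compat; lra).
  assert (H1 : exp (- al * L) <= eps / (C + 1)).
  { rewrite -(exp_ln _ H0). apply exp_le. apply (Rmult_le_compat_l al) in HL; [|lra].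
    replace (al * (- ln (eps / (C + 1)) / al)) with (- ln (eps / (C + 1))) in HL by (field; lra). lra. }
  apply (Rle_trans _ (C * (eps / (C + 1)))); [apply Rmult_le_compat_l; auto|].
  assert (E : eps = eps / (C + 1) * (C + 1)) by (field; lra). rewrite {2}E. nra.
Qed.

Lemma ex_lapl P w C0 b0 C1 b1 : (forall t, cont P t) ->
  (forall t, Cmod (P t) <= C0 * exp (- b0 * t)) -> (forall t, Cmod (P t) <= C1 * exp (- b1 * t)) ->
  b0 < fst w < b1 -> exists X, lapl P w X.
Proof.
  intros HP H0 H1 Hw. assert (HC0 := coef_nonneg _ _ _ H0). assert (HC1 := coef_nonneg _ _ _ H1).
  set (f := fun t => (P t * cexp (w * RtoC t))%C).
  assert (Hex : forall a b, ex_RInt (V := CR) f a b) by (intros; apply ex_CI_all; intros; apply cont_lapl, HP).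
  assert (Hd : forall eps, 0 < eps -> exists L0, 0 <= L0 /\ forall L L', L0 <= L -> L <= L' -> Cmod (CI f (- L') L' - CI f (- L) L)%C <= eps).
  { intros eps He.
    destruct (exp_small (C0 / (fst w - b0)) (fst w - b0) (eps / 2)) as [La HLa]; [apply Rmult_le_pos; [lra|apply Rlt_le, Rinv_0_lt_compat; lra]|lra|lra|].
    destruct (exp_small (C1 / (b1 - fst w)) (b1 - fst w) (eps / 2)) as [Lb HLb]; [apply Rmult_le_pos; [lra|apply Rlt_le, Rinv_0_lt_compat; lra]|lra|lra|].
    exists (Rmax 0 (Rmax La Lb)). split; [apply Rmax_l|]. intros L L' HL HLL.
    assert (HL0 : 0 <= L) by (eapply Rle_trans; [apply Rmax_l|exact HL]).
    assert (HL1 : La <= L) by (eapply Rle_trans; [apply Rmax_l|]; eapply Rle_trans; [apply Rmax_r|exact HL]).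
    assert (HL2 : Lb <= L) by (eapply Rle_trans; [apply Rmax_r|]; eapply Rle_trans; [apply Rmax_r|exact HL]).
    assert (E : CI f (- L') L' = (CI f (- L') (- L) + CI f (- L) L + CI f L L')%C).
    { rewrite (CI_Chasles f (-L') (- L) L) //. rewrite (CI_Chasles f (-L') L L') //. }
    replace (CI f (- L') L' - CI f (- L) L)%C with (CI f (- L') (- L) + CI f L L')%C by (rewrite E; ring).
    eapply Rle_trans; [apply Cmod_triangle|].
    assert (T1 : Cmod (CI f (- L') (- L)) <= C0 * exp ((fst w - b0) * (- L)) / (fst w - b0)) by (apply CI_left_tail; auto; lra).
    assert (T2 : Cmod (CI f L L') <= C1 * exp ((fst w - b1) * L) / (b1 - fst w)) by (apply CI_right_tail; auto; lra).
    specialize (HLa L HL1). specialize (HLb L HL2).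
    replace (C0 * exp ((fst w - b0) * - L) / (fst w - b0)) with (C0 / (fst w - b0) * exp (- (fst w - b0) * L)) in T1 by (replace ((fst w - b0) * - L) with (- (fst w - b0) * L) by ring; field; lra).
    replace (C1 * exp ((fst w - b1) * L) / (b1 - fst w)) with (C1 / (b1 - fst w) * exp (- (b1 - fst w) * L)) in T2 by (replace ((fst w - b1) * L) with (- (b1 - fst w) * L) by ring; field; lra).
    lra. }
  set (u := fun n : nat => CI f (- INR n) (INR n)).
  assert (HC : forall pr : C -> R, (forall z z', Rabs (pr z - pr z') <= Cmod (z - z')%C) -> Cauchy_crit (fun n => pr (u n))).
  { intros pr Hpr eps He. destruct (Hd (eps / 3)) as [L0 [HL0 HL]]; [lra|]. destruct (INR_unbounded L0) as [N HN].
    exists N. intros n n' Hn Hn'. unfold R_dist. eapply Rle_lt_trans; [apply Hpr|].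
    replace (u n - u n')%C with ((u n - u N) - (u n' - u N))%C by ring.
    eapply Rle_lt_trans; [apply Cmod_triang_minus|].
    assert (h1 : Cmod (u n - u N)%C <= eps / 3) by (refine (HL (INR N) _ _ _); [lra|apply le_INR; lia]).
    assert (h2 : Cmod (u n' - u N)%C <= eps / 3) by (refine (HL (INR N) _ _ _); [lra|apply le_INR; lia]). lra. }
  destruct (Rcomplete.R_complete (fun n => fst (u n))) as [x Hx]. { apply (HC fst). intros z z'. apply (Rabs_fst_le (z - z')%C). }
  destruct (Rcomplete.R_complete (fun n => snd (u n))) as [y Hy]. { apply (HC snd). intros z z'. apply (Rabs_snd_le (z - z')%C). }
  exists (x, y). intros eps He. destruct (Hd (eps / 2)) as [L0 [HL0 HL]]; [lra|]. exists L0. intros L HLL. fold f.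
  destruct (Hx (eps / 4)) as [N1 H3]; [lra|]. destruct (Hy (eps / 4)) as [N2 H4]; [lra|].
  destruct (INR_unbounded L) as [N3 HN3]. set (n := max N1 (max N2 N3)).
  specialize (H3 n ltac:(lia)). specialize (H4 n ltac:(lia)). unfold R_dist in *.
  assert (HnL : L <= INR n) by (apply Rle_trans with (INR N3); [lra|apply le_INR; lia]).
  specialize (HL L (INR n) HLL HnL).
  replace (CI f (- L) L - (x, y))%C with ((((fst (u n) - x)%R, (snd (u n) - y)%R) : C) - (CI f (- INR n) (INR n) - CI f (- L) L))%C.
  2:{ unfold u. destruct (CI f (- INR n) (INR n)), (CI f (- L) L). unfold Cminus, Cplus, Copp; simpl; f_equal; ring. }
  eapply Rle_trans; [apply Cmod_triang_minus|]. eapply Rle_trans; [apply Rplus_le_compat; [apply Cmod_le_sum|exact HL]|]. lra.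
Qed.

(** The function exp(-x) at x = e^s: in this variable [cGamma] is its two-sided Laplace
    transform. *)
Definition pG (s : R) : C := RtoC (exp (- exp s)).

Lemma pG_cexp t : pG t = cexp (RtoC (-1) * cexp (RtoC t))%C.
Proof. unfold pG. rewrite cexp_R -RtoC_mult cexp_R. f_equal. f_equal. ring. Qed.
Lemma cont_ext f g x : (forall t, f t = g t) -> cont f x -> cont g x.
Proof. intros E H eps He. destruct (H eps He) as [d [Hd H']]. exists d. split; auto. intros y Hy. rewrite -!E. auto. Qed.
Lemma pG_cont t : cont pG t.
Proof.
  eapply cont_ext; [intros; symmetry; apply pG_cexp|].
  apply (cont_Cder (fun z => cexp (RtoC (-1) * cexp z)%C)).
  apply ex_Cder_cexp, ex_Cder_mult; [apply ex_Cder_const|apply ex_Cder_cexp, ex_Cder_id].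
Qed.
Lemma exp_pow x n : exp x ^ n = exp (INR n * x).
Proof. rewrite -Rpower_pow; [|apply exp_pos]. unfold Rpower. rewrite ln_exp. reflexivity. Qed.

Lemma pG_decay B : exists K, 0 <= K /\ forall t, Cmod (pG t) <= K * exp (- INR B * t).
Proof.
  destruct (exp_decay B) as [K [HK H]]. exists K. split; auto. intros t.
  unfold pG. rewrite Coquelicot.Complex.Cmod_R Rabs_pos_eq; [|apply Rlt_le, exp_pos].
  specialize (H (exp t) (Rlt_le _ _ (exp_pos t))). rewrite exp_pow in H.
  replace (- INR B * t) with (- (INR B * t)) by ring. rewrite (exp_Ropp (INR B * t)).
  apply (Rmult_le_reg_l (exp (INR B * t))); [apply exp_pos|].
  eapply Rle_trans; [exact H|]. right. field. apply Rgt_not_eq, exp_pos.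
Qed.

(** The substitution x = e^t carries [a, b] to [ln a, ln b], and the endpoint conditions a < exp(-
    L0), b > exp(L0) turn the improper integral into the tail estimates of [lapl_tails]. *)
Lemma cGamma_lapl w : 0 < fst w -> lapl pG w (cGamma w).
Proof.
  intros Hw. destruct (pG_decay 0) as [K0 [HK0 H0]]. destruct (INR_unbounded (fst w)) as [B HB].
  destruct (pG_decay B) as [K1 [HK1 H1]].
  destruct (ex_lapl pG w K0 (INR 0) K1 (INR B) pG_cont H0 H1) as [X HX]; [simpl; lra|].
  replace (cGamma w) with X; [exact HX|]. symmetry. unfold cGamma.
  apply (is_RInt_gen_unique (V := C_R_CompleteNormedModule)).
  intros PP [eps HPP]. cbn [filtermapi].
  assert (Heps := cond_pos eps).
  destruct (exp_small (K0 / fst w) (fst w) (eps / 4)) as [La HLa]; [apply Rmult_le_pos; [lra|apply Rlt_le, Rinv_0_lt_compat; lra]|lra|lra|].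
  destruct (exp_small (K1 / (INR B - fst w)) (INR B - fst w) (eps / 4)) as [Lb HLb]; [apply Rmult_le_pos; [lra|apply Rlt_le, Rinv_0_lt_compat; lra]|lra|lra|].
  set (L0 := Rmax 0 (Rmax La Lb)). assert (HL0 : 0 <= L0) by apply Rmax_l.
  assert (HLa' : La <= L0) by (eapply Rle_trans; [|apply Rmax_r]; apply Rmax_l).
  assert (HLb' : Lb <= L0) by (eapply Rle_trans; [|apply Rmax_r]; apply Rmax_r).
  apply (Filter_prod _ _ _ (fun a => 0 < a < exp (- L0)) (fun b => exp L0 < b)).
  { exists (mkposreal _ (exp_pos (- L0))). intros a Ha Ha0. split; auto.
    unfold ball in Ha; simpl in Ha. unfold AbsRing_ball, abs, minus, plus, opp in Ha; simpl in Ha.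
    rewrite Rabs_pos_eq in Ha; lra. }
  { exists (exp L0). auto. }
  intros a b [Ha Ha'] Hb. exists (CI (fun t => pG t * cexp (w * RtoC t))%C (ln a) (ln b)).
  assert (Hlna : ln a <= - L0). { left. rewrite -(ln_exp (- L0)). apply ln_increasing; auto. }
  assert (Hb0 : 0 < b) by (apply Rlt_trans with (exp L0); [apply exp_pos|auto]).
  assert (Hlnb : L0 <= ln b). { left. rewrite -(ln_exp L0). apply ln_increasing; auto. apply exp_pos. }
  assert (Hab : a <= b). { rewrite -(exp_ln a) // -(exp_ln b) //. apply exp_le. lra. }
  split.
  - simpl. eapply is_RInt_ext; [|apply (is_RInt_comp (V := CR) (fun t => pG t * cexp (w * RtoC t))%C ln (fun t => / t) a b)].
    + intros x Hx. rewrite Rmin_left // Rmax_right // in Hx. unfold pG. rewrite exp_ln; [|lra].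
      unfold cpowR. replace ((w - 1) * RtoC (ln x))%C with (w * RtoC (ln x) + RtoC (- ln x))%C by (rewrite RtoC_opp; ring).
      rewrite cexp_plus cexp_R (exp_Ropp (ln x)) exp_ln; [|lra].
      destruct (cexp (w * RtoC (ln x))%C) as [p q]. unfold scal; simpl. unfold prod_scal, scal; simpl. unfold mult; simpl. unfold Cmult, RtoC; simpl. f_equal; ring.
    + intros x Hx. apply cont_continuous, cont_lapl, pG_cont.
    + intros x Hx. rewrite Rmin_left // Rmax_right // in Hx. split.
      * apply is_derive_Reals. apply derivable_pt_lim_ln. lra.
      * apply (ex_derive_continuous (fun t => / t)). auto_derive. lra.
  - apply HPP. apply: (norm_compat1 (V := C_R_NormedModule)). rewrite norm_Cmod.
    set (g := fun t => (pG t * cexp (w * RtoC t))%C).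
    assert (T := lapl_tails pG w X K0 (INR 0) K1 (INR B) (ln a) (ln b) pG_cont H0 H1 ltac:(simpl; lra) HX ltac:(lra)). fold g in T.
    change (minus (CI g (ln a) (ln b)) X) with (CI g (ln a) (ln b) - X)%C. rewrite -Cmod_opp. replace (- (CI g (ln a) (ln b) - X))%C with (X - CI g (ln a) (ln b))%C by ring.
    eapply Rle_lt_trans; [exact T|]. simpl INR. rewrite Rminus_0_r.
    specialize (HLa (- ln a) ltac:(lra)). specialize (HLb (ln b) ltac:(lra)).
    replace (K0 * exp (fst w * ln a) / fst w) with (K0 / fst w * exp (- fst w * - ln a)) by (replace (- fst w * - ln a) with (fst w * ln a) by ring; field; lra).
    replace (K1 * exp ((fst w - INR B) * ln b) / (INR B - fst w)) with (K1 / (INR B - fst w) * exp (- (INR B - fst w) * ln b)) by (replace ((fst w - INR B) * ln b) with (- (INR B - fst w) * ln b) by ring; field; lra).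
    lra.
Qed.

Lemma CI_shift (p : R -> C) a b d : (forall t, cont p t) -> CI (fun t => p (t + d)) a b = CI p (a + d) (b + d).
Proof.
  intros Hp. apply CI_unique.
  assert (H := is_RInt_comp_lin (V := CR) p 1 d a b (CI p (a + d) (b + d))).
  replace (1 * a + d) with (a + d) in H by ring. replace (1 * b + d) with (b + d) in H by ring.
  eapply is_RInt_ext; [|apply H, CI_correct, ex_CI_all, Hp].
  intros x _. simpl. replace (1 * x + d) with (x + d) by ring. exact (scal_one (V := C_R_NormedModule) (p (x + d))).
Qed.
Lemma cont_shift p d t : cont p (t + d) -> cont (fun t => p (t + d)) t.
Proof.
  intros H eps He. destruct (H eps He) as [r [Hr Hy]]. exists r; split; auto. intros y Hyr. apply Hy.
  replace (y + d - (t + d)) with (y - t) by ring. exact Hyr.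
Qed.

Lemma CI_psum p a b n : (forall i t, cont (p i) t) -> (forall t, cont (fun t => psum (fun i => p i t) n) t) /\
  CI (fun t => psum (fun i => p i t) n) a b = psum (fun i => CI (p i) a b) n.
Proof.
  intros Hp. induction n as [|n [IH1 IH2]]; simpl; [split; auto|].
  assert (Hc : forall t, cont (fun t => psum (fun i => p i t) n + p (S n) t)%C t).
  { intros t. eapply cont_ext; [|apply (cont_minus (fun t => psum (fun i => p i t) n) (fun t => (-1) * p (S n) t)%C)].
    - intros s; simpl; ring.
    - apply IH1.
    - apply cont_Cmult; [apply cont_const|apply Hp]. }
  split; auto. rewrite CI_plus; [|apply ex_CI_all, IH1|apply ex_CI_all, Hp]. rewrite IH2. reflexivity.
Qed.

Lemma CI_csum p P a b K : a <= b -> 0 <= K -> (forall i t, cont (p i) t) -> (forall t, cont P t) ->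
  (forall t, csum (fun i => p i t) (P t)) ->
  (forall i t, a <= t <= b -> Cmod (p i t) <= K * / INR (S i) ^ 2) ->
  csum (fun i => CI (p i) a b) (CI P a b).
Proof.
  intros Hab HK Hp HP Hs Hb eps He.
  destruct (INR_unbounded (2 * K * (b - a) / eps)) as [N HN]. exists N. intros n Hn.
  destruct (CI_psum p a b n Hp) as [Hc E]. rewrite -E.
  rewrite -CI_minus; [|apply ex_CI_all, Hc|apply ex_CI_all, HP].
  apply (Rle_trans _ (2 * K * / INR (S (S n)) * (b - a))).
  - apply CI_bound; auto.
    + apply ex_CI_all. intros t. apply cont_minus; auto.
    + intros x Hx. rewrite -Cmod_opp. replace (- (psum (fun i => p i x) n - P x))%C with (P x - psum (fun i => p i x) n)%C by ring.
      apply (csum_tail (fun i => p i x)); auto.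
  - assert (Hpos := S_pos (S n)). assert (H1 : INR N <= INR (S (S n))) by (apply le_INR; lia).
    apply (Rmult_le_reg_r (INR (S (S n)))); auto.
    replace (2 * K * / INR (S (S n)) * (b - a) * INR (S (S n))) with (2 * K * (b - a)) by (field; lra).
    assert (2 * K * (b - a) / eps * eps <= INR (S (S n)) * eps) by (apply Rmult_le_compat_r; lra).
    replace (2 * K * (b - a) / eps * eps) with (2 * K * (b - a)) in H by (field; lra). lra.
Qed.

Lemma pow_le_inv2 x m B : 1 <= x -> (m + 2 <= B)%nat -> x ^ m * / x ^ B <= / x ^ 2.
Proof.
  intros Hx H. replace B with (m + 2 + (B - m - 2))%nat by lia. rewrite !pow_add.
  assert (H1 : 0 < x ^ m) by (apply pow_lt; lra). assert (H2 : 0 < x ^ 2) by (apply pow_lt; lra).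
  assert (H3 : 1 <= x ^ (B - m - 2)) by (apply pow_R1_Rle; lra).
  replace (x ^ m * / (x ^ m * x ^ 2 * x ^ (B - m - 2))) with (/ x ^ 2 * / x ^ (B - m - 2)) by (field; repeat split; lra).
  rewrite -{2}(Rmult_1_r (/ x ^ 2)). apply Rmult_le_compat_l; [apply Rlt_le, Rinv_0_lt_compat; auto|].
  rewrite -Rinv_1. apply Rinv_le_contravar; lra.
Qed.

Lemma Rinv_pow_exp y B : 0 < y -> exp (- INR B * ln y) = / y ^ B.
Proof.
  intros Hy. replace (- INR B * ln y) with (- (INR B * ln y)) by ring. rewrite exp_Ropp -exp_pow exp_ln //.
Qed.

Section MellinSeries.
Variables (a : nat -> C) (A : R) (m : nat) (c : R) (P : R -> C).
Hypothesis Ha : polybd a A m.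
Hypothesis Hc : 0 < c.
Hypothesis HP : forall t, cont P t.
Hypothesis HS : forall t, csum (fun n => a n * pG (t + ln (c * INR (S n))))%C (P t).

Lemma ms_pos n : 0 < c * INR (S n).
Proof. apply Rmult_lt_0_compat; auto. apply S_pos. Qed.

(** Decay of order [B] in t is paid for by n^(-B), and B >= m + 2 leaves a summable 1/n^2 after the
    coefficient bound n^m. *)
Lemma ms_term B : (m + 2 <= B)%nat -> exists K, 0 <= K /\ forall n t,
  Cmod (a n * pG (t + ln (c * INR (S n))))%C <= K * exp (- INR B * t) * / INR (S n) ^ 2.
Proof.
  intros HB. destruct (pG_decay B) as [K [HK H]]. destruct Ha as [HA Hab].
  assert (HcB : 0 < c ^ B) by (apply pow_lt; auto).
  exists (A * K / c ^ B). split; [apply Rmult_le_pos; [apply Rmult_le_pos; auto|apply Rlt_le, Rinv_0_lt_compat; auto]|].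
  intros n t. rewrite Cmod_mult. specialize (H (t + ln (c * INR (S n)))).
  rewrite Rmult_plus_distr_l exp_plus Rinv_pow_exp in H; [|apply ms_pos].
  assert (Hn := S_ge1 n). assert (Hp := pow_le_inv2 (INR (S n)) m B Hn HB).
  rewrite Rpow_mult_distr in H.
  assert (HsB : 0 < INR (S n) ^ B) by (apply pow_lt; lra).
  apply (Rle_trans _ (A * INR (S n) ^ m * (K * (exp (- INR B * t) * / (c ^ B * INR (S n) ^ B))))).
  - apply Rmult_le_compat; auto; apply Cmod_ge_0.
  - replace (A * INR (S n) ^ m * (K * (exp (- INR B * t) * / (c ^ B * INR (S n) ^ B)))) with
      (A * K / c ^ B * exp (- INR B * t) * (INR (S n) ^ m * / INR (S n) ^ B)) by (field; split; lra).
    apply Rmult_le_compat_l; auto. apply Rmult_le_pos; [|apply Rlt_le, exp_pos].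
    apply Rmult_le_pos; [apply Rmult_le_pos; auto|apply Rlt_le, Rinv_0_lt_compat; auto].
Qed.

Lemma ms_decay B : (m + 2 <= B)%nat -> exists K, forall t, Cmod (P t) <= K * exp (- INR B * t).
Proof.
  intros HB. destruct (ms_term B HB) as [K [HK H]]. exists (2 * K). intros t.
  rewrite Rmult_assoc. apply (csum_bound (fun n => a n * pG (t + ln (c * INR (S n))))%C); auto.
  apply Rmult_le_pos; auto. apply Rlt_le, exp_pos.
Qed.

Lemma ms_CI n w α β : CI (fun t => a n * pG (t + ln (c * INR (S n))) * cexp (w * RtoC t))%C α β =
  (a n * cexp (- w * RtoC (ln (c * INR (S n)))) * CI (fun t => pG t * cexp (w * RtoC t)) (α + ln (c * INR (S n))) (β + ln (c * INR (S n))))%C.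
Proof.
  set (d := ln (c * INR (S n))).
  rewrite -(CI_shift (fun t => pG t * cexp (w * RtoC t))%C); [|intros; apply cont_lapl, pG_cont].
  rewrite -CI_Cmult.
  - apply CI_ext. intros x _. rewrite RtoC_plus. replace (w * (x + d))%C with (w * x + w * d)%C by ring.
    replace (- w * d)%C with (- (w * d))%C by ring. rewrite cexp_plus cexp_opp. field. apply cexp_neq0.
  - apply ex_CI_all. intros t. apply (cont_shift (fun t => pG t * cexp (w * RtoC t))%C). apply cont_lapl, pG_cont.
Qed.

(** Translation by ln(c (n+1)) turns the transform of [pG] into (c (n+1))^(-w) Gamma(w); summing
    gives Gamma(w) D, provided the truncation errors are summable in n. *)
Lemma ms_lapl w D : INR (m + 2) < fst w -> csum (fun n => a n * cexp (- w * RtoC (ln (c * INR (S n)))))%C D ->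
  lapl P w (cGamma w * D)%C.
Proof.
  intros Hw HD. destruct (INR_unbounded (fst w)) as [B1 HB1].
  assert (Hm2 := pos_INR (m + 2)).
  assert (HB1m : (m + 2 <= B1)%nat) by (apply INR_le; lra).
  set (B0 := (m + 2)%nat) in *.
  destruct (pG_decay B0) as [K0 [HK0 H0]]. destruct (pG_decay B1) as [K1 [HK1 H1]]. destruct Ha as [HA Hab].
  assert (HG := cGamma_lapl w ltac:(lra)).
  (* Constants for the left and right tails, bounded with the decay rates B0 < Re w < B1; both rates
     are at least m + 2, which makes each tail O(1/n^2). *)
  set (D0 := A * (K0 / (fst w - INR B0)) / c ^ B0). set (D1 := A * (K1 / (INR B1 - fst w)) / c ^ B1).
  assert (HcB : forall B, 0 < c ^ B) by (intros; apply pow_lt; auto).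
  assert (HD0 : 0 <= D0).
  { unfold D0. repeat (apply Rmult_le_pos; auto); try (apply Rlt_le, Rinv_0_lt_compat; auto; lra). }
  assert (HD1 : 0 <= D1).
  { unfold D1. repeat (apply Rmult_le_pos; auto); try (apply Rlt_le, Rinv_0_lt_compat; auto; lra). }
  intros eps He.
  destruct (exp_small D0 (fst w - INR B0) (eps / 4)) as [La HLa]; [auto|lra|lra|].
  destruct (exp_small D1 (INR B1 - fst w) (eps / 4)) as [Lb HLb]; [auto|lra|lra|].
  exists (Rmax 0 (Rmax La Lb)). intros L HL.
  assert (HL0 : 0 <= L) by (eapply Rle_trans; [apply Rmax_l|exact HL]).
  assert (HL1 : La <= L) by (eapply Rle_trans; [apply Rmax_l|]; eapply Rle_trans; [apply Rmax_r|exact HL]).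
  assert (HL2 : Lb <= L) by (eapply Rle_trans; [apply Rmax_r|]; eapply Rle_trans; [apply Rmax_r|exact HL]).
  specialize (HLa L HL1). specialize (HLb L HL2).
  assert (Hsum : csum (fun n => CI (fun t => a n * pG (t + ln (c * INR (S n))) * cexp (w * RtoC t))%C (- L) L)
     (CI (fun t => P t * cexp (w * RtoC t))%C (- L) L)).
  { destruct (ms_term B0 (le_n _)) as [K [HK HT]].
    apply (CI_csum _ _ _ _ (K * exp (INR B0 * L) * exp (Rabs (fst w) * L))); [lra| | | | |].
    - repeat apply Rmult_le_pos; auto; apply Rlt_le, exp_pos.
    - intros i t. apply cont_lapl. apply cont_Cmult; [apply cont_const|]. apply cont_shift, pG_cont.
    - intros t. apply cont_lapl, HP.
    - intros t. eapply csum_ext; [|rewrite Cmult_comm; apply csum_mult, HS]. intros n; simpl. ring.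
    - intros i t Ht. rewrite Cmod_mult Cmod_cexp.
      assert (Hi : 0 < / INR (S i) ^ 2) by (apply Rinv_0_lt_compat, pow_lt, S_pos).
      replace (K * exp (INR B0 * L) * exp (Rabs (fst w) * L) * / INR (S i) ^ 2) with
       ((K * exp (INR B0 * L) * / INR (S i) ^ 2) * exp (Rabs (fst w) * L)) by ring.
      apply Rmult_le_compat; [apply Cmod_ge_0|apply Rlt_le, exp_pos| |].
      + eapply Rle_trans; [apply HT|]. apply Rmult_le_compat_r; [lra|]. apply Rmult_le_compat_l; auto. apply exp_le. nra.
      + apply exp_le. replace (fst (w * t)%C) with (fst w * t) by (simpl; ring).
        eapply Rle_trans; [apply Rle_abs|]. rewrite Rabs_mult. apply Rmult_le_compat_l; [apply Rabs_pos|]. apply Rabs_le. lra. }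
  assert (HX := csum_minus _ _ _ _ Hsum (csum_mult (cGamma w) _ _ HD)).
  set (KK := D0 * exp (- (fst w - INR B0) * L) + D1 * exp (- (INR B1 - fst w) * L)).
  apply (Rle_trans _ (2 * KK)); [|unfold KK; lra].
  apply (csum_bound _ _ KK) in HX; auto.
  { unfold KK. apply Rplus_le_le_0_compat; apply Rmult_le_pos; auto; apply Rlt_le, exp_pos. }
  intros n. rewrite ms_CI. set (d := ln (c * INR (S n))).
  set (J := CI (fun t => pG t * cexp (w * RtoC t))%C (- L + d) (L + d)).
  replace (a n * cexp (- w * d) * J - cGamma w * (a n * cexp (- w * d)))%C with (- (a n * cexp (- w * d) * (cGamma w - J)))%C by ring.
  rewrite Cmod_opp !Cmod_mult Cmod_cexp.
  replace (fst (- w * d)%C) with (- fst w * d) by (simpl; ring).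
  assert (T := lapl_tails pG w (cGamma w) K0 (INR B0) K1 (INR B1) (- L + d) (L + d) pG_cont H0 H1 ltac:(lra) HG ltac:(lra)). fold J in T.
  apply (Rle_trans _ (A * INR (S n) ^ m * exp (- fst w * d) * (K0 * exp ((fst w - INR B0) * (- L + d)) / (fst w - INR B0) + K1 * exp ((fst w - INR B1) * (L + d)) / (INR B1 - fst w)))).
  { apply Rmult_le_compat; [apply Rmult_le_pos; [apply Cmod_ge_0|apply Rlt_le, exp_pos]|apply Cmod_ge_0| |exact T].
    apply Rmult_le_compat_r; [apply Rlt_le, exp_pos|apply Hab]. }
  assert (Hn := S_ge1 n).
  assert (HsB : forall B, 0 < INR (S n) ^ B) by (intros; apply pow_lt; lra).
  assert (E0 : exp (- fst w * d) * exp ((fst w - INR B0) * (- L + d)) = exp (- (fst w - INR B0) * L) * / (c ^ B0 * INR (S n) ^ B0)).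
  { rewrite -Rpow_mult_distr -(Rinv_pow_exp _ B0 (ms_pos n)) -!exp_plus. f_equal. unfold d. ring. }
  assert (E1 : exp (- fst w * d) * exp ((fst w - INR B1) * (L + d)) = exp (- (INR B1 - fst w) * L) * / (c ^ B1 * INR (S n) ^ B1)).
  { rewrite -Rpow_mult_distr -(Rinv_pow_exp _ B1 (ms_pos n)) -!exp_plus. f_equal. unfold d. ring. }
  replace (A * INR (S n) ^ m * exp (- fst w * d) * (K0 * exp ((fst w - INR B0) * (- L + d)) / (fst w - INR B0) + K1 * exp ((fst w - INR B1) * (L + d)) / (INR B1 - fst w)))
   with (A * INR (S n) ^ m * (K0 / (fst w - INR B0)) * (exp (- fst w * d) * exp ((fst w - INR B0) * (- L + d))) + A * INR (S n) ^ m * (K1 / (INR B1 - fst w)) * (exp (- fst w * d) * exp ((fst w - INR B1) * (L + d))))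
   by (field; lra).
  rewrite E0 E1.
  assert (G : forall B KB xx, (m + 2 <= B)%nat -> 0 <= KB -> A * INR (S n) ^ m * KB * (exp xx * / (c ^ B * INR (S n) ^ B)) <= A * KB / c ^ B * exp xx * / INR (S n) ^ 2).
  { intros B KB xx HB HKB. specialize (HsB B). specialize (HcB B).
    replace (A * INR (S n) ^ m * KB * (exp xx * / (c ^ B * INR (S n) ^ B))) with (A * KB / c ^ B * exp xx * (INR (S n) ^ m * / INR (S n) ^ B)) by (field; split; lra).
    apply Rmult_le_compat_l; [|apply pow_le_inv2; auto]. apply Rmult_le_pos; [|apply Rlt_le, exp_pos].
    apply Rmult_le_pos; [apply Rmult_le_pos; auto|apply Rlt_le, Rinv_0_lt_compat; auto]. }
  unfold KK. rewrite Rmult_plus_distr_r. apply Rplus_le_compat.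
  - apply G; auto. apply Rmult_le_pos; [auto|apply Rlt_le, Rinv_0_lt_compat; lra].
  - apply G; auto. apply Rmult_le_pos; [auto|apply Rlt_le, Rinv_0_lt_compat; lra].
Qed.
End MellinSeries.
End GammaMellin.

(** * From a functional equation of completed series to a relation on the upper half-plane *)

Module HeckeFunctionalEquation.
From Corelib Require Import ssreflect.
From Stdlib Require Import Reals Lra Lia ClassicalEpsilon List.
From Coquelicot Require Import Coquelicot.
Require Import Defs.
Import ComplexIntegral ComplexDerivative MaximumModulus ComplexExponential PhragmenLindelof MellinUniqueness QSeries GammaMellin.
Open Scope R_scope.

Lemma Cinv_snd z : 0 < snd z -> snd (/ z)%C < 0.
Proof.
  intros Hz. destruct z as [x y]; simpl in *. unfold Rdiv.
  assert (H : 0 < x * (x * 1) + y * (y * 1)) by nra.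
  apply Rinv_0_lt_compat in H. nra.
Qed.
Lemma snd_neg_inv M z : 0 < M -> 0 < snd z -> 0 < snd (- / (RtoC M * z))%C.
Proof.
  intros HM Hz. assert (H : 0 < snd (RtoC M * z)%C). { destruct z; simpl in *. nra. }
  apply Cinv_snd in H. unfold Copp. cbn [snd]. lra.
Qed.
Lemma RtoC_neq (x y : R) : x <> y -> RtoC x <> RtoC y.
Proof. intros H E. apply H. injection E. auto. Qed.
Lemma C_neq0_snd (z : C) : 0 < snd z -> z <> 0%C.
Proof. intros H E. rewrite E in H. simpl in H. lra. Qed.
Lemma cpown_mult z w n : cpown (z * w)%C n = (cpown z n * cpown w n)%C.
Proof. induction n as [|n IH]; simpl; [ring|rewrite IH; ring]. Qed.
Lemma cpown_neq0 (z : C) n : z <> 0%C -> cpown z n <> 0%C.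
Proof. intros H. induction n as [|n IH]; simpl; [exact C1_nz|exact (Cmult_neq_0 _ _ H IH)]. Qed.
Lemma cpown_RtoC x n : cpown (RtoC x) n = RtoC (x ^ n).
Proof. induction n as [|n IH]; simpl; [auto|rewrite IH -RtoC_mult; auto]. Qed.
Lemma cpown_inv (z : C) n : z <> 0%C -> cpown (/ z)%C n = (/ cpown z n)%C.
Proof.
  intros Hz. induction n as [|n IH]; simpl; [field; apply C1_nz|]. rewrite IH. field. split; auto. apply cpown_neq0; auto.
Qed.

Lemma e_imag s y : e_ (RtoC s * (0, y))%C = RtoC (exp (- (2 * PI * s * y))).
Proof.
  unfold e_. rewrite -cexp_R. f_equal. unfold Cmult, RtoC, Ci; simpl. f_equal; ring.
Qed.

Lemma entire_Cder F z : entire F -> exists l, Cder F z l.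
Proof. intros H. destruct (H z Logic.I) as [l Hl]. exists l. apply Cder_is_derive, Hl. Qed.

Section FuncEq.
Variables (k : nat) (a b : nat -> C) (A : R) (m : nat) (M : R) (c : C) (F G LF LG : C -> C).
Let kap := RtoC ((INR k - 1) / 2).
Hypothesis Ha : polybd a A m.
Hypothesis Hb : polybd b A m.
Hypothesis HM : 0 < M.
Hypothesis HF : forall z, 0 < snd z -> csum (qterm a z) (F z).
Hypothesis HG : forall z, 0 < snd z -> csum (qterm b z) (G z).
Hypothesis HLF : entire LF.
Hypothesis HLFo : finite_order LF.
Let lseries (u : nat -> C) (L : C -> C) := forall w, INR (m + 2) < fst w ->
  exists D, csum (fun n => u n * cpowR (INR (S n)) (- w))%C D /\ L (w - kap)%C = (GammaC w * D)%C.
Hypothesis HDF : lseries a LF.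
Hypothesis HDG : lseries b LG.
Hypothesis FE : forall s, LF s = (c * cpowR M (RtoC (1 / 2) - s) * LG (1 - s))%C.

Let sM := sqrt M.
Let lam := ln sM.
(** Restriction to the imaginary axis at height e^t / sqrt M, so that z -> -1/(M z) becomes t ->
    -t. *)
Let PP (H : C -> C) (t : R) : C := H ((0, exp t / sM) : C).
(** The factor 1/2 cancels the 2 in [GammaC], and exp(w lam) = M^(w/2) comes from the scaling by
    sqrt M; the shift by [kap] makes w the exponent in the Dirichlet series. *)
Let XX (L : C -> C) (w : C) : C := (RtoC (/ 2) * cexp (w * RtoC lam) * L (w - kap))%C.

Lemma fe_sM : 0 < sM. Proof. apply sqrt_lt_R0, HM. Qed.
Lemma fe_lam : ln M = 2 * lam.
Proof.
  unfold lam. assert (H := fe_sM). replace M with (sM * sM) at 1 by (apply sqrt_sqrt; lra).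
  rewrite ln_mult //. ring.
Qed.

Lemma fe_arg t : 0 < snd ((0, exp t / sM) : C).
Proof. simpl. apply Rdiv_lt_0_compat; [apply exp_pos|apply fe_sM]. Qed.

Lemma fe_cont u H t : polybd u A m -> (forall z, 0 < snd z -> csum (qterm u z) (H z)) -> cont (PP H) t.
Proof.
  intros Hu HH. assert (HsM := fe_sM).
  assert (E : forall s, (Ci * (cexp (RtoC s) * RtoC (/ sM)))%C = ((0, exp s / sM) : C)).
  { intros s. rewrite cexp_R. unfold Cmult, RtoC, Ci; simpl. f_equal; field; lra. }
  eapply cont_ext; [intros s; unfold PP; rewrite -E; reflexivity|].
  apply (cont_Cder (fun z => H (Ci * (cexp z * RtoC (/ sM)))%C)).
  apply (ex_Cder_comp H).
  - apply (qser_hol u A m H Hu HH). rewrite E. apply fe_arg.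
  - apply ex_Cder_mult; [apply ex_Cder_const|]. apply ex_Cder_mult; [|apply ex_Cder_const]. apply ex_Cder_cexp, ex_Cder_id.
Qed.

Let cc := 2 * PI / sM.
Lemma fe_cc : 0 < cc. Proof. assert (H := PI_RGT_0). apply Rdiv_lt_0_compat; [lra|apply fe_sM]. Qed.

Lemma fe_series u H t : (forall z, 0 < snd z -> csum (qterm u z) (H z)) ->
  csum (fun n => u n * pG (t + ln (cc * INR (S n))))%C (PP H t).
Proof.
  intros HH. eapply csum_ext; [|apply HH, fe_arg]. intros n. unfold qterm. f_equal. rewrite e_imag. unfold pG. do 2 f_equal.
  assert (Hn := S_pos n). assert (H1 := fe_cc). assert (H2 := fe_sM).
  rewrite exp_plus exp_ln; [|apply Rmult_lt_0_compat; auto]. unfold cc. field. lra.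
Qed.

Lemma fe_lapl u H L w : polybd u A m -> (forall z, 0 < snd z -> csum (qterm u z) (H z)) -> lseries u L ->
  INR (m + 2) < fst w -> lapl (PP H) w (XX L w).
Proof.
  intros Hu HH HL Hw. destruct (HL w Hw) as [D [HD HLD]].
  assert (Hcc := fe_cc). assert (HsM := fe_sM). assert (HPI := PI_RGT_0).
  assert (HD' := csum_mult (cexp (- w * RtoC (ln cc)))%C _ _ HD).
  assert (HD2 : csum (fun n => u n * cexp (- w * RtoC (ln (cc * INR (S n)))))%C (cexp (- w * RtoC (ln cc)) * D)%C).
  { eapply csum_ext; [|exact HD']. intros n; simpl. rewrite ln_mult //; [|apply S_pos].
    unfold cpowR. rewrite RtoC_plus Cmult_plus_distr_l cexp_plus. ring. }
  assert (T := ms_lapl u A m cc (PP H) Hu Hcc (fun t => fe_cont u H t Hu HH) (fun t => fe_series u H t HH) w _ Hw HD2).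
  replace (XX L w) with (cGamma w * (cexp (- w * RtoC (ln cc)) * D))%C; [exact T|].
  unfold XX. rewrite HLD. unfold GammaC, cpowR, cc. rewrite ln_div //; [|lra]. fold lam.
  rewrite RtoC_minus. replace (- w * (RtoC (ln (2 * PI)) - RtoC lam))%C with (- w * RtoC (ln (2 * PI)) + w * RtoC lam)%C by ring.
  rewrite cexp_plus. rewrite RtoC_inv; [|lra]. field.
Qed.

Lemma fe_real t : PP F t = (c * (cexp (RtoC (- INR k) * RtoC t) * PP G (- t)))%C.
Proof.
  apply (mellin_unique (PP F) (PP G) (m + 2) (XX LF) (XX LG) c (INR k)).
  - intros s; apply (fe_cont a); auto.
  - intros s; apply (fe_cont b); auto.
  - intros B HB. apply (ms_decay a A m cc (PP F) Ha fe_cc (fun t => fe_series a F t HF) B HB).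
  - intros B HB. apply (ms_decay b A m cc (PP G) Hb fe_cc (fun t => fe_series b G t HG) B HB).
  - intros w. unfold XX. apply ex_Cder_mult.
    + apply ex_Cder_mult; [apply ex_Cder_const|]. apply ex_Cder_cexp, ex_Cder_mult; [apply ex_Cder_id|apply ex_Cder_const].
    + apply (ex_Cder_comp LF (fun w => w - kap)%C). apply entire_Cder, HLF. apply ex_Cder_minus; [apply ex_Cder_id|apply ex_Cder_const].
  - unfold XX. apply fo_mult; [apply fo_mult; [apply fo_const|]|].
    + destruct (fo_cexp_lin 0 (RtoC lam)) as [A1 [D1 [m1 [h1 [h2 h3]]]]]. exists A1, D1, m1. repeat split; auto.
      intros z. replace (z * RtoC lam)%C with (0 + RtoC lam * z)%C by ring. apply h3.
    + destruct (fo_comp_affine LF (- kap) 1 (finite_order_fo _ HLFo)) as [A1 [D1 [m1 [h1 [h2 h3]]]]]. exists A1, D1, m1. repeat split; auto.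
      intros z. replace (z - kap)%C with (- kap + 1 * z)%C by ring. apply h3.
  - intros w Hw. apply (fe_lapl a); auto.
  - intros w Hw. apply (fe_lapl b); auto.
  - intros w. unfold XX. rewrite FE. unfold cpowR. rewrite fe_lam.
    (* This is why s -> 1 - s becomes w -> k - w. *)
    assert (Hk : (kap + kap)%C = (RtoC (INR k) - 1)%C).
    { unfold kap. rewrite -RtoC_plus -RtoC_minus. f_equal. field. }
    replace (1 - (w - kap))%C with (RtoC (INR k) - w - kap)%C.
    2:{ replace (1 - (w - kap))%C with (1 - w + (kap + kap) - kap)%C by ring. rewrite Hk. ring. }
    assert (E : (cexp (w * RtoC lam) * cexp ((RtoC (1 / 2) - (w - kap)) * RtoC (2 * lam)))%C = cexp ((RtoC (INR k) - w) * RtoC lam)).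
    { rewrite -cexp_plus. f_equal. rewrite RtoC_mult.
      replace (w * RtoC lam + (RtoC (1 / 2) - (w - kap)) * (2 * RtoC lam))%C with ((RtoC (1/2) * 2 - w + (kap + kap)) * RtoC lam)%C by ring.
      rewrite Hk. replace (RtoC (1/2) * 2)%C with (RtoC 1); [ring|]. rewrite -RtoC_mult. f_equal. field. }
    rewrite -E. ring.
Qed.

(** [fe_real] is the identity on the imaginary axis; both sides are holomorphic, and [identity_H]
    carries it to the half-plane. *)
Theorem func_eq z : 0 < snd z ->
  F z = (c * cpown Ci k * / cpown (RtoC sM * z) k * G (- / (RtoC M * z)))%C.
Proof.
  intros Hz. assert (HsM := fe_sM).
  assert (Hs2 : sM * sM = M) by (apply sqrt_sqrt; lra).
  apply Ceq_minus.
  apply (identity_H (fun z => F z - c * cpown Ci k * / cpown (RtoC sM * z) k * G (- / (RtoC M * z)))%C); auto.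
  - clear z Hz. intros z Hz. assert (Hz0 := C_neq0_snd z Hz). apply ex_Cder_minus.
    + apply (qser_hol a A m F Ha HF z Hz).
    + apply ex_Cder_mult; [apply ex_Cder_mult; [apply ex_Cder_const|]|].
      * apply (ex_Cder_inv (fun z => cpown (RtoC sM * z)%C k)).
        apply ex_Cder_cpown, ex_Cder_mult; [apply ex_Cder_const|apply ex_Cder_id].
        apply cpown_neq0, Cmult_neq_0; auto. apply RtoC_neq. lra.
      * apply (ex_Cder_comp G (fun z => - / (RtoC M * z))%C). apply (qser_hol b A m G Hb HG). apply snd_neg_inv; auto.
        destruct (ex_Cder_mult (fun _ => (-1)%C) (fun z => / (RtoC M * z))%C z) as [l Hl].
        apply ex_Cder_const. apply (ex_Cder_inv (fun z => RtoC M * z)%C). apply ex_Cder_mult; [apply ex_Cder_const|apply ex_Cder_id].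
        apply Cmult_neq_0; auto. apply RtoC_neq; lra.
        exists l. eapply Cder_ext; [|exact Hl]. intros x; simpl. ring.
  - clear z Hz. intros y Hy. set (t := ln (sM * y)).
    assert (Hsy : 0 < sM * y) by (apply Rmult_lt_0_compat; auto).
    assert (T := fe_real t). unfold PP, t in T. rewrite exp_Ropp exp_ln // in T.
    replace (sM * y / sM) with y in T by (field; lra).
    rewrite T.
    replace (- / (RtoC M * (0, y)))%C with ((0, / (sM * y) / sM) : C).
    2:{ rewrite -Hs2. unfold Copp, Cinv, Cmult, RtoC; simpl. f_equal; field; lra. }
    (* On the axis z = iy the power (sM z)^(-k) contains i^(-k), and the factor [cpown Ci k]
       compensates it. *)
    replace (cexp (RtoC (- INR k) * RtoC (ln (sM * y)))) with (cpown Ci k * / cpown (RtoC sM * (0, y)) k)%C.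
    { ring. }
    replace (RtoC sM * (0, y))%C with (Ci * RtoC (sM * y))%C by (unfold Cmult, RtoC, Ci; simpl; f_equal; ring).
    rewrite cpown_mult cpown_RtoC -RtoC_mult cexp_R.
    replace (- INR k * ln (sM * y)) with (- (INR k * ln (sM * y))) by ring. rewrite exp_Ropp -exp_pow exp_ln //.
    assert (Hp : 0 < (sM * y) ^ k) by (apply pow_lt; auto).
    rewrite RtoC_inv; [|lra]. field. split; [apply RtoC_neq; lra|]. apply cpown_neq0. intros E. injection E. lra.
Qed.
End FuncEq.
End HeckeFunctionalEquation.

(** * The relation between additive translates and slashes of f, for each modulus q *)

Module RamanujanTwists.
From Corelib Require Import ssreflect.
From Stdlib Require Import Reals Lra Lia ClassicalEpsilon List ZArith.
From Coquelicot Require Import Coquelicot.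
Require Import Defs.
Import ComplexIntegral ComplexDerivative MaximumModulus ComplexExponential PhragmenLindelof MellinUniqueness QSeries GammaMellin HeckeFunctionalEquation.
Open Scope R_scope.

(** The slash operator for real entries, meant for determinant 1: the relation involves matrices
    with an entry 1/q. *)
Definition slR (k : nat) (a b c d : R) (h : C -> C) (z : C) : C :=
  (/ cpown (RtoC c * z + RtoC d) k * h ((RtoC a * z + RtoC b) / (RtoC c * z + RtoC d)))%C.

Definition lsum (l : list nat) (t : nat -> C) : C := fold_right Cplus 0%C (map t l).

Lemma lsum_Cmult c l t : (c * lsum l t)%C = lsum l (fun a => c * t a)%C.
Proof. induction l as [|x l IH]; unfold lsum in *; simpl; [ring|rewrite -IH; ring]. Qed.
Lemma lsum_ext l t u : (forall a, In a l -> t a = u a) -> lsum l t = lsum l u.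
Proof. intros H. unfold lsum. f_equal. apply map_ext_in, H. Qed.
Lemma lsum_bound l t : (forall a, Cmod (t a) <= 1) -> Cmod (lsum l t) <= INR (length l).
Proof.
  intros H. induction l as [|x l IH]; [unfold lsum; simpl; rewrite Cmod_0; lra|].
  replace (length (x :: l)) with (S (length l)) by auto. rewrite S_INR. unfold lsum in *; simpl.
  eapply Rle_trans; [apply Cmod_triangle|]. specialize (H x). lra.
Qed.
Lemma csum_zero : csum (fun _ => 0%C) 0%C.
Proof.
  intros eps He. exists O. intros n _. replace (psum (fun _ => RtoC 0) n) with (RtoC 0).
  replace (0 - 0)%C with (RtoC 0) by ring. rewrite Cmod_0; lra. induction n as [|n IH]; simpl; [auto|rewrite -IH; ring].
Qed.

Lemma e_plus z w : e_ (z + w)%C = (e_ z * e_ w)%C.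
Proof. unfold e_. rewrite -cexp_plus. f_equal. ring. Qed.
Lemma e_nat n : e_ (RtoC (INR n)) = 1%C.
Proof.
  unfold e_. replace (2 * PI * Ci * INR n)%C with (INR n * (2 * PI * Ci))%C by ring. rewrite cexp_nat.
  replace (cexp (2 * PI * Ci)%C) with (RtoC 1).
  - induction n as [|n IH]; simpl; [auto|rewrite IH; ring].
  - unfold cexp, Cmult, RtoC, Ci; simpl.
    replace ((2 * PI - 0 * 0) * 0 - (2 * 0 + 0 * PI) * 1) with 0 by ring.
    replace ((2 * PI - 0 * 0) * 1 + (2 * 0 + 0 * PI) * 0) with (2 * PI) by ring.
    rewrite exp_0 cos_2PI sin_2PI. f_equal; ring.
Qed.

(** Multiplying the n-th coefficient by e(an/q) translates the function by a/q; the Ramanujan sum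
    therefore gives the sum of all these translates. *)
Lemma csum_shift u H l q z : (forall z, 0 < snd z -> csum (qterm u z) (H z)) -> 0 < snd z ->
  csum (qterm (fun n => u n * lsum l (fun a => e_ (RtoC (INR a * INR (S n) / INR q))))%C z)
    (lsum l (fun a => H (z + RtoC (INR a / INR q))%C)).
Proof.
  intros HH Hz. induction l as [|x l IH].
  - eapply csum_ext; [|apply csum_zero]. intros n. unfold qterm, lsum; simpl. ring.
  - assert (Hx : csum (qterm u (z + RtoC (INR x / INR q))%C) (H (z + RtoC (INR x / INR q))%C)).
    { apply HH. simpl. lra. }
    unfold lsum in *; cbn [map fold_right]. eapply csum_ext; [|apply csum_plus; [exact Hx|exact IH]].
    intros n. cbv beta. unfold qterm. replace (INR (S n) * (z + RtoC (INR x / INR q)))%C with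
      (INR (S n) * z + RtoC (INR x * INR (S n) / INR q))%C by (unfold Rdiv; rewrite !RtoC_mult; ring).
    rewrite e_plus. ring.
Qed.

Lemma q_periodic u H z : (forall z, 0 < snd z -> csum (qterm u z) (H z)) -> 0 < snd z -> H (z + 1)%C = H z.
Proof.
  intros HH Hz. apply (csum_unique (qterm u z)); [|apply HH; auto].
  assert (Hz1 : 0 < snd (z + 1)%C) by (simpl; lra).
  eapply csum_ext; [|apply (HH _ Hz1)]. intros n. unfold qterm. f_equal.
  replace (INR (S n) * (z + 1))%C with (INR (S n) * z + INR (S n))%C by ring. rewrite e_plus e_nat. ring.
Qed.

Lemma snd_mobius (a b c d : R) (z : C) : a * d - b * c = 1 -> 0 < snd z ->
  (RtoC c * z + RtoC d)%C <> 0%C /\ 0 < snd ((RtoC a * z + RtoC b) / (RtoC c * z + RtoC d))%C.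
Proof.
  intros Hd Hz. destruct z as [x y]; simpl in Hz.
  assert (Hn : 0 < (c * x + d) ^ 2 + (c * y) ^ 2).
  { destruct (Req_dec c 0) as [->|Hc].
    - assert (Hd0 : d <> 0) by (intros ->; lra). assert (H := Rlt_0_sqr d Hd0). unfold Rsqr in H. nra.
    - assert (Hc0 : c * y <> 0) by (apply Rmult_integral_contrapositive; split; lra).
      assert (H := Rlt_0_sqr _ Hc0). unfold Rsqr in H. assert (H1 := Rle_0_sqr (c * x + d)). unfold Rsqr in H1. nra. }
  split.
  - intros E. unfold Cmult, Cplus, RtoC in E; simpl in E. injection E. intros E1 E2.
    replace (c * x - 0 * y + d) with (c * x + d) in E2 by ring. replace (c * y + 0 * x + 0) with (c * y) in E1 by ring. rewrite E1 E2 in Hn. lra.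
  - unfold Cdiv, Cinv, Cmult, Cplus, RtoC; cbn [fst snd].
    set (D := (c * x - 0 * y + d) ^ 2 + (c * y + 0 * x + 0) ^ 2).
    assert (HD : D = (c * x + d) ^ 2 + (c * y) ^ 2) by (unfold D; ring).
    replace ((a * x - 0 * y + b) * (- (c * y + 0 * x + 0) / D) + (a * y + 0 * x + 0) * ((c * x - 0 * y + d) / D))
      with ((a * d - b * c) * y / D) by (rewrite HD; field; rewrite -HD; rewrite HD; lra).
    rewrite Hd HD. apply Rdiv_lt_0_compat; lra.
Qed.

Lemma Ci2 k : (cpown Ci k * cpown Ci k)%C = cpown (-1)%C k.
Proof. rewrite -cpown_mult. f_equal. unfold Cmult, Ci, RtoC, Copp; simpl. f_equal; ring. Qed.
Section Analytic.
Variables (N : nat) (xi : Z -> C) (k : nat) (fc gc : nat -> C) (sigma : R) (f : C -> C).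
Hypothesis HN : (0 < N)%nat.
Hypothesis xi1 : xi 1%Z = 1%C.
Hypothesis bnd : exists B : R, forall n : nat, (1 <= n)%nat ->
     Cmod (fc n) <= B * Rpower (INR n) sigma /\ Cmod (gc n) <= B * Rpower (INR n) sigma.
Hypothesis Hq : forall q : nat, (1 <= q)%nat -> Nat.gcd q N = 1%nat ->
     exists LF LG : C -> C,
       entire LF /\ finite_order LF /\ entire LG /\ finite_order LG /\
       (forall s : C, sigma + 1 - (INR k - 1) / 2 < Re s ->
          Lambda_series k fc q s (LF s) /\ Lambda_series k gc q s (LG s)) /\
       (forall s : C,
          LF s = (cpown Ci k * xi (Z.of_nat q)
                  * cpowR (INR (N * q * q)) (RtoC (1 / 2) - s) * LG (1 - s))%C).
Hypothesis Hf : forall z : C, in_H z ->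
     is_series (K := R_AbsRing) (V := C_R_NormedModule)
       (fun n => (fc (S n) * e_ (INR (S n) * z)))%C (f z).

Let fS n := fc (S n).
Let gS n := gc (S n).
(** The index list of [ramanujan]; for q = 1 it is the single residue 0, which makes the case q = 1
    the untwisted one. *)
Definition units (q : nat) := filter (fun a => Nat.eqb (Nat.gcd a q) 1) (seq 0 q).

Lemma an_polybd : exists B m, polybd fS B m /\ polybd gS B m /\ sigma <= INR m.
Proof.
  destruct bnd as [B HB]. destruct (INR_unbounded sigma) as [m Hm].
  assert (HB0 : 0 <= B).
  { destruct (HB 1%nat (le_n _)) as [H _]. simpl in H. unfold Rpower in H. rewrite ln_1 Rmult_0_r exp_0 in H.
    assert (H0 := Cmod_ge_0 (fc 1%nat)). lra. }
  assert (HR : forall n, Rpower (INR (S n)) sigma <= INR (S n) ^ m).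
  { intros n. rewrite -Rpower_pow; [|apply S_pos]. assert (H1 := S_ge1 n).
    unfold Rpower. apply exp_le. apply Rmult_le_compat_r; [|lra]. rewrite -ln_1. destruct H1 as [H1|<-]; [left; apply ln_increasing; lra|lra]. }
  exists B, m. repeat split; auto; try lra.
  - intros n. eapply Rle_trans; [apply (HB (S n)); lia|]. apply Rmult_le_compat_l; auto.
  - intros n. eapply Rle_trans; [apply (HB (S n)); lia|]. apply Rmult_le_compat_l; auto.
Qed.

Lemma an_f z : 0 < snd z -> csum (qterm fS z) (f z).
Proof. intros Hz. apply csum_is_series. apply Hf. exact Hz. Qed.

(** The theorem gives only the coefficients of g; its value is picked as the sum of its q-series,
    which converges by [qser_ex]. *)
Definition gfun (z : C) : C := epsilon (inhabits (RtoC 0)) (fun l => csum (qterm gS z) l).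
Lemma an_g z : 0 < snd z -> csum (qterm gS z) (gfun z).
Proof.
  intros Hz. destruct an_polybd as [B [m [_ [Hg _]]]]. apply (epsilon_spec (inhabits (RtoC 0)) (fun l => csum (qterm gS z) l)). apply (qser_ex gS B m z Hg Hz).
Qed.

Lemma polybd_ram u B m q : polybd u B m -> polybd (fun n => u n * ramanujan q (S n))%C (B * INR (length (units q))) m.
Proof.
  intros [HB Hu]. split; [apply Rmult_le_pos; auto; apply pos_INR|]. intros n. rewrite Cmod_mult.
  replace (B * INR (length (units q)) * INR (S n) ^ m) with (B * INR (S n) ^ m * INR (length (units q))) by ring.
  apply Rmult_le_compat; try apply Cmod_ge_0; auto. apply lsum_bound. intros a. rewrite Cmod_e_. simpl. rewrite Rmult_0_r exp_0. lra.
Qed.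

(** [func_eq] with M = N q^2 and c = i^k xi(q); its own factor i^k completes the sign to (-1)^k.
    Since [sigma <= INR m], the half-plane Re w > m + 2 lies inside the one where the Dirichlet
    series are given. *)
Lemma an_fe q (z : C) : (1 <= q)%nat -> Nat.gcd q N = 1%nat -> 0 < snd z ->
  lsum (units q) (fun a => f (z + RtoC (INR a / INR q))%C) =
  (xi (Z.of_nat q) * cpown (-1) k * / cpown (RtoC (sqrt (INR (N * q * q))) * z) k *
    lsum (units q) (fun a => gfun (- / (RtoC (INR (N * q * q)) * z) + RtoC (INR a / INR q))))%C.
Proof.
  intros Hq1 Hgcd Hz. destruct (Hq q Hq1 Hgcd) as [LF [LG [H1 [H2 [H3 [H4 [H5 H6]]]]]]].
  destruct an_polybd as [B [m [Hfb [Hgb Hm]]]].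
  assert (HM : 0 < INR (N * q * q)) by (apply lt_0_INR; nia).
  rewrite (func_eq k (fun n => fS n * ramanujan q (S n))%C (fun n => gS n * ramanujan q (S n))%C (B * INR (length (units q))) m
     (INR (N * q * q)) (cpown Ci k * xi (Z.of_nat q))%C (fun z => lsum (units q) (fun a => f (z + RtoC (INR a / INR q))%C))
     (fun z => lsum (units q) (fun a => gfun (z + RtoC (INR a / INR q))%C)) LF LG); auto.
  - rewrite -Ci2. ring.
  - apply polybd_ram; auto.
  - apply polybd_ram; auto.
  - intros w Hw. apply (csum_shift fS f (units q) q w an_f Hw).
  - intros w Hw. apply (csum_shift gS gfun (units q) q w an_g Hw).
  - intros w Hw. destruct (H5 (w - RtoC ((INR k - 1) / 2))%C) as [[D [HD1 HD2]] _].
    { unfold Re. rewrite plus_INR in Hw. simpl in *. lra. }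
    assert (E : forall x : C, (x - RtoC ((INR k - 1) / 2) + RtoC ((INR k - 1) / 2))%C = x) by (intros; ring). rewrite E in HD1 HD2.
    exists D. split; [apply csum_is_series; exact HD1|exact HD2].
  - intros w Hw. destruct (H5 (w - RtoC ((INR k - 1) / 2))%C) as [_ [D [HD1 HD2]]].
    { unfold Re. rewrite plus_INR in Hw. simpl in *. lra. }
    assert (E : forall x : C, (x - RtoC ((INR k - 1) / 2) + RtoC ((INR k - 1) / 2))%C = x) by (intros; ring). rewrite E in HD1 HD2.
    exists D. split; [apply csum_is_series; exact HD1|exact HD2].
Qed.

Lemma an_period_f (z : C) : 0 < snd z -> f (z + 1)%C = f z.
Proof. apply (q_periodic fS f z an_f). Qed.
Lemma an_period_g (z : C) : 0 < snd z -> gfun (z + 1)%C = gfun z.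
Proof. apply (q_periodic gS gfun z an_g). Qed.
Lemma an_hol (z : C) : 0 < snd z -> exists l, Cder f z l.
Proof. destruct an_polybd as [B [m [Hfb [Hgb Hm]]]]. apply (qser_hol fS B m f Hfb an_f). Qed.

Lemma an_fe1 (z : C) : 0 < snd z ->
  f z = (cpown (-1) k * / cpown (RtoC (sqrt (INR N)) * z) k * gfun (- / (RtoC (INR N) * z)))%C.
Proof.
  intros Hz. assert (H := an_fe 1 z (le_n _) (eq_refl _) Hz).
  rewrite !Nat.mul_1_r in H. unfold lsum, units in H. simpl in H. rewrite xi1 in H.
  replace (z + RtoC (0 / 1))%C with z in H by (replace (0 / 1) with 0 by field; ring).
  replace (- / (INR N * z) + RtoC (0 / 1))%C with (- / (INR N * z))%C in H by (replace (0 / 1) with 0 by field; ring).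
  replace (f z) with (f z + 0)%C by ring. rewrite H. ring.
Qed.

Lemma INRN_pos : 0 < INR N. Proof. apply lt_0_INR; auto. Qed.
Lemma sN_sq : (RtoC (sqrt (INR N)) * RtoC (sqrt (INR N)))%C = RtoC (INR N).
Proof. rewrite -RtoC_mult sqrt_sqrt //. apply Rlt_le, INRN_pos. Qed.
Lemma sN_neq : RtoC (sqrt (INR N)) <> 0%C.
Proof. apply RtoC_neq. apply Rgt_not_eq, sqrt_lt_R0, INRN_pos. Qed.

Lemma an_g_f (w : C) : 0 < snd w -> gfun w = (/ cpown (RtoC (sqrt (INR N)) * w) k * f (- / (RtoC (INR N) * w)))%C.
Proof.
  intros Hw. assert (HNp := INRN_pos).
  assert (Hz := snd_neg_inv (INR N) w HNp Hw). rewrite (an_fe1 _ Hz).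
  assert (Hw0 := C_neq0_snd w Hw). assert (HN0 : RtoC (INR N) <> 0%C) by (apply RtoC_neq; lra). assert (Hs := sN_neq).
  replace (- / (INR N * - / (INR N * w)))%C with w by (field; auto).
  replace (RtoC (sqrt (INR N)) * - / (INR N * w))%C with ((-1) * / (RtoC (sqrt (INR N)) * w))%C.
  2:{ rewrite -sN_sq. field. auto. }
  rewrite (cpown_mult (-1)%C) cpown_inv; [|apply Cmult_neq_0; auto].
  assert (H1 : cpown (-1)%C k <> 0%C) by (apply cpown_neq0; apply RtoC_neq; lra).
  field. split; auto. apply cpown_neq0, Cmult_neq_0; auto.
Qed.

(** The Fricke involution conjugates the translation z -> z + 1 into U, so the periodicity of g
    becomes the invariance of f. *)
Lemma an_U (z : C) : 0 < snd z -> slR k 1 0 (INR N) 1 f z = f z.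
Proof.
  intros Hz. unfold slR. assert (HNp := INRN_pos).
  destruct (snd_mobius 1 0 (INR N) 1 z ltac:(ring) Hz) as [Hd Hz'].
  assert (Hz0 := C_neq0_snd z Hz). assert (HN0 : RtoC (INR N) <> 0%C) by (apply RtoC_neq; lra). assert (Hs := sN_neq).
  rewrite (an_fe1 _ Hz') (an_fe1 _ Hz).
  replace ((1 * z + 0) / (INR N * z + 1))%C with (z / (INR N * z + 1))%C by (field; auto).
  rewrite -(an_period_g (- / (INR N * (z / (INR N * z + 1))))%C).
  2:{ replace (z / (INR N * z + 1))%C with ((1 * z + 0) / (INR N * z + 1))%C by (field; auto). apply snd_neg_inv; auto. }
  replace (- / (INR N * (z / (INR N * z + 1))) + 1)%C with (- / (INR N * z))%C.
  2:{ field. repeat split; auto. }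
  unfold Cdiv. rewrite !cpown_mult cpown_inv //. field. repeat split; apply cpown_neq0; auto.
Qed.

(** Insert [an_g_f] into [an_fe]: for w = -1/(N q^2 z) + a/q one has -1/(N w) = q z / (- a N z +
    1/q), which is the action of (q 0; -aN 1/q), and the automorphy factors combine accordingly. *)
Theorem an_rel q (z : C) : (1 <= q)%nat -> Nat.gcd q N = 1%nat -> 0 < snd z ->
  lsum (units q) (fun a => f (z + RtoC (INR a / INR q))%C) =
  (xi (Z.of_nat q) * lsum (units q) (fun a => slR k (INR q) 0 (- INR a * INR N) (/ INR q) f z))%C.
Proof.
  intros Hq1 Hgcd Hz. rewrite (an_fe q z Hq1 Hgcd Hz). rewrite -!Cmult_assoc. f_equal. rewrite !lsum_Cmult.
  apply lsum_ext. intros a _. assert (HNp := INRN_pos).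
  assert (Hqp : 0 < INR q) by (apply lt_0_INR; lia).
  assert (HM : 0 < INR (N * q * q)) by (apply lt_0_INR; nia).
  assert (Hw : 0 < snd (- / (INR (N * q * q) * z) + RtoC (INR a / INR q))%C).
  { assert (H := snd_neg_inv _ z HM Hz). set (u := (- / (INR (N * q * q) * z))%C) in *. clearbody u. destruct u; simpl in *. lra. }
  rewrite (an_g_f _ Hw). unfold slR.
  assert (Hz0 := C_neq0_snd z Hz). assert (HN0 : RtoC (INR N) <> 0%C) by (apply RtoC_neq; lra). assert (Hs := sN_neq).
  assert (Hq0 : RtoC (INR q) <> 0%C) by (apply RtoC_neq; lra).
  destruct (snd_mobius (INR q) 0 (- INR a * INR N) (/ INR q) z ltac:(field; lra) Hz) as [Hd Hz'].
  assert (HMc : RtoC (INR (N * q * q)) = (INR N * INR q * INR q)%C) by (rewrite !mult_INR !RtoC_mult; auto).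
  assert (Hsq : RtoC (sqrt (INR (N * q * q))) = (RtoC (sqrt (INR N)) * INR q)%C).
  { rewrite -RtoC_mult. f_equal. rewrite !mult_INR. replace (INR N * INR q * INR q) with (INR N * (INR q * INR q)) by ring.
    rewrite sqrt_mult; [|lra|nra]. rewrite sqrt_square //. lra. }
  assert (Hw0 := C_neq0_snd _ Hw).
  rewrite HMc Hsq. rewrite HMc in Hw0. clear Hsq HM Hw.
  assert (E1 : (- / (INR N * INR q * INR q * z) + RtoC (INR a / INR q))%C =
     (- (RtoC (- INR a * INR N) * z + RtoC (/ INR q)) / (INR N * INR q * z))%C).
  { unfold Rdiv. rewrite !RtoC_mult RtoC_opp RtoC_inv; [|lra]. field. auto. }
  rewrite E1. rewrite E1 in Hw0. set (D := (RtoC (- INR a * INR N) * z + RtoC (/ INR q))%C) in *.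
  replace (- / (INR N * (- D / (INR N * INR q * z))))%C with ((INR q * z + 0) / D)%C by (field; repeat split; auto).
  assert (E2 : (cpown (RtoC (sqrt (INR N)) * INR q * z) k * cpown (RtoC (sqrt (INR N)) * (- D / (INR N * INR q * z))) k)%C = (cpown (-1) k * cpown D k)%C).
  { rewrite -!cpown_mult. f_equal. rewrite -sN_sq. field. repeat split; auto. }
  assert (E3 : cpown (RtoC (sqrt (INR N)) * INR q * z)%C k <> 0%C) by (apply cpown_neq0; repeat apply Cmult_neq_0; auto).
  assert (E4 : cpown (RtoC (sqrt (INR N)) * (- D / (INR N * INR q * z)))%C k <> 0%C) by (apply cpown_neq0, Cmult_neq_0; auto).
  assert (E5 : cpown D k <> 0%C) by (apply cpown_neq0; auto).
  assert (E6 : cpown (-1)%C k <> 0%C) by (apply cpown_neq0; apply RtoC_neq; lra).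
  set (X1 := cpown (RtoC (sqrt (INR N)) * INR q * z)%C k) in *.
  set (X2 := cpown (RtoC (sqrt (INR N)) * (- D / (INR N * INR q * z)))%C k) in *.
  set (XD := cpown D k) in *. set (s := cpown (-1)%C k) in *.
  transitivity (s * / (X1 * X2) * f ((INR q * z + 0) / D))%C; [field; auto|rewrite E2; field; auto].
Qed.
End Analytic.
End RamanujanTwists.

(** * The right action of SL_2(R) on functions, Gamma0(N) inside it, and integrality of
    conjugates *)

Module SLAction.
From Corelib Require Import ssreflect.
From Stdlib Require Import Reals Lra Lia ZArith Znumtheory List FunctionalExtensionality ProofIrrelevance.
From Coquelicot Require Import Coquelicot.
Require Import Defs.
Import ComplexIntegral ComplexDerivative MaximumModulus ComplexExponential PhragmenLindelof MellinUniqueness QSeries GammaMellin HeckeFunctionalEquation RamanujanTwists.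
Open Scope R_scope.

Lemma cpown_1 n : cpown 1%C n = 1%C.
Proof. induction n as [|n IH]; simpl; [auto|rewrite IH; ring]. Qed.

Definition det1 (m : R * R * R * R) : Prop := let '(a, b, c, d) := m in a * d - b * c = 1.
(** SL_2(R) as a type: with proof irrelevance, elements are equal as soon as their entries are, and
    the group laws hold as equalities. *)
Definition SL := {m : R * R * R * R | det1 m}.
Definition ea (g : SL) := fst (fst (fst (proj1_sig g))).
Definition eb (g : SL) := snd (fst (fst (proj1_sig g))).
Definition ec (g : SL) := snd (fst (proj1_sig g)).
Definition ed (g : SL) := snd (proj1_sig g).
Definition mkSL a b c d (H : a * d - b * c = 1) : SL := exist det1 (a, b, c, d) H.
Lemma SL_det g : ea g * ed g - eb g * ec g = 1.
Proof. destruct g as [[[[a b] c] d] H]. exact H. Qed.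
Lemma SL_eq g h : ea g = ea h -> eb g = eb h -> ec g = ec h -> ed g = ed h -> g = h.
Proof.
  destruct g as [[[[a b] c] d] H], h as [[[[a' b'] c'] d'] H']. unfold ea, eb, ec, ed; simpl.
  intros -> -> -> ->. f_equal. apply proof_irrelevance.
Qed.
Definition SLone : SL := mkSL 1 0 0 1 ltac:(ring).
Lemma SLmul_det g h : (ea g * ea h + eb g * ec h) * (ec g * eb h + ed g * ed h)
  - (ea g * eb h + eb g * ed h) * (ec g * ea h + ed g * ec h) = 1.
Proof. rewrite -[RHS]Rmult_1_r -{1}(SL_det g) -(SL_det h). ring. Qed.
Definition SLmul (g h : SL) : SL := mkSL _ _ _ _ (SLmul_det g h).
Lemma SLinv_det g : ed g * ea g - (- eb g) * (- ec g) = 1.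
Proof. rewrite -(SL_det g). ring. Qed.
Definition SLinv (g : SL) : SL := mkSL _ _ _ _ (SLinv_det g).
Lemma SLmulA g h j : SLmul g (SLmul h j) = SLmul (SLmul g h) j.
Proof. apply SL_eq; cbn; ring. Qed.
Lemma SLmul1g g : SLmul SLone g = g.
Proof. destruct g as [[[[a b] c] d] H]. apply SL_eq; cbn; ring. Qed.
Lemma SLmulg1 g : SLmul g SLone = g.
Proof. destruct g as [[[[a b] c] d] H]. apply SL_eq; cbn; ring. Qed.
Lemma SLmulVg g : SLmul (SLinv g) g = SLone.
Proof.
  destruct g as [[[[a b] c] d] H]. simpl in H. apply SL_eq; cbn; lra.
Qed.
Lemma SLmulgV g : SLmul g (SLinv g) = SLone.
Proof.
  destruct g as [[[[a b] c] d] H]. simpl in H. apply SL_eq; cbn; lra.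
Qed.

Definition Hp := {z : C | 0 < snd z}.
Definition hz (z : Hp) : C := proj1_sig z.
Lemma Hp_eq (z w : Hp) : hz z = hz w -> z = w.
Proof. destruct z as [z Hz], w as [w Hw]. unfold hz; simpl. intros ->. f_equal. apply proof_irrelevance. Qed.
Definition jac (g : SL) (z : C) : C := (RtoC (ec g) * z + RtoC (ed g))%C.
Definition mob0 (g : SL) (z : C) : C := ((RtoC (ea g) * z + RtoC (eb g)) / jac g z)%C.
Lemma jac_neq0 g (z : Hp) : jac g (hz z) <> 0%C.
Proof. destruct z as [z Hz]. apply (proj1 (snd_mobius _ _ _ _ z (SL_det g) Hz)). Qed.
Lemma mob_pos g (z : Hp) : 0 < snd (mob0 g (hz z)).
Proof. destruct z as [z Hz]. apply (proj2 (snd_mobius _ _ _ _ z (SL_det g) Hz)). Qed.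
Definition mob (g : SL) (z : Hp) : Hp := exist _ _ (mob_pos g z).

(** Functions on the half-plane itself: no junk values outside it, so the action laws are plain
    equalities of functions. *)
Definition VV := Hp -> C.
Definition vadd (u v : VV) : VV := fun z => (u z + v z)%C.
Definition vopp (u : VV) : VV := fun z => (- u z)%C.
Definition vzero : VV := fun _ => 0%C.
Definition vscal (c : C) (u : VV) : VV := fun z => (c * u z)%C.
Definition actv (k : nat) (v : VV) (g : SL) : VV := fun z => (/ cpown (jac g (hz z)) k * v (mob g z))%C.
Definition rest (f : C -> C) : VV := fun z => f (hz z).

Ltac vext := apply functional_extensionality; intros ?; unfold vadd, vopp, vzero, vscal; cbv beta.
Lemma vaddA u v w : vadd u (vadd v w) = vadd (vadd u v) w. Proof. vext; ring. Qed.
Lemma vaddC u v : vadd u v = vadd v u. Proof. vext; ring. Qed.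
Lemma vadd0 u : vadd vzero u = u. Proof. vext; ring. Qed.
Lemma vaddN u : vadd (vopp u) u = vzero. Proof. vext; ring. Qed.
Lemma actvD k u v g : actv k (vadd u v) g = vadd (actv k u g) (actv k v g).
Proof. vext. unfold actv, vadd. ring. Qed.
Lemma actv_scal k c u g : actv k (vscal c u) g = vscal c (actv k u g).
Proof. vext. unfold actv. ring. Qed.
Lemma vscalD c u v : vscal c (vadd u v) = vadd (vscal c u) (vscal c v). Proof. vext; ring. Qed.
Lemma jac_mul g h (z : Hp) : jac (SLmul g h) (hz z) = (jac g (hz (mob h z)) * jac h (hz z))%C.
Proof.
  assert (Hn := jac_neq0 h z). change (hz (mob h z)) with (mob0 h (hz z)). unfold mob0.
  unfold jac in *. unfold SLmul, mkSL. cbn -[ea eb ec ed RtoC Cmult Cplus].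
  unfold ea at 1, ec at 1, ed at 1; cbn -[ea eb ec ed RtoC Cmult Cplus].
  rewrite !RtoC_plus !RtoC_mult. field. exact Hn.
Qed.
Lemma mob_mul g h (z : Hp) : mob (SLmul g h) z = mob g (mob h z).
Proof.
  apply Hp_eq. change (mob0 (SLmul g h) (hz z) = mob0 g (mob0 h (hz z))).
  assert (H1 := jac_neq0 (SLmul g h) z). assert (H2 := jac_neq0 h z). assert (H3 := jac_neq0 g (mob h z)).
  change (hz (mob h z)) with (mob0 h (hz z)) in H3.
  rewrite (jac_mul g h z) in H1. change (hz (mob h z)) with (mob0 h (hz z)) in H1.
  set (X := (RtoC (ea h) * hz z + RtoC (eb h))%C).
  assert (E : mob0 (SLmul g h) (hz z) = ((RtoC (ea g) * X + RtoC (eb g) * jac h (hz z)) / (jac g (mob0 h (hz z)) * jac h (hz z)))%C).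
  { unfold mob0 at 1. rewrite (jac_mul g h z). change (hz (mob h z)) with (mob0 h (hz z)). f_equal.
    unfold X, jac. change (ea (SLmul g h)) with (ea g * ea h + eb g * ec h). change (eb (SLmul g h)) with (ea g * eb h + eb g * ed h).
    rewrite !RtoC_plus !RtoC_mult. ring. }
  rewrite E. unfold mob0 at 2. change (mob0 h (hz z)) with (X / jac h (hz z))%C.
  change (mob0 h (hz z)) with (X / jac h (hz z))%C in H3.
  field. split; auto.
Qed.
Lemma actvM k v g h : actv k v (SLmul g h) = actv k (actv k v g) h.
Proof.
  apply functional_extensionality; intros z. unfold actv. rewrite jac_mul mob_mul cpown_mult.
  assert (H2 := jac_neq0 h z). assert (H3 := jac_neq0 g (mob h z)).
  field. split; apply cpown_neq0; auto.
Qed.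
Lemma actv1 k v : actv k v SLone = v.
Proof.
  apply functional_extensionality; intros z. unfold actv.
  assert (E : jac SLone (hz z) = 1%C) by (unfold jac; cbn -[RtoC Cmult Cplus]; ring).
  replace (mob SLone z) with z.
  - rewrite E. replace (cpown 1%C k) with (RtoC 1); [field|]. induction k as [|k IH]; simpl; [auto|rewrite -IH; ring].
  - apply Hp_eq. change (hz z = mob0 SLone (hz z)). unfold mob0. rewrite E. cbn -[RtoC Cmult Cplus Cdiv]. field.
Qed.

Lemma ofZ_det (g : mat2) : SL2Z g -> IZR (m_a g) * IZR (m_d g) - IZR (m_b g) * IZR (m_c g) = 1.
Proof. intros H. rewrite -!mult_IZR -minus_IZR. rewrite H. reflexivity. Qed.
Definition ofZ g (H : SL2Z g) : SL := mkSL _ _ _ _ (ofZ_det g H).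
Lemma slash_actv k g (H : SL2Z g) f (z : Hp) : slash k g f (hz z) = actv k (rest f) (ofZ g H) z.
Proof. reflexivity. Qed.

Definition Tr (x : R) : SL := mkSL 1 x 0 1 ltac:(ring).
Definition Lo (x : R) : SL := mkSL 1 0 x 1 ltac:(ring).
Lemma Tr_mul x y : SLmul (Tr x) (Tr y) = Tr (x + y). Proof. apply SL_eq; cbn; ring. Qed.
Lemma Lo_mul x y : SLmul (Lo x) (Lo y) = Lo (x + y). Proof. apply SL_eq; cbn; ring. Qed.
Lemma Di_det (p : R) : p <> 0 -> p * / p - 0 * 0 = 1. Proof. intros; field; auto. Qed.
Definition Di (p : R) (H : p <> 0) : SL := mkSL _ _ _ _ (Di_det p H).

(** Gamma0(N) as a predicate on SL_2(R), because the coset representatives T^(i/p) and diag(p, 1/p)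
    are not integral. *)
Definition GamN (N : nat) (g : SL) : Prop := exists a b c d : Z,
  ea g = IZR a /\ eb g = IZR b /\ ec g = IZR c /\ ed g = IZR d /\ (Z.of_nat N | c)%Z.
Lemma GamN_1 N : GamN N SLone.
Proof. exists 1%Z, 0%Z, 0%Z, 1%Z. repeat split; auto. apply Z.divide_0_r. Qed.
Lemma GamN_M N g h : GamN N g -> GamN N h -> GamN N (SLmul g h).
Proof.
  intros [a [b [c [d [E1 [E2 [E3 [E4 H]]]]]]]] [a' [b' [c' [d' [F1 [F2 [F3 [F4 H']]]]]]]].
  exists (a * a' + b * c')%Z, (a * b' + b * d')%Z, (c * a' + d * c')%Z, (c * b' + d * d')%Z.
  rewrite !plus_IZR !mult_IZR -E1 -E2 -E3 -E4 -F1 -F2 -F3 -F4. repeat split; auto.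
  apply Z.divide_add_r; [apply Z.divide_mul_l; auto|apply Z.divide_mul_r; auto].
Qed.
Lemma GamN_V N g : GamN N g -> GamN N (SLinv g).
Proof.
  intros [a [b [c [d [E1 [E2 [E3 [E4 H]]]]]]]]. exists d, (- b)%Z, (- c)%Z, a.
  rewrite !opp_IZR -E1 -E2 -E3 -E4. repeat split; auto. apply Z.divide_opp_r; auto.
Qed.
Lemma GamN_ofZ N g (H : SL2Z g) : (Z.of_nat N | m_c g)%Z -> GamN N (ofZ g H).
Proof. intros Hc. exists (m_a g), (m_b g), (m_c g), (m_d g). repeat split; auto. Qed.
Lemma GamN_Z N g : GamN N g -> exists m (H : SL2Z m), (Z.of_nat N | m_c m)%Z /\ g = ofZ m H.
Proof.
  intros [a [b [c [d [E1 [E2 [E3 [E4 Hc]]]]]]]].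
  assert (H : SL2Z (a, b, c, d)).
  { unfold SL2Z; simpl. apply eq_IZR. rewrite minus_IZR !mult_IZR -E1 -E2 -E3 -E4. apply SL_det. }
  exists (a, b, c, d), H. split; auto. apply SL_eq; auto.
Qed.

Fixpoint SLpow (g : SL) (n : nat) : SL := match n with O => SLone | S m => SLmul g (SLpow g m) end.
Lemma Tr_pow x n : SLpow (Tr x) n = Tr (INR n * x).
Proof.
  induction n as [|n IH]; [apply SL_eq; cbn; ring|]. cbn [SLpow]. rewrite IH Tr_mul S_INR. f_equal. ring.
Qed.
Lemma Lo_pow x n : SLpow (Lo x) n = Lo (INR n * x).
Proof.
  induction n as [|n IH]; [apply SL_eq; cbn; ring|]. cbn [SLpow]. rewrite IH Lo_mul S_INR. f_equal. ring.
Qed.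

Lemma Zinv_mod u m : (1 < m)%Z -> Z.gcd u m = 1%Z -> exists t, (m | u * t - 1)%Z.
Proof.
  intros Hm Hg. destruct (Z.gcd_bezout u m 1 Hg) as [x [y Hxy]]. exists x. exists (- y)%Z. lia.
Qed.
Lemma Znat_rep t m : (0 < m)%Z -> exists n : nat, (m | Z.of_nat n - t)%Z.
Proof.
  intros Hm. exists (Z.to_nat (t mod m)). rewrite Z2Nat.id; [|apply Z.mod_pos_bound; auto].
  exists (- (t / m))%Z. assert (H := Z.div_mod t m ltac:(lia)). lia.
Qed.
Lemma Zsolve u v m : (1 < m)%Z -> Z.gcd u m = 1%Z -> exists n : nat, (m | Z.of_nat n * u - v)%Z.
Proof.
  intros Hm Hg. destruct (Zinv_mod u m Hm Hg) as [t [x Hx]]. destruct (Znat_rep (t * v) m ltac:(lia)) as [n [y Hy]].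
  exists n. exists (y * u + x * v)%Z. replace (Z.of_nat n) with (t * v + y * m)%Z by lia.
  replace ((t * v + y * m) * u - v)%Z with ((u * t - 1) * v + y * u * m)%Z by ring. rewrite Hx. ring.
Qed.
Lemma Zprime_gcd_sq (P u : Z) : prime P -> ~ (P | u)%Z -> Z.gcd u (P * P) = 1%Z.
Proof.
  intros HP Hu. apply Zgcd_1_rel_prime. apply rel_prime_sym.
  assert (H : rel_prime P u) by (apply prime_rel_prime; auto).
  apply rel_prime_sym. apply rel_prime_mult; apply rel_prime_sym; auto.
Qed.

(* Column operations by T and U bring an element of Gamma0(N) into the principal congruence subgroup mod p^2. *)
Lemma reduce_mod_p2 (N : Z) (P : Z) (a b c d : Z) : prime P -> ~ (P | N)%Z -> (a * d - b * c = 1)%Z ->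
  exists e y x z : nat,
    let b1 := (b + Z.of_nat e * a)%Z in let d1 := (d + Z.of_nat e * c)%Z in
    let a2 := (a + Z.of_nat y * N * b1)%Z in let c2 := (c + Z.of_nat y * N * d1)%Z in
    let b3 := (b1 + Z.of_nat x * a2)%Z in let d3 := (d1 + Z.of_nat x * c2)%Z in
    let a4 := (a2 + Z.of_nat z * N * b3)%Z in let c4 := (c2 + Z.of_nat z * N * d3)%Z in
    (P * P | a4 - 1)%Z /\ (P * P | b3)%Z /\ (P * P | c4)%Z /\ (P * P | d3 - 1)%Z.
Proof.
  intros HP HN Hd. assert (HP1 := prime_ge_2 P HP). assert (Hm : (1 < P * P)%Z) by nia.
  (* [a] and [b] are not both divisible by P because of the determinant, so e = 0 or e = 1 works. *)
  assert (He : exists e : nat, ~ (P | b + Z.of_nat e * a)%Z).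
  { destruct (Zdivide_dec P b) as [Hb|Hb]; [|exists O; simpl; rewrite Z.add_0_r; auto].
    exists 1%nat. intros H. simpl in H. assert (Ha : (P | a)%Z).
    { replace a with (b + 1 * a - b)%Z by ring. apply Z.divide_sub_r; auto. }
    assert (H1 : (P | 1)%Z) by (rewrite -Hd; apply Z.divide_sub_r; [apply Z.divide_mul_l|apply Z.divide_mul_l]; auto).
    apply Z.divide_1_r in H1. lia. }
  destruct He as [e He]. exists e. set (b1 := (b + Z.of_nat e * a)%Z) in *. set (d1 := (d + Z.of_nat e * c)%Z).
  assert (Hd1 : (a * d1 - b1 * c = 1)%Z) by (unfold b1, d1; lia).
  assert (HNb : ~ (P | N * b1)%Z) by (intros H; apply prime_mult in H; auto; tauto).
  destruct (Zsolve (N * b1) (1 - a) (P * P) Hm (Zprime_gcd_sq P _ HP HNb)) as [y [ky Hy]]. exists y.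
  cbv zeta. set (a2 := (a + Z.of_nat y * N * b1)%Z). set (c2 := (c + Z.of_nat y * N * d1)%Z).
  assert (Ha2 : (a2 = 1 + ky * (P * P))%Z) by (unfold a2; lia).
  destruct (Znat_rep (- b1) (P * P) ltac:(lia)) as [x [kx Hx]]. exists x.
  set (b3 := (b1 + Z.of_nat x * a2)%Z). set (d3 := (d1 + Z.of_nat x * c2)%Z).
  assert (Hb3 : (P * P | b3)%Z).
  { exists (kx + Z.of_nat x * ky)%Z. unfold b3. rewrite Ha2. lia. }
  assert (Hd3 : (a2 * d3 - b3 * c2 = 1)%Z) by (unfold a2, b3, c2, d3 in *; nia).
  assert (Hd31 : (P * P | d3 - 1)%Z).
  { destruct Hb3 as [kb Hb3]. exists (kb * c2 - ky * d3)%Z. rewrite Ha2 Hb3 in Hd3. lia. }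
  destruct (Zsolve N (- c2) (P * P) Hm (Zprime_gcd_sq P _ HP HN)) as [z [kz Hz]]. exists z.
  repeat split; auto.
  - replace (a2 + Z.of_nat z * N * b3 - 1)%Z with (ky * (P * P) + Z.of_nat z * N * b3)%Z by lia.
    apply Z.divide_add_r; [apply Z.divide_factor_r|apply Z.divide_mul_r; auto].
  - destruct Hd31 as [kd Hd31]. exists (kz + Z.of_nat z * N * kd)%Z.
    replace d3 with (1 + kd * (P * P))%Z by lia. lia.
Qed.

Lemma prime_rel_prime_sq (N P : Z) : prime N -> prime P -> N <> P -> rel_prime N (P * P).
Proof.
  intros HN HP Hne. assert (H : rel_prime N P).
  { apply prime_rel_prime; auto. intros Hd. assert (H1 := prime_ge_2 N HN). assert (H2 := prime_ge_2 P HP).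
    destruct (prime_divisors P HP N Hd) as [E|[E|[E|E]]]; lia. }
  apply rel_prime_mult; auto.
Qed.

Lemma pq_neq0 p : prime (Z.of_nat p) -> INR p <> 0.
Proof. intros H. apply prime_ge_2 in H. apply not_0_INR. lia. Qed.

(** Conjugation by T^(i/p) adds the multiples i/p of c and of d - a and i^2/p^2 of c; the
    congruences modulo p^2 clear these denominators. *)
Lemma conj_Tr N p (g : SL) (a b c d : Z) i : prime (Z.of_nat p) ->
  ea g = IZR a -> eb g = IZR b -> ec g = IZR c -> ed g = IZR d -> (Z.of_nat N | c)%Z ->
  let q := (Z.of_nat p * Z.of_nat p)%Z in (q | a - 1)%Z -> (q | c)%Z -> (q | d - 1)%Z ->
  GamN N (SLmul (SLmul (Tr (INR i * (1 / INR p))) g) (SLinv (Tr (INR i * (1 / INR p))))).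
Proof.
  intros HP Ea Eb Ec Ed HN q [ka Ha] [kc Hc] [kd Hd]. assert (Hp0 := pq_neq0 p HP).
  exists (a + Z.of_nat i * Z.of_nat p * kc)%Z, (b + Z.of_nat i * Z.of_nat p * (kd - ka) - Z.of_nat i * Z.of_nat i * kc)%Z, c,
    (d - Z.of_nat i * Z.of_nat p * kc)%Z.
  assert (Ra : IZR a = 1 + IZR ka * (INR p * INR p)).
  { replace a with (1 + ka * q)%Z by lia. unfold q. rewrite plus_IZR !mult_IZR -!INR_IZR_INZ. ring. }
  assert (Rc : IZR c = IZR kc * (INR p * INR p)) by (rewrite Hc; unfold q; rewrite !mult_IZR -!INR_IZR_INZ; ring).
  assert (Rd : IZR d = 1 + IZR kd * (INR p * INR p)).
  { replace d with (1 + kd * q)%Z by lia. unfold q. rewrite plus_IZR !mult_IZR -!INR_IZR_INZ. ring. }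
  rewrite !minus_IZR !plus_IZR !mult_IZR !minus_IZR -!INR_IZR_INZ.
  change (ea (SLmul (SLmul (Tr (INR i * (1 / INR p))) g) (SLinv (Tr (INR i * (1 / INR p)))))) with
    ((1 * ea g + INR i * (1 / INR p) * ec g) * 1 + (1 * eb g + INR i * (1 / INR p) * ed g) * - 0).
  change (eb (SLmul (SLmul (Tr (INR i * (1 / INR p))) g) (SLinv (Tr (INR i * (1 / INR p)))))) with
    ((1 * ea g + INR i * (1 / INR p) * ec g) * - (INR i * (1 / INR p)) + (1 * eb g + INR i * (1 / INR p) * ed g) * 1).
  change (ec (SLmul (SLmul (Tr (INR i * (1 / INR p))) g) (SLinv (Tr (INR i * (1 / INR p)))))) with
    ((0 * ea g + 1 * ec g) * 1 + (0 * eb g + 1 * ed g) * - 0).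
  change (ed (SLmul (SLmul (Tr (INR i * (1 / INR p))) g) (SLinv (Tr (INR i * (1 / INR p)))))) with
    ((0 * ea g + 1 * ec g) * - (INR i * (1 / INR p)) + (0 * eb g + 1 * ed g) * 1).
  rewrite Ea Eb Ec Ed. repeat split; auto; rewrite ?Ra ?Rd ?Rc; field; auto.
Qed.

(** Conjugation by diag(p, 1/p) divides the lower-left entry by p^2; divisibility by N survives
    because N is prime to p. *)
Lemma conj_Di N p (g : SL) (a b c d : Z) (H0 : INR p <> 0) : prime (Z.of_nat N) -> prime (Z.of_nat p) -> N <> p ->
  ea g = IZR a -> eb g = IZR b -> ec g = IZR c -> ed g = IZR d -> (Z.of_nat N | c)%Z ->
  (Z.of_nat p * Z.of_nat p | c)%Z ->
  GamN N (SLmul (SLmul (Di (INR p) H0) g) (SLinv (Di (INR p) H0))).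
Proof.
  intros HNp HP Hne Ea Eb Ec Ed HN [kc Hc].
  assert (HNk : (Z.of_nat N | kc)%Z).
  { apply (Gauss _ (Z.of_nat p * Z.of_nat p)). rewrite Z.mul_comm -Hc. exact HN. apply prime_rel_prime_sq; auto. lia. }
  exists a, (Z.of_nat p * Z.of_nat p * b)%Z, kc, d.
  assert (Rc : IZR c = IZR kc * (INR p * INR p)) by (rewrite Hc !mult_IZR -!INR_IZR_INZ; ring).
  rewrite !mult_IZR -!INR_IZR_INZ.
  change (ea (SLmul (SLmul (Di (INR p) H0) g) (SLinv (Di (INR p) H0)))) with
    ((INR p * ea g + 0 * ec g) * / INR p + (INR p * eb g + 0 * ed g) * - 0).
  change (eb (SLmul (SLmul (Di (INR p) H0) g) (SLinv (Di (INR p) H0)))) with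
    ((INR p * ea g + 0 * ec g) * - 0 + (INR p * eb g + 0 * ed g) * INR p).
  change (ec (SLmul (SLmul (Di (INR p) H0) g) (SLinv (Di (INR p) H0)))) with
    ((0 * ea g + / INR p * ec g) * / INR p + (0 * eb g + / INR p * ed g) * - 0).
  change (ed (SLmul (SLmul (Di (INR p) H0) g) (SLinv (Di (INR p) H0)))) with
    ((0 * ea g + / INR p * ec g) * - 0 + (0 * eb g + / INR p * ed g) * INR p).
  rewrite Ea Eb Ec Ed. repeat split; auto; rewrite ?Rc; field; auto.
Qed.

(** Right multiplication by powers of T and U does not change g up to its action on f, and it
    reaches an element whose conjugates by all coset representatives lie in Gamma0(N). *)
Lemma kscale N p (g : SL) (H0 : INR p <> 0) : prime (Z.of_nat N) -> prime (Z.of_nat p) -> N <> p -> GamN N g ->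
  exists e y x z : nat,
    let b := SLmul (SLmul (SLmul (SLmul g (Tr (INR e))) (Lo (INR y * INR N))) (Tr (INR x))) (Lo (INR z * INR N)) in
    (forall i, GamN N (SLmul (SLmul (Tr (INR i * (1 / INR p))) b) (SLinv (Tr (INR i * (1 / INR p)))))) /\
    GamN N (SLmul (SLmul (Di (INR p) H0) b) (SLinv (Di (INR p) H0))).
Proof.
  intros HN HP Hne [a [b [c [d [Ea [Eb [Ec [Ed Hc]]]]]]]].
  assert (HPN : ~ (Z.of_nat p | Z.of_nat N)%Z).
  { intros Hd. assert (H1 := prime_ge_2 _ HP). assert (H2 := prime_ge_2 _ HN).
    destruct (prime_divisors _ HN _ Hd) as [E|[E|[E|E]]]; lia. }
  assert (Hdet : (a * d - b * c = 1)%Z).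
  { apply eq_IZR. rewrite minus_IZR !mult_IZR -Ea -Eb -Ec -Ed. apply SL_det. }
  destruct (reduce_mod_p2 (Z.of_nat N) (Z.of_nat p) a b c d HP HPN Hdet) as [e [y [x [z H]]]].
  exists e, y, x, z. cbv zeta in *.
  set (b1 := (b + Z.of_nat e * a)%Z) in *. set (d1 := (d + Z.of_nat e * c)%Z) in *.
  set (a2 := (a + Z.of_nat y * Z.of_nat N * b1)%Z) in *. set (c2 := (c + Z.of_nat y * Z.of_nat N * d1)%Z) in *.
  set (b3 := (b1 + Z.of_nat x * a2)%Z) in *. set (d3 := (d1 + Z.of_nat x * c2)%Z) in *.
  set (a4 := (a2 + Z.of_nat z * Z.of_nat N * b3)%Z) in *. set (c4 := (c2 + Z.of_nat z * Z.of_nat N * d3)%Z) in *.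
  destruct H as [H1 [H2 [H3 H4]]].
  set (bb := SLmul (SLmul (SLmul (SLmul g (Tr (INR e))) (Lo (INR y * INR N))) (Tr (INR x))) (Lo (INR z * INR N))).
  assert (HNc : (Z.of_nat N | c4)%Z).
  { unfold c4, c2. repeat apply Z.divide_add_r; auto; apply Z.divide_mul_l, Z.divide_factor_r. }
  assert (E : ea bb = IZR a4 /\ eb bb = IZR b3 /\ ec bb = IZR c4 /\ ed bb = IZR d3).
  { unfold a4, c4, b3, d3, a2, c2, b1, d1. repeat rewrite ?plus_IZR ?mult_IZR -?INR_IZR_INZ.
    rewrite -Ea -Eb -Ec -Ed.
    change (ea bb) with ((((ea g * 1 + eb g * 0) * 1 + (ea g * INR e + eb g * 1) * (INR y * INR N)) * 1 + ((ea g * 1 + eb g * 0) * 0 + (ea g * INR e + eb g * 1) * 1) * 0) * 1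
      + (((ea g * 1 + eb g * 0) * 1 + (ea g * INR e + eb g * 1) * (INR y * INR N)) * INR x + ((ea g * 1 + eb g * 0) * 0 + (ea g * INR e + eb g * 1) * 1) * 1) * (INR z * INR N)).
    change (eb bb) with ((((ea g * 1 + eb g * 0) * 1 + (ea g * INR e + eb g * 1) * (INR y * INR N)) * 1 + ((ea g * 1 + eb g * 0) * 0 + (ea g * INR e + eb g * 1) * 1) * 0) * 0
      + (((ea g * 1 + eb g * 0) * 1 + (ea g * INR e + eb g * 1) * (INR y * INR N)) * INR x + ((ea g * 1 + eb g * 0) * 0 + (ea g * INR e + eb g * 1) * 1) * 1) * 1).
    change (ec bb) with ((((ec g * 1 + ed g * 0) * 1 + (ec g * INR e + ed g * 1) * (INR y * INR N)) * 1 + ((ec g * 1 + ed g * 0) * 0 + (ec g * INR e + ed g * 1) * 1) * 0) * 1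
      + (((ec g * 1 + ed g * 0) * 1 + (ec g * INR e + ed g * 1) * (INR y * INR N)) * INR x + ((ec g * 1 + ed g * 0) * 0 + (ec g * INR e + ed g * 1) * 1) * 1) * (INR z * INR N)).
    change (ed bb) with ((((ec g * 1 + ed g * 0) * 1 + (ec g * INR e + ed g * 1) * (INR y * INR N)) * 1 + ((ec g * 1 + ed g * 0) * 0 + (ec g * INR e + ed g * 1) * 1) * 0) * 0
      + (((ec g * 1 + ed g * 0) * 1 + (ec g * INR e + ed g * 1) * (INR y * INR N)) * INR x + ((ec g * 1 + ed g * 0) * 0 + (ec g * INR e + ed g * 1) * 1) * 1) * 1).
    repeat split; ring. }
  destruct E as [E1 [E2 [E3 E4]]]. split.
  - intros i. apply (conj_Tr N p bb a4 b3 c4 d3 i); auto.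
  - apply (conj_Di N p bb a4 b3 c4 d3 H0); auto.
Qed.

(** The product has entries p, -i, N x, -t, where N x i - 1 = t p is the determinant condition. *)
Lemma gg_GamN N p (H0 : INR p <> 0) (x i : nat) : (Z.of_nat p | Z.of_nat N * Z.of_nat x * Z.of_nat i - 1)%Z ->
  GamN N (SLmul (SLmul (Di (INR p) H0) (Lo (INR N * INR x * INR p))) (SLinv (Tr (INR i * (1 / INR p))))).
Proof.
  intros [t Ht]. exists (Z.of_nat p), (- Z.of_nat i)%Z, (Z.of_nat N * Z.of_nat x)%Z, (- t)%Z.
  assert (Rt : IZR t * INR p = INR N * INR x * INR i - 1).
  { rewrite !INR_IZR_INZ -!mult_IZR -minus_IZR Ht mult_IZR. reflexivity. }
  rewrite !opp_IZR !mult_IZR -!INR_IZR_INZ. unfold SLmul, SLinv, Di, Lo, Tr, mkSL, ea, eb, ec, ed. cbn [proj1_sig fst snd].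
  repeat split; try (field; auto).
  - replace (- IZR t) with (- (IZR t * INR p) / INR p) by (field; auto). rewrite Rt. field. auto.
  - apply Z.divide_factor_l.
Qed.

(* The matrices of the relation differ from the chosen representatives by powers of U on the left. *)
Lemma Lmat_det (p y : R) : p <> 0 -> p * / p - 0 * y = 1. Proof. intros; field; auto. Qed.
Definition Lmat (p : R) (H : p <> 0) (y : R) : SL := mkSL _ _ _ _ (Lmat_det p y H).
Lemma Lmat_shift N p (H0 : INR p <> 0) (x a : nat) : (Z.of_nat p | Z.of_nat x + Z.of_nat a)%Z ->
  exists t : nat, SLmul (Di (INR p) H0) (Lo (INR N * INR x * INR p)) = SLmul (Lo (INR t * INR N)) (Lmat (INR p) H0 (- INR a * INR N)).
Proof.
  intros [t Ht]. destruct (Z_lt_le_dec t 0) as [Hn|Hn].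
  - exfalso. assert (Hp : p <> O) by (intros ->; apply H0; reflexivity). nia.
  - exists (Z.to_nat t). assert (Rt : INR (Z.to_nat t) * INR p = INR x + INR a).
    { rewrite !INR_IZR_INZ -mult_IZR -plus_IZR. f_equal. rewrite Z2Nat.id; auto. }
    apply SL_eq; unfold SLmul, SLinv, Di, Lo, Lmat, mkSL, ea, eb, ec, ed; cbn [proj1_sig fst snd]; try ring.
    + replace ((INR (Z.to_nat t) * INR N) * INR p + 1 * (- INR a * INR N)) with (INR N * (INR (Z.to_nat t) * INR p - INR a)) by ring.
      rewrite Rt. field. auto.
Qed.

Definition vsum (l : list nat) (F : nat -> VV) : VV := fold_right vadd vzero (map F l).
Lemma vsum_lsum l F z : vsum l F z = lsum l (fun a => F a z).
Proof. induction l as [|a l IH]; [reflexivity|]. unfold vsum, lsum in *. simpl. unfold vadd at 1. rewrite IH. reflexivity. Qed.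

Lemma units_prime p : prime (Z.of_nat p) -> units p = seq 1 (p - 1).
Proof.
  intros HP. assert (H2 := prime_ge_2 _ HP). unfold units.
  destruct p as [|p]; [lia|]. replace (S p - 1)%nat with p by lia. cbn [seq filter].
  replace (Nat.gcd 0 (S p) =? 1)%nat with false; [|symmetry; apply Nat.eqb_neq; rewrite Nat.gcd_0_l; lia].
  apply forallb_filter_id. apply forallb_forall. intros a Ha. apply in_seq in Ha. apply Nat.eqb_eq.
  destruct (Nat.gcd_divide_l a (S p)) as [u Hu]. destruct (Nat.gcd_divide_r a (S p)) as [v Hv].
  set (g := Nat.gcd a (S p)) in *.
  assert (Hd : (Z.of_nat g | Z.of_nat (S p))%Z) by (exists (Z.of_nat v); rewrite -Nat2Z.inj_mul -Hv; reflexivity).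
  assert (Hga : (g <= a)%nat) by (destruct u; nia).
  destruct (prime_divisors _ HP _ Hd) as [E|[E|[E|E]]]; lia.
Qed.

Lemma rel_V N p k xi f (H0 : INR p <> 0) : (1 <= p)%nat ->
  (forall z : C, 0 < snd z -> lsum (units p) (fun a => f (z + RtoC (INR a / INR p))%C) =
    (xi * lsum (units p) (fun a => slR k (INR p) 0 (- INR a * INR N) (/ INR p) f z))%C) ->
  vsum (units p) (fun a => actv k (rest f) (Tr (INR a * (1 / INR p)))) =
  vscal xi (vsum (units p) (fun a => actv k (rest f) (Lmat (INR p) H0 (- INR a * INR N)))).
Proof.
  intros Hp H. apply functional_extensionality. intros z. unfold vscal. rewrite !vsum_lsum.
  destruct z as [z Hz].
  transitivity (lsum (units p) (fun a => f (z + RtoC (INR a / INR p))%C)); [|rewrite H; auto].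
  apply lsum_ext. intros a _.
  change ((/ cpown (0 * z + 1) k * f ((1 * z + RtoC (INR a * (1 / INR p))) / (0 * z + 1)))%C = f (z + RtoC (INR a / INR p))%C).
  replace (0 * z + 1)%C with (RtoC 1) by ring. rewrite cpown_1.
  replace (INR a * (1 / INR p)) with (INR a / INR p) by (field; auto).
  replace ((1 * z + RtoC (INR a / INR p)) / 1)%C with (z + RtoC (INR a / INR p))%C by field. field.
Qed.

Lemma vscal_nat0 v : vscal (RtoC (INR 0)) v = vzero. Proof. vext. simpl. ring. Qed.
Lemma vscal_natS n v : vscal (RtoC (INR (S n))) v = vadd v (vscal (RtoC (INR n)) v).
Proof. vext. rewrite S_INR RtoC_plus. ring. Qed.
Lemma vscal_nat_inj n v : vscal (RtoC (INR (S n))) v = vzero -> v = vzero.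
Proof.
  intros H. vext. assert (E := f_equal (fun u => u x) H). unfold vscal, vzero in E.
  destruct (Ceq_dec (v x) 0%C) as [E0|E0]; auto. exfalso. revert E. apply Cmult_neq_0; auto.
  apply RtoC_neq. apply not_0_INR. lia.
Qed.

Lemma Tr_root p : INR p <> 0 -> SLpow (Tr (1 / INR p)) p = Tr 1.
Proof. intros H. rewrite Tr_pow. f_equal. field. auto. Qed.
Lemma Di_Tr p (H0 : INR p <> 0) : SLmul (Di (INR p) H0) (Tr (1 / INR p)) = SLmul (SLpow (Tr 1) p) (Di (INR p) H0).
Proof. rewrite Tr_pow. apply SL_eq; unfold SLmul, Di, Tr, mkSL, ea, eb, ec, ed; cbn [proj1_sig fst snd]; field; auto. Qed.
Lemma Lo_root N p m : Lo (INR N * INR m * INR p) = SLpow (Lo (INR N)) (p * m).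
Proof. rewrite Lo_pow mult_INR. f_equal. ring. Qed.
Lemma Di_Lo N p m (H0 : INR p <> 0) : SLmul (Di (INR p) H0) (SLpow (Lo (INR N * INR m * INR p)) p)
  = SLmul (SLpow (Lo (INR N)) m) (Di (INR p) H0).
Proof. rewrite !Lo_pow. apply SL_eq; unfold SLmul, Di, Lo, mkSL, ea, eb, ec, ed; cbn [proj1_sig fst snd]; field; auto. Qed.
Lemma Lo_pow_mul N p m j : SLpow (Lo (INR N * INR m * INR p)) j = Lo (INR N * INR (m * j) * INR p).
Proof. rewrite Lo_pow mult_INR. f_equal. ring. Qed.
Lemma Tr_nat n : Tr (INR n) = SLpow (Tr 1) n.
Proof. rewrite Tr_pow. f_equal. ring. Qed.
Lemma Lo_nat n x : Lo (INR n * x) = SLpow (Lo x) n.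
Proof. rewrite Lo_pow. reflexivity. Qed.
Lemma GamN_Tr1 N : GamN N (Tr 1).
Proof. exists 1%Z, 1%Z, 0%Z, 1%Z. repeat split; auto. apply Z.divide_0_r. Qed.
Lemma GamN_Lo N : GamN N (Lo (INR N)).
Proof. exists 1%Z, 0%Z, (Z.of_nat N), 1%Z. repeat split; auto. apply INR_IZR_INZ. apply Z.divide_refl. Qed.
Lemma gg_top N p (H0 : INR p <> 0) x i :
  let g := SLmul (SLmul (Di (INR p) H0) (Lo (INR N * INR x * INR p))) (SLinv (Tr (INR i * (1 / INR p)))) in
  ea g = INR p /\ eb g = - INR i.
Proof.
  unfold SLmul, SLinv, Di, Lo, Tr, mkSL, ea, eb, ec, ed; cbn [proj1_sig fst snd]. split; field; auto.
Qed.
Lemma vscal_inv (c : C) v : c <> 0%C -> vscal (/ c)%C (vscal c v) = v.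
Proof. intros H. vext. field. auto. Qed.
Lemma vscal_inv' (c : C) v : c <> 0%C -> vscal c (vscal (/ c)%C v) = v.
Proof. intros H. vext. field. auto. Qed.
End SLAction.

(** * An eigenvector of T^(1/p), diag(p, 1/p) and U vanishes *)

Module PeriodVanishing.
From Corelib Require Import ssreflect.
From Stdlib Require Import Reals Lra Lia ZArith Znumtheory List FunctionalExtensionality ProofIrrelevance.
From Coquelicot Require Import Coquelicot.
Require Import Defs.
Import ComplexIntegral ComplexDerivative MaximumModulus ComplexExponential PhragmenLindelof MellinUniqueness QSeries GammaMellin HeckeFunctionalEquation RamanujanTwists SLAction.
Open Scope R_scope.

(** Back to functions on [C], with the default value 0 outside the half-plane, so that continuity
    and arithmetic of points can be expressed. *)
Definition ext (h : VV) (z : C) : C := match Rlt_dec 0 (snd z) with left H => h (exist _ z H) | right _ => 0%C end.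
Lemma ext_hz h (z : Hp) : ext h (hz z) = h z.
Proof.
  destruct z as [z Hz]. unfold ext, hz; simpl. destruct (Rlt_dec 0 (snd z)) as [H|H]; [|contradiction].
  f_equal. f_equal. apply proof_irrelevance.
Qed.
Lemma ext_act k h g (z : C) : 0 < snd z -> ext (actv k h g) z = (/ cpown (jac g z) k * ext h (mob0 g z))%C.
Proof.
  intros Hz. set (z' := exist _ z Hz : Hp). change z with (hz z') at 1. rewrite ext_hz. unfold actv.
  change (mob0 g z) with (hz (mob g z')). rewrite ext_hz. reflexivity.
Qed.

Lemma Cconj_mult z w : Cconj (z * w)%C = (Cconj z * Cconj w)%C.
Proof. destruct z, w. unfold Cconj, Cmult; simpl. f_equal; ring. Qed.
Lemma cpown_negconj z k : cpown (- Cconj z)%C k = (RtoC ((-1) ^ k) * Cconj (cpown z k))%C.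
Proof.
  induction k as [|k IH]; simpl; [unfold Cconj, RtoC, Cmult; simpl; f_equal; ring|].
  rewrite IH Cconj_mult RtoC_mult. ring.
Qed.
Lemma pm1 k : (-1) ^ k = 1 \/ (-1) ^ k = -1.
Proof. induction k as [|k [IH|IH]]; simpl; [left; auto|right; rewrite IH; ring|left; rewrite IH; ring]. Qed.

Section Vanish.
Variables (N p k : nat) (H0 : INR p <> 0) (h : VV) (c : C).
Hypothesis HN : (0 < N)%nat.
Hypothesis Hp2 : (2 <= p)%nat.
Hypothesis Hk : (0 < k)%nat.
Hypothesis Hc : c <> 0%C.
Hypothesis hcont : forall z : C, 0 < snd z -> forall eps, 0 < eps -> exists d, 0 < d /\
  forall w : C, 0 < snd w -> Cmod (w - z)%C < d -> Cmod (ext h w - ext h z)%C < eps.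
Hypothesis hS : actv k h (Tr (1 / INR p)) = h.
Hypothesis hD : actv k h (Di (INR p) H0) = vscal c h.
Hypothesis hU : actv k h (Lo (INR N)) = h.
Let e := ext h.

Lemma va_S (z : C) : 0 < snd z -> e (z + RtoC (1 / INR p))%C = e z.
Proof.
  intros Hz. unfold e. rewrite -{2}hS ext_act //.
  replace (jac (Tr (1 / INR p)) z) with (RtoC 1) by (change (RtoC 1 = 0 * z + 1)%C; ring).
  rewrite cpown_1. replace (mob0 (Tr (1 / INR p)) z) with (z + RtoC (1 / INR p))%C; [field|].
  change (z + RtoC (1 / INR p) = (1 * z + RtoC (1 / INR p)) / (0 * z + 1))%C.
  replace (0 * z + 1)%C with (RtoC 1) by ring. field.
Qed.
Lemma va_pos : 0 < INR p. Proof. apply lt_0_INR; lia. Qed.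
Lemma va_D : exists kap : C, kap <> 0%C /\ forall z : C, 0 < snd z -> e (RtoC (INR p ^ 2) * z)%C = (kap * e z)%C.
Proof.
  assert (Hp := va_pos). set (P := RtoC (/ INR p)).
  assert (HP : cpown P k <> 0%C) by (apply cpown_neq0, RtoC_neq, Rinv_neq_0_compat; lra).
  exists (cpown P k * c)%C. split; [apply Cmult_neq_0; auto|]. intros z Hz.
  assert (E : ext (actv k h (Di (INR p) H0)) z = (c * e z)%C).
  { rewrite hD. unfold e, ext. destruct (Rlt_dec 0 (snd z)); [reflexivity|contradiction]. }
  rewrite ext_act // in E.
  replace (jac (Di (INR p) H0) z) with P in E by (change (P = 0 * z + P)%C; ring).
  replace (mob0 (Di (INR p) H0) z) with (RtoC (INR p ^ 2) * z)%C in E.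
  - rewrite -Cmult_assoc -E. unfold e. field. auto.
  - change (RtoC (INR p ^ 2) * z = (RtoC (INR p) * z + 0) / (0 * z + P))%C.
    unfold P. rewrite RtoC_inv; [|auto]. replace (INR p ^ 2) with (INR p * INR p) by ring. rewrite RtoC_mult.
    assert (RtoC (INR p) <> 0%C) by (apply RtoC_neq; auto). field; auto.
Qed.

(** Scaling by p^2 multiplies e by a nonzero constant, so with x also x/p^2 is a period; the descent
    starts from 1/p. *)
Lemma va_per r : exists x, 0 < x <= (/ 2) ^ r /\ forall z : C, 0 < snd z -> e (z + RtoC x)%C = e z.
Proof.
  assert (Hp := va_pos). assert (Hp2' : 2 <= INR p) by (apply (le_INR 2); auto).
  assert (Hi : / INR p <= / 2) by (apply Rinv_le_contravar; lra). assert (Hi0 : 0 < / INR p) by (apply Rinv_0_lt_compat; lra).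
  destruct va_D as [kap [Hkap HD]].
  induction r as [|r [x [Hx IH]]].
  - exists (1 / INR p). split; [unfold Rdiv; simpl; lra|]. exact va_S.
  - exists (x * (/ INR p * / INR p)). split.
    + assert (Hq : 0 < / INR p * / INR p <= / 2) by nra. simpl. split; [apply Rmult_lt_0_compat; lra|]. rewrite Rmult_comm. apply Rmult_le_compat; lra.
    + intros z Hz.
      assert (Hz' : 0 < snd (z + RtoC (x * (/ INR p * / INR p)))%C) by (simpl; lra).
      assert (Hz2 : 0 < snd (RtoC (INR p ^ 2) * z)%C) by (destruct z as [u v]; simpl in Hz; change (0 < INR p ^ 2 * v + 0 * u); assert (0 < INR p ^ 2) by (apply pow_lt; auto); nra).
      assert (E1 := HD _ Hz'). assert (E2 := HD _ Hz).
      replace (RtoC (INR p ^ 2) * (z + RtoC (x * (/ INR p * / INR p))))%C with (RtoC (INR p ^ 2) * z + RtoC x)%C in E1.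
      2:{ rewrite Cmult_plus_distr_l -RtoC_mult. do 2 f_equal. field. lra. }
      rewrite IH // E2 in E1.
      set (A := e (z + RtoC (x * (/ INR p * / INR p)))%C) in *. set (B := e z) in *.
      replace A with (/ kap * (kap * A))%C by (field; auto). rewrite -E1. field. auto.
Qed.
Lemma va_mult x m (z : C) : (forall z : C, 0 < snd z -> e (z + RtoC x)%C = e z) -> 0 < snd z -> e (z + RtoC (INR m * x))%C = e z.
Proof.
  intros Hx Hz. induction m as [|m IH].
  - simpl. replace (z + RtoC (0 * x))%C with z; [auto|]. replace (0 * x) with 0 by ring. ring.
  - rewrite S_INR. replace (z + RtoC ((INR m + 1) * x))%C with (z + RtoC (INR m * x) + RtoC x)%C.
    + rewrite Hx //. simpl; lra.
    + replace ((INR m + 1) * x) with (INR m * x + x) by ring. rewrite RtoC_plus. ring.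
Qed.
(** Multiples of arbitrarily small periods approximate t, and e is continuous. *)
Lemma va_pos_trans t (z : C) : 0 <= t -> 0 < snd z -> e (z + RtoC t)%C = e z.
Proof.
  intros Ht Hz. apply Ceq_minus, Cmod_eq_0, Rle_antisym; [|apply Cmod_ge_0]. apply le_epsilon. intros eps He.
  assert (Hzt : 0 < snd (z + RtoC t)%C) by (simpl; lra).
  destruct (hcont _ Hzt eps He) as [d [Hd Hcd]].
  destruct (pow_lt_1_zero (/ 2) ltac:(rewrite Rabs_pos_eq; lra) d Hd) as [r Hr]. specialize (Hr r (le_n _)).
  rewrite Rabs_pos_eq in Hr; [|apply pow_le; lra].
  destruct (va_per r) as [x [Hx Hper]].
  set (m := Z.to_nat (Int_part (t / x))).
  assert (Hq : 0 <= t / x) by (apply Rmult_le_pos; [lra|apply Rlt_le, Rinv_0_lt_compat; lra]).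
  destruct (base_Int_part (t / x)) as [Hm1 Hm2].
  assert (Hm0 : (0 <= Int_part (t / x))%Z) by (apply Z.lt_succ_r, lt_IZR; rewrite succ_IZR; lra).
  assert (Em : INR m = IZR (Int_part (t / x))) by (unfold m; rewrite INR_IZR_INZ Z2Nat.id; auto).
  assert (Htx : t = t / x * x) by (field; lra).
  assert (Hmt : Rabs (INR m * x - t) < d).
  { rewrite Em. rewrite {2}Htx. assert (H : (IZR (Int_part (t / x)) - t / x) * x <= 0) by nra.
    assert (H' : - x < (IZR (Int_part (t / x)) - t / x) * x) by nra.
    apply Rabs_def1; lra. }
  assert (Hzm : 0 < snd (z + RtoC (INR m * x))%C) by (simpl; lra).
  specialize (Hcd _ Hzm).
  replace (z + RtoC (INR m * x) - (z + RtoC t))%C with (RtoC (INR m * x - t)) in Hcd by (rewrite RtoC_minus; ring).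
  rewrite Coquelicot.Complex.Cmod_R in Hcd. specialize (Hcd Hmt). fold e in Hcd. rewrite (va_mult x m z Hper Hz) in Hcd.
  rewrite -Cmod_opp. replace (- (e (z + RtoC t) - e z))%C with (e z - e (z + RtoC t))%C by ring. lra.
Qed.
Lemma va_im (x x' y : R) : 0 < y -> e (x, y) = e (x', y).
Proof.
  intros Hy. assert (G : forall a b, a <= b -> e (a, y) = e (b, y)).
  { intros a b Hab. rewrite -(va_pos_trans (b - a) (a, y)); [|lra|exact Hy]. f_equal. unfold Cplus, RtoC; simpl. f_equal; ring. }
  destruct (Rle_dec x x'); [apply G; auto|symmetry; apply G; lra].
Qed.

(** By [va_im] the value depends on the height alone. Take two points of height y for which w = N z
    + 1 takes mirror values w and - conj(w): U sends both to height y/|w|^2, hence w^k e = (- conj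
    w)^k e, and the two k-th powers differ. *)
Lemma va_zero (x y : R) : 0 < y -> e (x, y) = 0%C.
Proof.
  intros Hy. assert (HPI := PI_RGT_0). assert (HNp : 0 < INR N) by (apply lt_0_INR; auto).
  assert (Hkp : 1 <= INR k) by (apply (le_INR 1); auto).
  (* As the argument of w this gives w^k the argument PI/4, so w^k is neither its own conjugate nor
     minus it, whatever the parity of k. The modulus r is fixed by Im w = N y. *)
  set (th := PI / (4 * INR k)).
  assert (Hth : 0 < th < PI).
  { unfold th. split; [apply Rdiv_lt_0_compat; lra|]. apply (Rmult_lt_reg_r (4 * INR k)); [lra|].
    replace (PI / (4 * INR k) * (4 * INR k)) with PI by (field; lra). nra. }
  assert (Hsin : 0 < sin th) by (apply sin_gt_0; lra).
  set (r := INR N * y / sin th). assert (Hr : 0 < r) by (unfold r; apply Rdiv_lt_0_compat; auto; nra).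
  assert (Hrs : r * sin th = INR N * y) by (unfold r; field; lra).
  set (w := (r * cos th, r * sin th) : C).
  assert (Ew : w = (RtoC r * cexp (Ci * RtoC th))%C).
  { unfold w, cexp, Cmult, RtoC, Ci; simpl. replace (0 * th - 1 * 0) with 0 by ring. replace (0 * 0 + 1 * th) with th by ring.
    rewrite exp_0. f_equal; ring. }
  assert (Hrk : 0 < r ^ k) by (apply pow_lt; auto).
  assert (Ewk : cpown w k = (r ^ k * cos (PI / 4), r ^ k * sin (PI / 4))).
  { rewrite Ew cpown_mult cpown_RtoC -cexp_nat.
    replace (INR k * (Ci * RtoC th))%C with (Ci * RtoC (PI / 4))%C.
    - unfold cexp, Cmult, RtoC, Ci; simpl. replace (0 * (PI / 4) - 1 * 0) with 0 by ring. replace (0 * 0 + 1 * (PI / 4)) with (PI / 4) by ring.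
      rewrite exp_0. f_equal; ring.
    - replace (PI / 4) with (INR k * th) by (unfold th; field; lra). rewrite RtoC_mult. ring. }
  assert (Hs4 : 0 < sin (PI / 4)) by (apply sin_gt_0; lra). assert (Hc4 : 0 < cos (PI / 4)) by (apply cos_gt_0; lra).
  assert (HU : forall s, s * s = 1 -> let wz := (s * r * cos th, r * sin th) : C in
     e (0, y / (r * r)) = (cpown wz k * e (x, y))%C).
  { intros s Hs wz. set (z := ((s * r * cos th - 1) / INR N, y) : C). assert (Hz : 0 < snd z) by exact Hy.
    assert (E : ext (actv k h (Lo (INR N))) z = e z) by (rewrite hU; auto).
    rewrite ext_act // in E.
    assert (Ej : jac (Lo (INR N)) z = wz).
    { change (RtoC (INR N) * z + 1 = wz)%C. unfold z, wz, Cmult, Cplus, RtoC; simpl. rewrite Hrs. f_equal; field; lra. }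
    assert (Hj : wz <> 0%C). { intros E0. injection E0. intros E1 _. rewrite Hrs in E1. nra. }
    assert (Em : mob0 (Lo (INR N)) z = (fst (mob0 (Lo (INR N)) z), y / (r * r))).
    { rewrite {1}(surjective_pairing (mob0 (Lo (INR N)) z)). f_equal.
      unfold mob0. rewrite Ej. change (snd ((1 * z + 0) / wz)%C = y / (r * r)).
      replace ((1 * z + 0) / wz)%C with (RtoC (/ INR N) * (1 - / wz))%C.
      2:{ rewrite -Ej. change (RtoC (/ INR N) * (1 - / (RtoC (INR N) * z + 1)) = (1 * z + 0) / (RtoC (INR N) * z + 1))%C.
          rewrite RtoC_inv; [|lra]. assert (RtoC (INR N) <> 0%C) by (apply RtoC_neq; lra).
          assert ((RtoC (INR N) * z + 1)%C <> 0%C) by (change (jac (Lo (INR N)) z <> 0%C); rewrite Ej; auto). field. auto. }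
      unfold wz, Cinv, Cminus, Cplus, Copp, Cmult, RtoC; simpl.
      replace (s * r * cos th * (s * r * cos th * 1) + r * sin th * (r * sin th * 1)) with (r * r).
      - replace (- (r * sin th) / (r * r)) with (- (INR N * y / (r * r))) by (rewrite Hrs; field; lra). field. split; lra.
      - replace (s * r * cos th * (s * r * cos th * 1) + r * sin th * (r * sin th * 1)) with (r * r * (s * s * Rsqr (cos th) + Rsqr (sin th))) by (unfold Rsqr; ring).
        rewrite Hs Rmult_1_l Rplus_comm sin2_cos2. ring. }
    assert (Hyr : 0 < y / (r * r)) by (apply Rdiv_lt_0_compat; nra).
    rewrite Ej Em in E. fold e in E. rewrite (va_im _ 0 _ Hyr) in E. unfold z in E. rewrite (va_im _ x _ Hy) in E.
    rewrite -E. field. apply cpown_neq0. auto. }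
  assert (E1 := HU 1 ltac:(ring)). assert (E2 := HU (-1) ltac:(ring)). cbv zeta in E1, E2.
  replace ((1 * r * cos th, r * sin th) : C) with w in E1 by (unfold w; f_equal; ring).
  replace ((-1 * r * cos th, r * sin th) : C) with (- Cconj w)%C in E2 by (unfold w, Copp, Cconj; simpl; f_equal; ring).
  rewrite cpown_negconj in E2. rewrite E1 in E2.
  destruct (Ceq_dec (e (x, y)) 0%C) as [E|E]; auto. exfalso.
  assert (E3 : cpown w k = (RtoC ((-1) ^ k) * Cconj (cpown w k))%C).
  { apply Ceq_minus. apply Cmod_eq_0. destruct (Req_dec (Cmod (cpown w k - RtoC ((-1) ^ k) * Cconj (cpown w k))%C) 0) as [Em|Em]; auto. exfalso.
    assert (E4 : ((cpown w k - RtoC ((-1) ^ k) * Cconj (cpown w k)) * e (x, y))%C = 0%C).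
    { replace ((cpown w k - RtoC ((-1) ^ k) * Cconj (cpown w k)) * e (x, y))%C with (cpown w k * e (x, y) - RtoC ((-1) ^ k) * Cconj (cpown w k) * e (x, y))%C by ring.
      rewrite E2. ring. }
    revert E4. apply Cmult_neq_0; auto. intros E5. rewrite E5 Cmod_0 in Em. auto. }
  rewrite Ewk in E3. unfold Cconj, Cmult, RtoC in E3; simpl in E3. injection E3. intros F1 F2.
  assert (G1 : 0 < r ^ k * cos (PI / 4)) by (apply Rmult_lt_0_compat; auto).
  assert (G2 : 0 < r ^ k * sin (PI / 4)) by (apply Rmult_lt_0_compat; auto).
  destruct (pm1 k) as [E4|E4]; rewrite E4 in F1, F2; lra.
Qed.
Lemma va_h : h = vzero.
Proof.
  apply functional_extensionality. intros [[x y] Hz]. rewrite -ext_hz. apply (va_zero x y Hz).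
Qed.
End Vanish.
End PeriodVanishing.

(** * Unipotent, Weyl and diagonal maps on the projective line over a finite field *)

Module ProjectiveLine.
From HB Require Import structures.
From mathcomp Require Import all_boot all_algebra.
From mathcomp Require Import ring zify.
Set Implicit Arguments. Unset Strict Implicit. Unset Printing Implicit Defensive.
Import GRing.Theory.
Local Open Scope ring_scope.

Lemma perm_swap13 (T : eqType) (a b x y : T) : perm_eq [:: a; b; x; y] [:: x; b; a; y].
Proof.
apply/permP => Q /=.
by move: (Q a : nat) (Q b : nat) (Q x : nat) (Q y : nat) => qa qb qx qy; lia.
Qed.
Lemma perm_swap14 (T : eqType) (a b x y : T) : perm_eq [:: a; b; x; y] [:: y; b; x; a].
Proof.
apply/permP => Q /=.
by move: (Q a : nat) (Q b : nat) (Q x : nat) (Q y : nat) => qa qb qx qy; lia.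
Qed.
(** This identity, with [braid_tr] and [braid_n], computes the points met by j = i m^2 under the two
    words compared in [braid]. *)
Lemma braid_w (F : fieldType) (i m : F) : i != 0 -> m != 0 -> 1 + m ^+ 2 != 0 ->
  ((i * m ^+ 2)^-1 + i^-1)^-1 = i * (1 + m ^+ 2) * (m / (1 + m ^+ 2)) ^+ 2.
Proof.
move=> i0 m0 n0.
have -> : (i * m ^+ 2)^-1 + i^-1 = (1 + m ^+ 2) / (i * m ^+ 2) by field; rewrite i0 m0.
by rewrite invf_div; field; rewrite n0.
Qed.
Lemma braid_tr (F : fieldType) (i m : F) : 1 + m ^+ 2 != 0 ->
  i * (1 + m ^+ 2) * (m / (1 + m ^+ 2)) ^+ 2 - i = - (i * (1 + m ^+ 2)) * (1 + m ^+ 2)^-1 ^+ 2.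
Proof. by move=> n0; field; rewrite n0. Qed.
Lemma braid_n (F : fieldType) (i m : F) : m != 0 ->
  - i * m^-1 ^+ 2 + i = (i * m ^+ 2 - i) * m^-1 ^+ 2.
Proof. by move=> m0; field; rewrite m0. Qed.

Section ProjectiveLine.
Variable F : finFieldType.
(** [option F] is the projective line with [None] as infinity; [pl_tr] is an upper unipotent map,
    and [pl_w] below is the lower unipotent one, conjugate to it by inversion. *)
Definition pl_tr (a : F) (y : option F) := omap (fun i => i + a) y.
Definition pl_inv (y : option F) : option F :=
  if y is Some i then (if i == 0 then None else Some i^-1) else Some 0.
Definition pl_w (b : F) (y : option F) := pl_inv (pl_tr b (pl_inv y)).

Lemma pl_invK : involutive pl_inv.
Proof.
case=> [i|] /=; last by rewrite eqxx.
by case: (i =P 0) => [->//|/eqP i0] /=; rewrite invr_eq0 (negPf i0) invrK.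
Qed.
Lemma pl_tr_inj a : injective (pl_tr a).
Proof. by move=> [i|] [j|] //= [/addIr ->]. Qed.
Lemma pl_w_inj b : injective (pl_w b).
Proof. by move=> x y /(can_inj pl_invK) /pl_tr_inj /(can_inj pl_invK). Qed.

Lemma pl_w0 b : pl_w b (Some 0) = Some 0.
Proof. by rewrite /pl_w /= eqxx. Qed.
Lemma pl_wN b : b != 0 -> pl_w b None = Some b^-1.
Proof. by move=> b0; rewrite /pl_w /= add0r (negPf b0). Qed.
Lemma pl_wS b i : i != 0 -> i^-1 + b != 0 -> pl_w b (Some i) = Some (i^-1 + b)^-1.
Proof. by move=> i0 d0; rewrite /pl_w /= (negPf i0) /= (negPf d0). Qed.
Lemma pl_wSN b i : i != 0 -> i^-1 + b = 0 -> pl_w b (Some i) = None.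
Proof. by move=> i0 d0; rewrite /pl_w /= (negPf i0) /= d0 eqxx. Qed.
Lemma pl_swap : pl_tr (-1) (pl_w 1 None) = Some 0.
Proof. by rewrite pl_wN ?oner_eq0 //= invr1 subrr. Qed.
Lemma pl_swap' : pl_w 1 (pl_tr (-1) (Some 0)) = None.
Proof. by rewrite /pl_w /= sub0r oppr_eq0 oner_eq0 /= invrN invr1 addNr eqxx. Qed.

(** The Weyl element y -> - i^2 / y. *)
Definition pl_neg (i : F) (y : option F) : option F :=
  if y is Some j then (if j == 0 then None else Some (- i ^+ 2 / j)) else Some 0.

(** Together with [pl_n'], which reaches the same map by the word with upper and lower unipotents
    exchanged, this is the braid relation. *)
Lemma pl_n i y : i != 0 -> pl_tr (- i) (pl_w i^-1 (pl_tr (- i) y)) = pl_neg i y.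
Proof.
move=> i0; case: y => [j|] /=; last first.
  by rewrite /pl_w /= add0r invr_eq0 (negPf i0) /= invrK subrr.
rewrite /pl_w /=; have [/eqP|ji] := eqVneq (j - i) 0.
  rewrite subr_eq0 => /eqP ->; rewrite /= ?eqxx /= add0r (negPf i0).
  by congr Some; field.
rewrite /=; have [->|j0] := eqVneq j 0.
  by rewrite sub0r invrN addNr eqxx.
have -> : (j - i)^-1 + i^-1 = j / ((j - i) * i) by field; rewrite ?i0.
rewrite mulf_eq0 invr_eq0 mulf_eq0 (negPf j0) (negPf ji) (negPf i0) /=.
by congr Some; field; rewrite ?j0 ?ji ?i0.
Qed.

Lemma pl_n' i y : i != 0 -> pl_w i^-1 (pl_tr (- i) (pl_w i^-1 y)) = pl_neg i y.
Proof.
move=> i0; have i0' : i^-1 != 0 by rewrite invr_eq0.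
case: y => [j|]; last by rewrite pl_wN //= invrK subrr pl_w0.
have [->|j0] := eqVneq j 0.
  rewrite pl_w0 /= sub0r pl_wSN ?oppr_eq0 ?eqxx //.
  by rewrite invrN addNr.
have [/eqP d0|d0] := eqVneq (j^-1 + i^-1) 0.
  rewrite pl_wSN //; last exact/eqP.
  have -> : j = - i by apply: invr_inj; rewrite invrN; apply/eqP; rewrite -addr_eq0.
  by rewrite /= pl_wN // invrK oppr_eq0 (negPf i0); congr Some; rewrite invrN mulrNN expr2 mulfK.
have s0 : i + j != 0.
  apply: contra d0 => /eqP s0; have -> : j = - i by apply/eqP; rewrite -addr_eq0 addrC s0.
  by rewrite invrN addNr.
rewrite pl_wS //= (negPf j0).
have -> : (j^-1 + i^-1)^-1 - i = - i ^+ 2 / (i + j) by field; rewrite j0 i0 s0.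
have q0 : - i ^+ 2 / (i + j) != 0 by rewrite mulf_neq0 ?invr_eq0 // oppr_eq0 expf_neq0.
have E : (- i ^+ 2 / (i + j))^-1 + i^-1 = (- i ^+ 2 / j)^-1.
  have Ei : i / - i ^+ 2 = - i^-1 by rewrite invrN mulrN expr2 invfM mulVKf.
  by rewrite !invf_div mulrDl Ei addrAC addNr add0r.
by rewrite pl_wS // E ?invrK // invr_eq0 mulf_neq0 ?invr_eq0 // oppr_eq0 expf_neq0.
Qed.

Definition pl_dil (e : F) (y : option F) := omap (fun i => i * e) y.
(** Two Weyl elements compose to a diagonal one, which acts through a square; this is why square
    classes enter. *)
Lemma pl_neg2 i y : i != 0 -> pl_neg 1 (pl_neg i y) = pl_dil (i ^- 2) y.
Proof.
move=> i0; case: y => [j|] /=; last by rewrite eqxx.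
have [->|j0] := eqVneq j 0; first by rewrite mul0r.
rewrite /=; have -> : (- i ^+ 2 / j == 0) = false by apply: negbTE; rewrite mulf_neq0 ?invr_eq0 // oppr_eq0 expf_neq0.
by congr Some; rewrite expr1n mulN1r invf_div invrN mulrN opprK.
Qed.
Lemma pl_dil_tr e a y : pl_dil e (pl_tr a y) = pl_tr (a * e) (pl_dil e y).
Proof. by case: y => [j|] //=; rewrite mulrDl. Qed.
Lemma pl_dil_inv e y : e != 0 -> pl_dil e (pl_inv y) = pl_inv (pl_dil e^-1 y).
Proof.
move=> e0; case: y => [j|] /=; last by rewrite mul0r.
rewrite mulf_eq0 invr_eq0 (negPf e0) orbF; case: ifP => //= j0.
by rewrite invfM invrK.
Qed.
Lemma pl_dil_w e b y : e != 0 -> pl_dil e (pl_w b y) = pl_w (b / e) (pl_dil e y).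
Proof.
move=> e0; rewrite /pl_w pl_dil_inv // pl_dil_tr; congr (pl_inv (pl_tr _ _)).
by rewrite -[in RHS](invrK e) -pl_dil_inv ?invr_eq0.
Qed.
Lemma sum_option (V : zmodType) (H : option F -> V) : \sum_y H y = H None + \sum_i H (Some i).
Proof.
rewrite (bigD1 None) //=; congr (_ + _).
rewrite (reindex_onto Some (odflt 0)); last by case.
by apply: eq_bigl => i; rewrite eqxx.
Qed.

Lemma sum_tr (V : zmodType) (H : option F -> V) y : y != None ->
  \sum_a H (pl_tr a y) = \sum_i H (Some i).
Proof.
case: y => // i _ /=. rewrite (reindex_inj (addrI (- i))) /=.
by apply: eq_bigr => j _; rewrite addNKr.
Qed.
End ProjectiveLine.
End ProjectiveLine.

(** * A nonsquare of the form 1 + m^2 modulo an odd prime *)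

Module SquareClasses.
From HB Require Import structures.
From mathcomp Require Import all_boot all_algebra all_fingroup all_solvable all_field.
From mathcomp Require Import ring.
Import ProjectiveLine.
Set Implicit Arguments. Unset Strict Implicit. Unset Printing Implicit Defensive.
Import GRing.Theory.
Local Open Scope ring_scope.

(** The unit group is cyclic of even order, so it has two square classes told apart by the parity of
    the exponent of a generator z, and 1 + m^2 is chosen as representative of the second. *)
Lemma Fp_square_classes p : prime p -> (2 < p)%N ->
  exists m : 'F_p, [/\ m != 0, 1 + m ^+ 2 != 0 &
    forall a : 'F_p, a != 0 -> exists2 u, u != 0 & (a = u ^+ 2 \/ a = (1 + m ^+ 2) * u ^+ 2)].
Proof.
move=> pP p2; set F := 'F_p.
have p1 : (0 < p.-1)%N by case: (p) p2 => [|[]].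
have X1 (x : F) : x != 0 -> x ^+ p.-1 = 1.
  move=> x0; apply: (mulfI x0); rewrite mulr1 -exprS prednK ?prime_gt0 //.
  by rewrite -{2}(expf_card x) card_Fp.
have [z Hz] : exists z : F, p.-1.-primitive_root z.
  have : has p.-1.-primitive_root [seq x <- enum F | x != 0].
    apply: has_prim_root => //.
    - by apply/allP => x; rewrite mem_filter => /andP [x0 _]; apply/unity_rootP; exact: X1.
    - by apply: filter_uniq; exact: enum_uniq.
    - rewrite size_filter -(leq_add2r (count (predC (fun x : F => x != 0)) (enum F))) count_predC -cardT card_Fp //.
      rewrite (@eq_count _ _ (pred1 0)); last by move=> x /=; rewrite negbK.
      by rewrite count_uniq_mem ?enum_uniq // mem_enum addn1 prednK ?prime_gt0.
  by case/hasP => z _; exists z.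
have z0 : z != 0.
  apply/eqP => E; have := prim_expr_order Hz; rewrite E expr0n (gtn_eqF p1) => /eqP.
  by rewrite eq_sym oner_eq0.
have Zp a : a != 0 -> exists i, a = z ^+ i.
  by move=> a0; have [i ->] := prim_rootP Hz (X1 _ a0); exists i.
pose sq (a : F) := [exists u : F, a == u ^+ 2].
have zns : ~~ sq z.
  apply/existsP => -[u /eqP E].
  have u0 : u != 0 by apply: contra z0 => /eqP u0; rewrite E u0 expr0n.
  have [k Ek] : exists k, p.-1 = k.*2.
    exists p.-1./2; have := odd_double_half p.-1.
    have : odd p by case: (even_prime pP) => // E2; rewrite E2 in p2.
    by rewrite -[in odd p](prednK (prime_gt0 pP)) /= => /negPf ->; rewrite add0n.
  have /eqP : z ^+ k = 1 by rewrite E -exprM mul2n -Ek X1.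
  have k0 : (0 < k)%N by rewrite -double_gt0 -Ek.
  rewrite -(prim_order_dvd Hz) Ek => /(dvdn_leq k0).
  by rewrite leqNgt -addnn -[X in (X < _)%N]addn0 ltn_add2l k0.
(* If every 1 + u^2 were a square, all residues would be squares by induction from 0, including
   z. *)
have [m Hm] : exists m : F, ~~ sq (1 + m ^+ 2).
  apply/existsP; apply: contraR zns; rewrite negb_exists => /forallP H.
  have all_sq k : sq (k%:R).
    elim: k => [|k /existsP [u /eqP E]]; first by apply/existsP; exists 0; rewrite expr0n.
    by have := H u; rewrite negbK -E -[1 + k%:R](natrD _ 1).
  by have := all_sq (val z); rewrite natr_Zp.
set n := 1 + m ^+ 2 in Hm *.
have sq0 : sq 0 by apply/existsP; exists 0; rewrite expr0n.
have n0 : n != 0 by apply: contra Hm => /eqP ->.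
exists m; split=> //.
  by apply: contra Hm => /eqP m0; rewrite /n m0 expr0n addr0; apply/existsP; exists 1; rewrite expr1n.
have sq_even i : ~~ odd i -> z ^+ i = (z ^+ i./2) ^+ 2.
  by move=> oi; rewrite -exprM muln2 -[in LHS](odd_double_half i) (negPf oi).
have [j Ej] := Zp _ n0.
have oj : odd j by apply: contraR Hm => /sq_even E; rewrite Ej E; apply/existsP; exists (z ^+ j./2).
move=> a a0; have [i Ei] := Zp _ a0; case: (boolP (odd i)) => oi.
  have := @sq_even (i + j)%N; rewrite oddD oi oj => /(_ isT) E.
  exists (z ^+ (i + j)./2 / n); first by rewrite mulf_neq0 ?invr_eq0 // expf_neq0.
  right; rewrite expr_div_n -E exprD -Ei -Ej [RHS]mulrC expr2 invfM !mulrA mulfK // mulfVK //.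
exists (z ^+ i./2); first by rewrite expf_neq0.
by left; rewrite -sq_even.
Qed.
End SquareClasses.

(** * Splitting a relation over the cosets of P^1(F_p) under an abelian action *)

Module CosetRelation.
From HB Require Import structures.
From mathcomp Require Import all_boot all_algebra all_fingroup all_solvable.
From mathcomp Require Import ring zify.
Import ProjectiveLine SquareClasses.
Set Implicit Arguments. Unset Strict Implicit. Unset Printing Implicit Defensive.
Import GRing.Theory.
Local Open Scope ring_scope.

Section AbelianAction.
(** Model: G = SL_2(R) acting by slashes, Gam = Gamma0(N), [c] the scalar 1/xi(p) with inverse [c'],
    S = T^(1/p), D = diag(p, 1/p), and W = U^(p m0) with m0 an inverse of N modulo p. *)
Variables (G : groupType) (V : zmodType) (act : V -> G -> V).
Local Notation "v @@ g" := (act v g%g) (at level 38, left associativity).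
Hypothesis actD : forall u v g, (u + v) @@ g = u @@ g + v @@ g.
Hypothesis actM : forall v g h, v @@ (g * h) = v @@ g @@ h.
Hypothesis act1 : forall v, v @@ 1 = v.
Hypothesis tors : forall (v : V) n, v *+ n.+1 = 0 -> v = 0.
Variables (c c' : V -> V).
Hypothesis cD : forall u v, c (u + v) = c u + c v.
Hypothesis cA : forall v g, c v @@ g = c (v @@ g).
Hypothesis cK : forall v, c' (c v) = v.
Hypothesis cK' : forall v, c (c' v) = v.
Variable Gam : G -> Prop.
Hypothesis Gam1 : Gam 1%g.
Hypothesis GamM : forall a b, Gam a -> Gam b -> Gam (a * b)%g.
Hypothesis GamV : forall a, Gam a -> Gam (a^-1)%g.
Variables (p m0 : nat) (pP : prime p) (p2 : (2 < p)%N) (T U S W D : G).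
Hypothesis GT : Gam T.
Hypothesis GU : Gam U.
Hypothesis ST : (S ^+ p = T)%g.
Hypothesis DS : (D * S = T ^+ p * D)%g.
Hypothesis WU : (W = U ^+ (p * m0))%g.
Hypothesis DW : (D * W ^+ p = U ^+ m0 * D)%g.
Local Notation P := (option 'F_p).
(** In the model this is the element of Gamma0(N) with top row (p, -i); it compares the
    representatives S^i and D W^(1/i) of the same coset. *)
Definition gg (i : 'F_p) : G := (D * W ^+ val (i^-1)%R * (S ^+ val i)^-1)%g.
Definition g_ (y : P) : G := if y is Some i then (if i == 0 then 1%g else gg i) else 1%g.
Hypothesis Ggg : forall i : 'F_p, i != 0 -> Gam (gg i).
(** Coset representatives indexed by the projective line, with D at infinity. *)
Definition al (y : P) : G := if y is Some i then (S ^+ val i)%g else D.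
(** Vectors on which Gam acts through an abelian quotient and which T and U fix; the class contains
    f and is stable under every operation used. *)
Definition Ab (v : V) : Prop :=
  [/\ forall a b, Gam a -> Gam b -> v @@ (a * b) = v @@ (b * a), v @@ T = v & v @@ U = v].
(** In the model these include the elements congruent to 1 modulo p^2: their right multiplication
    fixes every coset. *)
Definition Del (b : G) : Prop := forall y, Gam (al y * b * (al y)^-1)%g.
(** Vectors that cannot tell the conjugates of an element of [Del] apart; for them a cocycle is
    determined by its value at one coset, see [sameperm]. *)
Definition M1 (k : V) : Prop :=
  Ab k /\ forall b, Del b -> forall y, k @@ (al y * b * (al y)^-1) = k @@ b.
Definition eqA (a b : G) : Prop := forall v, Ab v -> v @@ a = v @@ b.
Hypothesis HK : forall a, Gam a -> exists b, Del b /\ eqA a b.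

Lemma act0 g : 0 @@ g = 0.
Proof. by apply: (addrI (0 @@ g)); rewrite -actD !addr0. Qed.
Lemma actN v g : (- v) @@ g = - (v @@ g).
Proof. by apply: (addrI (v @@ g)); rewrite -actD !subrr act0. Qed.
Lemma actB u v g : (u - v) @@ g = u @@ g - v @@ g.
Proof. by rewrite actD actN. Qed.
Lemma act_sum I r (Q : pred I) (F : I -> V) g : (\sum_(i <- r | Q i) F i) @@ g = \sum_(i <- r | Q i) F i @@ g.
Proof. by apply: (big_morph (fun v => v @@ g)) => [u v|]; rewrite ?actD ?act0. Qed.
Lemma actMn v n g : (v *+ n) @@ g = (v @@ g) *+ n.
Proof. by elim: n => [|n IH]; rewrite ?act0 // !mulrS actD IH. Qed.
Lemma actK v g : v @@ g @@ g^-1 = v. Proof. by rewrite -actM mulgV act1. Qed.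
Lemma actVK v g : v @@ g^-1 @@ g = v. Proof. by rewrite -actM mulVg act1. Qed.
Lemma act_inj g : injective (fun v => v @@ g).
Proof. by move=> u v E; rewrite -(actK u g) E actK. Qed.
Lemma c0 : c 0 = 0. Proof. by apply: (addrI (c 0)); rewrite -cD !addr0. Qed.
Lemma cN v : c (- v) = - c v.
Proof. by apply: (addrI (c v)); rewrite -cD !subrr c0. Qed.
Lemma cMn v n : c (v *+ n) = c v *+ n.
Proof. by elim: n => [|n IH]; rewrite ?c0 // !mulrS cD IH. Qed.
Lemma c_inj : injective c. Proof. exact: can_inj cK. Qed.
Lemma torsE n (u v : V) : (0 < n)%N -> u *+ n = v *+ n -> u = v.
Proof. by case: n => // n _ E; apply/subr0_eq/(@tors _ n); rewrite mulrnBl E subrr. Qed.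

Lemma GamX a n : Gam a -> Gam (a ^+ n)%g.
Proof. by move=> Ha; elim: n => [|n IH]; rewrite ?expg0 // expgS; apply: GamM. Qed.
Lemma Gg y : Gam (g_ y).
Proof. by case: y => [i|] //=; case: ifPn => // /Ggg. Qed.
Lemma Ab_act v a : Ab v -> Gam a -> Ab (v @@ a).
Proof.
move=> [H HT HU] Ga; split=> [x y Gx Gy||].
- rewrite -!actM H //; [|exact: GamM]. rewrite (H a) //; [|exact: GamM].
  by rewrite !actM -(actM v x) H // actM.
- by rewrite -actM H // actM HT.
- by rewrite -actM H // actM HU.
Qed.
Lemma actC v a b : Ab v -> Gam a -> Gam b -> v @@ a @@ b = v @@ b @@ a.
Proof. by case=> H _ _ Ga Gb; rewrite -!actM H. Qed.
Lemma Ab0 : Ab 0. Proof. by split=> *; rewrite !act0. Qed.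
Lemma AbD u v : Ab u -> Ab v -> Ab (u + v).
Proof. by move=> [H1 H2 H3] [K1 K2 K3]; split=> [a b Ga Gb||]; rewrite !actD ?H2 ?H3 ?K2 ?K3 // H1 // K1. Qed.
Lemma AbN u : Ab u -> Ab (- u).
Proof. by move=> [H1 H2 H3]; split=> [a b Ga Gb||]; rewrite !actN ?H2 ?H3 // H1. Qed.
Lemma Ab_c u : Ab u -> Ab (c u).
Proof. by move=> [H1 H2 H3]; split=> [a b Ga Gb||]; rewrite !cA ?H2 ?H3 // H1. Qed.
Lemma Ab_sum I r (Q : pred I) (F : I -> V) : (forall i, Ab (F i)) -> Ab (\sum_(i <- r | Q i) F i).
Proof. by move=> H; apply: big_ind => //; [exact: Ab0|exact: AbD]. Qed.
Hint Resolve Ab_act GamM GamV Gg GT GU Gam1 Ab0 AbD AbN Ab_c : core.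

Lemma AbT v n : Ab v -> v @@ T ^+ n = v.
Proof. by case=> _ H _; elim: n => [|n IH]; rewrite ?expg0 ?act1 // expgS actM H. Qed.
Lemma AbU v n : Ab v -> v @@ U ^+ n = v.
Proof. by case=> _ _ H; elim: n => [|n IH]; rewrite ?expg0 ?act1 // expgS actM H. Qed.

(* [mv k s C]: right multiplication by [k] permutes the cosets Gam * al y by [s],
   and the element of Gam that appears acts on Ab as [C y]. *)
Definition mv (k : G) (s : P -> P) (C : P -> G) : Prop :=
  forall y, Gam (C y) /\ exists a, [/\ Gam a, eqA a (C y) & (al y * k = a * al (s y))%g].

Lemma mv_comp k s C k' s' C' : mv k s C -> mv k' s' C' ->
  mv (k * k')%g (s' \o s) (fun y => C y * C' (s y))%g.
Proof.
move=> H H' y; have [GC [a [Ga Ea Ha]]] := H y; have [GC' [a' [Ga' Ea' Ha']]] := H' (s y).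
split; first by auto.
exists (a * a')%g; split; auto.
- by move=> v Av; rewrite !actM Ea // Ea' //; auto.
- by rewrite mulgA Ha -mulgA Ha' mulgA.
Qed.

Lemma valFD (i j : 'F_p) : (val i + val j)%N = ((val i + val j) %/ p * p + val (i + j)%R)%N.
Proof.
have -> : val (i + j)%R = ((val i + val j) %% p)%N by congr (_ %% _)%N; exact: Fp_cast.
exact: divn_eq.
Qed.

Lemma DSn n : (D * S ^+ n = T ^+ (p * n) * D)%g.
Proof.
elim: n => [|n IH]; first by rewrite muln0 !expg0 mulg1 mul1g.
by rewrite expgS mulgA DS -mulgA IH mulgA -expgnDr mulnS.
Qed.
Lemma mv_S (a : 'F_p) : mv (S ^+ val a)%g (pl_tr a) (fun=> 1%g).
Proof.
move=> y; split=> //; case: y => [i|] /=.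
- exists (T ^+ ((val i + val a) %/ p))%g; split; first by apply: GamX.
    by move=> v Av; rewrite AbT // act1.
  by rewrite -expgnDr -ST -expgnA -expgnDr; congr (S ^+ _)%g; rewrite mulnC; exact: valFD.
- exists (T ^+ (p * val a))%g; split; first by apply: GamX.
    by move=> v Av; rewrite AbT // act1.
  exact: DSn.
Qed.

(** A second system of representatives, on which W acts by shifts as S does on [al]; [g_] compares
    the two systems. *)
Definition alw (u : P) : G := if u is Some x then (D * W ^+ val x)%g else 1%g.
Lemma alwE y : (al y = (g_ y)^-1 * alw (pl_inv y))%g.
Proof.
case: y => [i|]; last by rewrite /= invg1 mul1g expg0 mulg1.
have [->|i0] := eqVneq i 0; first by rewrite /= invg1 mulg1.
by rewrite /al /g_ /pl_inv (negPf i0) /alw /gg invMg invgK mulgVK.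
Qed.
Lemma DWp n : (D * W ^+ (p * n) = U ^+ (m0 * n) * D)%g.
Proof.
elim: n => [|n IH]; first by rewrite !muln0 !expg0 mulg1 mul1g.
by rewrite mulnS expgnDr mulgA DW -mulgA IH mulgA -expgnDr mulnS.
Qed.
(** On [alw] only powers of U appear, and these are invisible on [Ab]; passing to [al] turns the
    trivial cocycle into the coboundary of [g_]. *)
Lemma mv_W (b : 'F_p) : mv (W ^+ val b)%g (pl_w b) (fun y => (g_ y)^-1 * g_ (pl_w b y))%g.
Proof.
move=> y; split; first by auto.
have [n Hn] : exists n, (alw (pl_inv y) * W ^+ val b = U ^+ n * alw (pl_tr b (pl_inv y)))%g.
  case: (pl_inv y) => [x|] /=.
  - exists (m0 * ((val x + val b) %/ p))%N.
    have EW : (W ^+ val x * W ^+ val b = W ^+ (p * ((val x + val b) %/ p)) * W ^+ val (x + b)%R)%g.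
      by rewrite -!expgnDr; congr (W ^+ _)%g; rewrite (mulnC p); exact: valFD.
    by rewrite -mulgA EW mulgA DWp mulgA.
  - by exists (p * m0 * val b)%N; rewrite mul1g mulg1 WU -expgnA.
exists ((g_ y)^-1 * U ^+ n * g_ (pl_w b y))%g; split.
- by apply: GamM; auto; apply: GamM; auto; apply: GamX.
- by move=> v Av; rewrite !actM AbU //; auto.
- by rewrite !alwE /pl_w pl_invK -[in RHS]mulgA mulVKg -!mulgA -Hn.
Qed.

(** Moving [al y] past k leaves an element a of Gam, and conjugation by a disappears on [Ab]. *)
Lemma Del_conj k s C b : mv k s C -> Del b -> Del (k * b * k^-1)%g /\
  forall v y, Ab v -> v @@ (al y * (k * b * k^-1) * (al y)^-1) = v @@ (al (s y) * b * (al (s y))^-1).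
Proof.
move=> H Hb.
have E y a : (al y * k = a * al (s y))%g ->
   (al y * (k * b * k^-1) * (al y)^-1 = a * (al (s y) * b * (al (s y))^-1) * a^-1)%g.
  by move=> Ha; rewrite !mulgA Ha -!mulgA -invMg Ha invMg !mulgA.
split=> [y|v y Av]; have [_ [a [Ga _ Ha]]] := H y; rewrite (E _ _ Ha); have Gb := Hb (s y).
  by apply: GamM; auto.
by rewrite actM (actM v a) (actC Av Ga Gb) actK.
Qed.

(** The quotient of k1 by k2 fixes all cosets, so it lies in [Del], and on [M1] its effect is the
    same at every coset; if it is trivial at y0 it is trivial everywhere. *)
Lemma sameperm k1 k2 s C1 C2 y0 v : M1 v -> mv k1 s C1 -> mv k2 s C2 ->
  v @@ C1 y0 = v @@ C2 y0 -> forall y, v @@ C1 y = v @@ C2 y.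
Proof.
move=> [Av Hv] H1 H2 E0.
have E y : exists a1 a2, [/\ Gam a1, Gam a2, eqA a1 (C1 y), eqA a2 (C2 y) & (al y * (k1 * k2^-1) * (al y)^-1 = a1 * a2^-1)%g].
  have [_ [a1 [G1 E1 Ha1]]] := H1 y; have [_ [a2 [G2 E2 Ha2]]] := H2 y.
  exists a1, a2; split=> //.
  by rewrite mulgA Ha1 -!mulgA -invMg Ha2 invMg !mulgA mulgK.
have HD : Del (k1 * k2^-1)%g by move=> y; have [a1 [a2 [G1 G2 _ _ ->]]] := E y; auto.
have Hb : v @@ (k1 * k2^-1) = v.
  have [a1 [a2 [G1 G2 E1 E2 Ea]]] := E y0.
  by rewrite -(Hv _ HD y0) Ea actM E1 // E0 -E2 // actK.
move=> y; have [a1 [a2 [G1 G2 E1 E2 Ea]]] := E y.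
by rewrite -E1 // -E2 // -{2}Hb -(Hv _ HD y) Ea actM actVK.
Qed.

Lemma sum_w (F : P -> V) y : y != Some 0 -> \sum_b F (pl_w b y) = \sum_z F z - F (Some 0).
Proof.
move=> y0; rewrite /pl_w (sum_tr (fun u => F (pl_inv u))); last first.
  by case: y y0 => [i|] //= i0; rewrite ifN //; apply: contra i0 => /eqP ->.
rewrite [X in _ = X - _](reindex_inj (can_inj (@pl_invK _))) /= sum_option /=.
by rewrite addrC addKr.
Qed.
Lemma sum_s (F : P -> V) y : y != None -> \sum_a F (pl_tr a y) = \sum_z F z - F None.
Proof. by move=> /sum_tr ->; rewrite sum_option addrC addKr. Qed.
Lemma sumF_const (v : V) : \sum_(b : 'F_p) v = v *+ p.
Proof. by rewrite sumr_const card_Fp. Qed.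
Lemma p0 : (0 < p)%N. Proof. exact: prime_gt0. Qed.

Definition ev (h : P -> V) : V := \sum_y h y @@ al y.
Lemma ev_mv k s C h : mv k s C -> (forall y, Ab (h y)) ->
  ev h @@ k = \sum_y h y @@ C y @@ al (s y).
Proof.
move=> H Ah; rewrite /ev act_sum; apply: eq_bigr => y _.
by have [_ [a [Ga Ea Ha]]] := H y; rewrite -actM Ha actM Ea.
Qed.
Lemma ev_Del b h : Del b -> ev h @@ b = \sum_y h y @@ (al y * b * (al y)^-1) @@ al y.
Proof.
by move=> Hb; rewrite /ev act_sum; apply: eq_bigr => y _; rewrite -!actM mulgVK.
Qed.

Lemma ev_conj k s C b h : mv k s C -> Del b -> (forall y, Ab (h y)) ->
  ev h @@ (k * b * k^-1) = \sum_y h y @@ (al (s y) * b * (al (s y))^-1) @@ al y.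
Proof.
move=> H Hb Ah; have [Hb' E] := Del_conj H Hb; rewrite ev_Del //.
by apply: eq_bigr => y _; rewrite E.
Qed.

(* Conjugating [b] by all powers of W, resp. of S, sums over the cosets other than 0, resp. oo;
   the difference of the two only sees the coefficient of the coset 0. *)
Lemma isolate0 h : (forall y, Ab (h y)) -> h None = 0 -> ev h = 0 -> M1 (h (Some 0)).
Proof.
move=> Ah h0 Eh; split=> //.
pose F b y z := h y @@ (al z * b * (al z)^-1).
pose sg := fun y : P => pl_tr (-1) (pl_w 1 y).
have sg_inj : injective sg by move=> x y /pl_tr_inj /pl_w_inj.
have rsg (H : P -> V) : \sum_z H (sg z) = \sum_z H z by rewrite [RHS](reindex_inj sg_inj).
have sgN : sg None = Some 0.
  exact: pl_swap.
have mvg := mv_comp (mv_W 1) (mv_S (-1)).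
(* Coset 0 is fixed by W and counts p times in the first family, while in the second it meets every
   coset but [sg None], which is 0. The other cosets cancel because both families omit exactly coset
   0 for them. *)
have key b : Del b -> F b (Some 0) (Some 0) *+ p.+1 = \sum_z F b (Some 0) z.
  move=> Hb; set g := (W ^+ val (1%R : 'F_p) * S ^+ val (-1%R : 'F_p))%g in mvg.
  have [Hb' Eb'] := Del_conj mvg Hb; set b' := (g * b * g^-1)%g in Hb' Eb'.
  have X1 : \sum_y (\sum_m F b y (pl_w m y)) @@ al y = 0.
    under eq_bigr => y _ do rewrite act_sum.
    rewrite exchange_big /= big1 // => m _.
    by rewrite -(ev_conj (mv_W m) Hb Ah) Eh act0.
  have X2 : \sum_y (\sum_a F b y (sg (pl_tr a y))) @@ al y = 0.
    under eq_bigr => y _ do rewrite act_sum.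
    rewrite exchange_big /= big1 // => a _.
    transitivity (ev h @@ (S ^+ val a * b' * (S ^+ val a)^-1)); last by rewrite Eh act0.
    rewrite (ev_conj (mv_S a) Hb' Ah); apply: eq_bigr => y _.
    by rewrite Eb'.
  have {X1 X2} X : \sum_y (\sum_m F b y (pl_w m y) - \sum_a F b y (sg (pl_tr a y))) @@ al y = 0.
    under eq_bigr => y _ do rewrite actB.
    by rewrite sumrB X1 X2 subrr.
  move: X; rewrite (bigD1 (Some 0)) //= [X in _ + X]big1 => [|y y0]; last first.
    case: y y0 => [i|] // i0; last by rewrite !big1 ?subrr ?act0 // => ? _; rewrite /F h0 act0.
    rewrite sum_w // (sum_s (fun z => F b (Some i) (sg z))) // sgN.
    by rewrite rsg subrr act0.
  rewrite addr0 expg0 act1.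
  under eq_bigr => m _ do rewrite pl_w0.
  have Es := @sum_s (fun z => F b (Some 0) (sg z)) (Some 0) isT; cbv beta in Es.
  rewrite sumF_const Es sgN rsg.
  by move/eqP; rewrite opprB addrA -mulrSr subr_eq0 => /eqP.
(* The right side of [key] is a sum over all cosets, so it does not change when k permutes them. *)
have step s k C b : mv k s C -> injective s -> Del b -> F b (Some 0) (s (Some 0)) = F b (Some 0) (Some 0).
  move=> H s_inj Hb; have [Hb' E] := Del_conj H Hb.
  have EF z : F b (Some 0) (s z) = F (k * b * k^-1)%g (Some 0) z by rewrite /F E.
  apply: (@torsE p.+1) => //; rewrite EF (key _ Hb') (key _ Hb) [RHS](reindex_inj s_inj) /=.
  by apply: eq_bigr => z _; rewrite EF.
have F0 b : F b (Some 0) (Some 0) = h (Some 0) @@ b by rewrite /F /= expg0 mul1g invg1 mulg1.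
move=> b Hb y; rewrite -[RHS]F0; case: y => [i|].
  have E0 : pl_tr i (Some 0) = Some i by congr Some; exact: add0r.
  by rewrite -E0; exact: (step _ _ _ _ (mv_S i) (@pl_tr_inj _ i) Hb).
rewrite -(pl_swap' 'F_p); apply: (step _ _ _ _ (mv_comp (mv_S (-1)) (mv_W 1)) _ Hb).
by move=> x y /pl_w_inj /pl_tr_inj.
Qed.

Lemma ev_shift (a : 'F_p) h : (forall y, Ab (h y)) -> h None = 0 ->
  ev h @@ S ^+ val a = ev (fun y => if y is Some i then h (Some (i - a)) else 0).
Proof.
move=> Ah h0; rewrite (ev_mv (mv_S a) Ah) /ev !sum_option /= h0 !act0 !add0r.
rewrite [RHS](reindex_inj (addIr a)) /=; apply: eq_bigr => i _; by rewrite act1 addrK.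
Qed.

(** Translation by S^(-i) moves index i to 0, where [isolate0] applies. *)
Lemma isolate (h : 'F_p -> V) : (forall i, Ab (h i)) -> \sum_i h i @@ S ^+ val i = 0 -> forall i, M1 (h i).
Proof.
move=> Ah E i; pose hh (y : P) := if y is Some j then h j else 0.
have Ahh y : Ab (hh y) by case: y => /=.
have Eh : ev hh = 0 by rewrite /ev sum_option /= act0 add0r.
have := ev_shift (- i) Ahh erefl; rewrite Eh act0 => E'.
have := @isolate0 (fun y => if y is Some j then hh (Some (j - - i)) else 0) _ erefl (esym E').
by rewrite /= opprK add0r; apply; case.
Qed.

(** By [HK] the element a acts like some b in [Del]; applying b to the relation conjugates it by
    [al], which [M1] ignores. *)
Lemma Kscale (h : 'F_p -> V) a : (forall i, M1 (h i)) -> \sum_i h i @@ S ^+ val i = 0 -> Gam a ->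
  \sum_i h i @@ a @@ S ^+ val i = 0.
Proof.
move=> Hh E Ga; have [b [Hb Eb]] := HK Ga.
have /(congr1 (fun v => v @@ b)) := E; rewrite act0 act_sum => {2}<-.
apply: eq_bigr => i _; have [Ai Mi] := Hh i.
by rewrite Eb // -(Mi _ Hb (Some i)) /= -!actM mulgVK.
Qed.

(** Averaging the relation over W gives one with coefficient p k at coset 0 and H(y) elsewhere.
    Averaging that over S kills the finite cosets by [Kscale] and leaves H(infinity) = 0. As all
    H(y) are images of it, only p k = 0 remains. *)
Lemma M1_sum_zero k : M1 k -> \sum_i k @@ S ^+ val (i : 'F_p) = 0 -> k = 0.
Proof.
move=> Mk E; have Ak := Mk.1.
have Ek a : Gam a -> \sum_i k @@ a @@ S ^+ val (i : 'F_p) = 0 by apply: Kscale.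
pose hh (y : P) := if y is Some j then k else 0.
have Ahh y : Ab (hh y) by case: y => /=.
have Eh : ev hh = 0 by rewrite /ev sum_option /= act0 add0r.
pose H (y : P) := \sum_(i | i != 0) k @@ ((g_ (Some i))^-1 * g_ y).
have AH y : Ab (H y) by apply: Ab_sum => i; auto.
pose h2 (y : P) := if y == Some 0 then k *+ p else H y.
have E2 : ev h2 = 0.
  have : \sum_b ev hh @@ W ^+ val (b : 'F_p) = 0 by rewrite big1 // => b _; rewrite Eh act0.
  under eq_bigr => b _ do rewrite (ev_mv (mv_W b) Ahh).
  rewrite exchange_big /= sum_option /= big1 ?add0r => [|b _]; last by rewrite !act0.
  rewrite (bigD1 0) //. under eq_bigr => b _ do rewrite pl_w0 mulVg act1.
  rewrite sumF_const => E1.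
  rewrite -[RHS]E1 /ev (bigD1 (Some 0)) // {1}/h2 eqxx actMn; congr (_ + _).
  transitivity (\sum_(y | y != Some 0) H y @@ al y).
    by apply: eq_bigr => y /negPf y0; rewrite /h2 y0.
  under [LHS]eq_bigr => y _ do rewrite /H act_sum.
  rewrite exchange_big /=; apply: eq_bigr => i i0.
  rewrite (sum_w (fun y => k @@ ((g_ (Some i))^-1 * g_ y) @@ al y)); last first.
    by apply: contra i0 => /eqP [->].
  by rewrite [X in _ = X - _](bigD1 (Some 0)) // [RHS]addrC addKr.
have Ah2 y : Ab (h2 y) by rewrite /h2; case: ifP => // _; elim: (p) => [|n IH]; rewrite ?mulr0n // mulrS; auto.
have HN : H None = 0.
  have : \sum_a ev h2 @@ S ^+ val (a : 'F_p) = 0 by rewrite big1 // => b _; rewrite E2 act0.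
  under eq_bigr => b _ do rewrite (ev_mv (mv_S b) Ah2).
  rewrite exchange_big /= sum_option /=.
  rewrite sumF_const act1 big1 => [|i _].
    rewrite addr0 -actMn => E3. apply: (@tors _ p.-1); rewrite prednK ?p0 //.
    by apply: (@act_inj D); rewrite E3 act0.
  have Es := @sum_tr _ V (fun y => h2 (Some i) @@ 1 @@ al y) (Some i) isT; cbv beta in Es; rewrite Es /=.
  under eq_bigr => j _ do rewrite act1.
  rewrite /h2 (inj_eq (@Some_inj _)); case: ifP => i0.
    under eq_bigr => j _ do rewrite actMn.
    by rewrite sumrMnl E mul0rn.
  under eq_bigr => j _ do rewrite /H act_sum.
  rewrite exchange_big /= big1 // => j _; apply: (Ek ((g_ (Some j))^-1 * g_ (Some i))%g); auto.
(* The sum over i in [H] ends with the factor [g_ y], which is 1 at infinity. *)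
have Hz y : H y = 0.
  have -> : H y = H None @@ g_ y.
    rewrite /H act_sum; apply: eq_bigr => i _; by rewrite -actM -mulgA /= mul1g.
  by rewrite HN act0.
move: E2; rewrite /ev (bigD1 (Some 0)) //= big1 => [|y y0]; last first.
  by rewrite /h2 (negPf y0) Hz act0.
rewrite addr0 expg0 act1 /h2 eqxx => Ekp.
by apply: (@tors _ p.-1); rewrite prednK ?p0.
Qed.

Lemma mv_ext k s C s' C' : mv k s C -> s =1 s' -> C =1 C' -> mv k s' C'.
Proof. by move=> H Es EC y; rewrite -Es -EC; exact: H. Qed.

(** A lift of the Weyl element y -> - i^2 / y, with cocycle [Cn]; [mv_n'] treats the other word of
    the braid relation. *)
Definition nS (i : 'F_p) : G := (S ^+ val (- i)%R * (W ^+ val (i^-1)%R * S ^+ val (- i)%R))%g.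
Definition Cn (i : 'F_p) (y : P) : G := ((g_ (pl_tr (- i) y))^-1 * g_ (pl_w (i^-1)%R (pl_tr (- i)%R y)))%g.
Arguments Cn i%_R y.
Lemma mv_n (i : 'F_p) : i != 0 -> mv (nS i) (pl_neg i) (Cn i).
Proof.
move=> i0; apply: (mv_ext (mv_comp (mv_S (- i)) (mv_comp (mv_W i^-1) (mv_S (- i))))) => y /=.
  exact: pl_n.
by rewrite /Cn mul1g mulg1.
Qed.
Lemma mv_n' (i : 'F_p) : i != 0 -> mv (W ^+ val (i^-1)%R * (S ^+ val (- i)%R * W ^+ val (i^-1)%R))%g (pl_neg i)
  (fun y => ((g_ y)^-1 * g_ (pl_w (i^-1)%R y)) *
    ((g_ (pl_tr (- i)%R (pl_w (i^-1)%R y)))^-1 * g_ (pl_neg i y)))%g.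
Proof.
move=> i0; apply: (mv_ext (mv_comp (mv_W i^-1) (mv_comp (mv_S (- i)) (mv_W i^-1)))) => y /=.
  exact: pl_n'.
by rewrite mul1g pl_n'.
Qed.

Definition gs (a : 'F_p) : G := g_ (Some a).
Arguments gs a%_R.
Lemma Ggs a : Gam (gs a). Proof. exact: Gg. Qed.
Hint Resolve Ggs : core.
Lemma Cn0 (i : 'F_p) : i != 0 -> Cn i (Some 0) = ((gs (- i)%R)^-1)%g.
Proof.
move=> i0; rewrite /Cn.
have -> : pl_tr (- i) (Some 0 : P) = Some (- i) by congr Some; exact: add0r.
by rewrite pl_wSN ?oppr_eq0 ?invrN ?addNr // mulg1.
Qed.
Lemma CnN (i : 'F_p) : i != 0 -> Cn i None = gs i.
Proof. by move=> i0; rewrite /Cn pl_wN ?invr_eq0 // invrK invg1 mul1g. Qed.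

Section FixedVector.
Variable k : V.
Hypothesis Mk : M1 k.
Hypothesis Sk : \sum_(i : 'F_p | i != 0) k @@ gs i = c k *+ p.-1.
Let Ak : Ab k := Mk.1.

(** As a permutation [nS i * nS 1] is a dilation by i^(-2), and commutes with S^a and W^(1/a) up to
    replacing a by a/i^2. [sameperm] applied to both commutations relates its cocycle at 0, a and
    infinity, and eliminating the value at a gives the identity. *)
Lemma torus (i a : 'F_p) : i != 0 -> a != 0 ->
  k @@ gs a @@ gs 1 @@ gs (-1) = k @@ gs (a / i ^+ 2) @@ gs i @@ gs (- i).
Proof.
move=> i0 a0; set e := i ^- 2.
have e0 : e != 0 by rewrite invr_eq0 expf_neq0.
have o0 : (1 : 'F_p) != 0 by exact: oner_neq0.
pose Ct y := (Cn i y * Cn 1%R (pl_neg i y))%g.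
have mvt : mv (nS i * nS 1%R) (pl_dil e) Ct.
  by apply: (mv_ext (mv_comp (mv_n i0) (mv_n o0))) => y //=; rewrite pl_neg2.
have GCt y : Gam (Ct y) by apply: GamM; apply: GamM; auto.
have Ct0 : Ct (Some 0) = ((gs (- i))^-1 * gs 1)%g by rewrite /Ct Cn0 // [pl_neg _ _]/= ?eqxx CnN.
have CtN : Ct None = (gs i * (gs (- 1))^-1)%g by rewrite /Ct CnN // [pl_neg _ _]/= Cn0.
have E1 : k @@ Ct (Some a) = k @@ Ct (Some 0).
  have H1 := mv_comp (mv_S a) mvt; have H2 := mv_comp mvt (mv_S (a * e)).
  have H2' := mv_ext H2 (fun y => esym (pl_dil_tr e a y)) (fun=> erefl).
  have := @sameperm _ _ _ _ _ None k Mk H1 H2' _ (Some 0).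
  by rewrite /= !mul1g !mulg1 add0r; apply.
have E2 : k @@ (gs a * Ct (Some a)) = k @@ (Ct None * gs (a * e)).
  have H1 := mv_comp (mv_W a^-1) mvt; have H2 := mv_comp mvt (mv_W (a^-1 / e)).
  have H2' := mv_ext H2 (fun y => esym (pl_dil_w a^-1 y e0)) (fun=> erefl).
  have := @sameperm _ _ _ _ _ (Some 0) k Mk H1 H2' _ None.
  have -> : pl_dil e (None : P) = None by [].
  have -> : pl_dil e (Some 0 : P) = Some 0 by congr Some; exact: mul0r.
  have ai : a^-1 != 0 by rewrite invr_eq0.
  have aei : a^-1 / e != 0 by apply: mulf_neq0 => //; rewrite invr_eq0.
  have Ei : (a^-1 / e)^-1 = a * e by rewrite invfM !invrK.
  rewrite !pl_w0 (pl_wN ai) (pl_wN aei) Ei invrK !mulVg mul1g mulg1 !invg1 !mul1g.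
  by apply.
move: E2; rewrite (actM k (gs a)) (actM k (Ct None)) (actC Ak (Ggs a) (GCt _)) E1 Ct0 CtN (actM k ((gs (- i))^-1)%g (gs 1)) (actM k (gs i) ((gs (-1))^-1)%g) => E2.
set A := gs a in E2 *; set E := gs (a / i ^+ 2) in E2 *; set B := gs 1 in E2 *.
set X := gs (- i) in E2 *; set Y := gs (-1) in E2 *; set I := gs i in E2 *.
have [GA GE GB] : [/\ Gam A, Gam E & Gam B] by split; exact: Ggs.
have [GX GY GI] : [/\ Gam X, Gam Y & Gam I] by split; exact: Ggs.
have := congr1 (fun v => v @@ Y @@ X) E2; rewrite /=.
rewrite (actC (v := k @@ I @@ Y^-1)); auto; rewrite actVK.
rewrite (actC (v := k @@ X^-1 @@ B)); auto. rewrite (actC (v := k @@ X^-1 @@ B @@ Y)); auto.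
rewrite (actC (v := k @@ X^-1 @@ B)); auto. rewrite (actC (v := k @@ X^-1)); auto.
rewrite actVK (actC (v := k @@ B)); auto. rewrite (actC Ak) //; auto.
by rewrite (actC Ak GI).
Qed.

(** Summing [torus] over a turns the factors [gs a] and [gs (a / i^2)] into the same scalar (p - 1)
    c, by [Sk]; c and p - 1 can be cancelled. *)
Lemma gs_cross i : i != 0 -> k @@ gs 1 @@ gs (-1) = k @@ gs i @@ gs (- i).
Proof.
move=> i0; apply: (@c_inj); apply: (@torsE p.-1); first by case: (p) p2 => [|[]].
have E : \sum_(a : 'F_p | a != 0) k @@ gs (a / i ^+ 2) = c k *+ p.-1.
  have i20 : i ^- 2 != 0 by rewrite invr_eq0 expf_neq0.
  rewrite -Sk [RHS](reindex_inj (mulIf i20)) /=; apply: eq_bigl => a.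
  by rewrite mulf_eq0 (negPf i20) orbF.
rewrite -!cA -!actMn -{1}Sk -E !act_sum; apply: eq_bigr => a a0; exact: torus.
Qed.

(** Once [gs_cross] has identified the remaining factors, [torus] with i = 1/u compares a with a
    u^2. *)
Lemma gs_sq a u : a != 0 -> u != 0 -> k @@ gs (a * u ^+ 2) = k @@ gs a.
Proof.
move=> a0 u0; have i0 : u^-1 != 0 by rewrite invr_eq0.
have := torus i0 a0; rewrite -exprVn invrK => E.
apply: (@act_inj (gs 1)); apply: (@act_inj (gs (-1))); rewrite E.
have Ga := Ggs (a * u ^+ 2).
rewrite (actC Ak Ga (Ggs 1)) (actC (Ab_act Ak (Ggs 1)) Ga (Ggs _)) (gs_cross i0).
by rewrite (actC (Ab_act Ak (Ggs _)) (Ggs _) Ga) (actC Ak (Ggs _) Ga).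
Qed.

(** Words in the commuting operators [gs a] applied to k; by [acts_perm] only the multiset of
    letters matters. *)
Definition acts (s : seq 'F_p) := foldl (fun v a => v @@ gs a) k s.
Lemma Ab_acts v (s : seq 'F_p) : Ab v -> Ab (foldl (fun v a => v @@ gs a) v s).
Proof. by elim: s v => //= a s IH v Av; apply: IH; auto. Qed.
Lemma acts_rot v a s : Ab v -> foldl (fun v a => v @@ gs a) (v @@ gs a) s = foldl (fun v a => v @@ gs a) v s @@ gs a.
Proof. by elim: s v => //= b s IH v Av; rewrite (actC Av) // IH; auto. Qed.
Lemma acts_perm s1 s2 : perm_eq s1 s2 -> acts s1 = acts s2.
Proof.
rewrite /acts; elim: s1 s2 k Ak => [|a s IH] s2 v Av; first by move/perm_size/esym/size0nil => ->.
move=> H; have as2 : a \in s2 by rewrite -(perm_mem H) mem_head.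
case/splitPr: as2 H => x y; rewrite perm_sym perm_catC cat_cons perm_cons perm_catC perm_sym => H.
rewrite /= (acts_rot a s Av) (IH _ _ Av H) !foldl_cat /= (acts_rot a y (Ab_acts x Av)) //.
Qed.
Lemma acts_sq a u s : a != 0 -> u != 0 -> acts (a * u ^+ 2 :: s) = acts (a :: s).
Proof. by move=> a0 u0; rewrite /acts /= gs_sq. Qed.
Lemma acts_cat s t : acts (s ++ t) = foldl (fun v a => v @@ gs a) (acts s) t.
Proof. by rewrite /acts foldl_cat. Qed.
Lemma acts_inj s t r : acts (s ++ r) = acts (t ++ r) -> acts s = acts t.
Proof.
rewrite !acts_cat; move: (acts s) (acts t); elim: r => //= a r IH u v /IH; exact: act_inj.
Qed.
Lemma acts_cross i s : i != 0 -> acts [:: 1, -1 & s] = acts [:: i, - i & s].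
Proof. by move=> i0; rewrite /acts /= (gs_cross i0). Qed.

(** The two words of the braid relation induce the same permutation and their cocycles agree at 0,
    hence at j = i m^2. The letters met there are, up to squares, i, i n, -i and -i n with n = 1 +
    m^2. *)
Lemma braid i m : i != 0 -> m != 0 -> 1 + m ^+ 2 != 0 ->
  acts [:: i; i] = acts [:: i * (1 + m ^+ 2); i * (1 + m ^+ 2)].
Proof.
move=> i0 m0' n0; set n := 1 + m ^+ 2 in n0 *; pose j := i * m ^+ 2.
have j0 : j != 0 by rewrite mulf_neq0 ?expf_neq0.
have in0 : i * n != 0 by rewrite mulf_neq0.
have mi0 : - i != 0 by rewrite oppr_eq0.
have min0 : - (i * n) != 0 by rewrite oppr_eq0.
have := @sameperm _ _ _ _ _ (Some 0) k Mk (mv_n i0) (mv_n' i0) _ (Some j).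
rewrite Cn0 // pl_w0 mulVg mul1g.
have -> : pl_tr (- i) (Some 0 : P) = Some (- i) by congr Some; exact: add0r.
have -> : pl_neg i (Some 0) = None by rewrite /= ?eqxx.
have -> : g_ None = 1%g by [].
rewrite mulg1 => /(_ erefl).
have nj : pl_neg i (Some j) = Some (- i * (m^-1) ^+ 2).
  rewrite /pl_neg (negPf j0); congr Some; rewrite /j exprVn.
  by rewrite invfM expr2 !mulNr mulrA mulfK.
have -> : pl_w i^-1 (Some j) = Some (i * n * (m / n) ^+ 2).
  rewrite pl_wS ?braid_w // -[_ + _]invrK braid_w // invr_eq0.
  by rewrite !mulf_neq0 ?expf_neq0 ?mulf_neq0 ?invr_eq0.
have -> : pl_tr (- i) (Some (i * n * (m / n) ^+ 2)) = Some (- (i * n) * (n^-1) ^+ 2).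
  by congr Some; exact: braid_tr.
(* One side of the comparison is trivial: the two indices in this cocycle are j - i and (j - i)/m^2,
   in the same square class. *)
have -> : k @@ Cn i (Some j) = k.
  have Ew : pl_w i^-1 (pl_tr (- i) (Some j)) = Some ((j - i) * m^-1 ^+ 2).
    apply: (@pl_tr_inj _ (- i)); rewrite pl_n // nj; congr Some.
    by rewrite -braid_n // addrK.
  rewrite /Cn Ew; have -> : pl_tr (- i) (Some j) = Some (j - i) by [].
  have [->|ji] := eqVneq (j - i) 0; first by rewrite mul0r mulVg act1.
  rewrite actM; apply: (@act_inj (gs (j - i))).
  rewrite (actC (Ab_act Ak _)) ?actVK; auto.
  by rewrite gs_sq ?invr_eq0.
rewrite nj => Hk.
have E : acts [:: i; - (i * n)] = acts [:: i * n; - i].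
  have Gi a : Gam (gs a)^-1%g by apply: GamV.
  have u1 : m / n != 0 by rewrite mulf_neq0 ?invr_eq0.
  have u2 : n^-1 != 0 by rewrite invr_eq0.
  have u3 : m^-1 != 0 by rewrite invr_eq0.
  set a := i * n * (m / n) ^+ 2 in Hk; set b := - (i * n) * n^-1 ^+ 2 in Hk; set d := - i * m^-1 ^+ 2 in Hk.
  have : acts [:: j; b] = acts [:: a; d].
    have AX X Y Z : Gam X -> Gam Y -> Gam Z -> Ab (k @@ X @@ Y @@ Z) by auto.
    have := congr1 (fun v => v @@ gs b @@ gs j) Hk; cbv beta.
    rewrite (actC Ak (Ggs b) (Ggs j)) actM (actM k _ (gs a)) (actM _ _ (gs d)).
    rewrite (@actC _ (gs d) (gs b)) ?actVK; auto.
    rewrite (@actC _ (gs d) (gs j)); auto.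
    rewrite (@actC (k @@ (gs j)^-1) (gs a) (gs j)) ?actVK; auto.
  have P2 x y : acts [:: x; y] = acts [:: y; x].
    exact/acts_perm/permEl/(perm_catC [:: x]).
  have -> : acts [:: j; b] = acts [:: i; - (i * n)].
    have Eb : acts [:: b; i] = acts [:: - (i * n); i] by exact: acts_sq.
    by rewrite (acts_sq [:: b] i0 m0') (P2 i b) Eb (P2 (- (i * n)) i).
  have Ea : acts [:: a; d] = acts [:: i * n; d] by exact: acts_sq.
  have Ed : acts [:: d; i * n] = acts [:: - i; i * n] by exact: acts_sq.
  by rewrite Ea (P2 (i * n) d) Ed (P2 (- i) (i * n)).
(* The pair 1, -1 may be rewritten as i n, - i n next to i, i, or as i, - i next to i n, i n; then
   [E] turns one word into the other. *)
apply: (@acts_inj _ _ [:: 1; -1]).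
have -> : acts ([:: i; i] ++ [:: 1; -1]) = acts ([:: 1; -1] ++ [:: i; i]).
  exact/acts_perm/permEl/(perm_catC [:: i; i]).
have -> : acts ([:: i * n; i * n] ++ [:: 1; -1]) = acts ([:: 1; -1] ++ [:: i * n; i * n]).
  exact/acts_perm/permEl/(perm_catC [:: i * n; i * n]).
rewrite (acts_cross [:: i; i] in0) (acts_cross [:: i * n; i * n] i0).
have -> : acts [:: i; - i; i * n; i * n] = acts [:: i; - (i * n); i; i * n].
  transitivity (foldl (fun v a => v @@ gs a) (acts [:: i; - (i * n)]) [:: i; i * n]); last by rewrite -acts_cat.
  by rewrite E -acts_cat; apply: acts_perm; apply: perm_swap13.
by apply: acts_perm; apply: perm_swap14.
Qed.

(** With x and y the actions of the two square classes on k, averaging gives x + y = 2c and [braid]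
    gives x^2 = y^2. Hence 2c x = x^2 + x y = y^2 + x y = 2c y, so x = y = c. *)
Lemma eigen i : i != 0 -> k @@ gs i = c k.
Proof.
move=> i0; have [m [m0' n0 Hcl]] := Fp_square_classes pP p2.
set n := 1 + m ^+ 2 in n0 Hcl.
have p10 : (0 < p.-1)%N by case: (p) p2 => [|[]].
have o0 : (1 : 'F_p) != 0 by exact: oner_neq0.
have cl a : a != 0 -> k @@ gs a = k @@ gs 1 \/ k @@ gs a = k @@ gs n.
  move=> a0; have [u u0 [->|->]] := Hcl a a0; [left|right]; last exact: gs_sq.
  by rewrite -[u ^+ 2]mul1r gs_sq.
have cl2 a : a != 0 -> k @@ gs a + k @@ gs (a * n) = k @@ gs 1 + k @@ gs n.
  move=> a0; have [u u0 [->|->]] := Hcl a a0.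
    rewrite (mulrC (u ^+ 2)) gs_sq // -[u ^+ 2]mul1r gs_sq //.
  rewrite gs_sq // mulrAC -expr2 -exprMn_comm; last exact: mulrC.
  by rewrite -[(n * u) ^+ 2]mul1r gs_sq ?mulf_neq0 // addrC.
have Sum : k @@ gs 1 + k @@ gs n = c k *+ 2.
  apply: (torsE p10).
  transitivity (\sum_(a : 'F_p | a != 0) (k @@ gs a + k @@ gs (a * n))).
    rewrite (eq_bigr (fun=> k @@ gs 1 + k @@ gs n)) //.
    rewrite sumr_const; congr (_ *+ _).
    rewrite (eq_card (B := predC1 0)); last by move=> a; rewrite !inE.
    by rewrite cardC1 card_Fp.
  rewrite big_split /= Sk.
  have -> : \sum_(a : 'F_p | a != 0) k @@ gs (a * n) = c k *+ p.-1.
    rewrite -Sk [RHS](reindex_inj (mulIf n0)) /=; apply: eq_bigl => a.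
    by rewrite mulf_eq0 (negPf n0) orbF.
  by rewrite -mulrnDl -mulr2n.
have Sq : k @@ gs 1 @@ gs 1 = k @@ gs n @@ gs n.
  by have := braid o0 m0' n0; rewrite mul1r.
have E1n : k @@ gs 1 = k @@ gs n.
  apply: c_inj; apply: (@torsE 2) => //.
  have H a : c (k @@ gs a) *+ 2 = (k @@ gs 1 + k @@ gs n) @@ gs a by rewrite Sum actMn cA.
  by rewrite !H !actD Sq (actC Ak (Ggs n) (Ggs 1)) addrC.
have E1 : k @@ gs 1 = c k.
  by apply: (@torsE 2) => //; rewrite -Sum -E1n mulr2n.
by case: (cl _ i0) => ->; rewrite -?E1n.
Qed.
End FixedVector.

(** Adding all translates of the relation by powers of S replaces every coefficient by their
    total. *)
Lemma sum_shift (h : 'F_p -> V) : (forall i, Ab (h i)) -> \sum_i h i @@ S ^+ val i = 0 ->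
  \sum_i (\sum_j h j) @@ S ^+ val (i : 'F_p) = 0.
Proof.
move=> Ah E; pose hh (y : P) := if y is Some j then h j else 0.
have Ahh y : Ab (hh y) by case: y => /=.
have Eh : ev hh = 0 by rewrite /ev sum_option /= act0 add0r.
have : \sum_a ev hh @@ S ^+ val (a : 'F_p) = 0 by rewrite big1 // => a _; rewrite Eh act0.
under eq_bigr => a _ do rewrite (ev_shift a Ahh erefl).
rewrite exchange_big /= sum_option /= big1 ?add0r => [E'|a _]; last by rewrite act0.
rewrite -[RHS]E'; apply: eq_bigr => i _; rewrite act_sum [RHS](reindex_inj (inv_inj (subKr i))).
by apply: eq_bigr => j _; rewrite subKr.
Qed.

(** First each h_i is shown to be an eigenvector of all [gs j]; the relation then collapses to
    [star], whose right side is visibly S-invariant, and the eigenvalue of D is read off. *)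
Theorem coset_relation (f : V) : Ab f ->
  \sum_(i : 'F_p | i != 0) (f @@ gg i - c f) @@ S ^+ val i = 0 ->
  forall i, i != 0 -> let h := f @@ gg i - c f in
  [/\ Ab h, h @@ S = h & h @@ D = c h].
Proof.
move=> Af E0; pose h i := if i == 0 then 0 else f @@ gg i - c f.
have p10 : (0 < p.-1)%N by case: (p) p2 => [|[]].
have Ah i : Ab (h i) by rewrite /h; case: ifPn => // i0; apply: AbD; auto.
have E : \sum_i h i @@ S ^+ val i = 0.
  rewrite (bigD1 0) //= {1}/h eqxx act0 add0r -[RHS]E0.
  by apply: eq_bigr => i /negPf i0; rewrite /h i0.
have Mh := isolate Ah E.
have Sh : \sum_i h i = 0.
  have H := sum_shift Ah E; apply: M1_sum_zero => //.
  by apply: (isolate (h := fun=> \sum_i h i) _ H 0) => i; apply: Ab_sum.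
have Sf : \sum_(i : 'F_p | i != 0) f @@ gs i = c f *+ p.-1.
  have : \sum_(i : 'F_p | i != 0) (f @@ gs i - c f) = 0.
    rewrite -[RHS]Sh [RHS](bigD1 0) //= {1}/h eqxx add0r.
    by apply: eq_bigr => i i0; rewrite /h (negPf i0) /gs /= (negPf i0).
  rewrite sumrB => /subr0_eq ->; rewrite sumr_const; congr (_ *+ _).
  by rewrite (eq_card (B := predC1 0)) ?cardC1 ?card_Fp // => a; rewrite !inE.
(* The averaged identity passes from f to h x, which is obtained from f by operators commuting with
   the [gs i]. *)
have Skh x : \sum_(i : 'F_p | i != 0) h x @@ gs i = c (h x) *+ p.-1.
  rewrite /h; case: ifPn => x0.
    by rewrite c0 mul0rn big1 // => i _; rewrite act0.
  under eq_bigr => i _ do rewrite actB cA (actC Af (Ggg x0) (Ggs i)).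
  rewrite sumrB -act_sum Sf cD cN mulrnBl actMn cA; congr (_ - _).
  rewrite -cMn -Sf (big_morph c cD c0).
  by [].
have eig x i : i != 0 -> h x @@ gs i = c (h x) by apply: eigen.
have c'A v g : c' v @@ g = c' (v @@ g) by rewrite -[LHS]cK -cA cK'.
have c'D u v : c' (u + v) = c' u + c' v by apply: c_inj; rewrite cD !cK'.
have eigV x i : i != 0 -> h x @@ (gs i)^-1 = c' (h x).
  by move=> i0; apply: (@act_inj (gs i)); rewrite actVK c'A eig ?cK.
(* The contribution of a nonzero coset once the eigenvalues are inserted: [c'] from the inverse of
   [gs i] cancels [c] from [gs j] at the finite cosets and survives at infinity. *)
pose L v := \sum_(j : 'F_p | j != 0) v @@ S ^+ val j + c' v @@ D.
have LD u v : L (u + v) = L u + L v.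
  rewrite /L c'D actD addrACA -big_split /=; congr (_ + _).
  by apply: eq_bigr => j _; rewrite actD.
have L0 : L 0 = 0 by apply: (addrI (L 0)); rewrite -LD !addr0.
(* Average over W the relation shifted so that x sits at coset 0: this coset gives p h x, the others
   L of their coefficients, and these coefficients add up to - h x. *)
have star x : h x *+ p.+1 = \sum_(j : 'F_p) h x @@ S ^+ val j + c' (h x) @@ D.
  pose hh (y : P) := if y is Some j then h j else 0.
  have Ahh y : Ab (hh y) by case: y => /=.
  have Eh : ev hh = 0 by rewrite /ev sum_option /= act0 add0r.
  pose h2 (y : P) := if y is Some j then h (j + x) else 0.
  have Ah2 y : Ab (h2 y) by case: y => /=.
  have E2 : ev h2 = 0.
    have := ev_shift (- x) Ahh erefl; rewrite Eh act0 => E'; rewrite [RHS]E'.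
    by apply: eq_bigr => -[j|] _ //; rewrite /h2 /= opprK.
  have : \sum_b ev h2 @@ W ^+ val (b : 'F_p) = 0 by rewrite big1 // => b _; rewrite E2 act0.
  under eq_bigr => b _ do rewrite (ev_mv (mv_W b) Ah2).
  rewrite exchange_big /= sum_option big1 ?add0r => [|b _]; last by rewrite !act0.
  rewrite (bigD1 0) //. under eq_bigr => b _ do rewrite pl_w0 mulVg act1.
  have -> : h2 (Some 0) @@ al (Some 0) = h x by rewrite /h2 add0r /= expg0 act1.
  rewrite sumF_const.
  rewrite (eq_bigr (fun i => L (h (i + x)))) => [|i i0]; last first.
    have Ei : h (i + x) @@ (g_ (Some i))^-1 = c' (h (i + x)) := eigV _ _ i0.
    pose F z := h (i + x) @@ ((g_ (Some i))^-1 * g_ z) @@ al z.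
    rewrite [LHS](_ : _ = \sum_b F (pl_w b (Some i))) // sum_w; last first.
      by apply: contra i0 => /eqP [->].
    rewrite sum_option (bigD1 0) // (addrCA (F None)) [LHS]addrC addKr /L [RHS]addrC /F mulg1 Ei; congr (_ + _).
    apply: eq_bigr => j j0; by rewrite actM Ei c'A -[g_ _]/(gs j) eig // cK.
  rewrite -(big_morph L LD L0) => E3.
  have Es : \sum_(i : 'F_p | i != 0) h (i + x) = - h x.
    by have := Sh; rewrite (reindex_inj (addIr x)) (bigD1 0) //= add0r => /eqP; rewrite addrC addr_eq0 => /eqP.
  have LN : L (- h x) = - L (h x) by apply: (addrI (L (h x))); rewrite -LD !subrr L0.
  move: E3; rewrite Es LN => /eqP; rewrite subr_eq0 => /eqP E3.
  by rewrite mulrS E3 /L [in RHS](bigD1 0) //= expg0 act1 addrA.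
move=> i i0; have -> : f @@ gg i - c f = h i by rewrite /h (negPf i0).
(* S permutes the cosets in [star] with trivial cocycle, so (p + 1) k is S-invariant. *)
move=> k; have Sk : k @@ S = k.
  pose hk (y : P) := if y is Some _ then k else c' k.
  have Ac' : Ab (c' k).
    by have [H1 H2 H3] := Ah i; split=> [a b Ga Gb||]; rewrite !c'A ?H2 ?H3 // H1.
  have Ahk y : Ab (hk y) by case: y => [j|] //=; exact: Ah.
  have Ek : k *+ p.+1 = ev hk by rewrite /ev sum_option addrC; exact: star.
  have E1 : ev hk @@ S ^+ val (1%R : 'F_p) = ev hk.
    rewrite (ev_mv (mv_S 1) Ahk) /ev [RHS](reindex_inj (@pl_tr_inj _ 1)) /=.
    by apply: eq_bigr => -[j|] _; rewrite act1.
  have v1 : val (1 : 'F_p) = 1%N by rewrite /= modn_small.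
  by apply: (@torsE p.+1) => //; rewrite -actMn Ek -[RHS]E1 v1 expg1.
split=> //; first exact: Ah.
have Sn n : k @@ S ^+ n = k by elim: n => [|n IH]; rewrite ?expg0 ?act1 // expgS actM Sk.
have := star i; rewrite -/k.
under eq_bigr => j _ do rewrite Sn.
rewrite sumF_const mulrSr => /addrI Ek.
have -> : c k = c (c' k @@ D) by rewrite -Ek.
by rewrite -cA cK'.
Qed.
End AbelianAction.
End CosetRelation.

(** * The abstract coset relation applied to SL_2(R) and functions on the half-plane *)

Module HeckeCosets.
From HB Require Import structures.
From mathcomp Require Import all_boot all_algebra.
From mathcomp.classical Require Import boolp.
From mathcomp Require Import zify.
From Stdlib Require ZArith Znumtheory.
Import ProjectiveLine SquareClasses CosetRelation.
Set Implicit Arguments. Unset Strict Implicit. Unset Printing Implicit Defensive.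
Import GRing.Theory.
Local Open Scope ring_scope.

Notation SL := SLAction.SL.
Notation VV := SLAction.VV.
(** An alias that receives the MathComp group structure, as [VVT] does that of a Z-module; equality
    is decided classically. *)
Definition SLT : Type := SL.
HB.instance Definition _ := gen_eqMixin SLT.
HB.instance Definition _ := gen_choiceMixin SLT.
HB.instance Definition _ := isGroup.Build SLT SLAction.SLmulA SLAction.SLmul1g SLAction.SLmulg1 SLAction.SLmulVg SLAction.SLmulgV.
Definition VVT : Type := VV.
HB.instance Definition _ := gen_eqMixin VVT.
HB.instance Definition _ := gen_choiceMixin VVT.
HB.instance Definition _ := GRing.isZmodule.Build VVT SLAction.vaddA SLAction.vaddC SLAction.vadd0 SLAction.vaddN.

Lemma prime_of_Z p : Znumtheory.prime (BinInt.Z.of_nat p) -> prime p.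
Proof.
move=> H; have p2 := Znumtheory.prime_ge_2 _ H.
apply/primeP; split; first by lia.
move=> d /dvdnP [k Ek]; have Hd : BinInt.Z.divide (BinInt.Z.of_nat d) (BinInt.Z.of_nat p).
  by exists (BinInt.Z.of_nat k); rewrite -Znat.Nat2Z.inj_mul; congr BinInt.Z.of_nat.
by case: (Znumtheory.prime_divisors _ H _ Hd) => [E|[E|[E|E]]]; apply/orP; rewrite -!(rwP eqP); lia.
Qed.

Lemma SLpowE (g : SLT) n : (g ^+ n)%g = SLAction.SLpow g n.
Proof. by elim: n => [|n IH] //=; rewrite expgS IH. Qed.

Lemma mulrnE (v : VVT) n : v *+ n = SLAction.vscal (Complex.RtoC (Raxioms.INR n)) v.
Proof. by elim: n => [|n IH]; rewrite ?SLAction.vscal_nat0 // mulrS IH SLAction.vscal_natS. Qed.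

Lemma vsumE (s : seq nat) (F : nat -> VVT) : SLAction.vsum s F = \sum_(a <- s) F a.
Proof. by elim: s => [|a s IH]; rewrite ?big_nil // big_cons -IH. Qed.

Lemma list_seq_iota m n : List.seq m n = iota m n.
Proof. by elim: n m => //= n IH m; rewrite IH. Qed.

Section Hecke.
Local Notation INR := Raxioms.INR.
Local Notation r0 := (Rdefinitions.IZR BinNums.Z0).
Local Notation r1 := (Rdefinitions.IZR (BinNums.Zpos BinNums.xH)).
Variables (N p k : nat) (f : Complex.C -> Complex.C) (xi : Complex.C).
Hypothesis HN : Znumtheory.prime (BinInt.Z.of_nat N).
Hypothesis HP : Znumtheory.prime (BinInt.Z.of_nat p).
Hypothesis p2 : (2 < p)%N.
Hypothesis Hne : N <> p.
Hypothesis H0 : INR p <> r0.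
Hypothesis xi0 : xi <> Complex.RtoC r0.
Local Notation act := (SLAction.actv k : VVT -> SLT -> VVT).
Let v0 : VVT := SLAction.rest f.
Let Gam := SLAction.GamN N : SLT -> Prop.
Hypothesis Hcomm : forall a b, Gam a -> Gam b -> act v0 (a * b)%g = act v0 (b * a)%g.
Hypothesis HT : act v0 (SLAction.Tr r1) = v0.
Hypothesis HU : act v0 (SLAction.Lo (INR N)) = v0.
Let L a : SLT := SLAction.Lmat (INR p) H0 (Rdefinitions.Rmult (Rdefinitions.Ropp (INR a)) (INR N)).
Let S : SLT := SLAction.Tr (Rdefinitions.Rdiv r1 (INR p)).
Hypothesis Hrel :
  SLAction.vsum (RamanujanTwists.units p) (fun a => act v0 (SLAction.Tr (Rdefinitions.Rmult (INR a) (Rdefinitions.Rdiv r1 (INR p))))) =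
  SLAction.vscal xi (SLAction.vsum (RamanujanTwists.units p) (fun a => act v0 (L a))).

Let pP : prime p := prime_of_Z HP.
Let NF : 'F_p := N%:R.
(** With x = m0/i the lower-left entry N x of [gg] satisfies N x i = 1 modulo p, as the determinant
    demands. *)
Let m0 : nat := val NF^-1.
Let T : SLT := SLAction.Tr r1.
Let U : SLT := SLAction.Lo (INR N).
Let W : SLT := SLAction.Lo (Rdefinitions.Rmult (Rdefinitions.Rmult (INR N) (INR m0)) (INR p)).
Let D : SLT := SLAction.Di (INR p) H0.
Let c : VVT -> VVT := SLAction.vscal (Complex.Cinv xi).
Let c' : VVT -> VVT := SLAction.vscal xi.

Lemma NF_neq0 : NF != 0.
Proof.
rewrite -(dvdn_pcharf (pchar_Fp pP)); apply/negP => /dvdnP [j Ej].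
have Hd : BinInt.Z.divide (BinInt.Z.of_nat p) (BinInt.Z.of_nat N).
  by exists (BinInt.Z.of_nat j); rewrite -Znat.Nat2Z.inj_mul; congr BinInt.Z.of_nat.
have := Znumtheory.prime_ge_2 _ HP; have := Znumtheory.prime_ge_2 _ HN.
by case: (Znumtheory.prime_divisors _ HN _ Hd) => [E|[E|[E|E]]]; lia.
Qed.

Lemma Fp_eq0_Z n : (n%:R = 0 :> 'F_p) -> BinInt.Z.divide (BinInt.Z.of_nat p) (BinInt.Z.of_nat n).
Proof.
move/eqP; rewrite -(dvdn_pcharf (pchar_Fp pP)) => /dvdnP [j Ej].
by exists (BinInt.Z.of_nat j); rewrite -Znat.Nat2Z.inj_mul; congr BinInt.Z.of_nat.
Qed.

Lemma val_natF (x : 'F_p) : (val x)%:R = x. Proof. exact: natr_Zp. Qed.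

Lemma ggE (i : 'F_p) : gg S W D i = SLAction.SLmul (SLAction.SLmul D (SLAction.Lo (Rdefinitions.Rmult (Rdefinitions.Rmult (INR N) (INR (m0 * val (i^-1)%R)%N)) (INR p))))
  (SLAction.SLinv (SLAction.Tr (Rdefinitions.Rmult (INR (val i)) (Rdefinitions.Rdiv r1 (INR p))))).
Proof. by rewrite /gg !SLpowE /W SLAction.Lo_pow_mul /S SLAction.Tr_pow. Qed.

Lemma sum_units (F : nat -> VVT) : SLAction.vsum (RamanujanTwists.units p) F = \sum_(a : 'F_p | a != 0) F (val a).
Proof.
rewrite SLAction.units_prime // vsumE list_seq_iota.
have -> : iota 1 (PeanoNat.Nat.sub p 1) = index_iota 1 p by rewrite /index_iota; congr iota; lia.
transitivity (\sum_(0 <= a < p | a != 0%N) F a).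
  rewrite [RHS](big_ltn_cond (prime_gt0 pP)) /= big_nat_cond [RHS]big_nat_cond; apply: eq_bigl => a.
  by case: a => [|a]; rewrite ?andbF ?andbT.
transitivity (\sum_(0 <= a < (Zp_trunc (pdiv p)).+2 | a != 0%N) F a); first by rewrite (Fp_cast pP).
exact: big_mkord.
Qed.

(** The three invariance properties are those under which [va_h] makes h vanish. *)
Theorem hecke_entry i : (0 < i < p)%N -> exists g0 : SLT,
  [/\ Gam g0, SLAction.ea g0 = INR p, SLAction.eb g0 = Rdefinitions.Ropp (INR i) &
   let h := act v0 g0 - c v0 in
   [/\ act h S = h, act h D = c h & act h U = h]].
Proof.
move=> Hi; pose j : 'F_p := i%:R.
have vj : val j = i by rewrite -[val _]/(nat_of_ord _) /j val_Fp_nat // modn_small //; case/andP: Hi.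
have j0 : j != 0.
  rewrite -(inj_eq val_inj) vj; case/andP: Hi => i0 _.
  by rewrite -[val _]/(nat_of_ord _) /= -lt0n.
have Fval (x : 'F_p) : x != 0 -> BinInt.Z.divide (BinInt.Z.of_nat p)
    (BinInt.Z.sub (BinInt.Z.mul (BinInt.Z.mul (BinInt.Z.of_nat N) (BinInt.Z.of_nat (m0 * val (x^-1)%R)%N)) (BinInt.Z.of_nat (val x))) (BinInt.Zpos BinNums.xH)).
  move=> x0.
  have E : (N * (m0 * val (x^-1)%R) * val x)%N%:R = 1 :> 'F_p.
    by rewrite !natrM /m0 !val_natF; rewrite mulrA mulfV ?NF_neq0 // mul1r mulVf.
  have n0 : (0 < N * (m0 * val (x^-1)%R) * val x)%N.
    by rewrite lt0n; apply/eqP => En; move/eqP: E; rewrite En eq_sym oner_eq0.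
  have : ((N * (m0 * val (x^-1)%R) * val x).-1)%:R = 0 :> 'F_p.
    by apply: (addIr 1); rewrite add0r natr1 prednK // E.
  move/Fp_eq0_Z => [t Ht]; exists t; rewrite -Ht; lia.
have Ggg (x : 'F_p) : x != 0 -> Gam (gg S W D x).
  by move=> x0; rewrite ggE; apply: SLAction.gg_GamN; exact: Fval.
have Av0 : Ab act Gam T U v0 by split.
have AT (v : VVT) n : Ab act Gam T U v -> act v (SLAction.Tr (INR n)) = v.
  case=> _ H _; rewrite SLAction.Tr_nat -SLpowE; elim: n => [|n IH]; first by rewrite expg0; exact: SLAction.actv1.
  by rewrite expgS SLAction.actvM H.
have AU (v : VVT) n : Ab act Gam T U v -> act v (SLAction.Lo (Rdefinitions.Rmult (INR n) (INR N))) = v.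
  case=> _ _ H; rewrite SLAction.Lo_nat -SLpowE; elim: n => [|n IH]; first by rewrite expg0; exact: SLAction.actv1.
  by rewrite expgS SLAction.actvM H.
have HK (a : SLT) : Gam a -> exists b, Del Gam p S D b /\ eqA act Gam T U a b.
  move=> Ga; have [e [y [x [z [H1 H2]]]]] := SLAction.kscale N p a H0 HN HP Hne Ga.
  exists (SLAction.SLmul (SLAction.SLmul (SLAction.SLmul (SLAction.SLmul a (SLAction.Tr (INR e))) (SLAction.Lo (Rdefinitions.Rmult (INR y) (INR N)))) (SLAction.Tr (INR x)))
    (SLAction.Lo (Rdefinitions.Rmult (INR z) (INR N)))); split.
    by move=> [i'|] /=; rewrite ?SLpowE ?SLAction.Tr_pow; [exact: H1|exact: H2].
  move=> v Av; have Aa : Ab act Gam T U (act v a).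
    exact: (@Ab_act SLT VVT act (SLAction.actvM k) Gam (@SLAction.GamN_M N) _ _ (SLAction.GamN_Tr1 N) (SLAction.GamN_Lo N) v a Av Ga).
  by rewrite !SLAction.actvM AT // AU // AT // AU.
have c'K (v : VVT) : c' (c v) = v by exact: SLAction.vscal_inv'.
have cK' (v : VVT) : c (c' v) = v by exact: SLAction.vscal_inv.
have cD (u v : VVT) : c (u + v) = c u + c v by exact: SLAction.vscalD.
have cA (v : VVT) g : act (c v) g = c (act v g) by exact: SLAction.actv_scal.
have tor (v : VVT) n : v *+ n.+1 = 0 -> v = 0 by rewrite mulrnE; exact: SLAction.vscal_nat_inj.
have EM (v : VVT) (g h : SLT) : act (act v g) h = act v (g * h)%g by exact: esym (SLAction.actvM _ _ _ _).
have c00 : c 0 = 0 by apply: (addrI (c 0)); rewrite -cD !addr0.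
have ST : (S ^+ p)%g = T by rewrite SLpowE; exact: SLAction.Tr_root.
have DS : (D * S)%g = (T ^+ p * D)%g by rewrite SLpowE; exact: SLAction.Di_Tr.
have WU : W = (U ^+ (p * m0))%g by rewrite SLpowE; exact: SLAction.Lo_root.
have DW : (D * W ^+ p)%g = (U ^+ m0 * D)%g by rewrite !SLpowE; exact: SLAction.Di_Lo.
have E0 : \sum_(x : 'F_p | x != 0) act (act v0 (gg S W D x) - c v0) (S ^+ val x)%g = 0.
  (* Up to a power of U on the left, [gg x * S^x = D * W^(1/x)] is the matrix of the relation with a
     = - m0/x, and x -> - m0/x permutes the units. *)
  rewrite (eq_bigr (fun x : 'F_p => act v0 (L (val (- (m0%:R * x^-1)))) - c (act v0 (S ^+ val x)%g))) => [|x x0]; last first.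
    rewrite (@actB SLT VVT act (SLAction.actvD k)) cA; congr (_ - _).
    rewrite EM /gg mulgVK SLpowE SLAction.Lo_pow_mul.
    have Hd : BinInt.Z.divide (BinInt.Z.of_nat p) (BinInt.Z.add (BinInt.Z.of_nat (m0 * val (x^-1)%R)%N) (BinInt.Z.of_nat (val (- (m0%:R * x^-1) : 'F_p)))).
      rewrite -Znat.Nat2Z.inj_add; apply: Fp_eq0_Z.
      by rewrite natrD natrM !val_natF subrr.
    have [t Ht] := SLAction.Lmat_shift N p H0 _ _ Hd.
    by rewrite -[(D * _)%g]/(SLAction.SLmul D _) Ht SLAction.actvM AU.
  rewrite sumrB -(big_morph c cD c00).
  have -> : \sum_(x : 'F_p | x != 0) act v0 (L (val (- (m0%:R * x^-1)))) = \sum_(x : 'F_p | x != 0) act v0 (L (val x)).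
    have m00 : m0%:R != 0 :> 'F_p by rewrite /m0 val_natF invr_eq0 NF_neq0.
    have hinj : injective (fun x : 'F_p => - (m0%:R * x^-1)).
      by move=> x y /oppr_inj /(mulfI m00) /invr_inj.
    rewrite [RHS](reindex_inj hinj) /=; apply: eq_bigl => x.
    by rewrite oppr_eq0 mulf_eq0 (negPf m00) invr_eq0.
  have -> : \sum_(x : 'F_p | x != 0) act v0 (S ^+ val x)%g =
     SLAction.vsum (RamanujanTwists.units p) (fun a => act v0 (SLAction.Tr (Rdefinitions.Rmult (INR a) (Rdefinitions.Rdiv r1 (INR p))))).
    by rewrite sum_units; apply: eq_bigr => x _; rewrite SLpowE SLAction.Tr_pow.
  by rewrite Hrel sum_units -/(c' _) cK' subrr.
have := @coset_relation SLT VVT act (SLAction.actvD k) (SLAction.actvM k) (SLAction.actv1 k) tor c c' cD cA c'K cK'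
   Gam (SLAction.GamN_1 N) (@SLAction.GamN_M N) (@SLAction.GamN_V N) p m0 pP p2 T U S W D (SLAction.GamN_Tr1 N) (SLAction.GamN_Lo N) ST DS WU DW Ggg HK v0 Av0 E0 j j0.
case=> [[_ _ hU] hS hD]; exists (gg S W D j).
have [E1 E2] := SLAction.gg_top N p H0 (m0 * val (j^-1)%R)%N (val j).
by split; [exact: Ggg|rewrite ggE E1|rewrite ggE E2 vj|].
Qed.
End Hecke.
End HeckeCosets.

(** * Transformation of f under elements whose top-left entry is an odd prime *)

Module PrimeTopEntry.
From Corelib Require Import ssreflect.
From Stdlib Require Import Reals Lra Lia ZArith Znumtheory List FunctionalExtensionality ProofIrrelevance.
From Coquelicot Require Import Coquelicot.
Require Import Defs.
Import ComplexIntegral ComplexDerivative MaximumModulus ComplexExponential PhragmenLindelof MellinUniqueness QSeries GammaMellin HeckeFunctionalEquation RamanujanTwists SLAction PeriodVanishing.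
Open Scope R_scope.

Section PrimeEntry.
Variables (N k : nat) (f : C -> C).
Hypothesis HN : prime (Z.of_nat N).
Hypothesis Hk : (0 < k)%nat.
Hypothesis Hhol : forall z : C, 0 < snd z -> exists l, Cder f z l.
Hypothesis HT : forall z : C, 0 < snd z -> f (z + 1)%C = f z.
Hypothesis HU : forall z : C, 0 < snd z -> slR k 1 0 (INR N) 1 f z = f z.
Hypothesis Hcomm : forall g1 g2 : mat2, Gamma0 N g1 -> Gamma0 N g2 ->
     forall z : C, in_H z -> slash k (mmul g1 g2) f z = slash k (mmul g2 g1) f z.

Lemma pe_cont g z : 0 < snd z -> forall eps, 0 < eps -> exists d, 0 < d /\
  forall w : C, 0 < snd w -> Cmod (w - z)%C < d -> Cmod (ext (actv k (rest f) g) w - ext (actv k (rest f) g) z)%C < eps.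
Proof.
  intros Hz eps He.
  set (F := fun z => (/ cpown (jac g z) k * f (mob0 g z))%C).
  assert (HF : exists l, Cder F z l).
  { assert (Hj := jac_neq0 g (exist _ z Hz)). assert (Hm := mob_pos g (exist _ z Hz)). cbn in Hj, Hm.
    unfold F. apply ex_Cder_mult.
    - apply (ex_Cder_inv (fun z => cpown (jac g z) k)); [|apply cpown_neq0; exact Hj].
      apply ex_Cder_cpown, ex_Cder_plus; [|apply ex_Cder_const]. apply ex_Cder_mult; [apply ex_Cder_const|apply ex_Cder_id].
    - apply (ex_Cder_comp f (mob0 g)); [apply Hhol; exact Hm|]. unfold mob0, Cdiv. apply ex_Cder_mult.
      + apply ex_Cder_plus; [|apply ex_Cder_const]. apply ex_Cder_mult; [apply ex_Cder_const|apply ex_Cder_id].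
      + apply (ex_Cder_inv (fun z => jac g z)); [|exact Hj]. apply ex_Cder_plus; [|apply ex_Cder_const]. apply ex_Cder_mult; [apply ex_Cder_const|apply ex_Cder_id]. }
  destruct HF as [l Hl]. destruct (Cder_cont F z l Hl eps He) as [d [Hd H]]. exists d; split; auto.
  intros w Hw Hwz. specialize (H (w - z)%C Hwz). replace (z + (w - z))%C with w in H by ring.
  rewrite !ext_act //. 
  assert (E : forall u : C, 0 < snd u -> ext (rest f) u = f u) by (intros u Hu; change u with (hz (exist _ u Hu)) at 1; rewrite ext_hz; reflexivity).
  rewrite !E; [exact H|apply (mob_pos g (exist _ z Hz))|apply (mob_pos g (exist _ w Hw))].
Qed.

Lemma pe_comm a b : GamN N a -> GamN N b -> actv k (rest f) (SLmul a b) = actv k (rest f) (SLmul b a).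
Proof.
  intros Ha Hb. destruct (GamN_Z N a Ha) as [m1 [D1 [H1 ->]]]. destruct (GamN_Z N b Hb) as [m2 [D2 [H2 ->]]].
  assert (G : forall m m' (D : SL2Z m) (D' : SL2Z m'), SL2Z (mmul m m')).
  { intros m m' D D'. unfold SL2Z in *. unfold mmul. simpl. nia. }
  assert (E : forall m m' (D : SL2Z m) (D' : SL2Z m'), SLmul (ofZ m D) (ofZ m' D') = ofZ (mmul m m') (G m m' D D')).
  { intros m m' D D'. apply SL_eq; unfold ofZ, SLmul, mkSL, ea, eb, ec, ed; cbn [proj1_sig fst snd]; unfold mmul; simpl;
    rewrite plus_IZR !mult_IZR; reflexivity. }
  rewrite !E. apply functional_extensionality. intros z. rewrite -!slash_actv. apply Hcomm; try (split; auto).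
  destruct z as [z Hz]; exact Hz.
Qed.

Lemma pe_T : actv k (rest f) (Tr 1) = rest f.
Proof.
  apply functional_extensionality. intros [z Hz]. rewrite /rest /=. rewrite -(HT z Hz).
  change ((/ cpown (0 * z + 1) k * f ((1 * z + 1) / (0 * z + 1)))%C = f (z + 1)%C).
  replace (0 * z + 1)%C with (RtoC 1) by ring. rewrite cpown_1.
  replace ((1 * z + 1) / 1)%C with (z + 1)%C by field. field.
Qed.
Lemma pe_U : actv k (rest f) (Lo (INR N)) = rest f.
Proof. apply functional_extensionality. intros [z Hz]. apply (HU z Hz). Qed.

Lemma act_Zpow (X : R -> SL) v x : (forall a b, SLmul (X a) (X b) = X (a + b)) -> X 0 = SLone -> actv k v (X x) = v ->
  forall s : Z, actv k v (X (IZR s * x)) = v.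
Proof.
  intros HX H0 Hv. assert (Hn : forall n : nat, actv k v (X (INR n * x)) = v).
  { induction n as [|n IH]; [simpl; rewrite Rmult_0_l H0 actv1; auto|].
    rewrite S_INR. replace ((INR n + 1) * x) with (INR n * x + x) by ring. rewrite -HX actvM IH Hv; auto. }
  intros s. destruct (Z_le_dec 0 s) as [Hs|Hs].
  - rewrite -(Z2Nat.id s Hs) -INR_IZR_INZ. apply Hn.
  - rewrite -{1}(Hn (Z.to_nat (- s))) -actvM HX.
    replace (INR (Z.to_nat (- s)) * x + IZR s * x) with 0; [rewrite H0; apply actv1|].
    rewrite INR_IZR_INZ Z2Nat.id; [|lia]. rewrite opp_IZR. ring.
Qed.
Lemma pe_Tz s : actv k (rest f) (Tr (IZR s)) = rest f.
Proof.
  rewrite -(Rmult_1_r (IZR s)). apply act_Zpow; [apply Tr_mul|apply SL_eq; reflexivity|apply pe_T].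
Qed.
Lemma pe_Uz s : actv k (rest f) (Lo (IZR s * INR N)) = rest f.
Proof. apply act_Zpow; [apply Lo_mul|apply SL_eq; reflexivity|apply pe_U]. Qed.

(** Two elements with the same top row differ by a power of U on the left, whose exponent is the
    lower-left entry c1 d2 - d1 c2 of the quotient divided by N. *)
Lemma pe_top a b : GamN N a -> GamN N b -> ea a = ea b -> eb a = eb b -> actv k (rest f) a = actv k (rest f) b.
Proof.
  intros [a1 [b1 [c1 [d1 [Ea [Eb [Ec [Ed H]]]]]]]] [a2 [b2 [c2 [d2 [Fa [Fb [Fc [Fd H']]]]]]]] E1 E2.
  assert (Hs : exists s : Z, (c1 * d2 - d1 * c2 = s * Z.of_nat N)%Z).
  { apply Z.divide_sub_r; [apply Z.divide_mul_l; auto|apply Z.divide_mul_r; auto]. }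
  destruct Hs as [s Hs].
  assert (Rs : IZR s * INR N = ec a * ed b - ed a * ec b).
  { rewrite INR_IZR_INZ -mult_IZR -Hs minus_IZR !mult_IZR Ec Ed Fc Fd. reflexivity. }
  assert (D1 := SL_det a). assert (D2 := SL_det b). rewrite E1 E2 in D1.
  assert (E : a = SLmul (Lo (IZR s * INR N)) b).
  { apply SL_eq; unfold SLmul, Lo, mkSL; unfold ea at 2, eb at 2, ec at 2, ed at 2 || idtac; cbn [proj1_sig fst snd].
    - change (ea a = 1 * ea b + 0 * ec b). lra.
    - change (eb a = 1 * eb b + 0 * ed b). lra.
    - change (ec a = IZR s * INR N * ea b + 1 * ec b). rewrite Rs.
      replace ((ec a * ed b - ed a * ec b) * ea b + 1 * ec b) with (ec a * (ea b * ed b - eb b * ec b) - (ea b * ed a - eb b * ec a) * ec b + ec b) by ring.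
      rewrite D1 D2. ring.
    - change (ed a = IZR s * INR N * eb b + 1 * ed b). rewrite Rs.
      replace ((ec a * ed b - ed a * ec b) * eb b + 1 * ed b) with (ed a * (ea b * ed b - eb b * ec b) - (ea b * ed a - eb b * ec a) * ed b + ed b) by ring.
      rewrite D1 D2. ring. }
  rewrite E actvM pe_Uz. reflexivity.
Qed.

(** The top row (p, b) is that of g0 T^r, where g0 has top row (p, -i) and i is the residue of -b;
    for g0 the claim is the vanishing of h, and T and U fix f. *)
Theorem prime_entry p (xi : C) g : prime (Z.of_nat p) -> (3 <= p)%nat -> N <> p -> xi <> 0%C ->
  (forall z : C, 0 < snd z -> lsum (units p) (fun a => f (z + RtoC (INR a / INR p))%C) =
    (xi * lsum (units p) (fun a => slR k (INR p) 0 (- INR a * INR N) (/ INR p) f z))%C) ->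
  GamN N g -> ea g = INR p -> actv k (rest f) g = vscal (/ xi)%C (rest f).
Proof.
  intros HP Hp3 Hne Hxi Hrel Hg Hga. assert (H0 := pq_neq0 p HP).
  assert (HrV := rel_V N p k xi f H0 ltac:(lia) Hrel).
  destruct Hg as [a [b [c [d [Ea [Eb [Ec [Ed Hc]]]]]]]].
  assert (Ha : a = Z.of_nat p) by (apply eq_IZR; rewrite -Ea Hga INR_IZR_INZ; auto).
  assert (Hdet : (a * d - b * c = 1)%Z).
  { apply eq_IZR. rewrite minus_IZR !mult_IZR -Ea -Eb -Ec -Ed. apply SL_det. }
  assert (Hpz : (0 < Z.of_nat p)%Z) by lia.
  set (i := Z.to_nat ((- b) mod Z.of_nat p)).
  assert (Hmod := Z.mod_pos_bound (- b) (Z.of_nat p) Hpz).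
  assert (Hi : Z.of_nat i = ((- b) mod Z.of_nat p)%Z) by (unfold i; apply Z2Nat.id; lia).
  assert (Hbr : exists r, b = (- Z.of_nat i + Z.of_nat p * r)%Z).
  { exists (- ((- b) / Z.of_nat p))%Z. assert (T := Z.div_mod (- b) (Z.of_nat p) ltac:(lia)). lia. }
  destruct Hbr as [r Hr].
  assert (Hi0 : (0 < i)%nat).
  { destruct i as [|i']; [|lia]. exfalso.
    assert (Hd : (Z.of_nat p | 1)%Z) by (exists (d - r * c)%Z; rewrite -Hdet Ha Hr; simpl; ring).
    apply Z.divide_1_r in Hd. lia. }
  destruct (@HeckeCosets.hecke_entry N p k f xi HN HP ltac:(apply (ssrbool.introT ssrnat.leP); lia) Hne H0 Hxi) with (i := i) as [g0 [G1 G2 G3 G4]].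
  - intros u v Gu Gv. apply pe_comm; auto.
  - apply pe_T.
  - apply pe_U.
  - exact HrV.
  - apply (ssrbool.introT ssrbool.andP); split; apply (ssrbool.introT ssrnat.leP); lia.
  - destruct G4 as [G4 G5 G6].
    match type of G4 with actv k ?hh _ = _ => set (h := hh) in * end.
    assert (Hcx : (/ xi)%C <> 0%C).
    { intros E. apply Hxi. apply Ceq_minus. apply Cmod_eq_0. replace (xi - 0)%C with (xi * xi * / xi)%C by (field; auto). rewrite E.
      replace (xi * xi * 0)%C with (RtoC 0) by ring. apply Cmod_0. }
    assert (Hh : h = vzero).
    { apply (va_h N p k H0 h (/ xi)%C); auto; try lia; [assert (T := prime_ge_2 _ HN); lia|].
      intros z Hz eps He. destruct (pe_cont g0 z Hz (eps / 2)) as [d1 [Hd1 B1]]; [lra|].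
      set (q := Cmod (/ xi)%C). assert (Hq : 0 < q) by (apply Cmod_gt_0; auto).
      destruct (pe_cont SLone z Hz (eps / (2 * q))) as [d2 [Hd2 B2]]; [apply Rdiv_lt_0_compat; lra|].
      exists (Rmin d1 d2). split; [apply Rmin_pos; auto|]. intros w Hw Hwz.
      specialize (B1 w Hw (Rlt_le_trans _ _ _ Hwz (Rmin_l _ _))). specialize (B2 w Hw (Rlt_le_trans _ _ _ Hwz (Rmin_r _ _))).
      rewrite actv1 in B2.
      assert (Eh : forall u : C, 0 < snd u -> ext h u = (ext (actv k (rest f) g0) u - / xi * ext (rest f) u)%C).
      { intros u Hu. unfold ext. destruct (Rlt_dec 0 (snd u)) as [Hu'|Hu']; [|contradiction]. reflexivity. }
      rewrite (Eh w Hw) (Eh z Hz).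
      set (A1 := ext (actv k (rest f) g0) w) in *. set (A2 := ext (actv k (rest f) g0) z) in *.
      set (A3 := ext (rest f) w) in *. set (A4 := ext (rest f) z) in *.
      replace (A1 - / xi * A3 - (A2 - / xi * A4))%C with ((A1 - A2) - / xi * (A3 - A4))%C by ring.
      eapply Rle_lt_trans; [apply Cmod_triang_minus|]. rewrite Cmod_mult. fold q.
      apply (Rmult_lt_compat_l q) in B2; auto. replace (q * (eps / (2 * q))) with (eps / 2) in B2 by (field; lra). lra. }
    assert (Hg0 : actv k (rest f) g0 = vscal (/ xi)%C (rest f)).
    { apply functional_extensionality. intros z. apply Ceq_minus. exact (f_equal (fun u => u z) Hh). }
    rewrite (pe_top g (SLmul g0 (Tr (IZR r)))).
    + rewrite actvM Hg0 actv_scal pe_Tz. reflexivity.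
    + exists a, b, c, d; auto.
    + apply GamN_M; auto. exists 1%Z, r, 0%Z, 1%Z. repeat split; auto. apply Z.divide_0_r.
    + change (ea g = ea g0 * 1 + eb g0 * 0). rewrite G2 Hga. ring.
    + change (eb g = ea g0 * IZR r + eb g0 * 1). rewrite G2 G3 Eb Hr plus_IZR opp_IZR mult_IZR -!INR_IZR_INZ. ring.
Qed.
End PrimeEntry.
End PrimeTopEntry.

(** * Von Mangoldt's function, Chebyshev's upper bound and Mertens' estimate *)

Module Chebyshev.
From HB Require Import structures.
From mathcomp Require Import all_boot all_order all_algebra.
From mathcomp Require Import reals exp.
From mathcomp Require Import zify ring lra.
Set Implicit Arguments. Unset Strict Implicit. Unset Printing Implicit Defensive.
Import Order.TTheory GRing.Theory Num.Theory.
Local Open Scope ring_scope.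

Section Arith.
Variable R : realType.
Implicit Types (n m d p : nat) (h : nat -> R).

Lemma dvd_sum d m h : (0 < d)%N ->
  \sum_(1 <= n < m.+1 | (d %| n)%N) h n = \sum_(1 <= j < (m %/ d).+1) h (d * j)%N.
Proof.
move=> d0; elim: m => [|m IH]; first by rewrite div0n !big_geq.
rewrite big_mkcond big_nat_recr //= -big_mkcond IH divnS //.
case: ifPn => dm; last by rewrite add0n addr0.
have E : (m %/ d).+1 = (m.+1 %/ d)%N by rewrite divnS // dm.
rewrite (_ : true + m %/ d = (m %/ d).+1)%N // [RHS]big_nat_recr //=. by rewrite E [(d * _)%N]mulnC divnK.
Qed.

(** Von Mangoldt's function: n is a prime power exactly when it equals the full power of its least
    prime factor [pdiv n]. *)
Definition Lam n : R := if (1 < n)%N && (n == pdiv n ^ logn (pdiv n) n)%N then ln (pdiv n)%:R else 0.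

Lemma ln_nat_ge0 n : 0 <= ln (n%:R : R).
Proof. by case: n => [|n]; [rewrite ln0|rewrite ln_ge0 // ler1n]. Qed.
Lemma Lam_ge0 n : 0 <= Lam n.
Proof. by rewrite /Lam; case: ifP => // _; exact: ln_nat_ge0. Qed.
Lemma Lam_pk p k : prime p -> (0 < k)%N -> Lam (p ^ k) = ln p%:R.
Proof.
move=> pp k0; rewrite /Lam.
have -> : pdiv (p ^ k) = p by rewrite -(prednK k0) pdiv_pfactor.
by rewrite pfactorK // eqxx andbT -[1%N](expn0 p) ltn_exp2l ?prime_gt1 // k0.
Qed.
Lemma Lam_neq0 n : Lam n != 0 -> exists p k, [/\ prime p, (0 < k)%N & n = (p ^ k)%N].
Proof.
rewrite /Lam; case: ifP => [/andP [n1 /eqP E] _|_]; last by rewrite eqxx.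
exists (pdiv n), (logn (pdiv n) n); split=> //; first exact: pdiv_prime.
by rewrite logn_gt0 mem_primes pdiv_prime // pdiv_dvd ltnW.
Qed.

(** Induction on n by removing its least prime p: among the divisors of n that do not divide n/p,
    only the full power of p in n has a nonzero [Lam]. *)
Lemma sum_Lam n m : (0 < n <= m)%N -> \sum_(1 <= d < m.+1 | (d %| n)%N) Lam d = ln n%:R.
Proof.
move=> /andP [n0 nm].
have -> : \sum_(1 <= d < m.+1 | (d %| n)%N) Lam d = \sum_(1 <= d < n.+1 | (d %| n)%N) Lam d.
  rewrite (@big_cat_nat _ _ _ n.+1 1 m.+1) //= [X in _ + X]big_nat_cond [X in _ + X]big1 ?addr0 // => d.
  by move=> /andP [/andP [nd _] /(dvdn_leq n0)]; rewrite leqNgt nd.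
elim/ltn_ind: n n0 {nm} => n IH n0.
have [n1|n1] := leqP n 1.
  have -> : n = 1%N by apply/eqP; rewrite eqn_leq n1.
  by rewrite big_mkcond big_nat1 /= ln1 /Lam.
have pp := pdiv_prime n1; set p := pdiv n in pp *.
have p0 := prime_gt0 pp; have pn : (p %| n)%N := pdiv_dvd n.
set n' := (n %/ p)%N; have En : n = (p * n')%N by rewrite mulnC divnK.
have n'0 : (0 < n')%N by rewrite divn_gt0 // dvdn_leq.
have n'n : (n' < n)%N by rewrite ltn_Pdiv ?prime_gt1.
rewrite (bigID (fun d => (d %| n')%N)) /=.
have -> : \sum_(1 <= d < n.+1 | (d %| n)%N && (d %| n')%N) Lam d = ln n'%:R.
  rewrite -(IH n') // (@big_cat_nat _ _ _ n'.+1 1 n.+1) //=; last by rewrite ltnS ltnW.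
  rewrite [X in _ + X]big_nat_cond [X in _ + X]big1 ?addr0 => [|d]; last first.
    by move=> /andP [/andP [nd _] /andP [_ /(dvdn_leq n'0)]]; rewrite leqNgt nd.
  apply: eq_bigl => d; case: (boolP (d %| n')%N) => dn; rewrite ?andbF // andbT.
  by rewrite En dvdn_mull.
have -> : \sum_(1 <= d < n.+1 | (d %| n)%N && ~~ (d %| n')%N) Lam d = ln p%:R.
  set v := logn p n'; set q := (p ^ v.+1)%N.
  have qn : (q %| n)%N by rewrite En /q expnS dvdn_pmul2l // pfactor_dvdnn.
  have qn' : ~~ (q %| n')%N by rewrite pfactor_dvdn // ltnn.
  have q0 : (0 < q)%N by rewrite expn_gt0 p0.
  have Eq : q = (p ^ v.+1)%N by [].
  have qin : q \in index_iota 1 n.+1 by rewrite mem_index_iota q0 ltnS dvdn_leq.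
  clearbody q; rewrite big_mkcond (bigD1_seq q) ?iota_uniq //= qn qn' /= Eq.
  rewrite Lam_pk // big1 ?addr0 // => d dq.
  case: ifP => // /andP [dn dn']; apply/eqP/negPn/negP => /Lam_neq0 [r [k [rp k0 Ed]]].
  move: dn dn' dq; rewrite Ed !pfactor_dvdn // En lognM // (logn_prime _ pp).
  have [->|rp'] := eqVneq r p; last by rewrite add0n => ->.
  rewrite /= add1n -ltnNge => h1 h2; have -> : k = v.+1 by apply/eqP; rewrite eqn_leq h1 h2.
  by rewrite -Eq eqxx.
by rewrite En natrM lnM ?posrE ?ltr0n // addrC.
Qed.

Lemma ln_fact m : \sum_(1 <= d < m.+1) Lam d * (m %/ d)%N%:R = ln (m`!)%:R.
Proof.
have -> : ln (m`!)%:R = \sum_(1 <= n < m.+1) ln n%:R :> R.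
  elim: m => [|m IH]; first by rewrite big_geq // fact0 ln1.
  by rewrite big_nat_recr //= -IH factS natrM lnM ?posrE ?ltr0n ?fact_gt0 // addrC.
transitivity (\sum_(1 <= n < m.+1) \sum_(1 <= d < m.+1 | (d %| n)%N) Lam d); last first.
  by apply: eq_big_nat => n; rewrite ltnS => /sum_Lam.
rewrite (exchange_big_dep_nat xpredT) //=; apply: eq_big_nat => d /andP [d0 _].
by rewrite (dvd_sum m (fun=> Lam d) d0) sumr_const_nat subSS subn0 mulr_natr.
Qed.

Definition psi m : R := \sum_(1 <= d < m.+1) Lam d.
Lemma psi_mono m n : (m <= n)%N -> psi m <= psi n.
Proof.
move=> mn; rewrite /psi (@big_cat_nat _ _ _ m.+1 1 n.+1) //= lerDl; apply: sumr_ge0 => *; exact: Lam_ge0.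
Qed.


Lemma bin_le_exp n k : ('C(n, k) <= 2 ^ n)%N.
Proof.
have /subset_leq_card : [set A : {set 'I_n} | #|A| == k] \subset powerset [set: 'I_n].
  by apply/subsetP => A _; rewrite inE subsetT.
by rewrite card_draws card_powerset cardsT card_ord.
Qed.
(** The logarithm of the binomial coefficient (2n choose n), which is at most 2^(2n), is a sum of
    [Lam d] with weights floor(2n/d) - 2 floor(n/d); these are nonnegative, and at least 1 for n < d
    <= 2n. *)
Lemma psi_double n : psi n.*2 - psi n <= (n.*2)%:R * ln 2.
Proof.
have E : ln (n.*2`!)%:R - 2 * ln (n`!)%:R <= (n.*2)%:R * ln 2 :> R.
  have := bin_fact (leq_addr n n); rewrite addnn -{2}addnn addnK => <-.
  rewrite !natrM !lnM ?posrE ?mulr_gt0 ?ltr0n ?fact_gt0 ?bin_gt0 -?addnn ?leq_addr //.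
  have -> : forall x y : R, x + (y + y) - 2 * y = x by move=> x y; ring.
  rewrite mulr_natl -lnXn ?ltr0n // ler_ln ?posrE ?ltr0n ?bin_gt0 ?leq_addr ?exprn_gt0 // -natrX ler_nat.
  exact: bin_le_exp.
apply: le_trans E; rewrite -!ln_fact (@big_cat_nat _ _ _ n.+1 1 n.*2.+1) //=; last by rewrite ltnS -addnn leq_addr.
rewrite /psi (@big_cat_nat _ _ _ n.+1 1 n.*2.+1 _ Lam) //=; last by rewrite ltnS -addnn leq_addr.
rewrite addrAC subrr add0r addrAC mulr_sumr -sumrB -[X in X <= _]add0r; apply: lerD.
  rewrite big_nat_cond; apply: sumr_ge0 => d; rewrite andbT => /andP [d0 _].
  rewrite mulrCA -mulrBr mulr_ge0 ?Lam_ge0 // subr_ge0 -natrM ler_nat mul2n -!addnn.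
  by rewrite divnD // leq_addr.
apply: ler_sum_nat => d; rewrite ltnS => /andP [d0 d1].
by rewrite ler_peMr ?Lam_ge0 // ler1n divn_gt0 // (leq_trans _ d0).
Qed.

Lemma ln_le_sub1 (x : R) : 0 < x -> ln x <= x - 1.
Proof. by move=> x0; rewrite -[X in X <= _]addr0 -{1}[x](addrNK 1) addr0 addrC le_ln1Dx // ltrBrDl subrr. Qed.

Lemma psi_le m : psi m <= 6 * m%:R.
Proof.
elim/ltn_ind: m => m IH; have [m1|m1] := leqP m 1.
  case: m m1 {IH} => [|[|//]] _; first by rewrite /psi big_geq // mulr0.
  by rewrite /psi big_nat1 /Lam /= mulr_ge0.
(* With u = [uphalf m], at most 3m/4 for m >= 2, doubling gives psi m <= 6u + 2u <= 6m; hence the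
   constant 6. *)
have l2 : ln 2 <= 1 :> R by have := @ln_le_sub1 2 ltac:(lra); lra.
have H := psi_double (uphalf m).
have h1 : (uphalf m < m)%N by lia.
have h2 : (4 * uphalf m <= 3 * m)%N by lia.
have h3 : psi m <= psi (uphalf m).*2 by apply: psi_mono; lia.
have h4 : 4 * (uphalf m)%:R <= 3 * m%:R :> R by rewrite -!natrM ler_nat.
have := IH _ h1; move: H; rewrite -[X in X%:R]mul2n natrM => H H'.
have : (uphalf m)%:R * ln 2 <= (uphalf m)%:R :> R by rewrite ler_piMr.
have : 0 <= (uphalf m)%:R :> R by [].
lra.
Qed.

Lemma ln_fact_le m : ln (m`!)%:R <= m%:R * ln m%:R :> R.
Proof.
case: m => [|m]; first by rewrite fact0 ln1 mul0r.
rewrite mulr_natl -lnXn ?ltr0n // ler_ln ?posrE ?exprn_gt0 ?ltr0n ?fact_gt0 // -natrX ler_nat.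
elim: m.+1 => // k IH; rewrite factS expnS leq_mul // (leq_trans IH) //.
by case: (posnP k) => [->|k0] //; rewrite leq_exp2r.
Qed.
Lemma ln_fact_ge m : m%:R * ln m%:R - m%:R <= ln (m`!)%:R :> R.
Proof.
elim: m => [|m IH]; first by rewrite fact0 ln1 mul0r subr0.
rewrite factS natrM lnM ?posrE ?ltr0n ?fact_gt0 //.
case: m IH => [|m] IH; first by rewrite fact0 ln1; lra.
have h : ln m.+2%:R <= ln m.+1%:R + m.+1%:R^-1 :> R.
  rewrite -[m.+2%:R]natr1; have x0 : 0 < m.+1%:R :> R by rewrite ltr0n.
  move: m.+1%:R x0 => x x0; have := @ln_le_sub1 ((x + 1) / x) ltac:(rewrite divr_gt0 //; lra).
  rewrite ln_div ?posrE //; last by lra.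
  by rewrite mulrDl mulfV ?gt_eqF // mul1r; lra.
have h' := ler_wpM2l (ler0n R m.+1) h; move: h'; rewrite mulrDr mulfV ?pnatr_eq0 //.
move: IH; rewrite -[m.+2%:R]natr1; lra.
Qed.

(** [ln_fact] contains floor(m/d); dropping the floors costs at most psi m <= 6 m, while ln m! lies
    between m ln m - m and m ln m. *)
Lemma mertens m : (0 < m)%N -> `|\sum_(1 <= d < m.+1) Lam d / d%:R - ln m%:R| <= 6.
Proof.
move=> m0; have M0 : 0 < m%:R :> R by rewrite ltr0n.
set s := \sum_(1 <= d < m.+1) _.
have E : s * m%:R = \sum_(1 <= d < m.+1) Lam d * (m%:R / d%:R).
  by rewrite mulr_suml; apply: eq_bigr => d _; rewrite mulrAC mulrA.
have H1 : ln (m`!)%:R <= s * m%:R.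
  rewrite E -ln_fact; apply: ler_sum_nat => d /andP [d0 _].
  by rewrite ler_wpM2l ?Lam_ge0 // ler_pdivlMr ?ltr0n // -natrM ler_nat leq_divM.
have H2 : s * m%:R <= ln (m`!)%:R + psi m.
  rewrite E -ln_fact /psi -big_split /=; apply: ler_sum_nat => d /andP [d0 _].
  rewrite -{3}[Lam d]mulr1 -mulrDr ler_wpM2l ?Lam_ge0 // ler_pdivrMr ?ltr0n // natr1 -!natrM ler_nat.
  by rewrite ltnW // ltn_ceil.
have H3 := psi_le m; have H4 := ln_fact_le m; have H5 := ln_fact_ge m.
by rewrite ler_norml; apply/andP; split; rewrite -(ler_pM2r M0); lra.
Qed.
End Arith.
End Chebyshev.

(** * Proper prime powers, the Moebius function and its divisor sums *)

Module Moebius.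
From HB Require Import structures.
From mathcomp Require Import all_boot all_order all_algebra.
From mathcomp Require Import reals exp.
From mathcomp Require Import zify ring lra.
Import Chebyshev.
Set Implicit Arguments. Unset Strict Implicit. Unset Printing Implicit Defensive.
Import Order.TTheory GRing.Theory Num.Theory.
Local Open Scope ring_scope.

Section Arith2.
Variable R : realType.
Implicit Types (n m d p : nat).
Local Notation Lam := (@Lam R).

Lemma sum_delta_le m c (x : R) : 0 <= x -> \sum_(1 <= n < m.+1) (if n == c then x else 0) <= x.
Proof.
move=> x0; suff -> : \sum_(1 <= n < m.+1) (if n == c then x else 0) = if (0 < c <= m)%N then x else 0 by case: ifP.
elim: m => [|m IH]; first by rewrite big_geq //; case: ifP => //; lia.
rewrite big_nat_recr //= IH; case: ifP => h1; case: ifP => h2; case: ifP => h3; rewrite ?addr0 ?add0r //; lia.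
Qed.

Lemma geo_sum m p : (1 < p)%N -> \sum_(2 <= k < m.+2) (p ^ k)%:R^-1 <= (p%:R * (p%:R - 1))^-1 :> R.
Proof.
move=> p1; have P : 1 < p%:R :> R by rewrite ltr1n.
suff -> : \sum_(2 <= k < m.+2) (p ^ k)%:R^-1 = (p%:R * (p%:R - 1))^-1 - (p ^ m.+1)%:R^-1 / (p%:R - 1) :> R.
  by rewrite gerBl divr_ge0 ?invr_ge0 ?ler0n //; lra.
elim: m => [|m IH]; first by rewrite big_geq // expn1 invfM subrr.
have P0 : p%:R != 0 :> R by rewrite gt_eqF //; lra.
have P1 : p%:R - 1 != 0 :> R by rewrite gt_eqF //; lra.
by rewrite big_nat_recr //= IH !natrX !exprS; field; rewrite ?expf_neq0 ?P0 ?P1.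
Qed.

(** The function (ln x + 2)/x decreases with slope -(ln x + 1)/x^2, enough to absorb
    ln(n+1)/(n(n+1)) in one step. *)
Definition tele n : R := (ln n%:R + 2) / n%:R.
Lemma tele_step n : (0 < n)%N -> ln n.+1%:R / (n.+1%:R * (n.+1%:R - 1)) <= tele n - tele n.+1.
Proof.
move=> n0; have N0 : 1 <= n%:R :> R by rewrite ler1n.
rewrite /tele -natr1 addrK; set x := n%:R in N0 *.
have x0 : x != 0 by rewrite gt_eqF //; lra.
have x1 : x + 1 != 0 by rewrite gt_eqF //; lra.
have h : ln (x + 1) <= ln x + x^-1.
  have := @ln_le_sub1 R ((x + 1) / x) ltac:(rewrite divr_gt0; lra).
  have L : ln ((x + 1) / x) = ln (x + 1) - ln x by apply: ln_div; rewrite posrE; lra.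
  by rewrite L mulrDl mulfV // mul1r; lra.
have h' : x * ln (x + 1) <= x * ln x + 1.
  by have := ler_wpM2l (_ : 0 <= x) h; rewrite mulrDr mulfV //; apply; lra.
rewrite -subr_ge0.
have -> : (ln x + 2) / x - (ln (x + 1) + 2) / (x + 1) - ln (x + 1) / ((x + 1) * x) =
  (x * ln x + ln x + 2 - x * ln (x + 1) - ln (x + 1)) / (x * (x + 1)) by field; rewrite x0 x1.
apply: divr_ge0; last by nra.
have : x^-1 <= 1 by rewrite invf_le1; lra.
lra.
Qed.

(** The powers of exponent at least 2 of a prime p contribute at most ln p/(p(p-1)), and the bound
    telescopes to [tele 1 = 2]. *)
Lemma np_bound m : \sum_(1 <= n < m.+1 | ~~ prime n) Lam n / n%:R <= 2.
Proof.
apply: (@le_trans _ _ (\sum_(2 <= p < m.+2) \sum_(2 <= k < m.+2) ln p%:R / (p ^ k)%:R)).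
  apply: (@le_trans _ _ (\sum_(1 <= n < m.+1) \sum_(2 <= p < m.+2) \sum_(2 <= k < m.+2)
     (if n == (p ^ k)%N then ln p%:R / (p ^ k)%:R else 0))).
    rewrite big_mkcond /=; apply: ler_sum_nat => n /andP [n0]; rewrite ltnS => nm.
    have pos p k : 0 <= (if n == (p ^ k)%N then ln p%:R / (p ^ k)%:R else 0) :> R.
      by case: ifP => // _; rewrite divr_ge0 ?ln_nat_ge0.
    case: ifPn => [np|_]; last by do 2!(apply: sumr_ge0 => ? _).
    have [->|/Lam_neq0 [p [k [pp k0 E]]]] := eqVneq (Lam n) 0.
      by rewrite mul0r; do 2!(apply: sumr_ge0 => ? _).
    have k2 : (1 < k)%N.
      by case: k k0 E => [|[|k]] // _ E; move: np; rewrite E expn1 pp.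
    have p1 := prime_gt1 pp.
    have pm : (p <= m)%N by rewrite (leq_trans _ nm) // E -[X in (X <= _)%N]expn1 leq_exp2l // ltnW.
    have km : (k <= m)%N by rewrite (leq_trans _ nm) // E ltnW // ltn_expl.
    rewrite (bigD1_seq p) ?iota_uniq ?mem_index_iota ?p1 ?ltnS ?leqW //=.
    rewrite (bigD1_seq k) ?iota_uniq ?mem_index_iota ?k2 ?ltnS ?leqW //=.
    rewrite {1 2}E Lam_pk // -E eqxx -addrA lerDl addr_ge0 //.
      by apply: sumr_ge0 => ? _.
    by do 2!(apply: sumr_ge0 => ? _).
  rewrite exchange_big /=; apply: ler_sum => p _.
  rewrite exchange_big /=; apply: ler_sum => k _.
  by apply: sum_delta_le; rewrite divr_ge0 ?ln_nat_ge0.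
apply: (@le_trans _ _ (\sum_(2 <= p < m.+2) (tele p.-1 - tele p))).
  apply: ler_sum_nat => p /andP [p1 _].
  rewrite -mulr_sumr.
  have := @tele_step p.-1; rewrite prednK; last by lia.
  move=> h; apply: le_trans (h _); last by lia.
  by rewrite ler_wpM2l ?ln_nat_ge0 // geo_sum.
suff -> : \sum_(2 <= p < m.+2) (tele p.-1 - tele p) = tele 1 - tele m.+1.
  by rewrite /tele ln1 add0r divr1 gerBl divr_ge0 // addr_ge0 // ln_nat_ge0.
elim: m => [|m IH]; first by rewrite big_geq // subrr.
by rewrite big_nat_recr //= IH addrA subrK.
Qed.

(** The Moebius function, as a product over primes so that multiplying by one more prime changes one
    factor. *)
Definition mu n : R := \prod_(p <- primes n) (if logn p n == 1%N then -1 else 0).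

Lemma mu1 : mu 1 = 1.
Proof. by rewrite /mu big_nil. Qed.
Lemma mu_norm n : `|mu n| <= 1.
Proof.
rewrite /mu; elim/big_ind: _ => [|x y hx hy|p _]; first by rewrite normr1.
  by rewrite normrM mulr_ile1.
by case: ifP; rewrite ?normrN ?normr1 ?normr0.
Qed.
Lemma mu_pM p e : prime p -> (0 < e)%N -> mu (p * e) = if (p %| e)%N then 0 else - mu e.
Proof.
move=> pp e0; have p0 := prime_gt0 pp.
have pin : p \in primes (p * e) by rewrite mem_primes pp muln_gt0 p0 e0 dvdn_mulr.
have lp r : logn r (p * e) = ((r == p) + logn r e)%N by rewrite lognM // (logn_prime _ pp).
rewrite /mu; case: ifPn => pe.
  rewrite (bigD1_seq p) ?primes_uniq //= lp eqxx.
  have : (0 < logn p e)%N by rewrite logn_gt0 mem_primes pp e0.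
  by case: (logn p e) => // k _; rewrite mul0r.
have pe' : perm_eq (primes (p * e)) (p :: primes e).
  apply: uniq_perm; rewrite ?primes_uniq //= ?primes_uniq ?andbT; first by rewrite mem_primes pp e0.
  by move=> r; rewrite primesM // primes_prime // inE.
rewrite (perm_big _ pe') /= big_cons lp eqxx.
have -> : logn p e = 0%N by apply/eqP; rewrite -leqn0 leqNgt logn_gt0 mem_primes pp e0.
rewrite /= mulN1r; congr (- _); rewrite !big_seq; apply: eq_bigr => r rin.
rewrite lp; have -> : (r == p) = false; last by [].
by apply/eqP => rp; move: rin pe; rewrite rp mem_primes => /and3P [_ _ ->].
Qed.

(** Divisors d prime to p are paired with p d, and multiples of p^2 drop out; the cases G = 1 and G
    = ln give [mu_sum] and [mu_ln]. *)
Lemma mu_split n m p (G : nat -> R) : (0 < n <= m)%N -> prime p -> (p %| n)%N ->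
  \sum_(1 <= d < m.+1 | (d %| n)%N) mu d * G d =
  \sum_(1 <= d < m.+1 | (d %| n)%N && ~~ (p %| d)%N) mu d * (G d - G (p * d)%N).
Proof.
move=> /andP [n0 nm] pp pn; have p0 := prime_gt0 pp; rewrite (bigID (fun d => (p %| d)%N)) /= addrC.
have -> : \sum_(1 <= d < m.+1 | (d %| n)%N && (p %| d)%N) mu d * G d =
   - \sum_(1 <= d < m.+1 | (d %| n)%N && ~~ (p %| d)%N) mu d * G (p * d)%N.
  under eq_bigl => d do rewrite andbC.
  rewrite big_mkcondr /= dvd_sum // [in RHS]big_mkcond /=.
  rewrite (@big_cat_nat _ _ _ (m %/ p).+1 1 m.+1) //=; last by rewrite ltnS leq_div.
  rewrite [X in _ + X]big1_seq ?addr0 => [|e].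
    rewrite -sumrN; apply: eq_big_nat => e /andP [e0 _]; rewrite mu_pM //.
    have [pe|pe] := boolP (p %| e)%N; first by rewrite andbF mul0r if_same oppr0.
    rewrite andbT -[in LHS](divnK pn) [(_ * p)%N]mulnC dvdn_pmul2l //.
    have -> : (e %| n)%N = (e %| n %/ p)%N.
      rewrite -{1}(divnK pn) Gauss_dvdl // coprime_sym prime_coprime //.
    by case: ifP; rewrite ?mulNr ?oppr0.
  rewrite mem_index_iota => /andP [_ /andP [e1 _]]; case: ifP => // /andP [en pe]; exfalso.
  have : (p * e %| n)%N by rewrite Gauss_dvd ?prime_coprime ?pn.
  move=> /(dvdn_leq n0) h; by move: e1; rewrite ltnNge leq_divRL // mulnC (leq_trans h nm).
by under [RHS]eq_bigr => d _ do rewrite mulrBr; rewrite [RHS]sumrB.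
Qed.

Lemma mu_sum n m : (0 < n <= m)%N -> \sum_(1 <= d < m.+1 | (d %| n)%N) mu d = (n == 1%N)%:R.
Proof.
move=> nm; have n0 : (0 < n)%N by case/andP: nm.
have [->|n1] := eqVneq n 1%N.
  rewrite (eq_bigl (pred1 1%N)) => [|d]; last by rewrite dvdn1.
  rewrite big_mkcond (bigD1_seq 1%N) ?iota_uniq ?mem_index_iota //=; last by lia.
  by rewrite mu1 big1 ?addr0 // => d /negPf ->.
have n2 : (1 < n)%N by lia.
rewrite (eq_bigr (fun d => mu d * 1)) => [|d _]; last by rewrite mulr1.
rewrite (mu_split (fun=> 1) nm (pdiv_prime n2) (pdiv_dvd n)) big1 // => d _.
by rewrite subrr mulr0.
Qed.

Lemma mu_ln n m : (0 < n <= m)%N -> \sum_(1 <= d < m.+1 | (d %| n)%N) mu d * ln d%:R = - Lam n.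
Proof.
move=> nm; have /andP [n0 nm'] := nm.
have [->|n1] := eqVneq n 1%N.
  rewrite big1 ?oppr0 // => d; first by rewrite dvdn1 => /eqP ->; rewrite ln1 mulr0.
have n2 : (1 < n)%N by lia.
have pp := pdiv_prime n2; have pn := pdiv_dvd n.
rewrite (mu_split (fun d => ln d%:R) nm pp pn).
have [n' cop E] := pfactor_coprime pp n0.
rewrite /Lam n2 /=; set p := pdiv n in pp pn cop E *; set v := logn p n in E *.
have n'0 : (0 < n')%N by move: n0; rewrite E muln_gt0 => /andP [].
have H d : (d %| n)%N && ~~ (p %| d)%N = (d %| n')%N.
  apply/andP/idP => [[dn pd]|dn'].
    by move: dn; rewrite E Gauss_dvdl // coprimeXr // coprime_sym prime_coprime.
  split; first by rewrite E dvdn_mulr.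
  by apply/negP => pd; move: cop; rewrite prime_coprime // (dvdn_trans pd dn').
transitivity (\sum_(1 <= d < m.+1 | (d %| n')%N) mu d * - ln p%:R).
  rewrite [LHS]big_nat_cond [RHS]big_nat_cond; apply: eq_big => d; first by rewrite H.
  move=> /andP [/andP [d0 _] _]; congr (_ * _).
  have p0 := prime_gt0 pp.
  by rewrite natrM lnM ?posrE ?ltr0n //; lra.
rewrite -mulr_suml mu_sum.
  have -> : (n == p ^ v)%N = (n' == 1%N).
    by rewrite {1}E -{2}[(p ^ v)%N]mul1n eqn_pmul2r // expn_gt0 prime_gt0.
  by case: (n' == 1%N); rewrite ?mul1r ?mul0r ?oppr0.
rewrite n'0 (leq_trans _ nm') // E leq_pmulr // expn_gt0 prime_gt0 //.
Qed.
End Arith2.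
End Moebius.

(** * Sums of w(n)/n over residue classes modulo N, and two evaluations of logarithmic sums *)

Module ClassSums.
From HB Require Import structures.
From mathcomp Require Import all_boot all_order all_algebra.
From mathcomp Require Import boolp classical_sets reals exp.
From mathcomp Require Import zify ring lra.
Import Chebyshev Moebius.
Set Implicit Arguments. Unset Strict Implicit. Unset Printing Implicit Defensive.
Import Order.TTheory GRing.Theory Num.Theory.
Local Open Scope ring_scope.

Section Abel.
Variable R : realType.

(** Abel summation: bounded partial sums of u against a decreasing nonnegative a. *)
Lemma abel_bound (u a : nat -> R) B k j :
  (forall i, (k <= i)%N -> `|\sum_(k <= n < i) u n| <= B) ->
  (forall n, (k <= n)%N -> a n.+1 <= a n) -> (forall n, (k <= n)%N -> 0 <= a n) ->
  `|\sum_(k <= n < j) u n * a n| <= B * a k.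
Proof.
move=> hu ha a0; have B0 : 0 <= B by apply: le_trans (hu k _).
have [jk|kj] := leqP j k; first by rewrite big_geq // normr0 mulr_ge0 // a0.
rewrite -(subnK kj) addnS; set m := (j - k.+1)%N; move: m => m {kj}.
(* The induction keeps the boundary term apart, so that the decrements of a telescope exactly. *)
have H : `|\sum_(k <= n < (m + k).+1) u n * a n - a (m + k)%N * \sum_(k <= n < (m + k).+1) u n| <= B * (a k - a (m + k)%N).
  elim: m => [|m IH]; first by rewrite add0n !big_nat1 mulrC !subrr mulr0 normr0.
  have km : (k <= (m + k).+1)%N by lia.
  rewrite addSn !(@big_nat_recr _ _ _ (m + k).+1 k _ km).
  set P := \sum_(k <= n < (m + k).+1) u n * a n in IH *.
  set Q := \sum_(k <= n < (m + k).+1) u n in IH *.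
  have U : `|(a (m + k)%N - a (m + k).+1) * Q| <= B * (a (m + k)%N - a (m + k).+1).
    rewrite normrM ger0_norm ?subr_ge0 ?ha ?leq_addl // mulrC ler_wpM2r ?subr_ge0 ?ha ?leq_addl //.
    by apply: hu; lia.
  rewrite (_ : _ - _ = (P - a (m + k)%N * Q) + (a (m + k)%N - a (m + k).+1) * Q); last by rewrite /=; ring.
  apply: le_trans (ler_normD _ _) _; move: IH U; move: `|_| `|_| => x y; lra.
have h1 := hu (m + k).+1 ltac:(lia); have h2 := a0 (m + k)%N ltac:(lia).
have U : `|a (m + k)%N * \sum_(k <= n < (m + k).+1) u n| <= a (m + k)%N * B.
  by rewrite normrM ger0_norm // ler_wpM2l.
rewrite -[X in `|X|](subrK (a (m + k)%N * \sum_(k <= n < (m + k).+1) u n)).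
by apply: le_trans (ler_normD _ _) _; move: H U; lra.
Qed.

Lemma lim_ex (u : nat -> R) B : (forall m n, (m <= n)%N -> `|u n - u m| <= B / m.+1%:R) ->
  exists L, forall m, `|u m - L| <= B / m.+1%:R.
Proof.
move=> h; have h' m n : u n - B / n.+1%:R <= u m + B / m.+1%:R.
  have B0 : 0 <= B by have := h 0%N 0%N (leqnn 0); rewrite divr1; exact: le_trans.
  have b0 k : 0 <= B / k.+1%:R by rewrite divr_ge0.
  have [mn|/ltnW nm] := leqP m n.
    by have := h _ _ mn; rewrite ler_norml => /andP [_]; move: (b0 n); move: (B / _) (B / _) => x y; lra.
  by have := h _ _ nm; rewrite ler_norml => /andP [+ _]; move: (b0 m); move: (B / _) (B / _) => x y; lra.
pose E := [set x | exists n, x = u n - B / n.+1%:R]%classic.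
have E0 : (E !=set0)%classic by exists (u 0%N - B / 1%:R), 0%N.
exists (sup E) => m; rewrite ler_norml; apply/andP; split.
  have : sup E <= u m + B / m.+1%:R by apply: ge_sup => // x [n ->].
  by move: (sup E) (B / _) => x y; lra.
have : u m - B / m.+1%:R <= sup E.
  by apply: ub_le_sup; [exists (u m + B / m.+1%:R) => x [n ->]|exists m].
by move: (sup E) (B / _) => x y; lra.
Qed.
End Abel.

Section ClassFun.
Variables (R : realType) (N : nat).
Hypothesis pN : prime N.
Local Notation F := 'F_N.
Implicit Types (w : F -> R) (n m d : nat).
Local Notation Lam := (@Lam R).
Local Notation mu := (@mu R).

Lemma natF_mod n : ((n%:R : F) : nat) = (n %% N)%N.
Proof. by rewrite val_Fp_nat. Qed.

Lemma window w k : \sum_(k <= n < k + N) w n%:R = \sum_x w x.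
Proof.
rewrite -{1}[k]add0n [(k + N)%N]addnC big_addn addnK big_mkord.
pose h (i : 'I_N) : F := (i + k)%:R.
have hi : injective h.
  move=> i j; rewrite /h !natrD => /addIr /(congr1 (fun x : F => x : nat)).
  by rewrite !natF_mod !modn_small // => /val_inj.
have hb : bijective h by apply: inj_card_bij => //; rewrite card_Fp // card_ord.
by rewrite (reindex h) //; exact: onW_bij.
Qed.

Definition nrm w := \sum_x `|w x|.
Lemma nrm_ge w x : `|w x| <= nrm w.
Proof. by rewrite /nrm (bigD1 x) //= lerDl sumr_ge0. Qed.
Lemma nrm_ge0 w : 0 <= nrm w.
Proof. exact: sumr_ge0. Qed.

Lemma partial_bound w k j : \sum_x w x = 0 -> `|\sum_(k <= n < j) w n%:R| <= N%:R * nrm w.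
Proof.
move=> w0; elim/ltn_ind: j => j IH.
have N0 := prime_gt0 pN.
have [h|h] := leqP (k + N) j.
  rewrite (@big_cat_nat _ _ _ (j - N)%N k j) //=; try lia.
  have -> : \sum_(j - N <= n < j) w n%:R = 0.
    have e : ((j - N) + N = j)%N by lia.
    by rewrite -{2}e window.
  by rewrite addr0; apply: IH; lia.
apply: le_trans (ler_norm_sum _ _ _) _.
apply: (@le_trans _ _ (\sum_(k <= n < j) nrm w)); first by apply: ler_sum => n _; exact: nrm_ge.
rewrite sumr_const_nat -[X in X <= _]mulr_natl ler_wpM2r ?nrm_ge0 // ler_nat; lia.
Qed.

Definition S w m := \sum_(1 <= n < m.+1) w n%:R / n%:R.

Lemma S_cauchy w m n : \sum_x w x = 0 -> (m <= n)%N -> `|S w n - S w m| <= (N%:R * nrm w) / m.+1%:R.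
Proof.
move=> w0 mn; rewrite /S (@big_cat_nat _ _ _ m.+1 1 n.+1) //= addrAC subrr add0r.
apply: (@abel_bound _ (fun n => w n%:R) (fun n => n%:R^-1)) => [i _|i mi|i mi]; first exact: partial_bound.
  by rewrite lef_pV2 ?posrE ?ltr0n ?ler_nat //; lia.
by rewrite invr_ge0.
Qed.

(** From 4 on, because ln 4 >= 1 follows from ln 2 >= 1/2 and 1 is the value of ln beyond which ln x
    / x decreases. *)
Lemma ln_over_decr n : (4 <= n)%N -> ln n.+1%:R / n.+1%:R <= ln n%:R / n%:R :> R.
Proof.
move=> n4; have N4 : 4 <= n%:R :> R by rewrite ler_nat.
have l2 : 1 / 2 <= ln 2 :> R.
  have := @ln_le_sub1 R (2^-1) ltac:(lra); rewrite lnV ?posrE; lra.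
have l4 : 1 <= ln n%:R :> R.
  have : ln 4 <= ln n%:R :> R by rewrite ler_ln ?posrE //; lra.
  have -> : 4 = 2 ^+ 2 :> R by ring.
  rewrite lnXn ?mulr2n; lra.
rewrite -natr1; set x := n%:R in N4 l4 *.
have x0 : x != 0 by rewrite gt_eqF //; lra.
have h : ln (x + 1) <= ln x + x^-1.
  have := @ln_le_sub1 R ((x + 1) / x) ltac:(rewrite divr_gt0; lra).
  have L : ln ((x + 1) / x) = ln (x + 1) - ln x by apply: ln_div; rewrite posrE; lra.
  by rewrite L mulrDl mulfV // mul1r; lra.
have h' : x * ln (x + 1) <= x * ln x + 1.
  by have := ler_wpM2l (_ : 0 <= x) h; rewrite mulrDr mulfV //; apply; lra.
rewrite ler_pdivrMr; last by lra.
by rewrite mulrAC ler_pdivlMr; lra.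
Qed.

Lemma ln_sum_bound w : \sum_x w x = 0 ->
  exists C, forall m, `|\sum_(1 <= n < m.+1) w n%:R / n%:R * ln n%:R| <= C.
Proof.
move=> w0; set B := N%:R * nrm w.
set C0 := \sum_(1 <= n < 4) `|w n%:R / n%:R * ln n%:R|.
have B0 : 0 <= B * (ln 4 / 4) by rewrite mulr_ge0 ?divr_ge0 ?ln_ge0 //; [rewrite mulr_ge0 ?nrm_ge0|lra].
exists (C0 + B * (ln 4 / 4)) => m.
have [m3|m3] := leqP m.+1 4.
  apply: le_trans (ler_norm_sum _ _ _) _.
  apply: (@le_trans _ _ C0); last by rewrite lerDl.
  by rewrite /C0 (@big_cat_nat _ _ _ m.+1 1 4) //= lerDl sumr_ge0.
rewrite (@big_cat_nat _ _ _ 4 1 m.+1) //=; last by lia.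
apply: le_trans (ler_normD _ _) _; apply: lerD; first exact: ler_norm_sum.
rewrite (eq_bigr (fun n => w n%:R * (ln n%:R / n%:R))) => [|n _]; last by rewrite mulrAC mulrA.
apply: (@abel_bound _ (fun n => w n%:R) (fun n => ln n%:R / n%:R)) => [i _|i mi|i mi]; first exact: partial_bound.
  exact: ln_over_decr.
by rewrite divr_ge0 ?ln_nat_ge0.
Qed.

(** Unit mass at h minus the uniform mass on the units; by [decomp] every zero-sum function
    vanishing at 0 is a combination of these. *)
Definition wdelta (h x : F) : R := (x == h)%:R - (x != 0)%:R / (N.-1)%:R.

Lemma card_nz : \sum_(x : F | x != 0) (1 : R) = (N.-1)%:R.
Proof.
by rewrite sumr_const (eq_card (B := predC1 (0 : F))) ?cardC1 ?card_Fp.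
Qed.
Lemma phi_neq0 : (N.-1)%:R != 0 :> R.
Proof. by rewrite pnatr_eq0; have := prime_gt1 pN; lia. Qed.

Lemma sum_ind (P : pred F) : \sum_x (P x)%:R = \sum_(x | P x) (1 : R).
Proof. by rewrite [RHS]big_mkcond; apply: eq_bigr => x _; case: (P x). Qed.

Lemma wdelta_sum h : \sum_x wdelta h x = 0.
Proof.
rewrite sumrB -mulr_suml (sum_ind (fun x => x != 0)) card_nz mulfV ?phi_neq0 //.
by rewrite (sum_ind (fun x => x == h)) big_pred1_eq subrr.
Qed.

Lemma decomp w x : w 0 = 0 -> \sum_y w y = 0 -> w x = \sum_h w h * wdelta h x.
Proof.
move=> w0 ws; rewrite /wdelta; under eq_bigr => h _ do rewrite mulrBr.
rewrite sumrB -mulr_suml ws mul0r subr0 (bigD1 x) //= eqxx mulr1 big1 ?addr0 // => h hx.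
by rewrite eq_sym (negPf hx) mulr0.
Qed.

Definition ip (w l : F -> R) := \sum_x w x * l x.

(** [l h] is the limit for [wdelta h], a constant term of the sum of 1/n over the class of h,
    measured against the mean over the units; linearity and [decomp] do the rest, with error
    O(1/m). *)
Lemma class_sum : exists (l : F -> R) C, 0 <= C /\ forall w, w 0 = 0 -> \sum_x w x = 0 ->
  forall m, `|S w m - ip w l| <= C * nrm w / m.+1%:R.
Proof.
have H h : exists L, forall m, `|S (wdelta h) m - L| <= (N%:R * nrm (wdelta h)) / m.+1%:R.
  by apply: lim_ex => m n; apply: S_cauchy; exact: wdelta_sum.
have [l Hl] := fin_all_exists H.
set C := \sum_h N%:R * nrm (wdelta h).
have c0 h : 0 <= N%:R * nrm (wdelta h) by rewrite mulr_ge0 ?nrm_ge0.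
exists l, C; split; first by apply: sumr_ge0 => h _.
move=> w w0 ws m.
have -> : S w m = \sum_h w h * S (wdelta h) m.
  rewrite /S; under eq_bigr => n _ do rewrite (decomp _ w0 ws) mulr_suml.
  by rewrite exchange_big; apply: eq_bigr => h _; rewrite mulr_sumr; apply: eq_bigr => n _; rewrite mulrA.
rewrite /ip -sumrB; apply: le_trans (ler_norm_sum _ _ _) _.
rewrite mulrAC mulr_sumr; apply: ler_sum => h _.
rewrite -mulrBr normrM mulrC; apply: ler_wpM2r => //; apply: le_trans (Hl h m) _.
by rewrite ler_wpM2r ?invr_ge0 // /C (bigD1 h) //= lerDl sumr_ge0.
Qed.

Definition tau (d : nat) w (x : F) := w (d%:R * x).

Lemma tau0 d w : w 0 = 0 -> tau d w 0 = 0.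
Proof. by rewrite /tau mulr0. Qed.
Lemma natF_neq0 d : (d%:R != 0 :> F) = ~~ (N %| d)%N.
Proof. by rewrite -(inj_eq (@ord_inj _)) natF_mod. Qed.
Lemma tau_sum d w : w 0 = 0 -> \sum_x w x = 0 -> \sum_x tau d w x = 0.
Proof.
move=> w0 ws; have [d0|d0] := eqVneq (d%:R : F) 0.
  by rewrite /tau big1 // => x _; rewrite d0 mul0r.
by transitivity (\sum_x w x) => //; rewrite [RHS](reindex_inj (mulfI d0)).
Qed.
Lemma tau_nrm d w : w 0 = 0 -> nrm (tau d w) <= nrm w.
Proof.
move=> w0; have [d0|d0] := eqVneq (d%:R : F) 0.
  by rewrite /nrm /tau big1 ?nrm_ge0 // => x _; rewrite d0 mul0r w0 normr0.
rewrite /nrm le_eqVlt; apply/orP; left; apply/eqP.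
by rewrite [RHS](reindex_inj (mulfI d0)).
Qed.

(** Writing n = d j and summing over d first; dilation by d acts on w through [tau]. *)
Lemma hyper w (a : nat -> nat -> R) m :
  \sum_(1 <= n < m.+1) w n%:R / n%:R * \sum_(1 <= d < m.+1 | (d %| n)%N) a d n =
  \sum_(1 <= d < m.+1) d%:R^-1 * \sum_(1 <= j < (m %/ d).+1) tau d w j%:R / j%:R * a d (d * j)%N.
Proof.
under eq_bigr => n _ do rewrite mulr_sumr.
rewrite (exchange_big_dep_nat xpredT) //=; apply: eq_big_nat => d /andP [d0 _].
rewrite (dvd_sum m (fun n => w n%:R / n%:R * a d n) d0) mulr_sumr; apply: eq_bigr => j _.
by rewrite /tau !natrM invfM; move: (w _) (a _ _) (d%:R^-1) (j%:R^-1) => *; ring.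
Qed.

Section Ell.
Variables (l : F -> R) (C : R).
Hypothesis C0 : 0 <= C.
Hypothesis Hl : forall w, w 0 = 0 -> \sum_x w x = 0 -> forall m, `|S w m - ip w l| <= C * nrm w / m.+1%:R.

Lemma tau_err w d m : w 0 = 0 -> \sum_x w x = 0 -> (0 < d)%N -> (0 < m)%N ->
  `|S (tau d w) (m %/ d) - ip (tau d w) l| <= C * nrm w * (d%:R / m%:R).
Proof.
move=> w0 ws d0 m0; apply: le_trans (Hl (tau0 d w0) (tau_sum d w0 ws) _) _.
have n0 := nrm_ge0 (tau d w).
apply: (@le_trans _ _ (C * nrm w / (m %/ d).+1%:R)).
  by rewrite ler_wpM2r ?invr_ge0 // ler_wpM2l // tau_nrm.
rewrite ler_wpM2l ?mulr_ge0 ?nrm_ge0 // ler_pdivlMr ?ltr0n // mulrC ler_pdivrMr ?ltr0n //.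
by rewrite -natrM ler_nat ltnW // mulnC ltn_ceil.
Qed.

(** Insert ln n = sum of Lam over divisors into the bounded sum of w(n) ln n / n; replacing inner
    sums by their limits costs a multiple of psi m / m, which is bounded. *)
Lemma A_bound w : w 0 = 0 -> \sum_x w x = 0 ->
  exists K, forall m, (0 < m)%N -> `|\sum_(1 <= d < m.+1) Lam d / d%:R * ip (tau d w) l| <= K.
Proof.
move=> w0 ws; have [K1 HK1] := ln_sum_bound ws.
exists (K1 + C * nrm w * 6) => m m0.
have E : \sum_(1 <= n < m.+1) w n%:R / n%:R * ln n%:R =
   \sum_(1 <= d < m.+1) Lam d / d%:R * S (tau d w) (m %/ d).
  transitivity (\sum_(1 <= n < m.+1) w n%:R / n%:R * \sum_(1 <= d < m.+1 | (d %| n)%N) Lam d).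
    by apply: eq_big_nat => n; rewrite ltnS => nm; rewrite sum_Lam.
  rewrite (hyper w (fun d _ => Lam d)); apply: eq_bigr => d _.
  rewrite -mulr_suml /S; move: (\sum_(_ <= _ < _) _) (Lam d) (d%:R^-1) => *; ring.
have -> : \sum_(1 <= d < m.+1) Lam d / d%:R * ip (tau d w) l =
   \sum_(1 <= n < m.+1) w n%:R / n%:R * ln n%:R - \sum_(1 <= d < m.+1) Lam d / d%:R * (S (tau d w) (m %/ d) - ip (tau d w) l).
  rewrite E -sumrB; apply: eq_bigr => d _; ring.
apply: le_trans (ler_normB _ _) _; apply: lerD => //.
apply: le_trans (ler_norm_sum _ _ _) _.
apply: (@le_trans _ _ (\sum_(1 <= d < m.+1) Lam d * (C * nrm w / m%:R))).
  apply: ler_sum_nat => d /andP [d0 _]; rewrite normrM ger0_norm ?divr_ge0 ?Lam_ge0 //.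
  rewrite -[X in X <= _]mulrA ler_wpM2l ?Lam_ge0 //.
  rewrite [X in X <= _]mulrC ler_pdivrMr ?ltr0n //; apply: le_trans (tau_err w0 ws d0 m0) _.
  by rewrite mulrA mulrAC.
rewrite -mulr_suml; apply: le_trans (ler_wpM2r _ (psi_le R m)) _.
  by rewrite !mulr_ge0 ?nrm_ge0 ?invr_ge0.
have M0 : m%:R != 0 :> R by rewrite pnatr_eq0 -lt0n.
have -> : 6 * m%:R * (C * nrm w / m%:R) = C * nrm w * 6 by field.
by [].
Qed.

(** Moebius inversion of the weight ln(m/d) yields Lam(n) plus ln m at n = 1. When the limits of all
    dilates vanish, the inner sums are O(d/m), and the sum of ln(m/d) over d <= m is at most m. *)
Lemma B_bound w : w 0 = 0 -> \sum_x w x = 0 -> (forall d, ip (tau d w) l = 0) ->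
  exists K, forall m, (0 < m)%N -> `|\sum_(1 <= n < m.+1) Lam n / n%:R * w n%:R + w 1 * ln m%:R| <= K.
Proof.
move=> w0 ws wz; exists (C * nrm w) => m m0.
have M0 : 0 < m%:R :> R by rewrite ltr0n.
have -> : \sum_(1 <= n < m.+1) Lam n / n%:R * w n%:R + w 1 * ln m%:R =
  \sum_(1 <= d < m.+1) mu d / d%:R * (ln m%:R - ln d%:R) * S (tau d w) (m %/ d).
  transitivity (\sum_(1 <= n < m.+1) w n%:R / n%:R * \sum_(1 <= d < m.+1 | (d %| n)%N) mu d * (ln m%:R - ln d%:R)).
    transitivity (\sum_(1 <= n < m.+1) w n%:R / n%:R * (Lam n + (n == 1%N)%:R * ln m%:R)).
      under [RHS]eq_bigr => n _ do rewrite mulrDr.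
      rewrite big_split /=; congr (_ + _); first by apply: eq_bigr => n _; rewrite mulrC mulrA mulrAC.
      rewrite big_ltn // big_nat big1 ?addr0 ?mul1r ?divr1 // => n /andP [n1 _].
      by rewrite gtn_eqF // mul0r mulr0.
    apply: eq_big_nat => n; rewrite ltnS => nm; congr (_ * _).
    under [RHS]eq_bigr => d _ do rewrite mulrBr.
    by rewrite sumrB -mulr_suml mu_sum // mu_ln // opprK addrC.
  rewrite (hyper w (fun d _ => mu d * (ln m%:R - ln d%:R))); apply: eq_bigr => d _.
  rewrite -mulr_suml /S; move: (\sum_(_ <= _ < _) _) (mu d) (d%:R^-1) => *; ring.
apply: le_trans (ler_norm_sum _ _ _) _.
apply: (@le_trans _ _ (\sum_(1 <= d < m.+1) C * nrm w / m%:R * (ln m%:R - ln d%:R))).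
  apply: ler_sum_nat => d /andP [d0]; rewrite ltnS => dm.
  have L0 : 0 <= ln m%:R - ln d%:R :> R by rewrite subr_ge0 ler_ln ?posrE ?ltr0n ?ler_nat.
  have D0 : 0 < d%:R :> R by rewrite ltr0n.
  have D1 : 0 <= d%:R :> R by [].
  have h := tau_err w0 ws d0 m0; rewrite wz subr0 in h.
  rewrite !normrM (ger0_norm L0) normfV (ger0_norm D1).
  have -> : C * nrm w / m%:R * (ln m%:R - ln d%:R) = 1 / d%:R * (ln m%:R - ln d%:R) * (C * nrm w * (d%:R / m%:R)).
    by field; rewrite !gt_eqF.
  apply: ler_pM => //; first by rewrite !mulr_ge0 ?invr_ge0.
  by rewrite ler_wpM2r // ler_wpM2r ?invr_ge0 // mu_norm.
rewrite -mulr_sumr sumrB sumr_const_nat subSS subn0.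
have -> : \sum_(1 <= d < m.+1) ln d%:R = ln (m`!)%:R :> R.
  elim: m {m0 M0} => [|m IH]; first by rewrite big_geq // fact0 ln1.
  by rewrite big_nat_recr //= IH factS natrM lnM ?posrE ?ltr0n ?fact_gt0 // addrC.
have h : ln m%:R *+ m - ln (m`!)%:R <= m%:R :> R.
  by have := ln_fact_ge R m; rewrite -[_ *+ m]mulr_natl; lra.
apply: le_trans (ler_wpM2l _ h) _; first by rewrite !mulr_ge0 ?nrm_ge0 ?invr_ge0.
by rewrite divfK ?gt_eqF.
Qed.
End Ell.
End ClassFun.
End ClassSums.

(** * Every unit class modulo N is a prime class or a quotient of two *)

Module PrimeClasses.
From HB Require Import structures.
From mathcomp Require Import all_boot all_order all_algebra.
From mathcomp Require Import boolp classical_sets reals exp topology normedtype sequences.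
From mathcomp Require Import zify ring lra.
Import Chebyshev Moebius ClassSums.
Set Implicit Arguments. Unset Strict Implicit. Unset Printing Implicit Defensive.
Import Order.TTheory GRing.Theory Num.Theory.
Import numFieldNormedType.Exports.
Local Open Scope ring_scope.

Section Gen.
Variable R : realType.

(** Bolzano-Weierstrass in finite dimension, from compactness of a product of segments. *)
Lemma cluster_row n (u : nat -> 'I_n -> R) K : (forall m i, `|u m i| <= K) ->
  exists v : 'I_n -> R, forall e, 0 < e -> forall M, exists2 m, (M <= m)%N & forall i, `|u m i - v i| < e.
Proof.
move=> uK.
have sc := @segment_compact R (- K) K.
have Hc := @rV_compact R n (fun=> _) (fun=> sc).
pose s m : 'rV[R]_n := \row_i u m i.
have [|v [_ clv]] := Hc (fmap s (nbhs eventually)) _.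
  exists 0%N => // m _ i /=; rewrite mxE in_itv /= -ler_norml; exact: uK.
exists (fun i => v ord0 i) => e e0 M.
have [w [[m /= Mm <-] wB]] := clv [set s m | m in [set m | (M <= m)%N]]%classic (ball v e) ltac:(by exists M => // m Mm; exists m) (nbhsx_ballx v e e0).
exists m => // i; have [_ /(_ ord0 i)] := wB.
rewrite /ball /= mxE distrC; exact.
Qed.

Lemma ln_large (y : R) : exists M, forall m, (M <= m)%N -> y < ln m%:R.
Proof.
exists (Num.bound (expR y)).+1 => m Mm.
have h : expR y < m%:R.
  apply: lt_le_trans (archi_boundP (expR_ge0 y)) _; rewrite ler_nat; lia.
have M0 : 0 < m%:R :> R by have := expR_gt0 y; lra.
by rewrite -[y]expRK ltr_ln ?posrE ?expR_gt0.
Qed.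

Lemma sum_rescale (F : finFieldType) (f : F -> R) (c : F) : c != 0 -> \sum_y f (y * c) = \sum_y f y.
Proof. by move=> c0; rewrite [RHS](reindex_inj (mulIf c0)). Qed.

(** Testing the hypothesis on differences of two point masses shows that the convolution E of v and
    l is constant on units, and it sums to 0, so it vanishes. The correlation with l then vanishes
    too, since both have the same sum of squares. *)
Lemma conv_corr (F : finFieldType) (l v : F -> R) : v 0 = 0 -> \sum_x v x = 0 ->
  (forall w, w 0 = 0 -> \sum_x w x = 0 -> \sum_g v g * (\sum_x w (g * x) * l x) = 0) ->
  forall z, \sum_x v (z * x) * l x = 0.
Proof.
move=> v0 vs H.
pose E y := \sum_g v g * l (y / g).
have Ec y : y != 0 -> E y = E 1.
  move=> y0; pose w (x : F) : R := (x == y)%:R - (x == 1)%:R.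
  have pick (c : F) : \sum_x (x == c)%:R = 1 :> R.
    by rewrite (bigD1 c) //= eqxx big1 ?addr0 // => x /negPf ->.
  have := H w; rewrite /w eq_sym (negPf y0) eq_sym oner_eq0 subrr => /(_ erefl).
  rewrite sumrB !pick subrr => /(_ erefl) h.
  apply/eqP; rewrite -subr_eq0 -h /E -sumrB; apply/eqP; apply: eq_bigr => g _.
  have [->|g0] := eqVneq g 0; first by rewrite v0 !mul0r subrr.
  have P (c : F) : \sum_x (g * x == c)%:R * l x = l (c / g).
    rewrite (bigD1 (c / g)) //= mulrCA mulfV // mulr1 eqxx mul1r big1 ?addr0 // => x xc.
    rewrite (_ : (g * x == c) = false) ?mul0r //; apply: contraNF xc => /eqP <-.
    by rewrite mulrAC mulfV // mul1r.
  rewrite -mulrBr; congr (_ * _); under eq_bigr => x _ do rewrite mulrBl.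
  by rewrite sumrB !P.
have E1 : E 1 = 0.
  have h : \sum_(y | y != 0) E y = 0.
    rewrite exchange_big /=; transitivity (\sum_g v g * \sum_(h | h != 0) l h); last by rewrite -mulr_suml vs mul0r.
    apply: eq_bigr => g _; rewrite -mulr_sumr; have [->|g0] := eqVneq g 0; first by rewrite v0 !mul0r.
    congr (_ * _); rewrite [RHS](reindex_inj (mulIf (invr_neq0 g0))) /=.
    by apply: eq_bigl => y; rewrite mulf_eq0 invr_eq0 (negPf g0) orbF.
  move: h; rewrite (eq_bigr (fun=> E 1)) => [|y y0]; last exact: Ec.
  rewrite sumr_const => /eqP; rewrite mulrn_eq0 => /orP [|/eqP //].
  by move=> /eqP /card0_eq /(_ (1 : F)) /negbT /negP; case; exact: oner_neq0.
pose D y := \sum_h v (y / h) * l h.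
have D0 y : D y = 0.
  have [->|y0] := eqVneq y 0; first by rewrite /D big1 // => h _; rewrite mul0r v0 mul0r.
  rewrite -E1 -(Ec y y0) /D /E.
  have yK : involutive (fun h : F => y / h).
    by move=> h; rewrite invfM invrK mulrA mulfV // mul1r.
  by rewrite (reindex_inj (inv_inj yK)) /=; apply: eq_bigr => h _; rewrite yK.
pose r z := \sum_x v (z * x) * l x.
(* After expanding, both sums of squares involve only the autocorrelation of v, which the rescaling
   y = z h h' shows to be the same for convolution and correlation. *)
have rs : \sum_z r z * r z = 0.
  transitivity (\sum_y D y * D y); last by rewrite big1 // => y _; rewrite D0 mul0r.
  transitivity (\sum_h \sum_h' (l h * l h') * \sum_z v (z * h) * v (z * h')).
    rewrite /r; under eq_bigr => z _ do rewrite mulr_suml.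
    rewrite exchange_big; apply: eq_bigr => h _.
    under eq_bigr => z _ do rewrite mulr_sumr.
    rewrite exchange_big; apply: eq_bigr => h' _; rewrite mulr_sumr; apply: eq_bigr => z _.
    by rewrite mulrACA mulrC.
  symmetry; rewrite /D; under eq_bigr => z _ do rewrite mulr_suml.
  rewrite exchange_big; apply: eq_bigr => h _.
  under eq_bigr => z _ do rewrite mulr_sumr.
  rewrite exchange_big; apply: eq_bigr => h' _.
  transitivity ((l h * l h') * \sum_y v (y / h) * v (y / h')).
    by rewrite mulr_sumr; apply: eq_bigr => z _; rewrite mulrACA mulrC.
  congr (_ * _).
  have [->|h0] := eqVneq h 0.
    by rewrite !big1 // => z _; rewrite ?invr0 mulr0 v0 mul0r.
  have [->|h0'] := eqVneq h' 0.
    by rewrite !big1 // => z _; rewrite ?invr0 !mulr0 v0 mulr0.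
  rewrite -(@sum_rescale _ _ (h * h')) ?mulf_neq0 //; apply: eq_bigr => z _.
  rewrite mulrC; congr (v _ * v _); first by rewrite mulrA mulfK.
  by rewrite [h * h']mulrC mulrA mulfK.
move=> z; have /eqP := rs; rewrite psumr_eq0 => [/allP|x _]; last by rewrite -expr2 sqr_ge0.
by move=> /(_ z (mem_index_enum z)) /=; rewrite mulf_eq0 orbb => /eqP.
Qed.
End Gen.

Section Main.
Variables (R : realType) (N : nat).
Hypothesis pN : prime N.
Local Notation F := 'F_N.
Local Notation Lam := (@Lam R).

Definition oddp (g : F) := exists p, [/\ prime p, (2 < p)%N, p != N & p%:R = g].

Definition lam m (g : F) : R := \sum_(1 <= n < m.+1) (n%:R == g)%:R * (Lam n / n%:R).

Lemma lam_ge0 m g : 0 <= lam m g.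
Proof. by apply: sumr_ge0 => n _; rewrite mulr_ge0 // divr_ge0 ?Lam_ge0. Qed.

Lemma lam_sum m (c : F -> R) : \sum_(1 <= n < m.+1) Lam n / n%:R * c n%:R = \sum_g c g * lam m g.
Proof.
under [RHS]eq_bigr => g _ do rewrite mulr_sumr.
rewrite exchange_big /=; apply: eq_bigr => n _.
rewrite (bigD1 n%:R) //= eqxx mul1r mulrC big1 ?addr0 // => g gn.
by rewrite eq_sym (negPf gn) mul0r mulr0.
Qed.

(** In such a class only the primes 2 and N and proper prime powers can contribute, and their total
    is bounded. *)
Lemma lam_noprime m g : ~ oddp g -> lam m g <= 2 + Lam 2 / 2%:R + Lam N / N%:R.
Proof.
move=> ng; have L0 n : 0 <= Lam n / n%:R by rewrite divr_ge0 ?Lam_ge0.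
apply: (@le_trans _ _ (\sum_(1 <= n < m.+1) ((if ~~ prime n then Lam n / n%:R else 0) +
  (if n == 2%N then Lam 2 / 2%:R else 0) + (if n == N then Lam N / N%:R else 0)))).
  apply: ler_sum_nat => n _.
  have P2 : 0 <= (if n == 2%N then Lam 2 / 2%:R else 0) by case: ifP.
  have PN : 0 <= (if n == N then Lam N / N%:R else 0) by case: ifP.
  have [ng0|_] := boolP (n%:R == g); last by rewrite mul0r !addr_ge0 //; case: ifP.
  rewrite mul1r; have [pn|_] := boolP (prime n); last by rewrite /= -addrA lerDl addr_ge0.
  rewrite /= add0r; have [n2|n2] := eqVneq n 2%N; first by rewrite n2 lerDl -n2.
  have [->|nN] := eqVneq n N; first by rewrite add0r.
  exfalso; apply: ng; exists n; split=> //; last exact/eqP.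
  by have := prime_gt1 pn; lia.
rewrite !big_split /=; apply: lerD; last exact: sum_delta_le.
apply: lerD; last exact: sum_delta_le.
by rewrite -big_mkcond np_bound.
Qed.

Lemma lam_total m : \sum_g lam m g = \sum_(1 <= d < m.+1) Lam d / d%:R.
Proof.
transitivity (\sum_g 1 * lam m g); first by apply: eq_bigr => g _; rewrite mul1r.
by rewrite -(lam_sum m (fun=> 1)); apply: eq_bigr => d _; rewrite mulr1.
Qed.

(** v is a limit point of [lam m / ln m]; a linear combination of the [lam m g] and ln m that stays
    bounded becomes an exact identity for v after division by ln m. *)
Lemma lam_limit : exists v : F -> R, [/\ forall g, 0 <= v g &
  forall (c : F -> R) c0 K, (forall m, (0 < m)%N -> `|\sum_g c g * lam m g + c0 * ln m%:R| <= K) ->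
    \sum_g c g * v g + c0 = 0].
Proof.
have [M HM] := ln_large (1 : R).
have ln1' m : (M <= m)%N -> 1 < ln m%:R :> R by exact: HM.
pose u m (g : F) := lam (m + M.+1) g / ln (m + M.+1)%:R.
have lnp m : 1 < ln (m + M.+1)%:R :> R by apply: HM; lia.
have lnp0 m : 0 < ln (m + M.+1)%:R :> R by have := lnp m; lra.
(* Mertens' error 6 plus the main term 1, since the shift by [M.+1] keeps the logarithm above 1. *)
have uK m g : `|u m g| <= 7.
  rewrite /u ger0_norm; last by rewrite divr_ge0 ?lam_ge0 // ltW.
  rewrite ler_pdivrMr //.
  have h1 : lam (m + M.+1) g <= \sum_h lam (m + M.+1) h.
    by rewrite (bigD1 g) //= lerDl sumr_ge0 // => h _; exact: lam_ge0.
  have := mertens R (_ : 0 < m + M.+1)%N; rewrite -lam_total ler_norml => /(_ ltac:(lia)) /andP [_ h2].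
  have := lnp m; lra.
have [v Hv] := cluster_row uK.
exists v; split.
  move=> g; rewrite leNgt; apply/negP => v0.
  have [m _ /(_ g)] := Hv (- v g) ltac:(lra) 0%N.
  rewrite ltr_norml => /andP [_]; have : 0 <= u m g by rewrite divr_ge0 ?lam_ge0 ?ltW.
  lra.
move=> c c0 K HK; set s := _ + _; apply/eqP/negPn/negP => s0.
have sp : 0 < `|s| by rewrite normr_gt0.
have n0 := nrm_ge0 c.
pose e := `|s| / (2 * (nrm c + 1)).
have e0 : 0 < e by rewrite divr_gt0 //; lra.
have es : e * nrm c + e = `|s| / 2 by rewrite /e; field; lra.
have [M' HM'] := ln_large (K / e).
have [m Mm Hm] := Hv e e0 M'.
have l1 : K < e * ln (m + M.+1)%:R by rewrite -ltr_pdivrMl // mulrC; apply: HM'; lia.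
have hK := HK (m + M.+1)%N ltac:(lia).
have E : s = \sum_g c g * (v g - u m g) + (\sum_g c g * lam (m + M.+1) g + c0 * ln (m + M.+1)%:R) / ln (m + M.+1)%:R.
  rewrite mulrDl mulfK ?gt_eqF // addrA; congr (_ + _).
  rewrite mulr_suml -big_split /=; apply: eq_bigr => g _; rewrite /u; ring.
have b1 : `|\sum_g c g * (v g - u m g)| <= e * nrm c.
  apply: le_trans (ler_norm_sum _ _ _) _; rewrite /nrm mulr_sumr; apply: ler_sum => g _.
  by rewrite normrM mulrC ler_wpM2r // distrC ltW.
have b2 : `|(\sum_g c g * lam (m + M.+1) g + c0 * ln (m + M.+1)%:R) / ln (m + M.+1)%:R| <= e.
  rewrite normrM normfV (gtr0_norm (lnp0 m)) ler_pdivrMr //; lra.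
have : `|s| <= e * nrm c + e by rewrite {1}E; apply: le_trans (ler_normD _ _) _; exact: lerD.
by rewrite es; lra.
Qed.

Theorem prime_or_quotient (a : F) : a != 0 -> oddp a \/ exists2 g, oddp g & oddp (a * g).
Proof.
move=> a0; have [v [vp vl]] := lam_limit.
have [l [C [C0 Hl]]] := class_sum R pN.
have vnp g : ~ oddp g -> v g = 0.
  move=> ng; have := vl (fun x => (x == g)%:R) 0 (2 + Lam 2 / 2%:R + Lam N / N%:R).
  have pk (f : F -> R) : \sum_x (x == g)%:R * f x = f g.
    by rewrite (bigD1 g) //= eqxx mul1r big1 ?addr0 // => x /negPf ->; rewrite mul0r.
  rewrite pk addr0; apply => m _; rewrite pk mul0r addr0 ger0_norm ?lam_ge0 //; exact: lam_noprime.
have v00 : v 0 = 0.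
  apply: vnp => -[p [pp _ pN' /eqP]]; apply/negP; rewrite natF_neq0 //.
  by rewrite dvdn_prime2 // eq_sym.
have vs : \sum_g v g = 1.
  have := vl (fun=> 1) (-1) 6; have -> : \sum_(g : F) 1 * v g = \sum_g v g by apply: eq_bigr => g _; rewrite mul1r.
  move=> h; apply/eqP; rewrite -subr_eq0; apply/eqP; apply: h => m m0.
  under eq_bigr => g _ do rewrite mul1r.
  by rewrite lam_total mulN1r; exact: mertens.
have phi0 := phi_neq0 R pN; set phi := (N.-1)%:R in phi0.
pose nu (x : F) : R := v x - (x != 0)%:R / phi.
have nu0 : nu 0 = 0 by rewrite /nu eqxx v00 mul0r subrr.
have nus : \sum_x nu x = 0.
  by rewrite sumrB vs -mulr_suml (sum_ind R (fun x => x != 0)) card_nz // mulfV // subrr.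
have cor : forall z, \sum_x nu (z * x) * l x = 0.
  apply: conv_corr => // w w0 ws.
  have h1 : \sum_g v g * ip (fun x => w (g * x)) l = 0.
    have [K HK] := A_bound pN C0 Hl w0 ws.
    have := vl (fun g => ip (fun x => w (g * x)) l) 0 K; rewrite addr0 => h.
    under eq_bigr => g _ do rewrite mulrC.
    by apply: h => m m0; rewrite mul0r addr0 -lam_sum; exact: HK.
  rewrite /nu; under eq_bigr => g _ do rewrite mulrBl.
  rewrite sumrB h1 sub0r; apply/eqP; rewrite oppr_eq0; apply/eqP.
  under eq_bigr => g _ do rewrite mulrAC mulr_sumr.
  rewrite -mulr_suml exchange_big big1 ?mul0r //= => x _.
  under eq_bigr => g _ do rewrite mulrA.
  rewrite -mulr_suml; have [->|x0] := eqVneq x 0.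
    by rewrite big1 ?mul0r // => g _; rewrite mulr0 w0 mulr0.
  rewrite (_ : \sum_i _ = 0) ?mul0r // -[RHS]ws -(sum_rescale w x0); apply: eq_bigr => g _.
  by have [->|g0] := eqVneq g 0; rewrite ?mul0r ?w0 //= mul1r.
(* [B_bound] for w(x) = nu(a x), whose dilates all have limit 0 by [cor], passed to the limit. *)
have main : \sum_g nu (a * g) * v g + nu a = 0.
  pose w (x : F) := nu (a * x).
  have w0 : w 0 = 0 by rewrite /w mulr0.
  have ws : \sum_x w x = 0.
    by rewrite -[RHS]nus -(sum_rescale nu a0); apply: eq_bigr => x _; rewrite /w mulrC.
  have wz d : ip (tau d w) l = 0.
    by rewrite -[RHS](cor (a * d%:R)); apply: eq_bigr => x _; rewrite /tau /w mulrA.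
  have [K HK] := B_bound C0 Hl w0 ws wz.
  rewrite -[a in nu a]mulr1; apply: (vl w (w 1) K) => m m0.
  by rewrite -lam_sum; exact: HK.
apply: contrapT => /not_orP [na nq].
have va : v a = 0 by exact: vnp.
have vag g : v (a * g) * v g = 0.
  have [og|ng] := pselect (oddp g); last by rewrite (vnp g) // mulr0.
  by rewrite (vnp (a * g)) ?mul0r // => oag; apply: nq; exists g.
(* Here v(a g) v(g) = 0 for every g, so only the uniform part of nu contributes, with total mass 1
   of v. *)
move: main; have -> : \sum_g nu (a * g) * v g = - phi^-1.
  rewrite -[RHS]mulr1 -vs mulr_sumr; apply: eq_bigr => g _.
  rewrite /nu mulrBl vag sub0r mulNr; have [->|g0] := eqVneq g 0; first by rewrite v00 !mulr0 oppr0.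
  by rewrite mulf_neq0 // mul1r.
rewrite /nu va a0 mul1r sub0r -opprD => /eqP; rewrite oppr_eq0 -mulr2n mulrn_eq0 invr_eq0 /=.
by rewrite (negPf phi0).
Qed.
End Main.

Lemma prime_or_quotient_mod (R : realType) (N a : nat) : prime N -> ~~ (N %| a)%N ->
  (exists p, [/\ prime p, (2 < p)%N, p <> N & p = a %[mod N]]) \/
  exists p q, [/\ prime p, (2 < p)%N & p <> N] /\ [/\ prime q, (2 < q)%N, q <> N & p = a * q %[mod N]].
Proof.
move=> pN na.
have E m n : (m%:R = n%:R :> 'F_N) -> m = n %[mod N].
  by move=> /(congr1 (fun x : 'F_N => x : nat)); rewrite !natF_mod.
have [[p [p1 p2 p3 p4]]|[g [q [q1 q2 q3 q4]] [p [p1 p2 p3 p4]]]] := @prime_or_quotient R N pN a%:R ltac:(by rewrite natF_neq0).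
  by left; exists p; split=> //; [exact/eqP|exact: E].
right; exists p, q; split; split=> //; [exact/eqP|exact/eqP|].
by apply: E; rewrite natrM q4.
Qed.
End PrimeClasses.

(** * The statement on prime classes in terms of integers *)

Module PrimeClassesZ.
From mathcomp Require Import all_boot all_order all_algebra.
From mathcomp Require Import reals Rstruct zify.
From Stdlib Require ZArith Znumtheory.
Set Implicit Arguments. Unset Strict Implicit. Unset Printing Implicit Defensive.
Import BinInt.

Definition okp (N : nat) (p : nat) := Znumtheory.prime (Z.of_nat p) /\ Peano.le 3 p /\ p <> N.

Lemma Zprime_of p : prime p -> Znumtheory.prime (Z.of_nat p).
Proof.
move=> pp; have p1 := prime_gt1 pp; apply/(proj1 (Znumtheory.prime_alt _)); split; first by lia.
move=> n Hn Hd; have E : n = Z.of_nat (Z.to_nat n) by lia.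
have : (Z.to_nat n %| p)%N.
  case: Hd => q Hq; apply/dvdnP; exists (Z.to_nat q); nia.
by move/primeP: pp => [_ H] /H /orP [/eqP|/eqP]; lia.
Qed.

Lemma okp_of N p : prime p -> (2 < p)%N -> p <> N -> okp N p.
Proof. by move=> h1 h2 h3; split; [exact: Zprime_of|split=> //; lia]. Qed.

Lemma mod_div N m n : (0 < N)%N -> m = n %[mod N] -> Z.divide (Z.of_nat N) (Z.of_nat m - Z.of_nat n).
Proof.
move=> N0 E; exists (Z.of_nat (m %/ N) - Z.of_nat (n %/ N))%Z.
have := divn_eq m N; have := divn_eq n N; rewrite E; nia.
Qed.

Lemma prime_or_quotient_Z (N : nat) (a : Z) : Znumtheory.prime (Z.of_nat N) -> ~ Z.divide (Z.of_nat N) a ->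
  (exists p, okp N p /\ Z.divide (Z.of_nat N) (Z.of_nat p - a)) \/
  exists p q, okp N p /\ okp N q /\ Z.divide (Z.of_nat N) (Z.of_nat p - a * Z.of_nat q).
Proof.
move=> HN na; have pN := HeckeCosets.prime_of_Z HN; have N0 := prime_gt0 pN.
set b := Z.to_nat (Z.modulo a (Z.of_nat N)).
have Hb : Z.of_nat b = Z.modulo a (Z.of_nat N) by rewrite /b Znat.Z2Nat.id //; have := Z.mod_pos_bound a (Z.of_nat N); lia.
have [k Hk] : exists k, Z.of_nat b = (a + k * Z.of_nat N)%Z.
  exists (- Z.div a (Z.of_nat N))%Z; rewrite Hb; have := Z.div_mod a (Z.of_nat N); lia.
have nb : ~~ (N %| b)%N.
  apply/negP => /dvdnP [c Hc]; apply: na; exists (Z.of_nat c - k)%Z; move: Hk; rewrite Hc; nia.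
have [[p [p1 p2 p3 p4]]|[p [q [[p1 p2 p3] [q1 q2 q3 p4]]]]] := @PrimeClasses.prime_or_quotient_mod Rdefinitions.R N b pN nb.
  left; exists p; split; first exact: okp_of.
  have [c Hc] := mod_div N0 p4; exists (c + k)%Z; nia.
right; exists p, q; split; first exact: okp_of; split; first exact: okp_of.
have [c Hc] := mod_div N0 p4; exists (c + k * Z.of_nat q)%Z; nia.
Qed.
End PrimeClassesZ.

(** * From prime top-left entries to all of Gamma0(N) *)

Module GoodElements.
From Corelib Require Import ssreflect.
From Stdlib Require Import Reals Lra Lia ZArith Znumtheory List FunctionalExtensionality.
From Coquelicot Require Import Coquelicot.
Require Import Defs.
Import ComplexExponential RamanujanTwists SLAction PrimeTopEntry.

Lemma ofZ_mmul_SL2Z m m' : SL2Z m -> SL2Z m' -> SL2Z (mmul m m').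
Proof. intros D D'. unfold SL2Z in *. unfold mmul. simpl. nia. Qed.
Lemma ofZ_mmul m m' (D : SL2Z m) (D' : SL2Z m') : SLmul (ofZ m D) (ofZ m' D') = ofZ (mmul m m') (ofZ_mmul_SL2Z m m' D D').
Proof.
  apply SL_eq; unfold ofZ, SLmul, mkSL, ea, eb, ec, ed; cbn [proj1_sig fst snd]; unfold mmul; simpl;
    rewrite plus_IZR !mult_IZR; reflexivity.
Qed.

Lemma slash_mul k m m' (h : C -> C) (z : C) : SL2Z m -> SL2Z m' -> in_H z ->
  slash k (mmul m m') h z = slash k m' (slash k m h) z.
Proof.
  intros D D' Hz. change z with (hz (exist _ z Hz)).
  rewrite (slash_actv k _ (ofZ_mmul_SL2Z m m' D D')) (slash_actv k _ D') -ofZ_mmul actvM.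
  reflexivity.
Qed.
Lemma slash_ext k m (h h' : C -> C) (z : C) : SL2Z m -> in_H z -> (forall w : C, in_H w -> h w = h' w) -> slash k m h z = slash k m h' z.
Proof.
  intros D Hz E. change z with (hz (exist _ z Hz)). rewrite !(slash_actv k _ D).
  f_equal. apply functional_extensionality. intros [w Hw]. apply E. exact Hw.
Qed.
Lemma slash_scal k m (c : C) (h : C -> C) (z : C) : slash k m (fun w => (c * h w)%C) z = (c * slash k m h z)%C.
Proof. unfold slash. ring. Qed.
Lemma slash_1 k (h : C -> C) (z : C) : slash k (1, 0, 0, 1)%Z h z = h z.
Proof.
  unfold slash; cbn [m_a m_b m_c m_d]. replace (0 * z + 1)%C with (RtoC 1) by ring. rewrite cpown_1.
  replace ((1 * z + 0) / 1)%C with z by field. field.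
Qed.

Definition minv (m : mat2) : mat2 := (m_d m, (- m_b m)%Z, (- m_c m)%Z, m_a m).
Lemma minv_Gamma0 N m : Gamma0 N m -> Gamma0 N (minv m).
Proof.
  destruct m as [[[a b] c] d]. unfold Gamma0, SL2Z, minv; simpl. intros [H1 H2]; split; [lia|]. apply Z.divide_opp_r; auto.
Qed.
Lemma mmul_Gamma0 N m m' : Gamma0 N m -> Gamma0 N m' -> Gamma0 N (mmul m m').
Proof.
  intros [D H] [D' H']; split; [apply ofZ_mmul_SL2Z; auto|]. unfold mmul; cbn [m_c].
  apply Z.divide_add_r; [apply Z.divide_mul_l; auto|apply Z.divide_mul_r; auto].
Qed.
Lemma mat2_eq (a b c d a' b' c' d' : Z) : a = a' -> b = b' -> c = c' -> d = d' -> (a, b, c, d) = (a', b', c', d') :> mat2.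
Proof. intros -> -> -> ->. reflexivity. Qed.
Lemma mmul_assoc a b c : mmul (mmul a b) c = mmul a (mmul b c).
Proof. destruct a as [[[? ?] ?] ?], b as [[[? ?] ?] ?], c as [[[? ?] ?] ?]. apply mat2_eq; cbv beta iota delta [mmul m_a m_b m_c m_d]; ring. Qed.
Lemma mmul_minv m : SL2Z m -> mmul m (minv m) = (1, 0, 0, 1)%Z.
Proof. destruct m as [[[a b] c] d]. unfold SL2Z, mmul, minv; simpl. intros H. repeat f_equal; lia. Qed.
Lemma minv_mmul m : SL2Z m -> mmul (minv m) m = (1, 0, 0, 1)%Z.
Proof. destruct m as [[[a b] c] d]. unfold SL2Z, mmul, minv; simpl. intros H. repeat f_equal; lia. Qed.
Lemma mmul_1r m : mmul m (1, 0, 0, 1)%Z = m.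
Proof. destruct m as [[[a b] c] d]. unfold mmul; simpl. repeat f_equal; ring. Qed.
Lemma mmul_1l m : mmul (1, 0, 0, 1)%Z m = m.
Proof. destruct m as [[[a b] c] d]. unfold mmul; cbn [m_a m_b m_c m_d]. repeat f_equal; ring. Qed.
Lemma mmul_d m m' : m_d (mmul m m') = (m_c m * m_b m' + m_d m * m_d m')%Z.
Proof. reflexivity. Qed.

Lemma prime_gcd_nat p N : prime (Z.of_nat p) -> prime (Z.of_nat N) -> p <> N -> Nat.gcd p N = 1%nat.
Proof.
  intros Hp HN Hne. destruct (Nat.gcd_divide_l p N) as [u Hu], (Nat.gcd_divide_r p N) as [v Hv].
  assert (D1 : (Z.of_nat (Nat.gcd p N) | Z.of_nat p)%Z) by (exists (Z.of_nat u); lia).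
  assert (D2 : (Z.of_nat (Nat.gcd p N) | Z.of_nat N)%Z) by (exists (Z.of_nat v); lia).
  assert (P1 := prime_ge_2 _ Hp). assert (P2 := prime_ge_2 _ HN).
  destruct (prime_divisors _ Hp _ D1) as [E|[E|[E|E]]]; try lia.
  destruct (prime_divisors _ HN _ D2) as [E'|[E'|[E'|E']]]; lia.
Qed.

Section Good.
Variables (N k : nat) (f : C -> C) (xi : Z -> C).
Hypothesis HN : prime (Z.of_nat N).
Hypothesis Hk : (0 < k)%nat.
Hypothesis Hhol : forall z : C, 0 < snd z -> exists l, ComplexIntegral.Cder f z l.
Hypothesis HT : forall z : C, 0 < snd z -> f (z + 1)%C = f z.
Hypothesis HU : forall z : C, 0 < snd z -> slR k 1 0 (INR N) 1 f z = f z.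
Hypothesis Hcomm : forall g1 g2 : mat2, Gamma0 N g1 -> Gamma0 N g2 ->
     forall z : C, in_H z -> slash k (mmul g1 g2) f z = slash k (mmul g2 g1) f z.
Hypothesis Hxi : dirichlet_char N xi.
Hypothesis Hpar : xi (-1)%Z = cpown (RtoC (-1)) k.
Hypothesis Hrel : forall q, (1 <= q)%nat -> Nat.gcd q N = 1%nat -> forall z : C, 0 < snd z ->
  lsum (units q) (fun a => f (z + RtoC (INR a / INR q))%C) =
    (xi (Z.of_nat q) * lsum (units q) (fun a => slR k (INR q) 0 (- INR a * INR N) (/ INR q) f z))%C.

Definition good (m : mat2) := forall z : C, in_H z -> slash k m f z = (xi (m_d m) * f z)%C.

Lemma xi_shift n s : xi (n + s * Z.of_nat N)%Z = xi n.
Proof.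
  destruct Hxi as [P _].
  assert (H : forall (j : nat) n, xi (n + Z.of_nat j * Z.of_nat N)%Z = xi n).
  { induction j as [|j IH]; intros n'; [f_equal; lia|].
    replace (n' + Z.of_nat (S j) * Z.of_nat N)%Z with ((n' + Z.of_nat j * Z.of_nat N) + Z.of_nat N)%Z by lia. rewrite P; apply IH. }
  destruct (Z_le_dec 0 s) as [Hs|Hs].
  - rewrite -(Z2Nat.id s Hs). apply H.
  - rewrite -(H (Z.to_nat (- s)) (n + s * Z.of_nat N)%Z). f_equal. rewrite Z2Nat.id; lia.
Qed.
Lemma xi_cong n m : (Z.of_nat N | n - m)%Z -> xi n = xi m.
Proof. intros [s Hs]. replace n with (m + s * Z.of_nat N)%Z by lia. apply xi_shift. Qed.
Lemma xi_mul m n : xi (m * n)%Z = (xi m * xi n)%C.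
Proof. apply Hxi. Qed.
Lemma xi_1 : xi 1%Z = 1%C.
Proof. apply Hxi. Qed.
Lemma xi_ad m : Gamma0 N m -> (xi (m_a m) * xi (m_d m))%C = 1%C.
Proof.
  destruct m as [[[a b] c] d]. intros [D H]. unfold SL2Z in D; simpl in *. rewrite -xi_mul -xi_1. apply xi_cong.
  replace (a * d - 1)%Z with (b * c)%Z by lia. apply Z.divide_mul_r; auto.
Qed.
Lemma C1_neq0 : (1%C : C) <> 0%C.
Proof. intros H. apply (f_equal fst) in H. simpl in H. lra. Qed.
Lemma good_mul m m' : Gamma0 N m -> Gamma0 N m' -> good m -> good m' -> good (mmul m m').
Proof.
  intros [D H] [D' H'] G G' z Hz. rewrite slash_mul; auto.
  rewrite (slash_ext k m' _ (fun w => (xi (m_d m) * f w)%C)); auto. rewrite slash_scal G'; auto. rewrite Cmult_assoc -xi_mul.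
  f_equal. apply xi_cong. rewrite mmul_d. replace (m_d m * m_d m' - (m_c m * m_b m' + m_d m * m_d m'))%Z with (- (m_b m') * m_c m)%Z by ring.
  apply Z.divide_mul_r; auto.
Qed.
Lemma good_inv m : Gamma0 N m -> good m -> good (minv m).
Proof.
  intros Hm G z Hz. assert (D := proj1 Hm). assert (Hm' := minv_Gamma0 N m Hm). assert (D' := proj1 Hm').
  assert (E : slash k (mmul m (minv m)) f z = f z) by (rewrite mmul_minv; auto; apply slash_1).
  rewrite slash_mul in E; auto. rewrite (slash_ext k _ _ (fun w => (xi (m_d m) * f w)%C)) in E; auto. rewrite slash_scal in E.
  assert (X := xi_ad m Hm). unfold minv at 2; cbn [m_d]. rewrite -E Cmult_assoc X. ring.
Qed.
(** Both the action on f and the class of d modulo N are determined by the top row, the latter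
    because a d = 1 modulo N. *)
Lemma good_row m m' : Gamma0 N m -> Gamma0 N m' -> m_a m = m_a m' -> m_b m = m_b m' -> good m -> good m'.
Proof.
  intros Hm Hm' Ea Eb G z Hz. destruct (Hm) as [D H], (Hm') as [D' H'].
  assert (E : slash k m' f z = slash k m f z).
  { change z with (hz (exist _ z Hz)). rewrite (slash_actv k _ D) (slash_actv k _ D').
    rewrite (pe_top N k f Hk HU (ofZ m' D') (ofZ m D)); auto; try apply GamN_ofZ; auto.
    - change (IZR (m_a m') = IZR (m_a m)). rewrite Ea; auto.
    - change (IZR (m_b m') = IZR (m_b m)). rewrite Eb; auto. }
  rewrite E G; auto. f_equal. assert (X := xi_ad m Hm). assert (X' := xi_ad m' Hm'). rewrite -Ea in X'.
  replace (xi (m_d m)) with (xi (m_d m) * (xi (m_a m) * xi (m_d m')))%C by (rewrite X'; ring).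
  replace (xi (m_d m) * (xi (m_a m) * xi (m_d m')))%C with ((xi (m_a m) * xi (m_d m)) * xi (m_d m'))%C by ring. rewrite X. ring.
Qed.
Lemma good_cancel_r m m' : Gamma0 N m -> Gamma0 N m' -> good m' -> good (mmul m m') -> good m.
Proof.
  intros H H' G' G. replace m with (mmul (mmul m m') (minv m')).
  - apply good_mul; auto; [apply mmul_Gamma0; auto|apply minv_Gamma0; auto|apply good_inv; auto].
  - rewrite mmul_assoc mmul_minv; [|apply H']. apply mmul_1r.
Qed.
Lemma good_cancel_l m m' : Gamma0 N m -> Gamma0 N m' -> good m -> good (mmul m m') -> good m'.
Proof.
  intros H H' G' G. replace m' with (mmul (minv m) (mmul m m')).
  - apply good_mul; auto; [apply minv_Gamma0; auto|apply mmul_Gamma0; auto|apply good_inv; auto].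
  - rewrite -mmul_assoc minv_mmul; [|apply H]. apply mmul_1l.
Qed.

Definition Tm (s : Z) : mat2 := (1, s, 0, 1)%Z.
Definition Um (s : Z) : mat2 := (1, 0, s * Z.of_nat N, 1)%Z.
Lemma Tm_Gamma0 s : Gamma0 N (Tm s).
Proof. split; [unfold SL2Z, Tm; cbn [m_a m_b m_c m_d]; lia|apply Z.divide_0_r]. Qed.
Lemma Um_Gamma0 s : Gamma0 N (Um s).
Proof. split; [unfold SL2Z, Um; cbn [m_a m_b m_c m_d]; lia|apply Z.divide_factor_r]. Qed.
Lemma good_T s : good (Tm s).
Proof.
  intros z Hz. cbn [m_d Tm]. rewrite xi_1 Cmult_1_l. change z with (hz (exist _ z Hz)) at 1.
  destruct (Tm_Gamma0 s) as [D _]. rewrite (slash_actv k _ D).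
  replace (ofZ (Tm s) D) with (Tr (IZR s)) by (apply SL_eq; reflexivity). rewrite (pe_Tz k f Hk HT). reflexivity.
Qed.
Lemma good_U s : good (Um s).
Proof.
  intros z Hz. cbn [m_d Um]. rewrite xi_1 Cmult_1_l. change z with (hz (exist _ z Hz)) at 1.
  destruct (Um_Gamma0 s) as [D _]. rewrite (slash_actv k _ D).
  replace (ofZ (Um s) D) with (Lo (IZR s * INR N)).
  - rewrite (pe_Uz N k f Hk HU). reflexivity.
  - apply SL_eq; try reflexivity. change (IZR s * INR N = IZR (s * Z.of_nat N)). rewrite mult_IZR INR_IZR_INZ. reflexivity.
Qed.
Definition Mone : mat2 := (-1, 0, 0, -1)%Z.
Lemma Mone_Gamma0 : Gamma0 N Mone.
Proof. split; [reflexivity|apply Z.divide_0_r]. Qed.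
Lemma good_Mone : good Mone.
Proof.
  intros z Hz. unfold slash, Mone; cbn [m_a m_b m_c m_d].
  replace (0 * z + -1)%C with (RtoC (-1)) by ring.
  replace ((-1 * z + 0) / -1)%C with z by (field; intros E; apply (f_equal fst) in E; simpl in E; lra).
  f_equal. rewrite -Hpar. assert (X : (xi (-1)%Z * xi (-1)%Z)%C = 1%C) by (rewrite -xi_mul; apply xi_1).
  assert (X0 : xi (-1)%Z <> 0%C) by (intros E; rewrite E in X; apply C1_neq0; rewrite -X; ring).
  replace (/ xi (-1)%Z)%C with (/ xi (-1)%Z * (xi (-1)%Z * xi (-1)%Z))%C by (rewrite X; ring). field. auto.
Qed.

(** [prime_entry] gives the factor 1/xi(p), which equals xi(d) because p d = 1 modulo N. *)
Lemma good_prime m p : Gamma0 N m -> PrimeClassesZ.okp N p -> m_a m = Z.of_nat p -> good m.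
Proof.
  intros Hm [Hp [Hp3 Hne]] Ha z Hz. destruct (Hm) as [D H].
  assert (X := xi_ad m Hm). rewrite Ha in X.
  assert (X0 : xi (Z.of_nat p) <> 0%C) by (intros E; rewrite E in X; apply C1_neq0; rewrite -X; ring).
  change z with (hz (exist _ z Hz)) at 1. rewrite (slash_actv k _ D).
  rewrite (prime_entry N k f HN Hk Hhol HT HU Hcomm p (xi (Z.of_nat p)) (ofZ m D) Hp Hp3); auto.
  - change ((/ xi (Z.of_nat p) * f z)%C = (xi (m_d m) * f z)%C). f_equal.
    replace (/ xi (Z.of_nat p))%C with (/ xi (Z.of_nat p) * (xi (Z.of_nat p) * xi (m_d m)))%C by (rewrite X; ring). field; auto.
  - apply Hrel; [lia|]. apply prime_gcd_nat; auto.
  - apply GamN_ofZ; auto.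
  - change (IZR (m_a m) = INR p). rewrite Ha INR_IZR_INZ. reflexivity.
Qed.

(** With top-right entry 1, multiplying by [Um s] on the right replaces a by a + s N, so a may be
    any integer of its class, in particular a prime if its class contains a suitable one. *)
Lemma good_row1 m : Gamma0 N m -> m_b m = 1%Z -> good m.
Proof.
  intros Hm Hb. destruct (Hm) as [D H]. destruct m as [[[a b] c] d]. cbn in Hb. subst b. unfold SL2Z in D. cbn [m_a m_b m_c m_d] in *.
  assert (P2 := prime_ge_2 _ HN).
  assert (Na : ~ (Z.of_nat N | a)%Z).
  { intros Da. assert (D1 : (Z.of_nat N | 1)%Z) by (rewrite -D; apply Z.divide_sub_r; [apply Z.divide_mul_l; auto|apply Z.divide_mul_r; auto]).
    apply Z.divide_1_r in D1. lia. }
  assert (shift : forall s, good (mmul (a, 1, c, d)%Z (Um s)) -> good (a, 1, c, d)%Z).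
  { intros s. apply good_cancel_r; auto; [apply Um_Gamma0|apply good_U]. }
  destruct (@PrimeClassesZ.prime_or_quotient_Z N a HN Na) as [[p [Hp [s Hs]]]|[p [q [Hp [Hq [s Hs]]]]]].
  - apply (shift s), (good_prime _ p); auto; [apply mmul_Gamma0; auto; apply Um_Gamma0|].
    unfold mmul, Um; cbn [m_a m_b m_c m_d]. lia.
  - destruct (Nat.eq_dec p q) as [->|Hpq].
    + assert (D1 : (Z.of_nat N | Z.of_nat q * (1 - a))%Z) by (exists s; lia).
      destruct (prime_mult _ HN _ _ D1) as [D2|[t Ht]].
      * exfalso. destruct Hq as [Hq [_ Hne]]. apply Hne. apply prime_div_prime in D2; auto; lia.
      * apply (shift t). apply (good_row (Tm 1)); try apply Tm_Gamma0; [apply mmul_Gamma0; auto; apply Um_Gamma0| | |apply good_T];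
        unfold mmul, Um, Tm; cbn [m_a m_b m_c m_d]; lia.
    + destruct Hq as [Hq Hq']. destruct (Hp) as [Hp0 _].
      assert (R0 : rel_prime (Z.of_nat q) (Z.of_nat p)).
      { apply prime_rel_prime; auto. intros Dq. apply prime_div_prime in Dq; auto. lia. }
      destruct (rel_prime_bezout _ _ R0) as [u v Huv].
      (* Top-left entry q, and lower-left entry p - a q, divisible by N; multiplied by the row (a,
         1) its first column gives a q + (p - a q) = p. *)
      set (g2 := (Z.of_nat q, (- v)%Z, (Z.of_nat p - a * Z.of_nat q)%Z, (u + a * v)%Z)).
      assert (Hg2 : Gamma0 N g2).
      { split; [unfold SL2Z, g2; cbn [m_a m_b m_c m_d]; nia|exists s; exact Hs]. }
      apply (good_cancel_r _ g2); auto.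
      * apply (good_prime _ q); auto. split; auto.
      * apply (good_prime _ p); auto; [apply mmul_Gamma0; auto|]. unfold mmul, g2; cbn [m_a m_b m_c m_d]. ring.
Qed.

Lemma Gamma0_a m : Gamma0 N m -> ~ (Z.of_nat N | m_a m)%Z.
Proof.
  intros [D H] Da. unfold SL2Z in D. assert (P2 := prime_ge_2 _ HN).
  assert (D1 : (Z.of_nat N | 1)%Z) by (rewrite -D; apply Z.divide_sub_r; [apply Z.divide_mul_l; auto|apply Z.divide_mul_r; auto]).
  apply Z.divide_1_r in D1. lia.
Qed.
(** Up to -1, whose action is the parity condition on xi, the top row is that of a power of T. *)
Lemma good_a1 m : Gamma0 N m -> Z.abs (m_a m) = 1%Z -> good m.
Proof.
  intros Hm Ha. assert (E : m_a m = 1%Z \/ m_a m = (-1)%Z) by lia. destruct E as [E|E].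
  - apply (good_row (Tm (m_b m))); auto; [apply Tm_Gamma0|apply good_T].
  - apply (good_cancel_l Mone); auto; [apply Mone_Gamma0|apply good_Mone|].
    apply (good_row (Tm (- m_b m))); auto; [apply Tm_Gamma0|apply mmul_Gamma0; auto; apply Mone_Gamma0| | |apply good_T];
    unfold mmul, Mone, Tm; cbn [m_a m_b m_c m_d]; lia.
Qed.

(* Euclidean descent on the top-left entry: if the top row of m' in Gamma0(N) is a Farey neighbour
   of that of m, then m' m^-1 has top-right entry 1. *)
Lemma good_all m : Gamma0 N m -> good m.
Proof.
  remember (Z.to_nat (Z.abs (m_a m))) as n eqn:En. revert m En. induction n as [n IH] using lt_wf_ind. intros m En Hm.
  assert (Na := Gamma0_a m Hm). assert (P2 := prime_ge_2 _ HN).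
  assert (A0 : m_a m <> 0%Z) by (intros E; apply Na; rewrite E; apply Z.divide_0_r).
  destruct (Z.eq_dec (Z.abs (m_a m)) 1) as [A1|A1]; [apply good_a1; auto|].
  destruct (Hm) as [D H]. destruct m as [[[a b] c] d]. unfold SL2Z in D. cbn [m_a m_b m_c m_d] in *.
  assert (Hr := Z.mod_pos_bound c (Z.abs a) ltac:(lia)).
  assert (Hq := Z.div_mod c (Z.abs a) ltac:(lia)).
  assert (Hr0 : (c mod Z.abs a <> 0)%Z).
  { intros E. rewrite E in Hq. assert (D1 : (a | 1)%Z).
    { rewrite -D. apply Z.divide_sub_r; [apply Z.divide_factor_l|]. apply Z.divide_mul_r. rewrite Hq Z.add_0_r.
      apply Z.divide_mul_l. apply Z.divide_abs_r. apply Z.divide_refl. }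
    apply Z.divide_1_r in D1. lia. }
  (* The two residues of c of absolute value below |a| differ by |a|, which N does not divide, so at
     least one of them is prime to N. *)
  assert (Hs : exists s, (Z.abs (c + s * a) < Z.abs a)%Z /\ ~ (Z.of_nat N | c + s * a)%Z).
  { assert (S1 : exists s, (c + s * a = c mod Z.abs a)%Z).
    { exists (- Z.sgn a * (c / Z.abs a))%Z. assert (T := Z.abs_sgn a). nia. }
    assert (S2 : exists s, (c + s * a = c mod Z.abs a - Z.abs a)%Z).
    { exists (- Z.sgn a * (c / Z.abs a) - Z.sgn a)%Z. assert (T := Z.abs_sgn a). nia. }
    destruct S1 as [s1 E1], S2 as [s2 E2].
    destruct (Zdivide_dec (Z.of_nat N) (c + s1 * a)) as [Y|Y].
    - exists s2. split; [lia|]. intros Y'. apply Na. apply Z.divide_abs_r.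
      replace (Z.abs a) with ((c + s1 * a) - (c + s2 * a))%Z by lia. apply Z.divide_sub_r; auto.
    - exists s1. split; [lia|auto]. }
  destruct Hs as [s [Hs1 Hs2]]. set (a' := (c + s * a)%Z) in *. set (b' := (d + s * b)%Z).
  assert (R1 : rel_prime a' b').
  { apply bezout_rel_prime. apply Bezout_intro with (- b)%Z a. unfold a', b'. lia. }
  assert (R2 : rel_prime a' (Z.of_nat N)) by (apply rel_prime_sym, prime_rel_prime; auto).
  (* Since a' is prime to N b', the row (a', b') can be completed with a lower-left entry divisible
     by N. *)
  destruct (rel_prime_bezout _ _ (rel_prime_mult _ _ _ R2 R1)) as [u v Huv].
  set (m' := (a', b', (- v * Z.of_nat N)%Z, u)).
  assert (Hm' : Gamma0 N m').
  { split; [unfold SL2Z, m'; cbn [m_a m_b m_c m_d]; nia|apply Z.divide_factor_r]. }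
  assert (G' : good m') by (apply (IH (Z.to_nat (Z.abs a'))); auto; lia).
  apply (good_cancel_l (mmul m' (minv (a, b, c, d)))); auto.
  - apply mmul_Gamma0; auto. apply minv_Gamma0; auto.
  - apply good_row1; [apply mmul_Gamma0; auto; apply minv_Gamma0; auto|].
    unfold mmul, minv, m'; cbn [m_a m_b m_c m_d]. unfold a', b'. lia.
  - rewrite mmul_assoc minv_mmul; [rewrite mmul_1r; auto|exact D].
Qed.
End Good.
End GoodElements.

(* Growth at the two cusps, and conclusion *)
From Corelib Require Import ssreflect.
From Stdlib Require Import Reals Lra Lia ZArith Znumtheory List.
From Coquelicot Require Import Coquelicot.
Require Import Defs.
Import ComplexDerivative ComplexExponential QSeries HeckeFunctionalEquation RamanujanTwists SLAction PrimeTopEntry GoodElements.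

Lemma qser_bounded a A m y h : polybd a A m -> 0 < y -> (forall z : C, 0 < snd z -> csum (qterm a z) (h z)) ->
  exists M, forall z : C, y <= snd z -> Cmod (h z) <= M.
Proof.
  intros Ha Hy Hh. destruct (qterm_bound a A m y Ha Hy) as [K [HK H]]. exists (2 * K). intros z Hz.
  apply (csum_bound (qterm a z)); auto. apply Hh; lra.
Qed.

(** For prime N the cusps are infinity and 0. When N does not divide c, take j = v d with v an
    inverse of c modulo N: this makes the lower-left entry d (v c - 1) of m divisible by N. *)
Lemma rational_cusp_coset N g : prime (Z.of_nat N) -> SL2Z g -> ~ (Z.of_nat N | m_c g)%Z ->
  exists j m, Gamma0 N m /\ g = mmul m (0, -1, 1, j)%Z.
Proof.
  intros HN Hg Hc. destruct g as [[[a b] c] d]. unfold SL2Z in Hg. cbn [m_a m_b m_c m_d] in *.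
  destruct (rel_prime_bezout _ _ (prime_rel_prime _ HN c Hc)) as [u v Huv].
  exists (v * d)%Z, (a * (v * d) - b, a, c * (v * d) - d, c)%Z. split; [split|].
  - unfold SL2Z; cbn [m_a m_b m_c m_d]. lia.
  - cbn [m_c]. exists (- u * d)%Z. replace (c * (v * d) - d)%Z with ((v * c - 1) * d)%Z by ring.
    replace (v * c - 1)%Z with (- u * Z.of_nat N)%Z by lia. ring.
  - unfold mmul; apply mat2_eq; cbv beta iota delta [mmul m_a m_b m_c m_d]; ring.
Qed.

Theorem theorem2p4
  (N : nat) (xi : Z -> C) (k : nat) (fc gc : nat -> C) (sigma : R)
  (f : C -> C) :
  Znumtheory.prime (Z.of_nat N) ->
  dirichlet_char N xi ->
  (0 < k)%nat ->
  xi (-1)%Z = cpown (RtoC (-1)) k ->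
  0 < sigma ->
  (exists B : R, forall n : nat, (1 <= n)%nat ->
     Cmod (fc n) <= B * Rpower (INR n) sigma /\ Cmod (gc n) <= B * Rpower (INR n) sigma) ->
  (forall q : nat, (1 <= q)%nat -> Nat.gcd q N = 1%nat ->
     exists LF LG : C -> C,
       entire LF /\ finite_order LF /\ entire LG /\ finite_order LG /\
       (forall s : C, sigma + 1 - (INR k - 1) / 2 < Re s ->
          Lambda_series k fc q s (LF s) /\ Lambda_series k gc q s (LG s)) /\
       (forall s : C,
          LF s = (cpown Ci k * xi (Z.of_nat q)
                  * cpowR (INR (N * q * q)) (RtoC (1 / 2) - s) * LG (1 - s))%C)) ->
  (forall z : C, in_H z ->
     is_series (K := R_AbsRing) (V := C_R_NormedModule)
       (fun n => (fc (S n) * e_ (INR (S n) * z)))%C (f z)) ->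
  (forall g1 g2 : mat2, Gamma0 N g1 -> Gamma0 N g2 ->
     forall z : C, in_H z -> slash k (mmul g1 g2) f z = slash k (mmul g2 g1) f z) ->
  modular_form k N xi f.
Proof.
  intros HN Hxi Hk Hpar Hsig Hbnd Hq Hf Hcomm.
  assert (P2 := prime_ge_2 _ HN). assert (HN0 : (0 < N)%nat) by lia. assert (X1 : xi 1%Z = 1%C) by apply Hxi.
  assert (Hhol : forall z : C, 0 < snd z -> exists l, ComplexIntegral.Cder f z l) by (eapply an_hol; eassumption).
  assert (HT : forall z : C, 0 < snd z -> f (z + 1)%C = f z) by (eapply an_period_f; eassumption).
  assert (HU : forall z : C, 0 < snd z -> slR k 1 0 (INR N) 1 f z = f z) by (eapply an_U; eassumption).
  assert (Hrel : forall q, (1 <= q)%nat -> Nat.gcd q N = 1%nat -> forall z : C, 0 < snd z ->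
    lsum (units q) (fun a => f (z + RtoC (INR a / INR q))%C) =
      (xi (Z.of_nat q) * lsum (units q) (fun a => slR k (INR q) 0 (- INR a * INR N) (/ INR q) f z))%C).
  { intros q Hq1 Hq2 z Hz. eapply an_rel; eassumption. }
  assert (Hgf : forall w : C, 0 < snd w -> gfun gc w = (/ cpown (RtoC (sqrt (INR N)) * w) k * f (- / (RtoC (INR N) * w)))%C)
    by (eapply an_g_f; eassumption).
  assert (Hf' : forall z : C, 0 < snd z -> csum (qterm (fun n => fc (S n)) z) (f z)) by (eapply an_f; eassumption).
  assert (Hg' : forall z : C, 0 < snd z -> csum (qterm (fun n => gc (S n)) z) (gfun gc z)) by (eapply an_g; eassumption).
  assert (Hgood := good_all N k f xi HN Hk Hhol HT HU Hcomm Hxi Hpar Hrel).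
  split; [|split].
  - intros z Hz. destruct (Hhol z Hz) as [l Hl]. exists l. apply Cder_is_derive. exact Hl.
  - intros g Hg z Hz. apply Hgood; auto.
  - intros g Hg. 
    assert (Hpb : exists B m, polybd (fun n => fc (S n)) B m /\ polybd (fun n => gc (S n)) B m /\ sigma <= INR m) by (eapply an_polybd; eassumption).
    destruct Hpb as [B [m [Hfb [Hgb _]]]].
    (* At infinity the growth is that of the q-series of f; at 0 it is that of the q-series of g,
       through the Fricke relation [Hgf]. *)
    destruct (Zdivide_dec (Z.of_nat N) (m_c g)) as [Hc|Hc].
    + destruct (qser_bounded _ B m 1 f Hfb Rlt_0_1 Hf') as [M HM].
      exists (Cmod (xi (m_d g)) * M), 1. intros z Hz. rewrite Hgood; [|split; auto|unfold in_H; lra].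
      rewrite Cmod_mult. apply Rmult_le_compat_l; [apply Cmod_ge_0|]. apply HM. change (snd z) with (Im z); lra.
    + destruct (rational_cusp_coset N g HN Hg Hc) as [j [m' [Hm' ->]]].
      assert (HNr : 1 <= INR N) by (apply (le_INR 1); lia).
      assert (Hy : 0 < / INR N) by (apply Rinv_0_lt_compat; lra).
      destruct (qser_bounded _ B m (/ INR N) _ Hgb Hy Hg') as [M HM].
      (* With w = (z + j)/N the Fricke factor (sqrt N w)^k equals c (z + j)^k. Im z > 1 becomes Im w
         > 1/N, hence the height used in the bound for g. *)
      set (c := (cpown (RtoC (sqrt (INR N) / INR N)) k)).
      exists (Cmod (xi (m_d m')) * (Cmod c * M)), 1. intros z Hz.
      assert (Hz' : in_H z) by (unfold in_H; lra).
      assert (Dj : SL2Z (0, -1, 1, j)%Z) by reflexivity.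
      rewrite slash_mul; auto; [|apply Hm'].
      rewrite (slash_ext k _ _ (fun w => (xi (m_d m') * f w)%C)); auto; [|intros w Hw; apply Hgood; auto].
      rewrite slash_scal Cmod_mult. apply Rmult_le_compat_l; [apply Cmod_ge_0|].
      set (w := (RtoC (/ INR N) * (z + IZR j))%C).
      assert (Hw : snd w = snd z / INR N) by (unfold w; simpl; field; lra).
      assert (Hw0 : / INR N <= snd w).
      { rewrite Hw. unfold Rdiv. rewrite -{1}(Rmult_1_l (/ INR N)). apply Rmult_le_compat_r; [lra|]. change (snd z) with (Im z); lra. }
      assert (HNC : RtoC (INR N) <> 0%C) by (apply RtoC_neq; lra).
      assert (Hzj : (z + IZR j)%C <> 0%C).
      { intros E. apply (f_equal snd) in E. simpl in E. unfold in_H, Im in Hz'. lra. }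
      assert (Hsq : RtoC (sqrt (INR N)) <> 0%C) by (apply RtoC_neq; assert (T := sqrt_lt_R0 (INR N) ltac:(lra)); lra).
      assert (E : slash k (0, -1, 1, j)%Z f z = (c * gfun gc w)%C).
      { rewrite Hgf; [|lra]. unfold slash; cbn [m_a m_b m_c m_d].
        replace (1 * z + IZR j)%C with (z + IZR j)%C by ring.
        replace (- / (INR N * w))%C with ((0 * z + -1) / (z + IZR j))%C.
        2: { unfold w. rewrite RtoC_inv; [|lra]. field. auto. }
        replace (RtoC (sqrt (INR N)) * w)%C with (RtoC (sqrt (INR N) / INR N) * (z + IZR j))%C.
        2: { unfold w, Rdiv. rewrite RtoC_mult. ring. }
        rewrite cpown_mult. fold c. field. split; apply cpown_neq0; auto.
        apply RtoC_neq. assert (T := sqrt_lt_R0 (INR N) ltac:(lra)). apply Rgt_not_eq, Rdiv_lt_0_compat; lra. }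
      rewrite E Cmod_mult. apply Rmult_le_compat_l; [apply Cmod_ge_0|]. apply HM. exact Hw0.
Qed.
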